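(* Let $f$ be a function satisfying the standing assumptions given in the context, with modulator $p_f$. (i) If $p_f$ is even, then for every integer $p\geq0$ $$L(2p,f)=\frac{(-1)^{p}(2\pi)^{2p}}{4i\pi}\int_{\mu_{f_{(2i\pi)}}}\frac{z^{(-2p,f_{(2i\pi)})}}{e^{-z}-1}\,dz,$$ $$F(2p,f_{(2i\pi)})=\frac{(-1)^{p+1}C_{\underline{f},2p}(1-n_f)}{2(2p)!}(2\pi)^{2p}.$$ (ii) If $p_f$ is odd, then for every integer $p\geq0$ $$L(2p+1,f)=\frac{(-1)^p(2\pi)^{2p+1}}{4\pi}\int_{\mu_{f_{(2i\pi)}}}\frac{z^{(-2p-1,f_{(2i\pi)})}}{e^{-z}-1}\,dz,$$ $$F(2p+1,f_{(2i\pi)})=\frac{(-1)^{p}C_{\underline{f},2p+1}(1-n_f)}{2i(2p+1)!}(2\pi)^{2p+1}.$$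
   Context: Standing assumptions and notation. $f$ is a real-analytic function at $0$, $f(t)=\sum_{n\ge 0}\frac{C_{f,n}}{n!}t^n$. Its modulator is $p_f(t):=\frac{e^t-1}{t}f(t)=\sum_{n\ge 0}\frac{P_{f,n}}{n!}t^n$, which defines the numbers $P_{f,n}$. It is assumed that the power series $\sum_{n\ge0}P_{f,n}t^n$ has a non-zero (possibly infinite) radius of convergence $\rho_f$; consequently $p_f$ extends to an entire function. Put $r_f:=1/\rho_f$ (with $r_f=0$ if $\rho_f=\infty$), $n_f:=\lfloor r_f\rfloor+1$, and $\Omega_f:=\{z\in\mathbb{C} : z\notin\mathbb{R}_{\le 0},\ |z|>r_f\}$. C-polynomials: the polynomials $C_{f,n}(x)$ are defined by $f(t)e^{xt}=\sum_{n\ge0}\frac{C_{f,n}(x)}{n!}t^n$. The function $\underline{f}$ is $\underline{f}(t):=e^{-t}f(-t)$, and $C_{\underline f,n}(x)$ are the corresponding polynomials defined by $\underline f(t)e^{xt}=\sum_{n\ge0}\frac{C_{\underline f,n}(x)}{n!}t^n$. Generalized power: for $s\in\mathbb{C}$ and $z\in\Omega_f$, $z^{(s,f)}:=\sum_{k=0}^{\infty}\binom{s}{k}P_{f,k}z^{s-k}$, where complex powers $z^{a}=e^{a\log z}$ use the principal logarithm. LC-function: for $\Re(s)>1$, $L(s,f):=\sum_{n=n_f}^{\infty}n^{(-s,f)}$. The same symbol denotes its meromorphic continuation to $\mathbb{C}$, which is known to be entire if $p_f(0)=0$ and otherwise to have only a simple pole, at $s=1$, with residue $p_f(0)$. For $\alpha\in\mathbb{C}\setminus\{0\}$,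 $f_{(\alpha)}(t):=\frac{e^{\alpha t}-1}{\alpha(e^t-1)}f(\alpha t)$. One has $p_{f_{(\alpha)}}(t)=p_f(\alpha t)$, hence $P_{f_{(\alpha)},n}=\alpha^nP_{f,n}$ and $r_{f_{(\alpha)}}=|\alpha|r_f$; all the definitions above and below apply to $f_{(\alpha)}$ in place of $f$ (its coefficients may be complex). FC-function: $F(s,f):=\frac{\Gamma(1-s)}{2i\pi}\int_{\mu_f}\frac{z^{(s-1,f)}}{e^{-z}-1}\,dz$, where $\mu_f$ is a Hankel contour contained in $\Omega_f$: it comes from $-\infty$ below the negative real axis, goes once counterclockwise around the closed disk $|z|\le r_f$ (around the origin if $r_f=0$), and returns to $-\infty$ above the negative real axis, without encircling any of the singularities $2i\pi k$ ($k\in\mathbb{Z}$, $2\pi|k|>r_f$) of $1/(e^{-z}-1)$ lying in $\Omega_f$. The integral is an entire function of $s$, so $F(s,f)$ is analytic for $s\neq1,2,3,\dots$. Convention: at the positive integers where $F(\cdot,f_{(2i\pi)})$ is evaluated (positive even integers in (i), positive odd integers in (ii)) its singularity is removable, and the value is that of its analytic continuation. *)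

(* Defs.v *)
From Stdlib Require Export Reals ZArith List ClassicalEpsilon.
From Coquelicot Require Export Coquelicot.

Open Scope C_scope.

(** * Complex analysis missing from Coquelicot *)

Definition Cexp (z : C) : C := (exp (Re z) * cos (Im z), exp (Re z) * sin (Im z))%R.

(* Principal argument, with values in (-PI, PI]; meaningful for z <> 0. *)
Definition Carg (z : C) : R :=
  if Rle_dec 0 (Im z) then acos (Re z / Cmod z) else (- acos (Re z / Cmod z))%R.

Definition Clog (z : C) : C := (ln (Cmod z), Carg z).

Definition Cpower (z a : C) : C := Cexp (a * Clog z).

(* Sums and limits of complex sequences, taken componentwise.  Like [Series]
   and [Lim_seq], they are total and meaningful for convergent sequences. *)
Definition CSeries (a : nat -> C) : C :=
  (Series (fun k => Re (a k)), Series (fun k => Im (a k))).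

Definition CLim_seq (u : nat -> C) : C :=
  (real (Lim_seq (fun k => Re (u k))), real (Lim_seq (fun k => Im (u k)))).

Fixpoint Cbinom (s : C) (k : nat) : C :=
  match k with
  | O => 1
  | S j => Cbinom s j * (s - RtoC (INR j)) / RtoC (INR (S j))
  end.

(* z (z + 1) ... (z + n) *)
Fixpoint Crising (z : C) (n : nat) : C :=
  match n with
  | O => z
  | S m => Crising z m * (z + RtoC (INR (S m)))
  end.

(* Gauss's limit formula, valid for every z which is not a non-positive integer. *)
Definition CGamma (z : C) : C :=
  CLim_seq (fun n => RtoC (INR (fact n)) * Cpower (RtoC (INR n)) z / Crising z n).

Definition holomorphic_at (g : C -> C) (z : C) : Prop :=
  locally z (fun w => @ex_derive C_AbsRing C_NormedModule g w).

(** * Functions near 0 and their expansions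

    Functions such as (e^t - 1) / t are written by their formula, which does not
    give the right value at the removable singularity t = 0; expansions at 0 are
    therefore only required to hold in a punctured neighbourhood of 0. *)

Definition is_egf (g : C -> C) (a : nat -> C) : Prop :=
  locally' (T := C_UniformSpace) (RtoC 0) (fun t =>
    @is_pseries C_AbsRing C_NormedModule
      (fun n => a n / RtoC (INR (fact n))) t (g t)).

(* The numbers a_n such that g(t) = sum_n a_n t^n / n! near 0; they are unique
   when they exist. *)
Definition egf_coef (g : C -> C) : nat -> C :=
  epsilon (inhabits (fun _ => RtoC 0)) (is_egf g).

Definition real_analytic_at_0 (f : R -> R) : Prop :=
  exists a : nat -> R,
    locally 0%R (fun t => @is_pseries R_AbsRing R_NormedModule a t (f t)).

(* Extension to complex t near 0 of a function that is real-analytic at 0. *)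
Definition complexify (f : R -> R) (t : C) : C :=
  CSeries (fun n => RtoC (Derive_n f n 0 / INR (fact n)) * t ^ n).

(** * C-polynomials, modulator, generalized powers

    In what follows g is a complex function near 0: either the complexification
    of f or one of its transforms [scale alpha g] and [underline g]. *)

Definition modulator (g : C -> C) (t : C) : C := (Cexp t - 1) / t * g t.

Definition Pcoef (g : C -> C) : nat -> C := egf_coef (modulator g).

(* The entire extension of the modulator. *)
Definition modulator_entire (g : C -> C) (z : C) : C :=
  CSeries (fun n => Pcoef g n / RtoC (INR (fact n)) * z ^ n).

Definition even_modulator (g : C -> C) : Prop :=
  forall z, modulator_entire g (- z) = modulator_entire g z.

Definition odd_modulator (g : C -> C) : Prop :=
  forall z, modulator_entire g (- z) = - modulator_entire g z.

Definition rho (g : C -> C) : Rbar := CV_radius (fun n => Cmod (Pcoef g n)).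

(* [Rbar_inv p_infty = 0]. *)
Definition rad (g : C -> C) : R := real (Rbar_inv (rho g)).

Definition start_index (g : C -> C) : nat := (Z.to_nat (Int_part (rad g)) + 1)%nat.

Definition Omega (g : C -> C) (z : C) : Prop :=
  ~ (Im z = 0 /\ Re z <= 0)%R /\ (rad g < Cmod z)%R.

Definition standing_assumptions (f : R -> R) : Prop :=
  real_analytic_at_0 f /\ Rbar_lt 0%R (rho (complexify f)).

Definition Cpoly (g : C -> C) (n : nat) (x : C) : C :=
  egf_coef (fun t => g t * Cexp (x * t)) n.

Definition underline (g : C -> C) (t : C) : C := Cexp (- t) * g (- t).

Definition scale (alpha : C) (g : C -> C) (t : C) : C :=
  (Cexp (alpha * t) - 1) / (alpha * (Cexp t - 1)) * g (alpha * t).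

Definition gen_power (g : C -> C) (z s : C) : C :=
  CSeries (fun k => Cbinom s k * Pcoef g k * Cpower z (s - RtoC (INR k))).

(** * LC-function

    [is_LC_function g L]: L is the meromorphic continuation to C of the series
    defining L(s, g), with its value at s = 1 when there is no pole there. *)

Record is_LC_function (g L : C -> C) : Prop := {
  LC_series : forall s : C, (1 < Re s)%R ->
    @is_series C_AbsRing C_NormedModule
      (fun k => gen_power g (RtoC (INR (start_index g + k))) (- s)) (L s);
  LC_holomorphic : forall s : C, s <> RtoC 1 -> holomorphic_at L s;
  LC_entire : modulator_entire g 0 = RtoC 0 -> holomorphic_at L (RtoC 1);
  LC_pole : modulator_entire g 0 <> RtoC 0 ->
    filterlim (fun s => (s - 1) * L s)
      (locally' (T := C_UniformSpace) (RtoC 1))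
      (locally (T := C_UniformSpace) (modulator_entire g 0))
}.

(** * Hankel contours and FC-function *)

Definition velocity (gamma : R -> C) (t : R) : C :=
  (Derive (fun u => Re (gamma u)) t, Derive (fun u => Im (gamma u)) t).

Definition piecewise_C1 (gamma : R -> C) : Prop :=
  (forall t, @continuous R_UniformSpace C_UniformSpace gamma t) /\
  exists breaks : list R,
    (forall t, ~ In t breaks ->
       @ex_derive R_AbsRing C_R_NormedModule gamma t /\
       @continuous R_UniformSpace C_UniformSpace (velocity gamma) t) /\
    (forall t, In t breaks ->
       (exists v, filterlim (velocity gamma) (at_left t)
                    (locally (T := C_UniformSpace) v)) /\
       (exists v, filterlim (velocity gamma) (at_right t)
                    (locally (T := C_UniformSpace) v))).

(* The curve avoids a, and a continuous argument of gamma - a increases by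
   2 n PI in total. *)
Definition winds_around (gamma : R -> C) (a : C) (n : Z) : Prop :=
  (forall t, gamma t <> a) /\
  exists theta : R -> R,
    (forall t, continuity_pt theta t) /\
    (forall t, gamma t - a =
       RtoC (Cmod (gamma t - a)) * (cos (theta t), sin (theta t))) /\
    exists l : R, is_lim theta m_infty l /\
                  is_lim theta p_infty (l + 2 * IZR n * PI)%R.

Record hankel_contour (g : C -> C) (gamma : R -> C) : Prop := {
  hankel_regular : piecewise_C1 gamma;
  hankel_Omega : forall t, Omega g (gamma t);
  (* both ends at -oo, in a horizontal strip, the first one below the negative
     real axis and the last one above it *)
  hankel_start : is_lim (fun t => Re (gamma t)) m_infty m_infty;
  hankel_below : Rbar_locally m_infty (fun t => Im (gamma t) < 0)%R;
  hankel_end : is_lim (fun t => Re (gamma t)) p_infty m_infty;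
  hankel_above : Rbar_locally p_infty (fun t => 0 < Im (gamma t))%R;
  hankel_strip : exists B : R, forall t, (Rabs (Im (gamma t)) <= B)%R;
  hankel_disk : forall a : C, (Cmod a <= rad g)%R -> winds_around gamma a 1;
  hankel_poles : forall k : Z, (rad g < 2 * PI * IZR (Z.abs k))%R ->
    winds_around gamma (2 * Ci * PI * IZR k) 0
}.

Definition contour_integral (gamma : R -> C) (h : C -> C) : C :=
  @RInt_gen C_R_CompleteNormedModule
    (fun t => h (gamma t) * velocity gamma t)
    (Rbar_locally m_infty) (Rbar_locally p_infty).

(* The integral over gamma of z^(a, g) / (e^(-z) - 1). *)
Definition hankel_integral (g : C -> C) (gamma : R -> C) (a : C) : C :=
  contour_integral gamma (fun z => gen_power g z a / (Cexp (- z) - 1)).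

(* Meaningful when s is not a positive integer. *)
Definition FC (g : C -> C) (gamma : R -> C) (s : C) : C :=
  CGamma (1 - s) / (2 * Ci * PI) * hankel_integral g gamma (s - 1).

(* F(s, g) = v, where at a positive integer s the singularity is removable and
   the value is the one of the analytic continuation. *)
Definition FC_value (g : C -> C) (gamma : R -> C) (s v : C) : Prop :=
  exists F : C -> C,
    holomorphic_at F s /\
    locally (T := C_UniformSpace) s (fun z =>
      (forall n : nat, z <> RtoC (INR (S n))) -> F z = FC g gamma z) /\
    F s = v.

(* Main.v *)
(* The generalized power satisfies P_{h,n} = (2 i PI)^n P_{f,n} for h = f_(2 i PI).
   With z = exp w, the Hankel integral I(a) of z^(a,h) / (e^(-z) - 1) is compared
   with the circles |z| = (2K + 1) PI: it is the limit of an integral V_K(a) over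
   the circle plus 2 i PI times the sum of the residues z^(a,h) at the poles
   z = 2 i PI k of modulus at most 2 K PI, and V_K(a) -> 0 when Re a < -1.  Since p_f
   is even or odd, the residues at 2 i PI k and - 2 i PI k are multiples of
   k^(a,f), whence I(a) = c(a) L(-a, f), with c a sum of two exponentials, first
   for Re a < -1 and then, by the identity theorem, everywhere.  The value a = -m
   gives L(m, f).  For a = s - 1 and s -> m, the pole of Gamma(1 - s) cancels the
   zero of c, and F(m, h) is expressed by L(1 - m, f).

   The latter is a value of a C-polynomial: for the formal power A_s(x) built on
   the Taylor coefficients of f instead of P_{f,n}, s x^(s-1,f) is
   A_s(x + 1) - A_s(x) up to a small remainder, because t p_f = (e^t - 1) f; the
   series of L telescopes, and when s = m the power A_m is a polynomial and the
   remainder vanishes. *)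

Require Import Defs.
From Stdlib Require Import Lra Lia Psatz FunctionalExtensionality.
From Stdlib Require FinFun.

(** The contour is known only through its ends and its winding numbers, so it is never deformed. It
    is lifted to the plane of w = log z, where the principal logarithm keeps it in the strip |Im w|
    < pi and circles become vertical segments. There the integrand has a primitive [Psi] on a strip
    from which the right half of the z-plane is removed beyond the first pole, and the integral is
    an increment of [Psi] between the two tails, around Im w = pi and Im w = - pi. The contour may
    leave this cut strip: finitely many polar parts are then removed, and winding number 0 makes
    their logarithms vary along the contour as the chosen branches do between its ends. Since
    exp(-z) explodes in the left sector, the increments of [Psi] converge for every exponent a,
    locally uniformly; hence I is entire although V_K(a) tends to 0 only for Re a < -1. The possible
    pole of L is avoided by working with (s - 1) L(s). Gamma is needed only in a disc around 1, to
    which its functional equation brings the neighbourhood of any m. Differentiability is pointwise,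
    in Carathéodory's form, and the analysis rests on Goursat's theorem. *)

Lemma Cmod_minus_sym (a b : C) : Cmod (a - b) = Cmod (b - a).
Proof. rewrite <- Cmod_opp. f_equal. ring. Qed.

Lemma Cmod_ge_minus (a b : C) : (Cmod a - Cmod b <= Cmod (a - b))%R.
Proof.
  pose proof (Cmod_triangle (a - b) b) as H.
  replace (a - b + b) with a in H by ring. lra.
Qed.

Lemma Cmod_sub_0 (a b : C) : Cmod (a - b) = 0%R -> a = b.
Proof.
  intros H. apply Cmod_eq_0 in H.
  replace a with (a - b + b) by ring. rewrite H. ring.
Qed.

Lemma Cmod_small_eq (a b : C) :
  (forall eps, (0 < eps)%R -> (Cmod (a - b) <= eps)%R) -> a = b.
Proof.
  intros H. apply Cmod_sub_0.
  destruct (Rle_lt_or_eq_dec 0 (Cmod (a - b)) (Cmod_ge_0 _)) as [h|h]; [|auto].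
  specialize (H (Cmod (a - b) / 2)%R). lra.
Qed.

Lemma Cminus_neq_0 (a b : C) : a <> b -> a - b <> 0.
Proof. intros h H. apply h. replace a with (a - b + b) by ring. rewrite H. ring. Qed.

(** * Continuity and differentiability along a map into C *)

(* [e] is the identity of C or the inclusion of R in C. *)
Definition cont_at {T : Type} (e : T -> C) (f : T -> C) (t : T) : Prop :=
  forall eps, (0 < eps)%R -> exists d, (0 < d)%R /\
    forall u, (Cmod (e u - e t) < d)%R -> (Cmod (f u - f t) < eps)%R.

(* Caratheodory's form of differentiability. *)
Definition diff_at {T : Type} (e : T -> C) (f : T -> C) (t : T) (l : C) : Prop :=
  exists q : T -> C, (forall u, f u - f t = q u * (e u - e t)) /\
    q t = l /\ cont_at e q t.

Notation Ccont := (cont_at (fun z : C => z)).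
Notation Rcont := (cont_at RtoC).
Notation Cdiff := (diff_at (fun z : C => z)).
Notation Rdiff := (diff_at RtoC).

Section ContDiff.
Context {T : Type} (e : T -> C).

Lemma cont_const (c : C) t : cont_at e (fun _ => c) t.
Proof.
  intros eps h. exists 1%R. split; [lra|]. intros u _.
  replace (c - c) with (RtoC 0) by ring. rewrite Cmod_0. lra.
Qed.

Lemma cont_e t : cont_at e e t.
Proof. intros eps h. exists eps. auto. Qed.

Lemma cont_ext_loc f g t :
  (exists d, (0 < d)%R /\ forall u, (Cmod (e u - e t) < d)%R -> f u = g u) ->
  cont_at e f t -> cont_at e g t.
Proof.
  intros [d [hd H]] hf eps heps.
  destruct (hf eps heps) as [d' [hd' H']].
  exists (Rmin d d'). split; [apply Rmin_pos; auto|]. intros u hu.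
  rewrite <- H, <- H.
  - apply H'. eapply Rlt_le_trans; [exact hu|apply Rmin_r].
  - replace (e t - e t) with (RtoC 0) by ring. rewrite Cmod_0. auto.
  - eapply Rlt_le_trans; [exact hu|apply Rmin_l].
Qed.

Lemma cont_ext f g t : (forall u, f u = g u) -> cont_at e f t -> cont_at e g t.
Proof. intros H. apply cont_ext_loc. exists 1%R. split; [lra|auto]. Qed.

Lemma cont_plus f g t :
  cont_at e f t -> cont_at e g t -> cont_at e (fun u => f u + g u) t.
Proof.
  intros hf hg eps h.
  destruct (hf (eps / 2)%R) as [d [hd H]]; [lra|].
  destruct (hg (eps / 2)%R) as [d' [hd' H']]; [lra|].
  exists (Rmin d d'). split; [apply Rmin_pos; auto|]. intros u hu.
  replace (f u + g u - (f t + g t)) with ((f u - f t) + (g u - g t)) by ring.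
  eapply Rle_lt_trans; [apply Cmod_triangle|].
  specialize (H u (Rlt_le_trans _ _ _ hu (Rmin_l _ _))).
  specialize (H' u (Rlt_le_trans _ _ _ hu (Rmin_r _ _))). lra.
Qed.

Lemma cont_mult f g t :
  cont_at e f t -> cont_at e g t -> cont_at e (fun u => f u * g u) t.
Proof.
  intros hf hg eps h.
  set (A := (Cmod (f t) + 1)%R). set (B := (Cmod (g t) + 1)%R).
  assert (hA : (0 < A)%R) by (unfold A; pose proof (Cmod_ge_0 (f t)); lra).
  assert (hB : (0 < B)%R) by (unfold B; pose proof (Cmod_ge_0 (g t)); lra).
  destruct (hf (Rmin 1 (eps / (2 * B)))) as [d [hd H]].
  { apply Rmin_pos; [lra|]. apply Rdiv_lt_0_compat; lra. }
  destruct (hg (eps / (2 * A))%R) as [d' [hd' H']].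
  { apply Rdiv_lt_0_compat; lra. }
  exists (Rmin d d'). split; [apply Rmin_pos; auto|]. intros u hu.
  specialize (H u (Rlt_le_trans _ _ _ hu (Rmin_l _ _))).
  specialize (H' u (Rlt_le_trans _ _ _ hu (Rmin_r _ _))).
  replace (f u * g u - f t * g t) with (f u * (g u - g t) + (f u - f t) * g t) by ring.
  eapply Rle_lt_trans; [apply Cmod_triangle|]. rewrite !Cmod_mult.
  assert (h1 : (Cmod (f u - f t) < 1)%R) by (eapply Rlt_le_trans; [exact H|apply Rmin_l]).
  assert (h2 : (Cmod (f u - f t) < eps / (2 * B))%R) by (eapply Rlt_le_trans; [exact H|apply Rmin_r]).
  assert (h3 : (Cmod (f u) < A)%R) by (unfold A; pose proof (Cmod_ge_minus (f u) (f t)); lra).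
  assert (h4 : (Cmod (f u) * Cmod (g u - g t) <= A * (eps / (2 * A)))%R).
  { apply Rmult_le_compat; try apply Cmod_ge_0; lra. }
  assert (h5 : (Cmod (f u - f t) * Cmod (g t) < eps / (2 * B) * B)%R).
  { apply Rmult_le_0_lt_compat; try apply Cmod_ge_0; auto. unfold B; lra. }
  replace (A * (eps / (2 * A)))%R with (eps / 2)%R in h4 by (field; lra).
  replace (eps / (2 * B) * B)%R with (eps / 2)%R in h5 by (field; lra). lra.
Qed.

Lemma cont_opp f t : cont_at e f t -> cont_at e (fun u => - f u) t.
Proof.
  intros hf. apply cont_ext with (f := fun u => (-(1)) * f u); [intros; ring|].
  apply cont_mult; [apply cont_const|auto].
Qed.

Lemma cont_minus f g t :
  cont_at e f t -> cont_at e g t -> cont_at e (fun u => f u - g u) t.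
Proof. intros hf hg. apply cont_plus; [auto|]. apply cont_opp; auto. Qed.

Lemma cont_neq_0 f t : cont_at e f t -> f t <> 0 ->
  exists d, (0 < d)%R /\ forall u, (Cmod (e u - e t) < d)%R ->
    (Cmod (f t) / 2 <= Cmod (f u))%R.
Proof.
  intros hf h. apply Cmod_gt_0 in h.
  destruct (hf (Cmod (f t) / 2)%R) as [d [hd H]]; [lra|].
  exists d. split; [auto|]. intros u hu. specialize (H u hu).
  rewrite Cmod_minus_sym in H.
  pose proof (Cmod_ge_minus (f t) (f u)). lra.
Qed.

Lemma cont_inv f t : cont_at e f t -> f t <> 0 -> cont_at e (fun u => / f u) t.
Proof.
  intros hf h eps heps.
  destruct (cont_neq_0 f t hf h) as [d [hd H]].
  assert (h' := h). apply Cmod_gt_0 in h'. set (K := Cmod (f t)) in *.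
  destruct (hf (eps * (K * K / 2))%R) as [d' [hd' H']]; [apply Rmult_lt_0_compat; nra|].
  exists (Rmin d d'). split; [apply Rmin_pos; auto|]. intros u hu.
  specialize (H u (Rlt_le_trans _ _ _ hu (Rmin_l _ _))).
  specialize (H' u (Rlt_le_trans _ _ _ hu (Rmin_r _ _))).
  assert (hu0 : f u <> 0). { apply Cmod_gt_0. lra. }
  replace (/ f u - / f t) with (- (f u - f t) / (f u * f t)) by (field; auto).
  rewrite Cmod_div, Cmod_opp, Cmod_mult; [|apply Cmult_neq_0; auto]. fold K.
  apply Rlt_div_l; [nra|].
  eapply Rlt_le_trans; [exact H'|]. apply Rmult_le_compat_l; [lra|]. nra.
Qed.

Lemma cont_div f g t : cont_at e f t -> cont_at e g t -> g t <> 0 ->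
  cont_at e (fun u => f u / g u) t.
Proof. intros. apply cont_mult; [auto|]. apply cont_inv; auto. Qed.

Lemma cont_comp {T'} (e' : T' -> C) (g : T' -> C) (f : T -> T') t :
  cont_at e' g (f t) -> cont_at e (fun u => e' (f u)) t ->
  cont_at e (fun u => g (f u)) t.
Proof.
  intros hg hf eps h. destruct (hg eps h) as [d [hd H]].
  destruct (hf d hd) as [d' [hd' H']]. exists d'. split; [auto|]. intros u hu.
  apply H. apply H'. auto.
Qed.

Lemma cont_Cmod f t : cont_at e f t -> cont_at e (fun u => RtoC (Cmod (f u))) t.
Proof.
  intros hf eps h. destruct (hf eps h) as [d [hd H]]. exists d. split; [auto|].
  intros u hu. rewrite <- RtoC_minus, Cmod_R. specialize (H u hu).
  apply Rabs_def1.
  - pose proof (Cmod_ge_minus (f u) (f t)). lra.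
  - pose proof (Cmod_ge_minus (f t) (f u)). rewrite Cmod_minus_sym in H. lra.
Qed.

Lemma diff_cont f t l : diff_at e f t l -> cont_at e f t.
Proof.
  intros [q [H [_ hq]]]. apply cont_ext with (f := fun u => f t + q u * (e u - e t)).
  { intros u. rewrite <- H. ring. }
  apply cont_plus; [apply cont_const|]. apply cont_mult; [auto|].
  apply cont_minus; [apply cont_e|apply cont_const].
Qed.

Lemma diff_const (c : C) t : diff_at e (fun _ => c) t 0.
Proof. exists (fun _ => 0). repeat split; [intros; ring|apply cont_const]. Qed.

Lemma diff_e t : diff_at e e t 1.
Proof. exists (fun _ => 1). repeat split; [intros; ring|apply cont_const]. Qed.

Lemma diff_ext f g t l : (forall u, f u = g u) -> diff_at e f t l -> diff_at e g t l.
Proof.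
  intros H [q [h1 [h2 h3]]]. exists q. repeat split; auto.
  intros u. rewrite <- !H. auto.
Qed.

Lemma diff_eq f t l l' : l = l' -> diff_at e f t l -> diff_at e f t l'.
Proof. intros ->. auto. Qed.

Lemma diff_plus f g t l m : diff_at e f t l -> diff_at e g t m ->
  diff_at e (fun u => f u + g u) t (l + m).
Proof.
  intros [q [h1 [h2 h3]]] [q' [h1' [h2' h3']]].
  exists (fun u => q u + q' u). repeat split.
  - intros u. rewrite Cmult_plus_distr_r, <- h1, <- h1'. ring.
  - rewrite h2, h2'; auto.
  - apply cont_plus; auto.
Qed.

Lemma diff_mult f g t l m : diff_at e f t l -> diff_at e g t m ->
  diff_at e (fun u => f u * g u) t (l * g t + f t * m).
Proof.
  intros hf hg. assert (hc := diff_cont f t l hf). revert hf hg.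
  intros [q [h1 [h2 h3]]] [q' [h1' [h2' h3']]].
  exists (fun u => q u * g t + f u * q' u). repeat split.
  - intros u. rewrite Cmult_plus_distr_r.
    transitivity ((q u * (e u - e t)) * g t + f u * (q' u * (e u - e t))); [|ring].
    rewrite <- h1, <- h1'. ring.
  - rewrite h2, h2'; auto.
  - apply cont_plus; apply cont_mult; auto. apply cont_const.
Qed.

Lemma diff_scal c f t l : diff_at e f t l -> diff_at e (fun u => c * f u) t (c * l).
Proof.
  intros h. eapply diff_eq; [|apply diff_mult; [apply diff_const|exact h]]. simpl. ring.
Qed.

Lemma diff_opp f t l : diff_at e f t l -> diff_at e (fun u => - f u) t (- l).
Proof.
  intros h. apply diff_ext with (f := fun u => (-(1)) * f u); [intros; ring|].
  eapply diff_eq; [|apply diff_scal, h]. ring.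
Qed.

Lemma diff_minus f g t l m : diff_at e f t l -> diff_at e g t m ->
  diff_at e (fun u => f u - g u) t (l - m).
Proof. intros. apply diff_plus; [auto|]. apply diff_opp; auto. Qed.

Lemma diff_comp {T'} (e' : T' -> C) (g : T' -> C) (f : T -> T') t l m :
  diff_at e' g (f t) l -> diff_at e (fun u => e' (f u)) t m ->
  diff_at e (fun u => g (f u)) t (l * m).
Proof.
  intros hg hf. assert (hc := diff_cont _ t m hf). revert hg hf.
  intros [q [h1 [h2 h3]]] [q' [h1' [h2' h3']]].
  exists (fun u => q (f u) * q' u). repeat split.
  - intros u. rewrite h1, h1'. ring.
  - rewrite h2, h2'; auto.
  - apply cont_mult; [|auto]. apply (cont_comp e' q f); auto.
Qed.

(* Off [t], Caratheodory's quotient is determined by the function. *)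
Lemma diff_of_bound f t l :
  (forall u, e u = e t -> u = t) ->
  (forall eps, (0 < eps)%R -> exists d, (0 < d)%R /\ forall u, (Cmod (e u - e t) < d)%R ->
     (Cmod (f u - f t - l * (e u - e t)) <= eps * Cmod (e u - e t))%R) ->
  diff_at e f t l.
Proof.
  intros inj H.
  exists (fun u => if excluded_middle_informative (e u = e t) then l
                   else (f u - f t) / (e u - e t)).
  repeat split.
  - intros u. destruct (excluded_middle_informative _) as [h|h].
    + rewrite (inj u h). ring.
    + field. apply Cminus_neq_0; auto.
  - destruct (excluded_middle_informative _) as [h|h]; [auto|]. exfalso; auto.
  - intros eps heps. destruct (H (eps / 2)%R) as [d [hd Hd]]; [lra|].
    exists d. split; [auto|]. intros u hu.
    destruct (excluded_middle_informative (e t = e t)) as [_|h]; [|exfalso; auto].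
    destruct (excluded_middle_informative _) as [h|h].
    { replace (l - l) with (RtoC 0) by ring. rewrite Cmod_0; auto. }
    assert (h' := Cminus_neq_0 _ _ h). assert (h0 := proj1 (Cmod_gt_0 _) h').
    replace ((f u - f t) / (e u - e t) - l) with ((f u - f t - l * (e u - e t)) / (e u - e t))
      by (field; auto).
    rewrite Cmod_div; auto. apply Rlt_div_l; [auto|].
    specialize (Hd u hu). nra.
Qed.

Lemma diff_bound f t l : diff_at e f t l ->
  forall eps, (0 < eps)%R -> exists d, (0 < d)%R /\ forall u, (Cmod (e u - e t) < d)%R ->
     (Cmod (f u - f t - l * (e u - e t)) <= eps * Cmod (e u - e t))%R.
Proof.
  intros [q [h1 [h2 h3]]] eps heps. destruct (h3 eps heps) as [d [hd H]].
  exists d. split; [auto|]. intros u hu. rewrite h1.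
  replace (q u * (e u - e t) - l * (e u - e t)) with ((q u - q t) * (e u - e t))
    by (rewrite h2; ring).
  rewrite Cmod_mult. apply Rmult_le_compat_r; [apply Cmod_ge_0|].
  apply Rlt_le, H, hu.
Qed.

(** The quotient of [f] does not serve [g] far from [t], so the proof passes through the epsilon
    form; injectivity of [e] at [t] is what allows a new quotient to be built from it. *)
Lemma diff_ext_loc f g t l :
  (forall u, e u = e t -> u = t) ->
  (exists d, (0 < d)%R /\ forall u, (Cmod (e u - e t) < d)%R -> f u = g u) ->
  diff_at e f t l -> diff_at e g t l.
Proof.
  intros inj [d [hd H]] hf. apply diff_of_bound; [auto|].
  intros eps heps. destruct (diff_bound f t l hf eps heps) as [d' [hd' H']].
  exists (Rmin d d'). split; [apply Rmin_pos; auto|]. intros u hu.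
  rewrite <- H, <- H.
  - apply H'. eapply Rlt_le_trans; [exact hu|apply Rmin_r].
  - replace (e t - e t) with (RtoC 0) by ring. rewrite Cmod_0. auto.
  - eapply Rlt_le_trans; [exact hu|apply Rmin_l].
Qed.
End ContDiff.

(** Carathéodory's identity must hold at 0 as well, where [/ w] is a default value. The inverse is
    therefore replaced at 0 by its tangent at [z], which changes nothing near [z]. *)
Lemma Cdiff_inv (z : C) : z <> 0 -> Cdiff (fun w => / w) z (- / (z * z)).
Proof.
  intros h. apply diff_ext_loc with (f := fun w : C => if excluded_middle_informative (w = 0) then / z - (/z * /z) * (w - z) else / w); [auto| |].
  { exists (Cmod z). split; [apply Cmod_gt_0; auto|]. intros u hu.
    destruct (excluded_middle_informative _) as [h0|h0]; [|auto].
    subst u. exfalso. replace (0 - z) with (- z) in hu by ring. rewrite Cmod_opp in hu. lra. }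
  exists (fun w : C => if excluded_middle_informative (w = 0) then - / (z * z) else - / (z * w)).
  split; [|split].
  - intros u. destruct (excluded_middle_informative (z = 0)) as [h0|_]; [contradiction|].
    destruct (excluded_middle_informative (u = 0)) as [h0|h0]; field; auto.
  - destruct (excluded_middle_informative _) as [h0|h0]; [contradiction|auto].
  - apply cont_ext_loc with (f := fun w : C => - / (z * w)).
    { exists (Cmod z). split; [apply Cmod_gt_0; auto|]. intros u hu.
      destruct (excluded_middle_informative _) as [h0|h0]; [|auto].
      subst u. exfalso. replace (0 - z) with (- z) in hu by ring. rewrite Cmod_opp in hu. lra. }
    apply cont_opp, cont_inv; [|apply Cmult_neq_0; auto].
    apply cont_mult; [apply cont_const|apply cont_e].
Qed.

Section Div.
Context {T : Type} (e : T -> C).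
Lemma diff_inv f t l : diff_at e f t l -> f t <> 0 ->
  diff_at e (fun u => / f u) t (- l / (f t * f t)).
Proof.
  intros hf h. eapply diff_eq; [|apply (diff_comp e (fun z => z) (fun w => / w) f)].
  2: apply Cdiff_inv, h. 2: exact hf. simpl. field. auto.
Qed.

Lemma diff_div f g t l m : diff_at e f t l -> diff_at e g t m -> g t <> 0 ->
  diff_at e (fun u => f u / g u) t ((l * g t - f t * m) / (g t * g t)).
Proof.
  intros hf hg h. eapply diff_eq; [|apply diff_mult; [exact hf|apply diff_inv; [exact hg|exact h]]].
  simpl. field. auto.
Qed.
End Div.

(** * Comparison with Coquelicot *)

(** Balls of [C_UniformSpace] are squares: the passage to [Cmod] costs a factor sqrt 2, absorbed by
    halving [eps]. *)
Lemma Rcont_continuous (f : R -> C) t :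
  Rcont f t <-> @continuous R_UniformSpace C_UniformSpace f t.
Proof.
  split.
  - intros h P [eps HP]. destruct (h eps (cond_pos eps)) as [d [hd H]].
    exists (mkposreal d hd). intros u hu. apply HP.
    apply C_NormedModule_mixin_compat1. apply H.
    rewrite <- RtoC_minus, Cmod_R. exact hu.
  - intros h eps heps.
    assert (he : (0 < eps / 2)%R) by lra.
    destruct (h (fun z => ball (f t) (mkposreal _ he) z)) as [d Hd].
    { exists (mkposreal _ he). auto. }
    exists d. split; [apply cond_pos|]. intros u hu.
    specialize (Hd u). rewrite <- RtoC_minus, Cmod_R in hu.
    specialize (Hd hu). apply C_NormedModule_mixin_compat2 in Hd.
    eapply Rlt_le_trans; [exact Hd|]. simpl.
    assert (sqrt 2 <= 2)%R.
    { rewrite <- (sqrt_Rsqr 2) at 2; [|lra]. apply sqrt_le_1; unfold Rsqr; lra. }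
    nra.
Qed.

Lemma C_R_minus_scal (x y l : C) (u t : R) :
  @minus C_R_NormedModule (@minus C_R_NormedModule x y)
    (@scal R_AbsRing C_R_NormedModule (@minus R_NormedModule u t) l) = x - y - l * RtoC (u - t).
Proof.
  destruct x as [x1 x2], y as [y1 y2], l as [l1 l2].
  apply injective_projections.
  - change (x1 + - y1 + - ((u + - t) * l1) = x1 + - y1 + - (l1 * (u - t) - l2 * 0))%R. ring.
  - change (x2 + - y2 + - ((u + - t) * l2) = x2 + - y2 + - (l1 * 0 + l2 * (u - t)))%R. ring.
Qed.

Lemma Rdiff_is_derive (f : R -> C) t l :
  Rdiff f t l <-> @is_derive R_AbsRing C_R_NormedModule f t l.
Proof.
  split.
  - intros h. split; [apply is_linear_scal_l|].
    intros x hx.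
    assert (hx' : t = x) by exact (@is_filter_lim_locally_unique R_AbsRing R_NormedModule t x hx). subst x.
    intros eps. destruct (diff_bound _ f t l h eps (cond_pos eps)) as [d [hd H]].
    exists (mkposreal d hd). intros u hu.
    specialize (H u). rewrite <- RtoC_minus, Cmod_R in H. specialize (H hu).
    eapply Rle_trans; [|exact H]. apply Req_le. rewrite <- Cmod_norm. apply f_equal.
    apply C_R_minus_scal.
  - intros [_ h]. apply diff_of_bound; [intros u hu; apply (f_equal fst) in hu; exact hu|].
    intros eps heps. destruct (h t (fun P HP => HP) (mkposreal eps heps)) as [d Hd].
    exists d. split; [apply cond_pos|]. intros u hu.
    rewrite <- RtoC_minus, Cmod_R in hu. specialize (Hd u hu). rewrite <- Cmod_norm in Hd.
    rewrite <- RtoC_minus, Cmod_R.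
    eapply Rle_trans; [|exact Hd]. apply Req_le. apply f_equal.
    symmetry. apply C_R_minus_scal.
Qed.

Lemma Cdiff_is_derive (f : C -> C) z l :
  Cdiff f z l <-> @is_derive C_AbsRing C_NormedModule f z l.
Proof.
  split.
  - intros h. split; [apply is_linear_scal_l|].
    intros x hx.
    assert (hx' : z = x) by exact (@is_filter_lim_locally_unique C_AbsRing (AbsRing_NormedModule C_AbsRing) z x hx). subst x.
    intros eps. destruct (diff_bound _ f z l h eps (cond_pos eps)) as [d [hd H]].
    exists (mkposreal d hd). intros u hu.
    specialize (H u hu). rewrite (Cmult_comm l) in H. exact H.
  - intros [_ h]. apply diff_of_bound; [auto|].
    intros eps heps. destruct (h z (fun P HP => HP) (mkposreal eps heps)) as [d Hd].
    exists d. split; [apply cond_pos|]. intros u hu. specialize (Hd u hu).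
    rewrite (Cmult_comm l). exact Hd.
Qed.

(** * Integrals of complex functions of a real variable *)

Definition CI (f : R -> C) (a b : R) : C := @RInt C_R_CompleteNormedModule f a b.

Definition contI (f : R -> C) (a b : R) : Prop :=
  forall t, (Rmin a b <= t <= Rmax a b)%R -> Rcont f t.

Lemma contI_sym f a b : contI f a b -> contI f b a.
Proof. unfold contI. rewrite Rmin_comm, Rmax_comm. auto. Qed.

Lemma contI_ex f a b : contI f a b -> @ex_RInt C_R_NormedModule f a b.
Proof.
  intros h. apply (@ex_RInt_continuous C_R_CompleteNormedModule).
  intros z hz. apply (proj1 (Rcont_continuous f z)), h, hz.
Qed.

Lemma CI_is f a b : contI f a b -> @is_RInt C_R_NormedModule f a b (CI f a b).
Proof. intros h. apply (@RInt_correct C_R_CompleteNormedModule), contI_ex, h. Qed.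

Lemma CI_unique f a b l : @is_RInt C_R_NormedModule f a b l -> CI f a b = l.
Proof. apply (@is_RInt_unique C_R_CompleteNormedModule). Qed.

Lemma CI_FTC (F f : R -> C) a b :
  (forall t, (Rmin a b <= t <= Rmax a b)%R -> Rdiff F t (f t)) -> contI f a b ->
  CI f a b = F b - F a.
Proof.
  intros h hc. apply CI_unique.
  apply (@is_RInt_derive C_R_CompleteNormedModule).
  - intros x hx. apply Rdiff_is_derive, h, hx.
  - intros x hx. apply (proj1 (Rcont_continuous f x)), hc, hx.
Qed.

Lemma CI_ext f g a b :
  (forall t, (Rmin a b < t < Rmax a b)%R -> f t = g t) -> CI f a b = CI g a b.
Proof. apply (@RInt_ext C_R_CompleteNormedModule). Qed.

Lemma CI_chasles f a b c : contI f a b -> contI f b c ->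
  CI f a c = CI f a b + CI f b c.
Proof.
  intros h h'. symmetry. apply (@RInt_Chasles C_R_CompleteNormedModule).
  - apply contI_ex, h.
  - apply contI_ex, h'.
Qed.

Lemma CI_swap f a b : contI f a b -> CI f b a = - CI f a b.
Proof.
  intros h. symmetry.
  apply (@opp_RInt_swap C_R_CompleteNormedModule), contI_ex, h.
Qed.

Lemma CI_point f a : CI f a a = 0.
Proof. apply (@RInt_point C_R_CompleteNormedModule). Qed.

Lemma CI_plus f g a b : contI f a b -> contI g a b ->
  CI (fun t => f t + g t) a b = CI f a b + CI g a b.
Proof.
  intros h h'. apply (@RInt_plus C_R_CompleteNormedModule); apply contI_ex; auto.
Qed.

Lemma is_RInt_pair (f : R -> C) a b l :
  @is_RInt C_R_NormedModule f a b l <->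
  is_RInt (fun t => Re (f t)) a b (Re l) /\ is_RInt (fun t => Im (f t)) a b (Im l).
Proof.
  split.
  - intros h. split.
    + apply (@is_RInt_fct_extend_fst R_NormedModule R_NormedModule), h.
    + apply (@is_RInt_fct_extend_snd R_NormedModule R_NormedModule), h.
  - intros [h h']. rewrite (surjective_pairing l).
    apply (@is_RInt_fct_extend_pair R_NormedModule R_NormedModule); auto.
Qed.

(** A complex factor is not a scalar of the real normed module in which the integral is taken, so
    linearity goes through the components. *)
Lemma is_RInt_Cscal c (f : R -> C) a b l :
  @is_RInt C_R_NormedModule f a b l -> @is_RInt C_R_NormedModule (fun t => c * f t) a b (c * l).
Proof.
  intros h. apply is_RInt_pair in h. destruct h as [h1 h2]. apply is_RInt_pair. split.
  - apply (is_RInt_minus (V := R_NormedModule)); apply (is_RInt_scal (V := R_NormedModule)); auto.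
  - apply (is_RInt_plus (V := R_NormedModule)); apply (is_RInt_scal (V := R_NormedModule)); auto.
Qed.

Lemma CI_scal c f a b : contI f a b -> CI (fun t => c * f t) a b = c * CI f a b.
Proof. intros h. apply CI_unique, is_RInt_Cscal, CI_is, h. Qed.

Lemma contI_plus f g a b : contI f a b -> contI g a b -> contI (fun t => f t + g t) a b.
Proof. intros h h' t ht. apply cont_plus; auto. Qed.

Lemma contI_scal c f a b : contI f a b -> contI (fun t => c * f t) a b.
Proof. intros h t ht. apply cont_mult; auto. apply cont_const. Qed.

Lemma contI_minus f g a b : contI f a b -> contI g a b -> contI (fun t => f t - g t) a b.
Proof. intros h h' t ht. apply cont_minus; auto. Qed.

Lemma CI_minus f g a b : contI f a b -> contI g a b ->
  CI (fun t => f t - g t) a b = CI f a b - CI g a b.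
Proof.
  intros h h'. apply (@RInt_minus C_R_CompleteNormedModule); apply contI_ex; auto.
Qed.

Lemma CI_const c a b : CI (fun _ => c) a b = RtoC (b - a) * c.
Proof.
  rewrite CI_FTC with (F := fun t : R => RtoC t * c).
  - rewrite RtoC_minus. ring.
  - intros t _. eapply diff_eq; [|apply diff_mult; [apply diff_e|apply diff_const]]. cbv beta. ring.
  - intros t _. apply cont_const.
Qed.

Lemma CI_bound f a b M : (a <= b)%R -> contI f a b ->
  (forall t, (a <= t <= b)%R -> (Cmod (f t) <= M)%R) ->
  (Cmod (CI f a b) <= (b - a) * M)%R.
Proof.
  intros hab h hM. rewrite Cmod_norm.
  apply (@norm_RInt_le_const C_R_NormedModule f a b); auto.
  - intros t ht. rewrite <- Cmod_norm. auto.
  - apply CI_is, h.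
Qed.

Lemma CI_le f (g : R -> R) a b : (a <= b)%R -> contI f a b -> ex_RInt g a b ->
  (forall t, (a <= t <= b)%R -> (Cmod (f t) <= g t)%R) ->
  (Cmod (CI f a b) <= RInt g a b)%R.
Proof.
  intros hab h hg hM. rewrite Cmod_norm.
  apply (@norm_RInt_le C_R_NormedModule f g a b); auto.
  - intros t ht. rewrite <- Cmod_norm. auto.
  - apply CI_is, h.
  - apply (@RInt_correct R_CompleteNormedModule), hg.
Qed.

(** * Goursat's theorem on rectangles *)

(** Counterclockwise integral over the boundary: the bottom and right sides minus the top and left
    ones. *)
Definition rect_int (f : C -> C) (a b c d : R) : C :=
  CI (fun x => f (x, c)) a b + Ci * CI (fun y => f (b, y)) c d
  - CI (fun x => f (x, d)) a b - Ci * CI (fun y => f (a, y)) c d.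

Definition in_rect (a b c d : R) (z : C) : Prop :=
  (a <= Re z <= b)%R /\ (c <= Im z <= d)%R.

Lemma Rdiff_hor c x : Rdiff (fun x => (x, c) : C) x 1.
Proof.
  apply diff_ext with (f := fun x : R => RtoC x + Ci * RtoC c).
  - intros u. apply injective_projections; simpl; ring.
  - eapply diff_eq; [|apply diff_plus; [apply diff_e|apply diff_const]]. cbv beta. ring.
Qed.

Lemma Rdiff_ver a y : Rdiff (fun y => (a, y) : C) y Ci.
Proof.
  apply diff_ext with (f := fun y : R => RtoC a + Ci * RtoC y).
  - intros u. apply injective_projections; simpl; ring.
  - eapply diff_eq; [|apply diff_plus; [apply diff_const|apply diff_scal, diff_e]]. ring.
Qed.

Lemma Rcont_hor (f : C -> C) c x : Ccont f (x, c) -> Rcont (fun x => f (x, c)) x.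
Proof.
  intros h. apply (cont_comp RtoC (fun z : C => z) f (fun x : R => (x, c) : C)); [exact h|].
  eapply diff_cont, Rdiff_hor.
Qed.

Lemma Rcont_ver (f : C -> C) a y : Ccont f (a, y) -> Rcont (fun y => f (a, y)) y.
Proof.
  intros h. apply (cont_comp RtoC (fun z : C => z) f (fun y : R => (a, y) : C)); [exact h|].
  eapply diff_cont, Rdiff_ver.
Qed.

Section Rect.
Variables (a b c d : R).
Hypotheses (hab : (a <= b)%R) (hcd : (c <= d)%R).

Definition cont_rect f := forall z, in_rect a b c d z -> Ccont f z.

Lemma contI_hor f y : cont_rect f -> (c <= y <= d)%R -> contI (fun x => f (x, y)) a b.
Proof.
  intros h hy x hx. rewrite Rmin_left, Rmax_right in hx; auto.
  apply Rcont_hor, h. split; simpl; lra.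
Qed.

Lemma contI_ver f x : cont_rect f -> (a <= x <= b)%R -> contI (fun y => f (x, y)) c d.
Proof.
  intros h hx y hy. rewrite Rmin_left, Rmax_right in hy; auto.
  apply Rcont_ver, h. split; simpl; lra.
Qed.

Lemma rect_int_plus f g : cont_rect f -> cont_rect g ->
  rect_int (fun z => f z + g z) a b c d = rect_int f a b c d + rect_int g a b c d.
Proof.
  intros hf hg. unfold rect_int.
  rewrite !CI_plus; try (apply contI_hor; auto; lra); try (apply contI_ver; auto; lra). ring.
Qed.

Lemma rect_int_bound f M : cont_rect f -> (forall z, in_rect a b c d z -> (Cmod (f z) <= M)%R) ->
  (Cmod (rect_int f a b c d) <= 2 * (b - a + (d - c)) * M)%R.
Proof.
  intros hf hM. unfold rect_int.
  assert (h1 := CI_bound (fun x => f (x, c)) a b M hab (contI_hor f c hf ltac:(lra))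
    (fun t ht => hM (t, c) (conj ht (conj (Rle_refl c) hcd)))).
  assert (h2 := CI_bound (fun x => f (x, d)) a b M hab (contI_hor f d hf ltac:(lra))
    (fun t ht => hM (t, d) (conj ht (conj hcd (Rle_refl d))))).
  assert (h3 := CI_bound (fun y => f (a, y)) c d M hcd (contI_ver f a hf ltac:(lra))
    (fun t ht => hM (a, t) (conj (conj (Rle_refl a) hab) ht))).
  assert (h4 := CI_bound (fun y => f (b, y)) c d M hcd (contI_ver f b hf ltac:(lra))
    (fun t ht => hM (b, t) (conj (conj hab (Rle_refl b)) ht))).
  unfold Cminus.
  eapply Rle_trans; [apply Cmod_triangle|].
  eapply Rle_trans; [apply Rplus_le_compat_r, Cmod_triangle|].
  eapply Rle_trans; [apply Rplus_le_compat_r, Rplus_le_compat_r, Cmod_triangle|].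
  rewrite !Cmod_opp, !Cmod_mult, Cmod_Ci. lra.
Qed.

Lemma rect_int_primitive F f : cont_rect f -> (forall z, in_rect a b c d z -> Cdiff F z (f z)) ->
  rect_int f a b c d = 0.
Proof.
  intros hf hF. unfold rect_int.
  assert (hh : forall y, (c <= y <= d)%R -> CI (fun x => f (x, y)) a b = F (b, y) - F (a, y)).
  { intros y hy. apply (CI_FTC (fun x => F (x, y))).
    - intros t ht. rewrite Rmin_left, Rmax_right in ht; auto.
      eapply diff_eq; [|apply (diff_comp RtoC (fun z : C => z) F (fun x : R => (x, y) : C))].
      3: apply Rdiff_hor. 2: apply hF; split; simpl; lra. ring.
    - apply contI_hor; auto. }
  assert (hv : forall x, (a <= x <= b)%R -> Ci * CI (fun y => f (x, y)) c d = F (x, d) - F (x, c)).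
  { intros x hx. rewrite <- CI_scal; [|apply contI_ver; auto].
    apply (CI_FTC (fun y => F (x, y))).
    - intros t ht. rewrite Rmin_left, Rmax_right in ht; auto.
      eapply diff_eq; [|apply (diff_comp RtoC (fun z : C => z) F (fun y : R => (x, y) : C))].
      3: apply Rdiff_ver. 2: apply hF; split; simpl; lra. ring.
    - apply contI_scal, contI_ver; auto. }
  rewrite !hh, !hv by lra. ring.
Qed.
End Rect.

Lemma rect_int_split_hor f a x b c d : (a <= x <= b)%R -> (c <= d)%R -> cont_rect a b c d f ->
  rect_int f a b c d = rect_int f a x c d + rect_int f x b c d.
Proof.
  intros hx hcd hf. unfold rect_int.
  rewrite (CI_chasles (fun t => f (t, c)) a x b), (CI_chasles (fun t => f (t, d)) a x b).
  { ring. }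
  all: intros t ht; revert ht; rewrite Rmin_left, Rmax_right by lra; intros ht;
    apply Rcont_hor, hf; split; simpl; lra.
Qed.

Lemma rect_int_split_ver f a b c y d : (a <= b)%R -> (c <= y <= d)%R -> cont_rect a b c d f ->
  rect_int f a b c d = rect_int f a b c y + rect_int f a b y d.
Proof.
  intros hab hy hf. unfold rect_int.
  rewrite (CI_chasles (fun t => f (a, t)) c y d), (CI_chasles (fun t => f (b, t)) c y d).
  { ring. }
  all: intros t ht; revert ht; rewrite Rmin_left, Rmax_right by lra; intros ht;
    apply Rcont_ver, hf; split; simpl; lra.
Qed.

Record rectangle := Rect { ra : R; rb : R; rc : R; rd : R }.

Definition rint (f : C -> C) (Q : rectangle) : C := rect_int f (ra Q) (rb Q) (rc Q) (rd Q).

Definition quarter (Q : rectangle) (i j : bool) : rectangle :=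
  let x := ((ra Q + rb Q) / 2)%R in let y := ((rc Q + rd Q) / 2)%R in
  Rect (if i then ra Q else x) (if i then x else rb Q)
       (if j then rc Q else y) (if j then y else rd Q).

Definition good (f : C -> C) (Q : rectangle) : Prop :=
  (ra Q <= rb Q)%R /\ (rc Q <= rd Q)%R /\ cont_rect (ra Q) (rb Q) (rc Q) (rd Q) f.

Lemma good_quarter f Q i j : good f Q -> good f (quarter Q i j).
Proof.
  intros (h1 & h2 & h3). unfold quarter, good. simpl.
  split; [destruct i; lra|]. split; [destruct j; lra|].
  intros z [[hz1 hz2] [hz3 hz4]]. apply h3. unfold in_rect.
  destruct i, j; lra.
Qed.

Lemma exists_quarter f Q K : good f Q -> (4 * K <= Cmod (rint f Q))%R ->
  exists i j, (K <= Cmod (rint f (quarter Q i j)))%R.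
Proof.
  intros hg hK. apply NNPP. intros hn.
  assert (h : forall i j, (Cmod (rint f (quarter Q i j)) < K)%R).
  { intros i j. apply Rnot_le_lt. intros h. apply hn. exists i, j. auto. }
  destruct hg as (h1 & h2 & h3).
  assert (E : rint f Q = rint f (quarter Q true true) + rint f (quarter Q true false)
    + rint f (quarter Q false true) + rint f (quarter Q false false)).
  { unfold rint, quarter. simpl.
    rewrite (rect_int_split_hor f (ra Q) ((ra Q + rb Q) / 2) (rb Q)); auto; [|lra].
    rewrite (rect_int_split_ver f (ra Q) _ (rc Q) ((rc Q + rd Q) / 2) (rd Q)); [|lra|lra|].
    2:{ intros z [hz1 hz2]. apply h3. split; lra. }
    rewrite (rect_int_split_ver f _ (rb Q) (rc Q) ((rc Q + rd Q) / 2) (rd Q)); [|lra|lra|].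
    2:{ intros z [hz1 hz2]. apply h3. split; lra. }
    ring. }
  rewrite E in hK.
  pose proof (h true true). pose proof (h true false).
  pose proof (h false true). pose proof (h false false).
  pose proof (Cmod_triangle (rint f (quarter Q true true) + rint f (quarter Q true false)
    + rint f (quarter Q false true)) (rint f (quarter Q false false))).
  pose proof (Cmod_triangle (rint f (quarter Q true true) + rint f (quarter Q true false))
    (rint f (quarter Q false true))).
  pose proof (Cmod_triangle (rint f (quarter Q true true)) (rint f (quarter Q true false))).
  lra.
Qed.

Definition big_quarter (f : C -> C) (Q : rectangle) : rectangle :=
  epsilon (inhabits Q) (fun Q' => exists i j, Q' = quarter Q i j /\
    (Cmod (rint f Q) / 4 <= Cmod (rint f Q'))%R).

Lemma big_quarter_spec f Q : good f Q -> exists i j, big_quarter f Q = quarter Q i j /\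
    (Cmod (rint f Q) / 4 <= Cmod (rint f (quarter Q i j)))%R.
Proof.
  intros hg. unfold big_quarter.
  assert (hex : exists Q', exists i j, Q' = quarter Q i j /\
    (Cmod (rint f Q) / 4 <= Cmod (rint f Q'))%R).
  { destruct (exists_quarter f Q (Cmod (rint f Q) / 4) hg) as (i & j & h); [lra|].
    exists (quarter Q i j), i, j. auto. }
  destruct (epsilon_spec (inhabits Q) _ hex) as (i & j & h & h').
  exists i, j. split; [exact h|]. rewrite <- h. exact h'.
Qed.

Fixpoint nested (f : C -> C) (Q : rectangle) (n : nat) : rectangle :=
  match n with O => Q | S m => big_quarter f (nested f Q m) end.

Lemma nested_spec f Q n : good f Q ->
  let Qn := nested f Q n in
  good f Qn /\ (Cmod (rint f Q) / 4 ^ n <= Cmod (rint f Qn))%R /\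
  (rb Qn - ra Qn = (rb Q - ra Q) / 2 ^ n)%R /\ (rd Qn - rc Qn = (rd Q - rc Q) / 2 ^ n)%R.
Proof.
  intros hg. induction n as [|n IH]; simpl.
  - repeat split; try apply hg; lra.
  - destruct IH as (h1 & h2 & h3 & h4). set (Qn := nested f Q n) in *.
    destruct (big_quarter_spec f Qn h1) as (i & j & -> & h).
    assert (p4 : (0 < 4 ^ n)%R) by (apply pow_lt; lra).
    assert (p2 : (0 < 2 ^ n)%R) by (apply pow_lt; lra).
    split; [apply good_quarter; auto|]. split; [|split].
    + eapply Rle_trans; [|exact h].
      replace (Cmod (rint f Q) / (4 * 4 ^ n))%R with ((Cmod (rint f Q) / 4 ^ n) / 4)%R by (field; lra).
      lra.
    + replace ((rb Q - ra Q) / (2 * 2 ^ n))%R with (((rb Q - ra Q) / 2 ^ n) / 2)%R by (field; lra).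
      rewrite <- h3. unfold quarter. simpl. destruct i; field.
    + replace ((rd Q - rc Q) / (2 * 2 ^ n))%R with (((rd Q - rc Q) / 2 ^ n) / 2)%R by (field; lra).
      rewrite <- h4. unfold quarter. simpl. destruct j; field.
Qed.

Lemma nested_step f Q n : good f Q ->
  let Qn := nested f Q n in let Qs := nested f Q (S n) in
  (ra Qn <= ra Qs)%R /\ (rb Qs <= rb Qn)%R /\ (rc Qn <= rc Qs)%R /\ (rd Qs <= rd Qn)%R.
Proof.
  intros hg. destruct (nested_spec f Q n hg) as ((h1 & h2 & h3) & _).
  destruct (big_quarter_spec f (nested f Q n) (conj h1 (conj h2 h3))) as (i & j & h & _).
  simpl. rewrite h. unfold quarter; simpl. destruct i, j; lra.
Qed.

Lemma nested_seq_limit (u v : nat -> R) (w : R) :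
  (forall n, (u n <= u (S n))%R) -> (forall n, (v (S n) <= v n)%R) ->
  (forall n, (v n - u n = w / 2 ^ n)%R) -> (0 <= w)%R ->
  exists x, forall n, (u n <= x <= v n)%R.
Proof.
  intros hu hv hw h0.
  assert (mu : forall n k, (u n <= u (n + k)%nat)%R).
  { intros n k. induction k; [rewrite Nat.add_0_r; lra|].
    rewrite Nat.add_succ_r. eapply Rle_trans; [exact IHk|apply hu]. }
  assert (mv : forall n k, (v (n + k)%nat <= v n)%R).
  { intros n k. induction k; [rewrite Nat.add_0_r; lra|].
    rewrite Nat.add_succ_r. eapply Rle_trans; [apply hv|exact IHk]. }
  assert (uv : forall n, (u n <= v n)%R).
  { intros n. specialize (hw n). assert (0 <= w / 2 ^ n)%R; [|lra].
    apply Rdiv_le_0_compat; [auto|apply pow_lt; lra]. }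
  assert (uv2 : forall n m, (u n <= v m)%R).
  { intros n m. eapply Rle_trans; [apply (mu n m)|]. eapply Rle_trans; [apply uv|].
    rewrite Nat.add_comm. apply mv. }
  destruct (completeness (fun x => exists n, x = u n)) as [x [hx1 hx2]].
  - exists (v O). intros y [n ->]. apply uv2.
  - exists (u O). exists O. auto.
  - exists x. intros n. split; [apply hx1; exists n; auto|].
    apply hx2. intros y [m ->]. apply uv2.
Qed.

Definition Cdiffable (f : C -> C) (z : C) : Prop := exists l, Cdiff f z l.

Lemma Cdiffable_cont f z : Cdiffable f z -> Ccont f z.
Proof. intros [l h]. eapply diff_cont, h. Qed.

Lemma Cmod_le_Re_Im (z : C) : (Cmod z <= Rabs (Re z) + Rabs (Im z))%R.
Proof.
  replace z with (RtoC (Re z) + Ci * RtoC (Im z)) at 1.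
  - eapply Rle_trans; [apply Cmod_triangle|]. rewrite Cmod_mult, Cmod_Ci, !Cmod_R. lra.
  - destruct z as [x y]. apply injective_projections; simpl; ring.
Qed.

(** Bisection: quarters that keep at least a fourth of the integral shrink to a point where [f] is
    differentiable, and there the integral is too small for the size of the quarter. No regularity
    of the derivative is assumed. *)
Lemma goursat f a b c d : (a <= b)%R -> (c <= d)%R ->
  (forall z, in_rect a b c d z -> Cdiffable f z) -> rect_int f a b c d = 0.
Proof.
  intros hab hcd hf. set (Q := Rect a b c d).
  assert (hg : good f Q).
  { split; [|split]; auto. intros z hz. apply Cdiffable_cont, hf, hz. }
  destruct (nested_seq_limit (fun n => ra (nested f Q n)) (fun n => rb (nested f Q n)) (b - a))
    as [x hx].
  { intros n. apply (nested_step f Q n hg). }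
  { intros n. apply (nested_step f Q n hg). }
  { intros n. apply (nested_spec f Q n hg). }
  { lra. }
  destruct (nested_seq_limit (fun n => rc (nested f Q n)) (fun n => rd (nested f Q n)) (d - c))
    as [y hy].
  { intros n. apply (nested_step f Q n hg). }
  { intros n. apply (nested_step f Q n hg). }
  { intros n. apply (nested_spec f Q n hg). }
  { lra. }
  destruct (hf (x, y)) as [l hl].
  { split; [apply (hx O)|apply (hy O)]. }
  apply Cmod_eq_0. set (K := Cmod (rect_int f a b c d)).
  destruct (Rle_lt_or_eq_dec 0 K (Cmod_ge_0 _)) as [hK|hK]; [exfalso|auto].
  set (w := (b - a + (d - c))%R). assert (hw : (0 <= w)%R) by (unfold w; lra).
  (* Chosen so that 2 w^2 eps < K, the final contradiction; the 1 covers the case w = 0. *)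
  set (eps := (K / (2 * w * w + 1) / 2)%R).
  assert (heps : (0 < eps)%R).
  { unfold eps. apply Rdiv_lt_0_compat; [|lra]. apply Rdiv_lt_0_compat; nra. }
  destruct (diff_bound _ f (x, y) l hl eps heps) as [dl [hdl H]].
  destruct (pow_lt_1_zero (1 / 2) ltac:(rewrite Rabs_right; lra) (dl / (w + 1))%R) as [n hn].
  { apply Rdiv_lt_0_compat; lra. }
  specialize (hn n (le_n n)).
  assert (p2 : (0 < 2 ^ n)%R) by (apply pow_lt; lra).
  assert (hsmall : (w / 2 ^ n < dl)%R).
  { rewrite Rabs_right in hn.
    2:{ apply Rle_ge, pow_le; lra. }
    unfold Rdiv in hn at 1. rewrite Rmult_1_l, pow_inv in hn.
    apply Rlt_div_r in hn; [|lra]. unfold Rdiv.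
    assert (0 < / 2 ^ n)%R by (apply Rinv_0_lt_compat; auto). nra. }
  destruct (nested_spec f Q n hg) as ((g1 & g2 & g3) & h2 & h3 & h4).
  set (Qn := nested f Q n) in *. specialize (hx n). specialize (hy n).
  fold Qn in hx, hy. simpl in h3, h4.
  set (p := (x, y) : C) in *.
  (* The tangent [f0] has a quadratic primitive, hence integral 0; only the first-order remainder
     [f1] contributes. *)
  set (f1 := fun z : C => f z - f p - l * (z - p)).
  set (f0 := fun z : C => f p + l * (z - p)).
  assert (c0 : cont_rect (ra Qn) (rb Qn) (rc Qn) (rd Qn) f0).
  { intros z hz. unfold f0. apply cont_plus; [apply cont_const|].
    apply cont_mult; [apply cont_const|]. apply cont_minus; [apply cont_e|apply cont_const]. }
  assert (c1 : cont_rect (ra Qn) (rb Qn) (rc Qn) (rd Qn) f1).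
  { intros z hz. apply cont_ext with (f := fun z => f z - f0 z).
    { intros; unfold f0, f1; ring. }
    apply cont_minus; [apply g3, hz|apply c0, hz]. }
  assert (E : rint f Qn = rint f1 Qn).
  { unfold rint. transitivity (rect_int (fun z => f1 z + f0 z) (ra Qn) (rb Qn) (rc Qn) (rd Qn)).
    { f_equal. apply functional_extensionality. intros z. unfold f1, f0. cbv beta. ring. }
    rewrite rect_int_plus; auto.
    rewrite (rect_int_primitive _ _ _ _ g1 g2 (fun z => f p * z + l / 2 * ((z - p) * (z - p))) f0 c0).
    - ring.
    - intros z _. unfold f0.
      eapply diff_eq; [|apply diff_plus; [apply diff_scal, diff_e|apply diff_scal, diff_mult;
        apply diff_minus; try apply diff_const; apply diff_e]]. cbv beta. field. }
  assert (hb : (Cmod (rint f1 Qn) <= 2 * (w / 2 ^ n) * (eps * (w / 2 ^ n)))%R).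
  { replace (w / 2 ^ n)%R with (rb Qn - ra Qn + (rd Qn - rc Qn))%R.
    2:{ rewrite h3, h4. unfold w. field. lra. }
    refine (rect_int_bound _ _ _ _ g1 g2 f1 (eps * _)%R _ _); [assumption|]. intros z [[z1 z2] [z3 z4]].
    assert (hz : (Cmod (z - p) <= rb Qn - ra Qn + (rd Qn - rc Qn))%R).
    { eapply Rle_trans; [apply Cmod_le_Re_Im|]. unfold Re, Im in *. simpl.
      apply Rplus_le_compat; apply Rabs_le; lra. }
    unfold f1. eapply Rle_trans; [apply H|].
    - eapply Rle_lt_trans; [exact hz|]. rewrite h3, h4.
      replace ((b - a) / 2 ^ n + (d - c) / 2 ^ n)%R with (w / 2 ^ n)%R; [auto|].
      unfold w; field; lra.
    - apply Rmult_le_compat_l; [lra|exact hz]. }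
  rewrite E in h2. change (Cmod (rint f Q)) with K in h2.
  assert (h5 : (K / 4 ^ n <= 2 * (w / 2 ^ n) * (eps * (w / 2 ^ n)))%R) by lra.
  replace (2 * (w / 2 ^ n) * (eps * (w / 2 ^ n)))%R with ((2 * w * w * eps) / 4 ^ n)%R in h5.
  2:{ replace 4%R with (2 * 2)%R by ring. rewrite Rpow_mult_distr. field. lra. }
  assert (p4 : (0 < 4 ^ n)%R) by (apply pow_lt; lra).
  apply Rmult_le_reg_r in h5; [|apply Rinv_0_lt_compat; auto].
  unfold eps in h5.
  replace (2 * w * w * (K / (2 * w * w + 1) / 2))%R
    with (K / 2 * ((2 * w * w) / (2 * w * w + 1)))%R in h5 by (field; nra).
  assert (2 * w * w / (2 * w * w + 1) <= 1)%R by (apply Rle_div_l; nra).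
  nra.
Qed.

(** * The complex exponential *)

Lemma Cexp_0 : Cexp 0 = 1.
Proof. unfold Cexp. simpl. rewrite exp_0, cos_0, sin_0. apply injective_projections; simpl; ring. Qed.

Lemma Cexp_plus z w : Cexp (z + w) = Cexp z * Cexp w.
Proof.
  unfold Cexp. destruct z as [x y], w as [x' y']. simpl.
  rewrite exp_plus, cos_plus, sin_plus. apply injective_projections; simpl; ring.
Qed.

Lemma Cexp_neq_0 z : Cexp z <> 0.
Proof.
  intros H. assert (E : Cexp z * Cexp (- z) = 1).
  { rewrite <- Cexp_plus. replace (z + - z) with (RtoC 0) by ring. apply Cexp_0. }
  rewrite H, Cmult_0_l in E. apply C1_nz. auto.
Qed.

Lemma Cexp_opp z : Cexp (- z) = / Cexp z.
Proof.
  assert (E : Cexp z * Cexp (- z) = 1).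
  { rewrite <- Cexp_plus. replace (z + - z) with (RtoC 0) by ring. apply Cexp_0. }
  pose proof (Cexp_neq_0 z). rewrite <- (Cmult_1_r (/ Cexp z)), <- E. field. auto.
Qed.

Lemma Cmod_cos_sin y : Cmod (cos y, sin y) = 1%R.
Proof.
  unfold Cmod. simpl. rewrite !Rmult_1_r.
  replace (cos y * cos y + sin y * sin y)%R with 1%R; [apply sqrt_1|].
  pose proof (sin2_cos2 y). unfold Rsqr in *. lra.
Qed.

Lemma Cexp_polar x y : Cexp (x, y) = RtoC (exp x) * (cos y, sin y).
Proof. apply injective_projections; simpl; ring. Qed.

Lemma Cmod_Cexp z : Cmod (Cexp z) = exp (Re z).
Proof.
  destruct z as [x y]. rewrite Cexp_polar, Cmod_mult, Cmod_cos_sin, Cmod_R, Rabs_right; simpl.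
  - ring.
  - apply Rle_ge, Rlt_le, exp_pos.
Qed.

Lemma Cexp_RtoC x : Cexp (RtoC x) = RtoC (exp x).
Proof. unfold Cexp. simpl. rewrite cos_0, sin_0. apply injective_projections; simpl; ring. Qed.

Lemma R_deriv_bound (f : R -> R) x l : derivable_pt_lim f x l ->
  forall eps, (0 < eps)%R -> exists d, (0 < d)%R /\ forall h, (Rabs h < d)%R ->
    (Rabs (f (x + h) - f x - l * h) <= eps * Rabs h)%R.
Proof.
  intros H eps heps. destruct (H eps heps) as [d Hd]. exists d. split; [apply cond_pos|].
  intros h hh. destruct (Req_dec h 0) as [->|h0].
  - rewrite Rplus_0_r. replace (f x - f x - l * 0)%R with 0%R by ring. rewrite Rabs_R0. lra.
  - specialize (Hd h h0 hh).
    replace (f (x + h) - f x - l * h)%R with (((f (x + h) - f x) / h - l) * h)%R by (field; auto).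
    rewrite Rabs_mult. apply Rmult_le_compat_r; [apply Rabs_pos|lra].
Qed.

Lemma Cdiff_Cexp_0 : Cdiff Cexp 0 1.
Proof.
  apply diff_of_bound; [auto|]. intros eps heps.
  (* The three error terms found below add up to at most 9 [e1] |w|. *)
  set (e1 := Rmin 1 (eps / 16)).
  assert (he1 : (0 < e1)%R) by (apply Rmin_pos; lra).
  assert (le1 : (e1 <= 1)%R) by apply Rmin_l.
  assert (le8 : (e1 <= eps / 16)%R) by apply Rmin_r.
  destruct (R_deriv_bound exp 0 (exp 0) (derivable_pt_lim_exp 0) e1 he1) as [d1 [hd1 H1]].
  destruct (R_deriv_bound cos 0 (- sin 0) (derivable_pt_lim_cos 0) e1 he1) as [d2 [hd2 H2]].
  destruct (R_deriv_bound sin 0 (cos 0) (derivable_pt_lim_sin 0) e1 he1) as [d3 [hd3 H3]].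
  exists (Rmin (Rmin d1 d2) (Rmin d3 e1)).
  split; [apply Rmin_pos; apply Rmin_pos; assumption|]. intros w hw.
  rewrite Cexp_0. replace (w - 0) with w in * by ring.
  destruct w as [x y].
  assert (hx := re_le_Cmod (x, y)). assert (hy := Rmax_Cmod (x, y)). simpl in hx, hy.
  assert (hy' : (Rabs y <= Cmod (x, y))%R) by (eapply Rle_trans; [apply Rmax_r|exact hy]).
  set (m := Cmod (x, y)) in *. assert (hm : (0 <= m)%R) by apply Cmod_ge_0.
  assert (m1 : (m < d1)%R /\ (m < d2)%R /\ (m < d3)%R /\ (m < e1)%R).
  { pose proof (Rmin_l (Rmin d1 d2) (Rmin d3 e1)). pose proof (Rmin_r (Rmin d1 d2) (Rmin d3 e1)).
    pose proof (Rmin_l d1 d2). pose proof (Rmin_r d1 d2).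
    pose proof (Rmin_l d3 e1). pose proof (Rmin_r d3 e1). lra. }
  specialize (H1 x ltac:(lra)). specialize (H2 y ltac:(lra)). specialize (H3 y ltac:(lra)).
  rewrite Rplus_0_l, exp_0 in H1. rewrite Rplus_0_l, sin_0, cos_0 in H2.
  rewrite Rplus_0_l, sin_0, cos_0 in H3.
  set (u := (exp x - 1 - 1 * x)%R) in *. set (v := (cos y - 1 - - 0 * y)%R) in *.
  set (s := (sin y - 0 - 1 * y)%R) in *.
  replace (Cexp (x, y) - 1 - 1 * (x, y)) with
    (RtoC u + RtoC (exp x) * (RtoC v + Ci * RtoC s) + RtoC (exp x - 1) * (Ci * RtoC y)).
  2:{ rewrite Cexp_polar. apply injective_projections; simpl; unfold u, v, s; ring. }
  eapply Rle_trans; [apply Cmod_triangle|].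
  eapply Rle_trans; [apply Rplus_le_compat_r, Cmod_triangle|].
  rewrite !Cmod_mult, !Cmod_R, Cmod_Ci.
  assert (hvs : (Cmod (RtoC v + Ci * RtoC s) <= 2 * e1 * m)%R).
  { eapply Rle_trans; [apply Cmod_triangle|]. rewrite Cmod_mult, !Cmod_R, Cmod_Ci. nra. }
  assert (hex : (Rabs (exp x - 1) <= 2 * m)%R).
  { replace (exp x - 1)%R with (u + x)%R by (unfold u; ring).
    eapply Rle_trans; [apply Rabs_triang|]. nra. }
  assert (hex3 : (Rabs (exp x) <= 3)%R).
  { replace (exp x) with ((exp x - 1) + 1)%R by ring.
    eapply Rle_trans; [apply Rabs_triang|]. rewrite Rabs_R1. nra. }
  assert (Rabs (exp x) * Cmod (RtoC v + Ci * RtoC s) <= 3 * (2 * e1 * m))%R.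
  { apply Rmult_le_compat; auto using Rabs_pos, Cmod_ge_0. }
  assert (Rabs (exp x - 1) * (1 * Rabs y) <= (2 * m) * m)%R.
  { apply Rmult_le_compat; auto using Rabs_pos. rewrite Rmult_1_l; apply Rabs_pos. lra. }
  assert (e1 * Rabs x <= e1 * m)%R by (apply Rmult_le_compat_l; lra).
  assert (m * m <= e1 * m)%R by (apply Rmult_le_compat_r; lra).
  assert (e1 * m <= eps / 16 * m)%R by (apply Rmult_le_compat_r; lra).
  assert (0 <= eps * m)%R by (apply Rmult_le_pos; lra).
  lra.
Qed.

Lemma Cdiff_Cexp z : Cdiff Cexp z (Cexp z).
Proof.
  apply diff_ext with (f := fun w : C => Cexp z * Cexp (w - z)).
  { intros u. rewrite <- Cexp_plus. f_equal. ring. }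
  eapply diff_eq; [|apply diff_scal, (diff_comp (fun z => z) (fun z => z) Cexp (fun w => w - z))].
  3: apply diff_minus; [apply diff_e|apply diff_const].
  2:{ replace (z - z) with (RtoC 0) by ring. apply Cdiff_Cexp_0. }
  ring.
Qed.

Section ExpDiff.
Context {T : Type} (e : T -> C).
Lemma diff_Cexp f t l : diff_at e f t l -> diff_at e (fun u => Cexp (f u)) t (l * Cexp (f t)).
Proof.
  intros h. eapply diff_eq; [|apply (diff_comp e (fun z => z) Cexp f)].
  2: apply Cdiff_Cexp. 2: exact h. ring.
Qed.
End ExpDiff.

(** * Circles *)

Definition circ (c : C) (r th : R) : C := c + RtoC r * (cos th, sin th).

Lemma circ_Cexp c r th : (0 < r)%R -> circ c r th = c + Cexp (ln r, th).
Proof. intros h. unfold circ. rewrite Cexp_polar, exp_ln; auto. Qed.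

Lemma Cmod_circ c r th : (0 <= r)%R -> Cmod (circ c r th - c) = r.
Proof.
  intros h. unfold circ. replace (c + RtoC r * (cos th, sin th) - c) with (RtoC r * (cos th, sin th)) by ring.
  rewrite Cmod_mult, Cmod_cos_sin, Cmod_R, Rabs_right; lra.
Qed.

Lemma Rdiff_circ c r th : Rdiff (circ c r) th (Ci * (circ c r th - c)).
Proof.
  apply diff_ext with (f := fun th => c + RtoC r * Cexp (Ci * RtoC th)).
  { intros u. unfold circ. do 2 f_equal. replace (Ci * RtoC u) with ((0, u)%R : C).
    - rewrite Cexp_polar, exp_0. ring.
    - apply injective_projections; simpl; ring. }
  eapply diff_eq; [|apply diff_plus; [apply diff_const|apply diff_scal, diff_Cexp, diff_scal, diff_e]].
  unfold circ. replace (Ci * RtoC th) with ((0, th)%R : C).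
  - rewrite Cexp_polar, exp_0. ring.
  - apply injective_projections; simpl; ring.
Qed.

Lemma Rcont_circ f c r th : Ccont f (circ c r th) -> Rcont (fun th => f (circ c r th)) th.
Proof.
  intros h. apply (cont_comp RtoC (fun z => z) f (circ c r)); [exact h|].
  eapply diff_cont, Rdiff_circ.
Qed.

Lemma continuous_bounded (f : R -> C) a b : (a <= b)%R -> contI f a b ->
  exists M, (0 <= M)%R /\ forall t, (a <= t <= b)%R -> (Cmod (f t) <= M)%R.
Proof.
  intros hab hf.
  destruct (continuity_ab_maj (fun t => Cmod (f t)) a b hab) as [tm [H _]].
  - intros t ht. assert (hc : Rcont (fun u => RtoC (Cmod (f u))) t).
    { apply cont_Cmod, hf. rewrite Rmin_left, Rmax_right; auto. }
    intros eps heps. destruct (hc eps heps) as [d [hd Hd]]. exists d. split; [auto|].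
    intros u [_ hu]. simpl in *. unfold Rdist in *.
    specialize (Hd u). rewrite <- !RtoC_minus, !Cmod_R in Hd. auto.
  - exists (Cmod (f tm)). split; [apply Cmod_ge_0|]. intros t ht. apply (H t ht).
Qed.

(** An integral with respect to the angle, hence 2 pi times the mean value; the contour integral of
    [f] is i times [cmean] of (z - c) f(z). *)
Definition cmean (f : C -> C) (c : C) (r : R) : C := CI (fun th => f (circ c r th)) (- PI) PI.

Definition cont_circle (f : C -> C) (c : C) (r : R) : Prop :=
  forall z, Cmod (z - c) = r -> Ccont f z.

Lemma minus_PI_le : (- PI <= PI)%R.
Proof. pose proof PI_RGT_0. lra. Qed.

Lemma contI_circ f c r a b : (0 <= r)%R -> cont_circle f c r ->
  contI (fun th => f (circ c r th)) a b.
Proof. intros hr h t _. apply Rcont_circ, h, Cmod_circ, hr. Qed.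

Lemma cmean_bound f c r M : (0 <= r)%R -> cont_circle f c r ->
  (forall z, Cmod (z - c) = r -> (Cmod (f z) <= M)%R) -> (Cmod (cmean f c r) <= 2 * PI * M)%R.
Proof.
  intros hr hf hM. replace (2 * PI * M)%R with ((PI - - PI) * M)%R by ring.
  apply CI_bound; [apply minus_PI_le|apply contI_circ; auto|].
  intros t _. apply hM, Cmod_circ, hr.
Qed.

Lemma circ_surj c r z : Cmod (z - c) = r -> exists th, (- PI <= th <= PI)%R /\ z = circ c r th.
Proof.
  intros h. assert (hr : (0 <= r)%R) by (rewrite <- h; apply Cmod_ge_0).
  destruct (Req_dec r 0) as [h0|h0].
  { exists 0%R. pose proof PI_RGT_0. split; [lra|]. unfold circ. rewrite h0.
    rewrite h0 in h. apply Cmod_sub_0 in h. rewrite h. ring. }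
  set (x := (Re (z - c) / r)%R). set (y := (Im (z - c) / r)%R).
  assert (hxy : (x * x + y * y = 1)%R).
  { unfold x, y. pose proof (Cmod2_alt (z - c)) as E. rewrite h in E.
    apply Rmult_eq_reg_r with (r * r)%R; [|nra].
    transitivity (Re (z - c) ^ 2 + Im (z - c) ^ 2)%R; [field; auto|]. rewrite <- E. ring. }
  assert (hx : (-1 <= x <= 1)%R) by nra.
  assert (ez : z = c + RtoC r * (x, y)).
  { replace z with (c + (z - c)) at 1 by ring. f_equal. unfold x, y.
    destruct (z - c) as [u v]. apply injective_projections; simpl; field; auto. }
  pose proof (acos_bound x). assert (hs : sin (acos x) = sqrt (1 - x²)) by (apply sin_acos; auto).
  destruct (Rle_dec 0 y) as [hy|hy].
  - exists (acos x). split; [lra|]. rewrite ez. unfold circ. rewrite cos_acos, hs by auto.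
    do 2 f_equal. f_equal. symmetry. apply sqrt_lem_1; unfold Rsqr; nra.
  - exists (- acos x)%R. split; [lra|]. rewrite ez. unfold circ.
    rewrite cos_neg, sin_neg, cos_acos, hs by auto.
    do 2 f_equal. f_equal. symmetry.
    replace (sqrt (1 - x²)) with (- y)%R; [ring|]. symmetry. apply sqrt_lem_1; unfold Rsqr; nra.
Qed.

Lemma circle_bounded f c r : (0 <= r)%R -> cont_circle f c r ->
  exists M, (0 <= M)%R /\ forall z, Cmod (z - c) = r -> (Cmod (f z) <= M)%R.
Proof.
  intros hr hf.
  destruct (continuous_bounded (fun th => f (circ c r th)) (- PI) PI minus_PI_le) as [M [hM H]].
  { apply contI_circ; auto. }
  exists M. split; [auto|]. intros z hz.
  destruct (circ_surj c r z hz) as [th [hth ->]]. auto.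
Qed.

(** * Cauchy's theorem for functions differentiable off a vertical line *)

(** Only one of the two points is on the segment, the other is free in the plane. This is what
    controls [f] on thin rectangles around the segment; it follows from compactness, the radii being
    doubled to leave room for the triangle inequality. *)
Lemma unif_cont_segment f x c d :
  (forall y, (c <= y <= d)%R -> Ccont f (x, y)) ->
  forall eps, (0 < eps)%R -> exists dl, (0 < dl)%R /\ forall y z, (c <= y <= d)%R ->
    (Cmod (z - (x, y)) < dl)%R -> (Cmod (f z - f (x, y)) < eps)%R.
Proof.
  intros hf eps heps.
  assert (hex : forall t, exists dl : posreal, (c <= t <= d)%R ->
    forall z, (Cmod (z - (x, t)) < 2 * dl)%R -> (Cmod (f z - f (x, t)) < eps / 2)%R).
  { intros t. destruct (excluded_middle_informative (c <= t <= d)%R) as [ht|ht].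
    - destruct (hf t ht (eps / 2)%R) as [d0 [hd0 H]]; [lra|].
      assert (h2 : (0 < d0 / 2)%R) by lra. exists (mkposreal _ h2). intros _ z hz.
      apply H. simpl in hz. lra.
    - exists (mkposreal 1 Rlt_0_1). tauto. }
  set (del := fun t => epsilon (inhabits (mkposreal 1 Rlt_0_1)) (fun dl : posreal => (c <= t <= d)%R ->
    forall z, (Cmod (z - (x, t)) < 2 * dl)%R -> (Cmod (f z - f (x, t)) < eps / 2)%R)).
  assert (hdel : forall t, (c <= t <= d)%R ->
    forall z, (Cmod (z - (x, t)) < 2 * del t)%R -> (Cmod (f z - f (x, t)) < eps / 2)%R).
  { intros t. apply (epsilon_spec (inhabits (mkposreal 1 Rlt_0_1)) _ (hex t)). }
  destruct (compactness_value_1d c d del) as [d0 Hd0].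
  exists d0. split; [apply cond_pos|]. intros y z hy hz.
  apply NNPP. intros hn. apply (Hd0 y hy). intros [t [ht [ht1 ht2]]]. apply hn.
  assert (e1 : Cmod ((x, y) - (x, t) : C) = Rabs (y - t)).
  { replace ((x, y) - (x, t) : C) with (Ci * RtoC (y - t)).
    - rewrite Cmod_mult, Cmod_Ci, Cmod_R. ring.
    - apply injective_projections; simpl; ring. }
  assert (h1 : (Cmod (f (x, y) - f (x, t)) < eps / 2)%R).
  { apply hdel; auto. rewrite e1. pose proof (cond_pos (del t)). lra. }
  assert (h2 : (Cmod (f z - f (x, t)) < eps / 2)%R).
  { apply hdel; auto. replace (z - (x, t)) with ((z - (x, y)) + ((x, y) - (x, t))) by ring.
    eapply Rle_lt_trans; [apply Cmod_triangle|]. rewrite e1. lra. }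
  replace (f z - f (x, y)) with ((f z - f (x, t)) + - (f (x, y) - f (x, t))) by ring.
  eapply Rle_lt_trans; [apply Cmod_triangle|]. rewrite Cmod_opp. lra.
Qed.

(** A thin rectangle around the exceptional line contributes little: its horizontal sides are short,
    and on its vertical sides the values of [f] nearly agree. In logarithmic coordinates the line is
    a circle through a point where [f] is only known to be continuous. *)
Lemma goursat_off_line f a b c d x : (a <= b)%R -> (c <= d)%R ->
  cont_rect a b c d f ->
  (forall z, in_rect a b c d z -> Re z <> x -> Cdiffable f z) -> rect_int f a b c d = 0.
Proof.
  intros hab hcd hc hf.
  destruct (excluded_middle_informative (a <= x <= b)%R) as [hx|hx].
  2:{ apply goursat; auto. intros z hz. apply hf; auto. intros E. apply hx.
      rewrite <- E. apply hz. }
  apply Cmod_small_eq. intros eps heps.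
  replace (rect_int f a b c d - 0) with (rect_int f a b c d) by ring.
  set (e1 := (eps / (4 * (d - c + 1)))%R).
  assert (he1 : (0 < e1)%R) by (apply Rdiv_lt_0_compat; lra).
  destruct (unif_cont_segment f x c d) with (eps := e1) as [dl [hdl H]]; auto.
  { intros y hy. apply hc. split; simpl; lra. }
  set (K := (Cmod (f (x, c)) + Cmod (f (x, d)) + 2 * e1 + 1)%R).
  assert (hK : (1 <= K)%R).
  { unfold K. pose proof (Cmod_ge_0 (f (x, c))). pose proof (Cmod_ge_0 (f (x, d))). lra. }
  (* The first bound keeps the vertical sides where uniform continuity applies, the second makes the
     horizontal sides contribute at most eps / 2. *)
  set (s := (Rmin (dl / 2) (eps / (4 * K)))%R).
  assert (hs : (0 < s)%R) by (apply Rmin_pos; [lra|apply Rdiv_lt_0_compat; lra]).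
  assert (hs1 : (s <= dl / 2)%R) by apply Rmin_l.
  assert (hs2 : (s <= eps / (4 * K))%R) by apply Rmin_r.
  set (x1 := Rmax a (x - s)). set (x2 := Rmin b (x + s)).
  assert (hx1 : (a <= x1 <= x)%R /\ (x - s <= x1)%R).
  { unfold x1. pose proof (Rmax_l a (x - s)). pose proof (Rmax_r a (x - s)).
    split; [split; [auto|apply Rmax_lub; lra]|auto]. }
  assert (hx2 : (x <= x2 <= b)%R /\ (x2 <= x + s)%R).
  { unfold x2. pose proof (Rmin_l b (x + s)). pose proof (Rmin_r b (x + s)).
    split; [split; [apply Rmin_glb; lra|auto]|auto]. }
  assert (z1 : rect_int f a x1 c d = 0).
  { destruct (Rle_lt_or_eq_dec a x) as [h|h]; [lra| |].
    - assert (x1 < x)%R by (apply Rmax_lub_lt; lra).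
      apply goursat; try lra. intros z [hz1 hz2]. apply hf; [split; lra|lra].
    - replace x1 with a by lra. unfold rect_int. rewrite !CI_point. ring. }
  assert (z2 : rect_int f x2 b c d = 0).
  { destruct (Rle_lt_or_eq_dec x b) as [h|h]; [lra| |].
    - assert (x < x2)%R by (apply Rmin_glb_lt; lra).
      apply goursat; try lra. intros z [hz1 hz2]. apply hf; [split; lra|lra].
    - replace x2 with b by lra. unfold rect_int. rewrite !CI_point. ring. }
  rewrite (rect_int_split_hor f a x1 b), (rect_int_split_hor f x1 x2 b), z1, z2; auto; try lra.
  2:{ intros z [hz1 hz2]. apply hc. split; lra. }
  rewrite Cplus_0_l, Cplus_0_r.
  assert (hcc : cont_rect x1 x2 c d f).
  { intros z [hz1 hz2]. apply hc. split; lra. }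
  assert (hz : forall u y, (x1 <= u <= x2)%R -> (c <= y <= d)%R ->
    (Cmod (f (u, y) - f (x, y)) < e1)%R).
  { intros u y hu hy. apply H; auto.
    replace ((u, y) - (x, y) : C) with (RtoC (u - x)).
    - rewrite Cmod_R. apply Rabs_def1; lra.
    - apply injective_projections; simpl; ring. }
  assert (hn : forall u y, (x1 <= u <= x2)%R -> (c <= y <= d)%R ->
    (Cmod (f (u, y)) <= Cmod (f (x, y)) + e1)%R).
  { intros u y hu hy. specialize (hz u y hu hy). pose proof (Cmod_ge_minus (f (u, y)) (f (x, y))). lra. }
  unfold rect_int.
  replace (CI (fun x0 : R => f (x0, c)) x1 x2 + Ci * CI (fun y : R => f (x2, y)) c d -
     CI (fun x0 : R => f (x0, d)) x1 x2 - Ci * CI (fun y : R => f (x1, y)) c d)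
    with (CI (fun x0 : R => f (x0, c)) x1 x2 + - CI (fun x0 : R => f (x0, d)) x1 x2
      + Ci * CI (fun y : R => f (x2, y) - f (x1, y)) c d).
  2:{ rewrite CI_minus; [ring| |]; intros y hy; rewrite Rmin_left, Rmax_right in hy by lra;
      apply Rcont_ver, hcc; split; simpl; lra. }
  assert (b1 : (Cmod (CI (fun x0 : R => f (x0, c)) x1 x2) <= (x2 - x1) * (Cmod (f (x, c)) + e1))%R).
  { apply CI_bound; [lra| |intros; apply hn; lra].
    intros y hy; rewrite Rmin_left, Rmax_right in hy by lra;
      apply Rcont_hor, hcc; split; simpl; lra. }
  assert (b2 : (Cmod (CI (fun x0 : R => f (x0, d)) x1 x2) <= (x2 - x1) * (Cmod (f (x, d)) + e1))%R).
  { apply CI_bound; [lra| |intros; apply hn; lra].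
    intros y hy; rewrite Rmin_left, Rmax_right in hy by lra;
      apply Rcont_hor, hcc; split; simpl; lra. }
  assert (b3 : (Cmod (CI (fun y : R => (f (x2, y) - f (x1, y))%C) c d) <= (d - c) * (2 * e1))%R).
  { apply CI_bound; [lra| |].
    - apply contI_minus; intros y hy; rewrite Rmin_left, Rmax_right in hy by lra;
      apply Rcont_ver, hcc; split; simpl; lra.
    - intros y hy. replace (f (x2, y) - f (x1, y)) with ((f (x2, y) - f (x, y)) + - (f (x1, y) - f (x, y))) by ring.
      eapply Rle_trans; [apply Cmod_triangle|]. rewrite Cmod_opp.
      pose proof (hz x2 y ltac:(lra) hy). pose proof (hz x1 y ltac:(lra) hy). lra. }
  eapply Rle_trans; [apply Cmod_triangle|].
  eapply Rle_trans; [apply Rplus_le_compat_r, Cmod_triangle|].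
  rewrite Cmod_opp, Cmod_mult, Cmod_Ci, Rmult_1_l.
  assert (b4 : ((x2 - x1) * K <= eps / 2)%R).
  { apply Rle_trans with (2 * (eps / (4 * K)) * K)%R; [apply Rmult_le_compat_r; lra|].
    right. field. lra. }
  assert (b5 : ((d - c) * (2 * e1) <= eps / 2)%R).
  { unfold e1. apply Rle_trans with ((d - c + 1) * (2 * (eps / (4 * (d - c + 1)))))%R.
    - apply Rmult_le_compat_r; [|lra]. fold e1. lra.
    - right. field. lra. }
  unfold K in b4. nra.
Qed.

(** * Circle means and Cauchy's formula *)

(* Both circles are vertical sides of a rectangle in the coordinate [w], where
   [z = c + exp w]; the horizontal sides cancel by periodicity. *)
Lemma cmean_indep f c r1 r2 rho : (0 < r1 <= r2)%R ->
  (forall z, (r1 <= Cmod (z - c) <= r2)%R -> Ccont f z) ->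
  (forall z, (r1 <= Cmod (z - c) <= r2)%R -> Cmod (z - c) <> rho -> Cdiffable f z) ->
  cmean f c r1 = cmean f c r2.
Proof.
  intros hr hc hd. pose proof PI_RGT_0 as hpi.
  set (g := fun w : C => f (c + Cexp w)).
  assert (hl : (ln r1 <= ln r2)%R).
  { destruct (Req_dec r1 r2) as [->|h]; [lra|]. apply Rlt_le, ln_increasing; lra. }
  assert (hmod : forall w, in_rect (ln r1) (ln r2) (- PI) PI w ->
    (r1 <= Cmod (c + Cexp w - c) <= r2)%R).
  { intros w [[h1 h2] _]. replace (c + Cexp w - c) with (Cexp w) by ring. rewrite Cmod_Cexp.
    split.
    - rewrite <- (exp_ln r1) by lra. destruct (Req_dec (ln r1) (Re w)) as [->|h]; [lra|].
      apply Rlt_le, exp_increasing; lra.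
    - rewrite <- (exp_ln r2) by lra. destruct (Req_dec (ln r2) (Re w)) as [->|h]; [lra|].
      apply Rlt_le, exp_increasing; lra. }
  assert (dC : forall w, Cdiff (fun w => c + Cexp w) w (Cexp w)).
  { intros w. eapply diff_eq; [|apply diff_plus; [apply diff_const|apply Cdiff_Cexp]]. ring. }
  assert (G : rect_int g (ln r1) (ln r2) (- PI) PI = 0).
  { apply goursat_off_line with (x := ln rho); auto; [lra| |].
    - intros w hw. unfold g. apply (cont_comp (fun z : C => z) (fun z : C => z) f).
      + apply hc, hmod, hw.
      + eapply diff_cont, dC.
    - intros w hw hne. destruct (hd (c + Cexp w)) as [l hl'].
      + apply hmod, hw.
      + replace (c + Cexp w - c) with (Cexp w) by ring. rewrite Cmod_Cexp.
        intros E. apply hne. rewrite <- E, ln_exp. auto.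
      + exists (l * Cexp w). apply (diff_comp (fun z : C => z) (fun z : C => z) f); auto. }
  unfold rect_int in G.
  assert (E1 : CI (fun x : R => g (x, - PI)%R) (ln r1) (ln r2) = CI (fun x : R => g (x, PI)) (ln r1) (ln r2)).
  { f_equal. apply functional_extensionality. intros x. unfold g. do 2 f_equal.
    unfold Cexp. simpl. rewrite cos_neg, sin_neg, sin_PI, Ropp_0. reflexivity. }
  assert (E2 : forall r, (0 < r)%R -> CI (fun y : R => g (ln r, y)) (- PI) PI = cmean f c r).
  { intros r h. unfold cmean. f_equal. apply functional_extensionality. intros y.
    unfold g. rewrite <- circ_Cexp; auto. }
  rewrite E1, !E2 in G by lra.
  apply Cmod_sub_0. rewrite Cmod_minus_sym.
  replace (cmean f c r2 - cmean f c r1) with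
    (- Ci * (CI (fun x : R => g (x, PI)) (ln r1) (ln r2) + Ci * cmean f c r2 -
      CI (fun x : R => g (x, PI)) (ln r1) (ln r2) - Ci * cmean f c r1)).
  - rewrite G. rewrite Cmult_0_r. apply Cmod_0.
  - transitivity (- (Ci * Ci) * (cmean f c r2 - cmean f c r1)); [ring|].
    replace (Ci * Ci) with (- (1)) by (apply injective_projections; simpl; ring). ring.
Qed.

Lemma cmean_const k c r : cmean (fun _ => k) c r = 2 * PI * k.
Proof. unfold cmean. rewrite CI_const. rewrite <- RtoC_mult. do 2 f_equal. ring. Qed.

Lemma cmean_minus f g c r : (0 <= r)%R -> cont_circle f c r -> cont_circle g c r ->
  cmean (fun z => f z - g z) c r = cmean f c r - cmean g c r.
Proof. intros hr hf hg. apply CI_minus; apply contI_circ; auto. Qed.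

Lemma cmean_scal k f c r : (0 <= r)%R -> cont_circle f c r ->
  cmean (fun z => k * f z) c r = k * cmean f c r.
Proof. intros hr hf. apply CI_scal; apply contI_circ; auto. Qed.

Lemma cmean_ext f g c r : (0 <= r)%R -> (forall z, Cmod (z - c) = r -> f z = g z) ->
  cmean f c r = cmean g c r.
Proof. intros hr h. apply CI_ext. intros t _. apply h, Cmod_circ, hr. Qed.

Lemma cmean_near f k c r eps : (0 <= r)%R -> cont_circle f c r ->
  (forall z, Cmod (z - c) = r -> (Cmod (f z - k) <= eps)%R) ->
  (Cmod (cmean f c r - 2 * PI * k) <= 2 * PI * eps)%R.
Proof.
  intros hr hf h. rewrite <- (cmean_const k c r), <- cmean_minus; auto.
  2:{ intros z _. apply cont_const. }
  apply cmean_bound; auto. intros z hz. apply cont_minus; [auto|apply cont_const].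
Qed.

(** The circle shrinks to [c] without changing the mean, while [f] tends to [k]. On the circle of
    radius [rho], [f] need only be continuous. *)
Lemma cmean_limit_in f c r rho k : (0 < r)%R ->
  (forall z, (0 < Cmod (z - c) <= r)%R -> Ccont f z) ->
  (forall z, (0 < Cmod (z - c) <= r)%R -> Cmod (z - c) <> rho -> Cdiffable f z) ->
  (forall eps, (0 < eps)%R -> exists d, (0 < d)%R /\ forall z, (0 < Cmod (z - c) < d)%R ->
     (Cmod (f z - k) <= eps)%R) ->
  cmean f c r = 2 * PI * k.
Proof.
  intros hr hc hd hl. apply Cmod_small_eq. intros eps heps. pose proof PI_RGT_0 as hpi.
  destruct (hl (eps / (2 * PI))%R) as [d [hd0 H]]; [apply Rdiv_lt_0_compat; lra|].
  set (s := Rmin r (d / 2)).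
  assert (hs : (0 < s)%R) by (apply Rmin_pos; lra).
  assert (hs1 : (s <= r)%R) by apply Rmin_l. assert (hs2 : (s <= d / 2)%R) by apply Rmin_r.
  rewrite <- (cmean_indep f c s r rho).
  - replace eps with (2 * PI * (eps / (2 * PI)))%R by (field; lra).
    apply cmean_near; [lra| |].
    + intros z hz. apply hc. lra.
    + intros z hz. apply H. lra.
  - lra.
  - intros z hz. apply hc. lra.
  - intros z hz. apply hd. lra.
Qed.

Lemma Cdiffable_id z : Cdiffable (fun z => z) z.
Proof. exists 1. apply diff_e. Qed.
Lemma Cdiffable_const k z : Cdiffable (fun _ => k) z.
Proof. exists 0. apply diff_const. Qed.
Lemma Cdiffable_plus f g z : Cdiffable f z -> Cdiffable g z -> Cdiffable (fun w => f w + g w) z.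
Proof. intros [l h] [m h']. exists (l + m). apply diff_plus; auto. Qed.
Lemma Cdiffable_minus f g z : Cdiffable f z -> Cdiffable g z -> Cdiffable (fun w => f w - g w) z.
Proof. intros [l h] [m h']. exists (l - m). apply diff_minus; auto. Qed.
Lemma Cdiffable_opp f z : Cdiffable f z -> Cdiffable (fun w => - f w) z.
Proof. intros [l h]. exists (- l). apply diff_opp; auto. Qed.
Lemma Cdiffable_mult f g z : Cdiffable f z -> Cdiffable g z -> Cdiffable (fun w => f w * g w) z.
Proof. intros [l h] [m h']. eexists. apply diff_mult; eauto. Qed.
Lemma Cdiffable_div f g z : Cdiffable f z -> Cdiffable g z -> g z <> 0 ->
  Cdiffable (fun w => f w / g w) z.
Proof. intros [l h] [m h'] h0. eexists. apply diff_div; eauto. Qed.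
Lemma Cdiffable_pow f n z : Cdiffable f z -> Cdiffable (fun w => f w ^ n) z.
Proof.
  intros h. induction n as [|n IH]; simpl; [apply Cdiffable_const|].
  apply Cdiffable_mult; auto.
Qed.
Lemma Cdiffable_comp f g z : Cdiffable g (f z) -> Cdiffable f z -> Cdiffable (fun w => g (f w)) z.
Proof.
  intros [l h] [m h']. exists (l * m). apply (diff_comp (fun z : C => z) (fun z : C => z)); auto.
Qed.
Lemma Cdiffable_Cexp f z : Cdiffable f z -> Cdiffable (fun w => Cexp (f w)) z.
Proof. intros [l h]. eexists. apply diff_Cexp. eauto. Qed.
Lemma Cdiffable_ext_loc f g z : (exists d, (0 < d)%R /\ forall u, (Cmod (u - z) < d)%R -> f u = g u) ->
  Cdiffable f z -> Cdiffable g z.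
Proof. intros h [l hl]. exists l. eapply diff_ext_loc; eauto. Qed.

(** Outside the circle the integrand is holomorphic and tends to 1 at infinity, so the circle is
    enlarged instead of shrunk. *)
Lemma cmean_kernel c r a : (0 < r)%R -> (Cmod (a - c) < r)%R ->
  cmean (fun z => (z - c) / (z - a)) c r = 2 * PI * 1.
Proof.
  intros hr ha. apply Cmod_small_eq. intros eps heps. pose proof PI_RGT_0 as hpi.
  set (m := Cmod (a - c)) in *. assert (hm : (0 <= m)%R) by apply Cmod_ge_0.
  assert (hne : forall z, (r <= Cmod (z - c))%R -> z - a <> 0).
  { intros z hz. apply Cminus_neq_0. intros ->. fold m in hz. lra. }
  set (e1 := (eps / (2 * PI))%R). assert (he1 : (0 < e1)%R) by (apply Rdiv_lt_0_compat; lra).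
  (* On this circle |z - a| exceeds m / e1, which makes the kernel differ from 1 by less than
     [e1]. *)
  set (s := (r + m / e1)%R).
  assert (hme : (0 <= m / e1)%R) by (apply Rdiv_le_0_compat; lra).
  assert (hdd : forall z, (r <= Cmod (z - c))%R -> Cdiffable (fun z => (z - c) / (z - a)) z).
  { intros z hz. apply Cdiffable_div; [| |apply hne, hz];
      apply Cdiffable_minus; try apply Cdiffable_id; apply Cdiffable_const. }
  rewrite (cmean_indep _ c r s 0).
  - replace eps with (2 * PI * e1)%R by (unfold e1; field; lra).
    apply cmean_near; [unfold s; lra| |].
    + intros z hz. apply Cdiffable_cont, hdd. unfold s in hz; lra.
    + intros z hz. assert (hz' : (r <= Cmod (z - c))%R) by (unfold s in hz; lra).
      replace ((z - c) / (z - a) - 1) with ((a - c) / (z - a)) by (field; apply hne, hz').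
      rewrite Cmod_div by (apply hne, hz'). fold m.
      pose proof (Cmod_ge_minus (z - c) (a - c)) as h.
      replace (z - c - (a - c)) with (z - a) in h by ring. fold m in h. rewrite hz in h.
      assert (hp : (m / e1 < Cmod (z - a))%R) by (unfold s in h; lra).
      apply Rle_div_l; [lra|]. apply Rlt_div_l in hp; lra.
  - unfold s; lra.
  - intros z hz. apply Cdiffable_cont, hdd. lra.
  - intros z hz _. apply hdd. lra.
Qed.

(** Riemann's condition, weaker than boundedness near [c]. *)
Definition removable (f : C -> C) (c : C) : Prop :=
  forall eps, (0 < eps)%R -> exists d, (0 < d)%R /\ forall z, (0 < Cmod (z - c) < d)%R ->
     (Cmod ((z - c) * f z) <= eps)%R.

Lemma cont_removable f c : Ccont f c -> removable f c.
Proof.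
  intros h eps heps. destruct (h 1%R) as [d [hd H]]; [lra|].
  set (K := (Cmod (f c) + 1)%R). assert (hK : (0 < K)%R) by (unfold K; pose proof (Cmod_ge_0 (f c)); lra).
  exists (Rmin d (eps / K)). split; [apply Rmin_pos; [auto|apply Rdiv_lt_0_compat; lra]|].
  intros z [hz0 hz]. pose proof (Rmin_l d (eps / K)). pose proof (Rmin_r d (eps / K)).
  rewrite Cmod_mult. specialize (H z ltac:(lra)).
  pose proof (Cmod_ge_minus (f z) (f c)).
  assert (h1 : (Cmod (z - c) * Cmod (f z) <= eps / K * K)%R).
  { apply Rmult_le_compat; try apply Cmod_ge_0; [lra|unfold K; lra]. }
  replace (eps / K * K)%R with eps in h1 by (field; lra). exact h1.
Qed.

(** The kernel vanishes at the centre, so [f] may be singular there: this form of Cauchy's formula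
    already contains Riemann's theorem. The quotient of [f] at [a], times z - c, is continuous at
    [a], differentiable at the other points of the punctured disc, and tends to 0 at [c]; hence its
    mean is 0. *)
Lemma cauchy_formula_off f c r a : (0 < r)%R -> (0 < Cmod (a - c) < r)%R ->
  (forall z, (0 < Cmod (z - c) <= r)%R -> Cdiffable f z) -> removable f c ->
  2 * PI * f a = cmean (fun z => f z * ((z - c) / (z - a))) c r.
Proof.
  intros hr ha hd hrem.
  destruct (hd a ltac:(lra)) as [l [q [hq1 [hq2 hq3]]]].
  set (F := fun z => q z * (z - c)).
  assert (hF : forall z, z <> a -> F z = f z * ((z - c) / (z - a)) - f a * ((z - c) / (z - a))).
  { intros z hz. unfold F. assert (h0 := Cminus_neq_0 _ _ hz).
    replace (q z) with ((f z - f a) / (z - a)); [field; auto|]. rewrite hq1. field. auto. }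
  assert (hFd : forall z, (0 < Cmod (z - c) <= r)%R -> z <> a -> Cdiffable F z).
  { intros z hz hza. assert (h0 := Cminus_neq_0 _ _ hza).
    apply Cdiffable_ext_loc with (f := fun z => (f z - f a) * ((z - c) / (z - a))).
    - exists (Cmod (z - a)). split; [apply Cmod_gt_0; auto|]. intros u hu.
      rewrite hF; [ring|]. intros ->. rewrite Cmod_minus_sym in hu. lra.
    - apply Cdiffable_mult; [apply Cdiffable_minus; [auto|apply Cdiffable_const]|].
      apply Cdiffable_div; auto; apply Cdiffable_minus; try apply Cdiffable_id; apply Cdiffable_const. }
  assert (hk : forall z, Cmod (z - c) = r -> z - a <> 0).
  { intros z hz. apply Cminus_neq_0. intros ->. lra. }
  assert (E : cmean F c r = 2 * PI * 0).
  { apply (cmean_limit_in F c r (Cmod (a - c)) 0); auto.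
    - intros z hz. destruct (excluded_middle_informative (z = a)) as [->|h].
      + unfold F. apply cont_mult; [exact hq3|apply cont_minus; [apply cont_e|apply cont_const]].
      + apply Cdiffable_cont, hFd; auto.
    - intros z hz hne. apply hFd; auto. intros ->. auto.
    - intros eps heps. set (m := Cmod (a - c)) in *.
      (* Near [c] the denominator satisfies |z - a| >= m / 2, so the two terms of the numerator may
         each reach eps m / 4. *)
      destruct (hrem (eps * m / 4)%R) as [d [hd0 H]]; [nra|].
      set (K := (Cmod (f a) + 1)%R).
      assert (hK : (0 < K)%R) by (unfold K; pose proof (Cmod_ge_0 (f a)); lra).
      set (d2 := (eps * m / 4 / K)%R).
      assert (hd2 : (0 < d2)%R) by (apply Rdiv_lt_0_compat; nra).
      exists (Rmin (Rmin d d2) (m / 2)). split; [apply Rmin_pos; [apply Rmin_pos; auto|lra]|].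
      intros z [hz0 hz].
      pose proof (Rmin_l (Rmin d d2) (m / 2)). pose proof (Rmin_r (Rmin d d2) (m / 2)).
      pose proof (Rmin_l d d2). pose proof (Rmin_r d d2).
      specialize (H z ltac:(lra)).
      assert (hza : (m / 2 <= Cmod (z - a))%R).
      { pose proof (Cmod_ge_minus (a - c) (z - c)) as h.
        replace (a - c - (z - c)) with (a - z) in h by ring. rewrite (Cmod_minus_sym a z) in h.
        fold m in h. lra. }
      assert (hne : z <> a).
      { intros ->. replace (a - a) with (RtoC 0) in hza by ring. rewrite Cmod_0 in hza. lra. }
      assert (h0 := Cminus_neq_0 _ _ hne).
      rewrite hF; auto.
      replace (f z * ((z - c) / (z - a)) - f a * ((z - c) / (z - a)) - 0)
        with (((z - c) * f z - f a * (z - c)) / (z - a)) by (field; auto).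
      rewrite Cmod_div; auto. apply Rle_div_l; [lra|].
      eapply Rle_trans; [apply Cmod_triangle|]. rewrite Cmod_opp, (Cmod_mult (f a)).
      assert (h2 : (Cmod (f a) * Cmod (z - c) <= K * d2)%R).
      { apply Rmult_le_compat; try apply Cmod_ge_0; [unfold K|]; lra. }
      replace (K * d2)%R with (eps * m / 4)%R in h2 by (unfold d2; field; lra).
      assert (eps * (m / 2) <= eps * Cmod (z - a))%R by (apply Rmult_le_compat_l; lra).
      lra. }
  assert (ck : cont_circle (fun z => (z - c) / (z - a)) c r).
  { intros z hz. apply Cdiffable_cont, Cdiffable_div; [| |apply hk; auto];
      apply Cdiffable_minus; try apply Cdiffable_id; apply Cdiffable_const. }
  rewrite (cmean_ext F (fun z => f z * ((z - c) / (z - a)) - f a * ((z - c) / (z - a)))) in E.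
  3:{ intros z hz. apply hF. intros ->. lra. }
  2: lra.
  rewrite cmean_minus in E; [|lra| |].
  - rewrite cmean_scal, cmean_kernel in E; [|lra|lra|lra|auto].
    apply Cmod_sub_0. rewrite Cmod_minus_sym.
    transitivity (Cmod (2 * PI * 0)); [rewrite <- E; f_equal; ring|].
    rewrite Cmult_0_r. apply Cmod_0.
  - intros z hz. apply cont_mult; [|apply ck, hz]. apply Cdiffable_cont, hd. lra.
  - intros z hz. apply cont_mult; [apply cont_const|apply ck, hz].
Qed.

Lemma cauchy_formula f c r a : (0 < r)%R -> (Cmod (a - c) < r)%R ->
  (forall z, (Cmod (z - c) <= r)%R -> Cdiffable f z) ->
  2 * PI * f a = cmean (fun z => f z * ((z - c) / (z - a))) c r.
Proof.
  intros hr ha hd. destruct (Rle_lt_or_eq_dec 0 (Cmod (a - c)) (Cmod_ge_0 _)) as [h|h].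
  - apply cauchy_formula_off; auto.
    + intros z hz. apply hd. lra.
    + apply cont_removable, Cdiffable_cont, hd. replace (c - c) with (RtoC 0) by ring. rewrite Cmod_0. lra.
  - symmetry in h. apply Cmod_sub_0 in h. subst a.
    rewrite (cmean_ext _ f); [|lra|].
    + symmetry. apply cmean_limit_in with (rho := 0%R); auto.
      * intros z hz. apply Cdiffable_cont, hd. lra.
      * intros z hz _. apply hd. lra.
      * intros eps heps. assert (hc : Ccont f c).
        { apply Cdiffable_cont, hd. replace (c - c) with (RtoC 0) by ring. rewrite Cmod_0. lra. }
        destruct (hc eps heps) as [d [hd0 H]]. exists d. split; [auto|].
        intros z hz. apply Rlt_le, H. lra.
    + intros z hz. assert (z - c <> 0) by (apply Cmod_gt_0; lra). field. auto.
Qed.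

(** Only continuity of [phi] on the circle is used. The kernel differs from its first-order
    expansion in [a] by (z - c)(u - a)^2 / ((z - u)(z - a)^2), and both distances to the circle are
    at least s / 2, whence the constant 8 M / s^3. *)
Lemma cauchy_integral_diff phi c r a : (0 < r)%R -> (Cmod (a - c) < r)%R -> cont_circle phi c r ->
  Cdiffable (fun a => cmean (fun z => phi z * ((z - c) / (z - a))) c r) a.
Proof.
  intros hr ha hphi.
  set (psi := fun z => phi z * (z - c)).
  destruct (circle_bounded psi c r) as [M [hM HM]]; [lra| |].
  { intros z hz. apply cont_mult; [auto|]. apply cont_minus; [apply cont_e|apply cont_const]. }
  set (s := (r - Cmod (a - c))%R).
  assert (hs : (0 < s)%R) by (unfold s; lra).
  assert (hdist : forall z u, Cmod (z - c) = r -> (Cmod (u - a) < s / 2)%R -> (s / 2 <= Cmod (z - u))%R).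
  { intros z u hz hu. pose proof (Cmod_triangle (z - u) ((u - a) + (a - c))) as h1.
    replace (z - u + (u - a + (a - c))) with (z - c) in h1 by ring.
    pose proof (Cmod_triangle (u - a) (a - c)). unfold s in *. lra. }
  assert (ha0 : (Cmod (a - a) < s / 2)%R).
  { replace (a - a) with (RtoC 0) by ring. rewrite Cmod_0. lra. }
  assert (hne : forall z u, Cmod (z - c) = r -> (Cmod (u - a) < s / 2)%R -> z - u <> 0).
  { intros z u hz hu. apply Cmod_gt_0. specialize (hdist z u hz hu). lra. }
  assert (ck : forall u, (Cmod (u - a) < s / 2)%R -> cont_circle (fun z => phi z * ((z - c) / (z - u))) c r).
  { intros u hu z hz. apply cont_mult; [auto|].
    apply Cdiffable_cont, Cdiffable_div; [| |apply hne; auto];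
      apply Cdiffable_minus; try apply Cdiffable_id; apply Cdiffable_const. }
  assert (ck2 : cont_circle (fun z => psi z / ((z - a) * (z - a))) c r).
  { intros z hz. apply cont_div.
    - apply cont_mult; [auto|]. apply cont_minus; [apply cont_e|apply cont_const].
    - apply cont_mult; apply cont_minus; try apply cont_e; apply cont_const.
    - apply Cmult_neq_0; apply hne; auto. }
  exists (cmean (fun z => psi z / ((z - a) * (z - a))) c r).
  apply diff_of_bound; [auto|]. intros eps heps. pose proof PI_RGT_0 as hpi.
  set (K := (2 * PI * (8 * M / (s * s * s)) + 1)%R).
  assert (h8 : (0 <= 8 * M / (s * s * s))%R) by (apply Rdiv_le_0_compat; [lra|repeat apply Rmult_lt_0_compat; auto]).
  assert (hK : (0 < K)%R) by (unfold K; nra).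
  exists (Rmin (s / 2) (eps / K)). split; [apply Rmin_pos; [lra|apply Rdiv_lt_0_compat; lra]|].
  intros u hu. pose proof (Rmin_l (s / 2) (eps / K)). pose proof (Rmin_r (s / 2) (eps / K)).
  assert (hu2 : (Cmod (u - a) < s / 2)%R) by lra.
  rewrite <- cmean_minus; [|lra|apply ck; auto|apply ck; auto].
  rewrite (Cmult_comm (cmean _ _ _)), <- cmean_scal; [|lra|auto].
  rewrite <- cmean_minus; [|lra| |].
  2:{ intros z hz. apply cont_minus; apply ck; auto. }
  2:{ intros z hz. apply cont_mult; [apply cont_const|apply ck2, hz]. }
  eapply Rle_trans; [apply cmean_bound with (M := (8 * M / (s * s * s) * (Cmod (u - a) * Cmod (u - a)))%R); [lra| |]|].
  - intros z hz. repeat apply cont_minus; try (apply ck; auto).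
    apply cont_mult; [apply cont_const|apply ck2, hz].
  - intros z hz. assert (n1 := hne z u hz hu2). assert (n2 := hne z a hz ha0).
    replace (phi z * ((z - c) / (z - u)) - phi z * ((z - c) / (z - a)) - (u - a) * (psi z / ((z - a) * (z - a))))
      with (psi z * ((u - a) * (u - a)) / ((z - u) * ((z - a) * (z - a)))).
    2:{ unfold psi. field. auto. }
    rewrite Cmod_div; [|repeat apply Cmult_neq_0; auto]. rewrite !Cmod_mult.
    pose proof (hdist z u hz hu2). pose proof (hdist z a hz ha0). specialize (HM z hz).
    set (D := Cmod (u - a)) in *. assert (0 <= D)%R by apply Cmod_ge_0.
    assert (hden : (s * s * s / 8 <= Cmod (z - u) * (Cmod (z - a) * Cmod (z - a)))%R).
    { replace (s * s * s / 8)%R with (s / 2 * (s / 2 * (s / 2)))%R by field.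
      apply Rmult_le_compat; [lra|nra|lra|apply Rmult_le_compat; lra]. }
    assert (hsss : (0 < s * s * s)%R) by (repeat apply Rmult_lt_0_compat; auto).
    apply Rle_div_l; [lra|].
    apply Rle_trans with (M * (D * D))%R; [apply Rmult_le_compat_r; [nra|auto]|].
    apply Rle_trans with (8 * M / (s * s * s) * (D * D) * (s * s * s / 8))%R.
    + right. field. lra.
    + apply Rmult_le_compat_l; [|auto]. apply Rmult_le_pos; nra.
  - set (D := Cmod (u - a)) in *. assert (0 <= D)%R by apply Cmod_ge_0.
    replace (2 * PI * (8 * M / (s * s * s) * (D * D)))%R with ((2 * PI * (8 * M / (s * s * s))) * D * D)%R by ring.
    apply Rmult_le_compat_r; auto.
    apply Rle_trans with (K * (eps / K))%R; [|right; field; lra].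
    apply Rmult_le_compat; [nra|auto|unfold K; lra|lra].
Qed.

(** * Consequences of Cauchy's formula *)

Lemma two_PI_neq_0 : 2 * PI <> 0.
Proof.
  pose proof PI_RGT_0. rewrite <- RtoC_mult. intros h. apply RtoC_inj in h. lra.
Qed.

Lemma Cmult_div_cancel (k z : C) : k <> 0 -> k * z / k = z.
Proof. intros h. field. auto. Qed.

(** The Cauchy integral over a smaller circle is differentiable at [c] too, and agrees with [f] off
    [c] by [cauchy_formula_off]. *)
Lemma riemann f c R0 : (0 < R0)%R ->
  (forall z, (0 < Cmod (z - c) < R0)%R -> Cdiffable f z) -> removable f c ->
  exists F : C -> C, (forall z, z <> c -> F z = f z) /\
    (forall z, (Cmod (z - c) < R0)%R -> Cdiffable F z).
Proof.
  intros hR hd hrem. pose proof two_PI_neq_0 as h2pi. set (r := (R0 / 2)%R).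
  set (G := fun a => cmean (fun z => f z * ((z - c) / (z - a))) c r / (2 * PI)).
  assert (hG : forall z, (0 < Cmod (z - c) < r)%R -> G z = f z).
  { intros z hz. unfold G. assert (hr : (0 < r)%R) by (unfold r; lra).
    rewrite <- (cauchy_formula_off f c r z hr hz); [apply Cmult_div_cancel; auto| |auto].
    intros w hw. apply hd. unfold r in hw. lra. }
  set (F := fun z => if excluded_middle_informative (z = c) then G c else f z).
  assert (hFG : forall z, (Cmod (z - c) < r)%R -> G z = F z).
  { intros z hz. unfold F. destruct (excluded_middle_informative (z = c)) as [->|h]; [auto|].
    apply hG. split; [apply Cmod_gt_0, Cminus_neq_0; auto|auto]. }
  assert (hFf : forall z, z <> c -> F z = f z).
  { intros z hz. unfold F. destruct (excluded_middle_informative (z = c)); [contradiction|auto]. }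
  exists F. split; [exact hFf|]. intros z hz.
  destruct (excluded_middle_informative (z = c)) as [->|h].
  - apply Cdiffable_ext_loc with (f := G).
    { exists r. split; [unfold r; lra|]. auto. }
    apply Cdiffable_div; [|apply Cdiffable_const|auto].
    apply cauchy_integral_diff; [unfold r; lra| |].
    + replace (c - c) with (RtoC 0) by ring. rewrite Cmod_0. unfold r; lra.
    + intros w hw. apply Cdiffable_cont, hd. unfold r in hw. lra.
  - assert (h0 : (0 < Cmod (z - c))%R) by (apply Cmod_gt_0, Cminus_neq_0; auto).
    apply Cdiffable_ext_loc with (f := f); [|apply hd; auto].
    exists (Cmod (z - c)). split; [auto|]. intros u hu. symmetry. apply hFf.
    intros ->. rewrite Cmod_minus_sym in hu. lra.
Qed.

(** Cauchy's formula passes to the uniform limit, and a Cauchy integral is differentiable. One good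
    index for each [eps] is enough. *)
Lemma weierstrass (f : nat -> C -> C) (g : C -> C) c r : (0 < r)%R ->
  (forall n z, (Cmod (z - c) <= r)%R -> Cdiffable (f n) z) ->
  (forall eps, (0 < eps)%R -> exists n, forall z, (Cmod (z - c) <= r)%R ->
     (Cmod (f n z - g z) <= eps)%R) ->
  forall z, (Cmod (z - c) < r)%R -> Cdiffable g z.
Proof.
  intros hr hf hu. pose proof two_PI_neq_0 as h2pi. pose proof PI_RGT_0 as hpi.
  (* The uniform limit is only continuous along the inside of the closed disc. *)
  assert (hcont : forall z, (Cmod (z - c) < r)%R -> Ccont g z).
  { intros z hz eps heps. destruct (hu (eps / 4)%R) as [n hn]; [lra|].
    destruct (Cdiffable_cont _ _ (hf n z (Rlt_le _ _ hz)) (eps / 4)%R) as [d [hd H]]; [lra|].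
    exists (Rmin d (r - Cmod (z - c))). split; [apply Rmin_pos; lra|]. intros u hu'.
    pose proof (Rmin_l d (r - Cmod (z - c))). pose proof (Rmin_r d (r - Cmod (z - c))).
    assert (h1 : (Cmod (u - c) <= r)%R).
    { replace (u - c) with ((u - z) + (z - c)) by ring.
      eapply Rle_trans; [apply Cmod_triangle|]. lra. }
    pose proof (hn u h1) as e1. pose proof (hn z (Rlt_le _ _ hz)) as e2.
    specialize (H u ltac:(lra)).
    replace (g u - g z) with (- (f n u - g u) + (f n u - f n z) + (f n z - g z)) by ring.
    eapply Rle_lt_trans; [apply Cmod_triangle|].
    eapply Rle_lt_trans; [apply Rplus_le_compat_r, Cmod_triangle|]. rewrite Cmod_opp. lra. }
  intros z hz. set (s := ((Cmod (z - c) + r) / 2)%R).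
  assert (hs : (0 < s)%R) by (unfold s; pose proof (Cmod_ge_0 (z - c)); lra).
  assert (hzs : (Cmod (z - c) < s)%R) by (unfold s; lra).
  assert (hsr : (s < r)%R) by (unfold s; lra).
  apply Cdiffable_ext_loc with (f := fun a => cmean (fun z => g z * ((z - c) / (z - a))) c s / (2 * PI)).
  2:{ apply Cdiffable_div; [|apply Cdiffable_const|auto].
      apply cauchy_integral_diff; auto. intros w hw. apply hcont. lra. }
  exists (s - Cmod (z - c))%R. split; [lra|]. intros a ha0.
  assert (ha : (Cmod (a - c) < s)%R).
  { replace (a - c) with ((a - z) + (z - c)) by ring.
    eapply Rle_lt_trans; [apply Cmod_triangle|]. lra. }
  assert (hk : forall w, Cmod (w - c) = s -> (s - Cmod (a - c) <= Cmod (w - a))%R).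
  { intros w hw. pose proof (Cmod_ge_minus (w - c) (a - c)) as h.
    replace (w - c - (a - c)) with (w - a) in h by ring. lra. }
  assert (hk0 : forall w, Cmod (w - c) = s -> w - a <> 0).
  { intros w hw. apply Cmod_gt_0. specialize (hk w hw). lra. }
  assert (ck : cont_circle (fun z => (z - c) / (z - a)) c s).
  { intros w hw. apply Cdiffable_cont, Cdiffable_div; [| |apply hk0; auto];
      apply Cdiffable_minus; try apply Cdiffable_id; apply Cdiffable_const. }
  cut (cmean (fun z => g z * ((z - c) / (z - a))) c s = 2 * PI * g a).
  { intros ->. apply Cmult_div_cancel; auto. }
  apply Cmod_small_eq. intros eps heps.
  set (K := (2 * PI * (s / (s - Cmod (a - c))) + 2 * PI)%R).
  assert (hq : (0 < s / (s - Cmod (a - c)))%R) by (apply Rdiv_lt_0_compat; lra).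
  assert (hK : (0 < K)%R) by (unfold K; nra).
  destruct (hu (eps / K)%R) as [n hn]; [apply Rdiv_lt_0_compat; lra|].
  assert (heK : (0 < eps / K)%R) by (apply Rdiv_lt_0_compat; lra).
  replace (cmean (fun z => g z * ((z - c) / (z - a))) c s - 2 * PI * g a) with
    (cmean (fun z => (g z - f n z) * ((z - c) / (z - a))) c s + 2 * PI * (f n a - g a)).
  2:{ rewrite (cmean_ext _ (fun z => g z * ((z - c) / (z - a)) - f n z * ((z - c) / (z - a)))).
      2: lra. 2: intros; ring.
      rewrite cmean_minus; [|lra| |].
      - rewrite <- (cauchy_formula (f n) c s a); auto; [ring|]. intros w hw. apply hf. lra.
      - intros w hw. apply cont_mult; [apply hcont; lra|apply ck, hw].
      - intros w hw. apply cont_mult; [apply Cdiffable_cont, hf; lra|apply ck, hw]. }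
  eapply Rle_trans; [apply Cmod_triangle|].
  assert (b1 : (Cmod (cmean (fun z => ((g z - f n z) * ((z - c) / (z - a)))%C) c s) <=
    2 * PI * (eps / K * (s / (s - Cmod (a - c)))))%R).
  { apply cmean_bound; [lra| |].
    - intros w hw. apply cont_mult; [|apply ck, hw].
      apply cont_minus; [apply hcont; lra|apply Cdiffable_cont, hf; lra].
    - intros w hw. rewrite Cmod_mult. apply Rmult_le_compat; try apply Cmod_ge_0.
      + rewrite Cmod_minus_sym. apply hn. lra.
      + rewrite Cmod_div by (apply hk0; auto). rewrite hw.
        apply Rmult_le_compat_l; [lra|]. apply Rinv_le_contravar; [lra|]. apply hk, hw. }
  assert (b2 : (Cmod (2 * PI * (f n a - g a)) <= 2 * PI * (eps / K))%R).
  { rewrite <- RtoC_mult, Cmod_mult, Cmod_R, Rabs_right by lra.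
    apply Rmult_le_compat_l; [lra|]. apply hn. lra. }
  apply Rle_trans with (eps / K * K)%R; [unfold K at 2; lra|]. right. field. lra.
Qed.

(** The constant depends on [f] only through its bound on the circle, which gives equicontinuity of
    a whole family, as integrals with a parameter require. It is r times (2 / r)^2 times M. *)
Lemma cauchy_lipschitz f c r M : (0 < r)%R ->
  (forall z, (Cmod (z - c) <= r)%R -> Cdiffable f z) ->
  (forall z, Cmod (z - c) = r -> (Cmod (f z) <= M)%R) ->
  forall a b, (Cmod (a - c) <= r / 2)%R -> (Cmod (b - c) <= r / 2)%R ->
    (Cmod (f a - f b) <= 4 * M / r * Cmod (a - b))%R.
Proof.
  intros hr hf hM a b ha hb. pose proof PI_RGT_0 as hpi.
  assert (hk : forall a w, (Cmod (a - c) <= r / 2)%R -> Cmod (w - c) = r -> (r / 2 <= Cmod (w - a))%R).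
  { intros a' w ha' hw. pose proof (Cmod_ge_minus (w - c) (a' - c)) as h.
    replace (w - c - (a' - c)) with (w - a') in h by ring. lra. }
  assert (hk0 : forall a w, (Cmod (a - c) <= r / 2)%R -> Cmod (w - c) = r -> w - a <> 0).
  { intros a' w ha' hw. apply Cmod_gt_0. specialize (hk a' w ha' hw). lra. }
  assert (ck : forall a, (Cmod (a - c) <= r / 2)%R -> cont_circle (fun z => f z * ((z - c) / (z - a))) c r).
  { intros a' ha' w hw. apply cont_mult; [apply Cdiffable_cont, hf; lra|].
    apply Cdiffable_cont, Cdiffable_div; [| |apply hk0; auto];
      apply Cdiffable_minus; try apply Cdiffable_id; apply Cdiffable_const. }
  apply Rmult_le_reg_l with (2 * PI)%R; [lra|].
  replace (2 * PI * Cmod (f a - f b))%R with (Cmod (2 * PI * f a - 2 * PI * f b)).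
  2:{ replace (2 * PI * f a - 2 * PI * f b) with (RtoC (2 * PI) * (f a - f b)).
      - rewrite Cmod_mult, Cmod_R, Rabs_right; lra.
      - rewrite RtoC_mult. ring. }
  rewrite (cauchy_formula f c r a), (cauchy_formula f c r b); auto; try lra.
  rewrite <- cmean_minus; [|lra|apply ck; auto|apply ck; auto].
  apply cmean_bound; [lra| |].
  - intros w hw. apply cont_minus; apply ck; auto.
  - intros w hw. assert (n1 := hk0 a w ha hw). assert (n2 := hk0 b w hb hw).
    replace (f w * ((w - c) / (w - a)) - f w * ((w - c) / (w - b)))
      with (f w * ((w - c) * (a - b)) / ((w - a) * (w - b))) by (field; auto).
    rewrite Cmod_div by (apply Cmult_neq_0; auto). rewrite !Cmod_mult, hw.
    pose proof (hk a w ha hw). pose proof (hk b w hb hw). specialize (hM w hw).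
    pose proof (Cmod_ge_0 (f w)). pose proof (Cmod_ge_0 (a - b)).
    assert (hden : (r / 2 * (r / 2) <= Cmod (w - a) * Cmod (w - b))%R) by (apply Rmult_le_compat; lra).
    apply Rle_div_l; [nra|].
    apply Rle_trans with (4 * M / r * Cmod (a - b) * (r / 2 * (r / 2)))%R.
    + replace (4 * M / r * Cmod (a - b) * (r / 2 * (r / 2)))%R with (M * (r * Cmod (a - b)))%R by (field; lra).
      apply Rmult_le_compat_r; [apply Rmult_le_pos; lra|auto].
    + apply Rmult_le_compat_l; [|auto]. apply Rmult_le_pos; [|auto].
      apply Rdiv_le_0_compat; lra.
Qed.

(** Weaker than the maximum principle by the factor r / (r - |a - c|). The factor is harmless in
    [identity_disc], where the bound is applied to quotients with arbitrarily large powers. *)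
Lemma cauchy_bound f c r M a : (0 < r)%R -> (Cmod (a - c) < r)%R ->
  (forall z, (Cmod (z - c) <= r)%R -> Cdiffable f z) ->
  (forall z, Cmod (z - c) = r -> (Cmod (f z) <= M)%R) ->
  (Cmod (f a) <= r / (r - Cmod (a - c)) * M)%R.
Proof.
  intros hr ha hf hM. pose proof PI_RGT_0 as hpi.
  assert (hk : forall w, Cmod (w - c) = r -> (r - Cmod (a - c) <= Cmod (w - a))%R).
  { intros w hw. pose proof (Cmod_ge_minus (w - c) (a - c)) as h.
    replace (w - c - (a - c)) with (w - a) in h by ring. lra. }
  assert (hk0 : forall w, Cmod (w - c) = r -> w - a <> 0).
  { intros w hw. apply Cmod_gt_0. specialize (hk w hw). lra. }
  apply Rmult_le_reg_l with (2 * PI)%R; [lra|].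
  replace (2 * PI * Cmod (f a))%R with (Cmod (2 * PI * f a)).
  2:{ rewrite <- RtoC_mult, Cmod_mult, Cmod_R, Rabs_right; lra. }
  rewrite (cauchy_formula f c r a); auto.
  apply cmean_bound; [lra| |].
  - intros w hw. apply cont_mult; [apply Cdiffable_cont, hf; lra|].
    apply Cdiffable_cont, Cdiffable_div; [| |apply hk0; auto];
      apply Cdiffable_minus; try apply Cdiffable_id; apply Cdiffable_const.
  - intros w hw. rewrite Cmod_mult, Rmult_comm. apply Rmult_le_compat; try apply Cmod_ge_0; auto.
    rewrite Cmod_div by auto. rewrite hw. apply Rmult_le_compat_l; [lra|].
    apply Rinv_le_contravar; [lra|auto].
Qed.

(* Apply the bound to [f z / (z - c) ^ n], which is holomorphic for every n. *)
Lemma identity_disc f c R0 : (forall z, (Cmod (z - c) < R0)%R -> Cdiffable f z) ->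
  (exists d, (0 < d)%R /\ forall z, (Cmod (z - c) < d)%R -> f z = 0) ->
  forall a, (Cmod (a - c) < R0)%R -> f a = 0.
Proof.
  intros hf [d [hd H]] a ha.
  set (m := Cmod (a - c)) in *. assert (hm0 : (0 <= m)%R) by apply Cmod_ge_0.
  destruct (Rlt_dec m d) as [h|h]; [apply H; auto|].
  set (r := ((m + R0) / 2)%R). assert (hr : (m < r < R0)%R) by (unfold r; lra).
  destruct (circle_bounded f c r) as [M [hM HM]]; [lra| |].
  { intros z hz. apply Cdiffable_cont, hf. lra. }
  apply Cmod_small_eq. intros eps heps. replace (f a - 0) with (f a) by ring.
  set (K := (r / (r - m) * M + 1)%R).
  assert (hq : (0 < r / (r - m))%R) by (apply Rdiv_lt_0_compat; lra).
  assert (hK : (0 < K)%R) by (unfold K; nra).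
  assert (hmr : (0 <= m / r < 1)%R).
  { split; [apply Rdiv_le_0_compat; lra|]. apply Rlt_div_l; lra. }
  destruct (pow_lt_1_zero (m / r) ltac:(rewrite Rabs_right; lra) (eps / K)) as [n hn].
  { apply Rdiv_lt_0_compat; lra. }
  specialize (hn n (le_n n)). rewrite Rabs_right in hn by (apply Rle_ge, pow_le; lra).
  assert (hac : a - c <> 0) by (apply Cmod_gt_0; fold m; lra).
  assert (hb := cauchy_bound (fun z => f z / (z - c) ^ n) c r (M / r ^ n) a).
  cbv beta in hb. rewrite Cmod_div in hb by (apply Cpow_nz; auto).
  rewrite Cmod_pow in hb. fold m in hb.
  assert (hb' : (Cmod (f a) / m ^ n <= r / (r - m) * (M / r ^ n))%R).
  { apply hb; try lra.
    - intros z hz. destruct (excluded_middle_informative (z = c)) as [->|hzc].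
      (* The numerator is 0 near [c], hence so is the quotient, even at [c] where the division takes
         its default value. *)
      + apply Cdiffable_ext_loc with (f := fun _ : C => 0).
        * exists d. split; [auto|]. intros u hu. rewrite (H u hu). unfold Cdiv. ring.
        * apply Cdiffable_const.
      + apply Cdiffable_div; [apply hf; lra| |apply Cpow_nz, Cminus_neq_0; auto].
        apply Cdiffable_pow, Cdiffable_minus; [apply Cdiffable_id|apply Cdiffable_const].
    - intros z hz. rewrite Cmod_div, Cmod_pow, hz.
      + apply Rmult_le_compat_r; [|auto]. apply Rlt_le, Rinv_0_lt_compat, pow_lt; lra.
      + apply Cpow_nz, Cmod_gt_0. lra. }
  assert (pm : (0 < m ^ n)%R) by (apply pow_lt; lra).
  assert (pr : (0 < r ^ n)%R) by (apply pow_lt; lra).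
  assert (hb2 := proj1 (Rle_div_l (Cmod (f a)) (r / (r - m) * (M / r ^ n)) (m ^ n) pm) hb').
  eapply Rle_trans; [exact hb2|].
  apply Rle_trans with (K * (m / r) ^ n)%R.
  - unfold Rdiv at 3. rewrite Rpow_mult_distr, pow_inv.
    replace (r / (r - m) * (M / r ^ n) * m ^ n)%R with ((r / (r - m) * M) * (m ^ n * / r ^ n))%R
      by (field; lra).
    apply Rmult_le_compat_r; [|unfold K; lra]. apply Rmult_le_pos; [lra|].
    apply Rlt_le, Rinv_0_lt_compat; auto.
  - apply Rle_trans with (K * (eps / K))%R; [apply Rmult_le_compat_l; lra|]. right. field. lra.
Qed.

(** * Complex sequences and series *)

Definition Clim (u : nat -> C) (l : C) : Prop :=
  forall eps, (0 < eps)%R -> exists N, forall n, (N <= n)%nat -> (Cmod (u n - l) < eps)%R.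

(** Indexed by the number of terms, so that the empty sum exists; [sum_n] is one step ahead. *)
Fixpoint csum (a : nat -> C) (n : nat) : C :=
  match n with O => 0 | S m => csum a m + a m end.

Fixpoint rsum (a : nat -> R) (n : nat) : R :=
  match n with O => 0 | S m => rsum a m + a m end.

Definition Csums (a : nat -> C) (l : C) : Prop := Clim (csum a) l.

Definition summable (a : nat -> C) : Prop := ex_series (fun k => Cmod (a k)).

Lemma Clim_unique u l l' : Clim u l -> Clim u l' -> l = l'.
Proof.
  intros h h'. apply Cmod_small_eq. intros eps heps.
  destruct (h (eps / 2)%R) as [N HN]; [lra|]. destruct (h' (eps / 2)%R) as [N' HN']; [lra|].
  specialize (HN (max N N') (Nat.le_max_l _ _)). specialize (HN' (max N N') (Nat.le_max_r _ _)).
  replace (l - l') with (- (u (max N N') - l) + (u (max N N') - l')) by ring.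
  eapply Rle_trans; [apply Cmod_triangle|]. rewrite Cmod_opp. lra.
Qed.

Lemma Clim_const l : Clim (fun _ => l) l.
Proof.
  intros eps heps. exists O. intros. replace (l - l) with (RtoC 0) by ring. rewrite Cmod_0. auto.
Qed.

Lemma Clim_ext_ev u v l : (exists N, forall n, (N <= n)%nat -> u n = v n) -> Clim u l -> Clim v l.
Proof.
  intros [N0 H0] h eps heps. destruct (h eps heps) as [N HN]. exists (max N N0). intros n hn.
  rewrite <- H0 by lia. apply HN. lia.
Qed.

Lemma Clim_ext u v l : (forall n, u n = v n) -> Clim u l -> Clim v l.
Proof. intros H. apply Clim_ext_ev. exists O. auto. Qed.

Lemma Clim_plus u v l m : Clim u l -> Clim v m -> Clim (fun n => u n + v n) (l + m).
Proof.
  intros h h' eps heps.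
  destruct (h (eps / 2)%R) as [N HN]; [lra|]. destruct (h' (eps / 2)%R) as [N' HN']; [lra|].
  exists (max N N'). intros n hn. specialize (HN n ltac:(lia)). specialize (HN' n ltac:(lia)).
  replace (u n + v n - (l + m)) with ((u n - l) + (v n - m)) by ring.
  eapply Rle_lt_trans; [apply Cmod_triangle|]. lra.
Qed.

Lemma Clim_bounded u l : Clim u l -> exists M, (0 < M)%R /\ exists N, forall n, (N <= n)%nat -> (Cmod (u n) <= M)%R.
Proof.
  intros h. destruct (h 1%R) as [N HN]; [lra|]. exists (Cmod l + 1)%R.
  pose proof (Cmod_ge_0 l). split; [lra|]. exists N. intros n hn. specialize (HN n hn).
  pose proof (Cmod_ge_minus (u n) l). lra.
Qed.

Lemma Clim_mult u v l m : Clim u l -> Clim v m -> Clim (fun n => u n * v n) (l * m).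
Proof.
  intros h h' eps heps. destruct (Clim_bounded u l h) as (M & hM & N0 & H0).
  pose proof (Cmod_ge_0 m) as hm.
  destruct (h (eps / (2 * (Cmod m + 1)))%R) as [N HN]; [apply Rdiv_lt_0_compat; lra|].
  destruct (h' (eps / (2 * M))%R) as [N' HN']; [apply Rdiv_lt_0_compat; lra|].
  exists (max N0 (max N N')). intros n hn. specialize (HN n ltac:(lia)). specialize (HN' n ltac:(lia)).
  specialize (H0 n ltac:(lia)).
  replace (u n * v n - l * m) with (u n * (v n - m) + (u n - l) * m) by ring.
  eapply Rle_lt_trans; [apply Cmod_triangle|]. rewrite !Cmod_mult.
  assert (Cmod (u n) * Cmod (v n - m) <= M * Cmod (v n - m))%R by (apply Rmult_le_compat_r; [apply Cmod_ge_0|auto]).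
  assert (M * Cmod (v n - m) < M * (eps / (2 * M)))%R by (apply Rmult_lt_compat_l; auto).
  assert (Cmod (u n - l) * Cmod m <= eps / (2 * (Cmod m + 1)) * (Cmod m + 1))%R.
  { apply Rmult_le_compat; try apply Cmod_ge_0; lra. }
  replace (M * (eps / (2 * M)))%R with (eps / 2)%R in * by (field; lra).
  replace (eps / (2 * (Cmod m + 1)) * (Cmod m + 1))%R with (eps / 2)%R in * by (field; lra). lra.
Qed.

Lemma Clim_scal k u l : Clim u l -> Clim (fun n => k * u n) (k * l).
Proof. apply Clim_mult, Clim_const. Qed.

Lemma Clim_opp u l : Clim u l -> Clim (fun n => - u n) (- l).
Proof.
  intros h. apply Clim_ext with (u := fun n => - (1) * u n); [intros; ring|].
  replace (- l) with (- (1) * l) by ring. apply Clim_scal, h.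
Qed.

Lemma Clim_minus u v l m : Clim u l -> Clim v m -> Clim (fun n => u n - v n) (l - m).
Proof. intros. apply Clim_plus; [auto|]. apply Clim_opp; auto. Qed.

Lemma Clim_le u l M : Clim u l -> (exists N, forall n, (N <= n)%nat -> (Cmod (u n) <= M)%R) -> (Cmod l <= M)%R.
Proof.
  intros h [N0 H0]. apply Rnot_lt_le. intros hl.
  destruct (h (Cmod l - M)%R) as [N HN]; [lra|].
  specialize (HN (max N N0) ltac:(lia)). specialize (H0 (max N N0) ltac:(lia)).
  pose proof (Cmod_ge_minus l (u (max N N0))). rewrite Cmod_minus_sym in HN. lra.
Qed.

Lemma is_lim_seq_eps (u : nat -> R) (l : R) : is_lim_seq u l <->
  forall eps, (0 < eps)%R -> exists N, forall n, (N <= n)%nat -> (Rabs (u n - l) < eps)%R.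
Proof.
  rewrite <- is_lim_seq_spec. split.
  - intros h eps heps. exact (h (mkposreal eps heps)).
  - intros h eps. exact (h eps (cond_pos eps)).
Qed.

Lemma Clim_of_R (u : nat -> R) (l : R) : is_lim_seq u l -> Clim (fun n => RtoC (u n)) (RtoC l).
Proof.
  intros h eps heps. rewrite is_lim_seq_eps in h. destruct (h eps heps) as [N HN].
  exists N. intros n hn. rewrite <- RtoC_minus, Cmod_R. apply (HN n hn).
Qed.

Lemma Clim_0_le (u : nat -> C) (b : nat -> R) :
  is_lim_seq b 0%R -> (exists N, forall n, (N <= n)%nat -> (Cmod (u n) <= b n)%R) -> Clim u 0.
Proof.
  intros hb [N0 H0] eps heps. rewrite is_lim_seq_eps in hb. destruct (hb eps heps) as [N HN].
  exists (max N N0). intros n hn. specialize (HN n ltac:(lia)). specialize (H0 n ltac:(lia)).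
  simpl in HN. replace (u n - 0) with (u n) by ring. rewrite Rminus_0_r in HN.
  apply Rabs_def2 in HN. lra.
Qed.

Lemma is_lim_seq_Clim (u : nat -> C) l :
  is_lim_seq (fun n => Re (u n)) (Re l) -> is_lim_seq (fun n => Im (u n)) (Im l) -> Clim u l.
Proof.
  intros h h' eps heps. rewrite is_lim_seq_eps in h. rewrite is_lim_seq_eps in h'.
  assert (h2 : (0 < eps / 2)%R) by lra.
  destruct (h _ h2) as [N HN]. destruct (h' _ h2) as [N' HN'].
  exists (max N N'). intros n hn. specialize (HN n ltac:(lia)). specialize (HN' n ltac:(lia)). simpl in *.
  eapply Rle_lt_trans; [apply Cmod_le_Re_Im|].
  replace (Re (u n - l)) with (Re (u n) - Re l)%R by (unfold Re; simpl; ring).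
  replace (Im (u n - l)) with (Im (u n) - Im l)%R by (unfold Im; simpl; ring). lra.
Qed.

Lemma Clim_is_lim_seq (u : nat -> C) l : Clim u l ->
  is_lim_seq (fun n => Re (u n)) (Re l) /\ is_lim_seq (fun n => Im (u n)) (Im l).
Proof.
  intros h. split; apply is_lim_seq_eps; intros eps heps; destruct (h eps heps) as [N HN];
    exists N; intros n hn; eapply Rle_lt_trans; [| apply (HN n hn) | | apply (HN n hn)].
  - replace (Re (u n) - Re l)%R with (Re (u n - l)) by (unfold Re; simpl; ring). apply re_le_Cmod.
  - replace (Im (u n) - Im l)%R with (snd (u n - l)) by (unfold Im; simpl; ring).
    eapply Rle_trans; [apply Rmax_r|apply Rmax_Cmod].
Qed.

Lemma CLim_seq_Clim u l : Clim u l -> CLim_seq u = l.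
Proof.
  intros h. apply Clim_is_lim_seq in h. destruct h as [h1 h2]. unfold CLim_seq.
  rewrite (is_lim_seq_unique _ _ h1), (is_lim_seq_unique _ _ h2). destruct l; auto.
Qed.

Lemma rsum_sum_n a n : sum_n (G := R_AbelianMonoid) a n = rsum a (S n).
Proof.
  induction n as [|n IH].
  - rewrite sum_O. simpl. symmetry. apply Rplus_0_l.
  - rewrite sum_Sn, IH. reflexivity.
Qed.

Lemma csum_sum_n a n : sum_n (G := C_AbelianMonoid) a n = csum a (S n).
Proof.
  induction n as [|n IH].
  - rewrite sum_O. simpl. symmetry. apply Cplus_0_l.
  - rewrite sum_Sn, IH. reflexivity.
Qed.

Lemma Re_csum a n : Re (csum a n) = rsum (fun k => Re (a k)) n.
Proof. induction n as [|n IH]; simpl; [auto|]. rewrite <- IH. auto. Qed.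

Lemma Im_csum a n : Im (csum a n) = rsum (fun k => Im (a k)) n.
Proof. induction n as [|n IH]; simpl; [auto|]. rewrite <- IH. auto. Qed.

Lemma is_series_rsum a l : is_series a l <-> is_lim_seq (rsum a) l.
Proof.
  split; intros h.
  - apply is_lim_seq_incr_1. apply is_lim_seq_ext with (sum_n (G := R_AbelianMonoid) a).
    + intros n. apply rsum_sum_n.
    + exact h.
  - apply is_lim_seq_incr_1 in h. apply is_lim_seq_ext with (v := sum_n (G := R_AbelianMonoid) a) in h.
    + exact h.
    + intros n. symmetry. apply rsum_sum_n.
Qed.

Lemma Csums_pair a l : Csums a l <->
  is_series (fun k => Re (a k)) (Re l) /\ is_series (fun k => Im (a k)) (Im l).
Proof.
  split.
  - intros h. apply Clim_is_lim_seq in h. destruct h as [h1 h2].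
    split; apply is_series_rsum.
    + eapply is_lim_seq_ext; [|exact h1]. intros n. apply Re_csum.
    + eapply is_lim_seq_ext; [|exact h2]. intros n. apply Im_csum.
  - intros [h1 h2]. apply is_series_rsum in h1. apply is_series_rsum in h2.
    apply is_lim_seq_Clim.
    + eapply is_lim_seq_ext; [|exact h1]. intros n. symmetry. apply Re_csum.
    + eapply is_lim_seq_ext; [|exact h2]. intros n. symmetry. apply Im_csum.
Qed.

Lemma CSeries_Csums a l : Csums a l -> CSeries a = l.
Proof.
  intros h. apply Csums_pair in h. destruct h as [h1 h2]. unfold CSeries.
  rewrite (is_series_unique _ _ h1), (is_series_unique _ _ h2). destruct l; auto.
Qed.

Lemma summable_Csums a : summable a -> Csums a (CSeries a).
Proof.
  intros h. apply Csums_pair. unfold CSeries. simpl. split.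
  - apply Series_correct. apply (ex_series_le (V := R_CompleteNormedModule)) with (b := fun k => Cmod (a k)); auto.
    intros n. apply re_le_Cmod.
  - apply Series_correct. apply (ex_series_le (V := R_CompleteNormedModule)) with (b := fun k => Cmod (a k)); auto.
    intros n. eapply Rle_trans; [apply Rmax_r|apply Rmax_Cmod].
Qed.

Lemma summable_le a (b : nat -> R) : (forall k, (Cmod (a k) <= b k)%R) -> ex_series b -> summable a.
Proof.
  intros h hb. apply (ex_series_le (V := R_CompleteNormedModule)) with (b := b); auto.
  intros n. change (Rabs (Cmod (a n)) <= b n)%R. rewrite Rabs_right; auto. apply Rle_ge, Cmod_ge_0.
Qed.

Lemma Csums_is_series a l : Csums a l <-> @is_series C_AbsRing C_NormedModule a l.
Proof.
  split.
  - intros h P [eps HP]. destruct (h (eps / 2)%R) as [N HN].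
    { pose proof (cond_pos eps). lra. }
    exists N. intros n hn. apply HP. rewrite csum_sum_n.
    apply C_NormedModule_mixin_compat1. specialize (HN (S n) ltac:(lia)).
    eapply Rlt_trans; [exact HN|]. pose proof (cond_pos eps). lra.
  - intros h eps heps.
    assert (he : (0 < eps / 2)%R) by lra.
    destruct (h (fun z => ball (M := C_UniformSpace) l (mkposreal _ he) z)) as [N HN].
    { exists (mkposreal _ he). auto. }
    exists (S N). intros [|n] hn; [lia|]. specialize (HN n ltac:(lia)). rewrite csum_sum_n in HN.
    apply C_NormedModule_mixin_compat2 in HN. eapply Rlt_le_trans; [exact HN|]. simpl.
    assert (hs : (sqrt 2 <= 2)%R).
    { rewrite <- (sqrt_Rsqr 2) at 2; [|lra]. apply sqrt_le_1; unfold Rsqr; lra. }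
    nra.
Qed.

Lemma csum_ext a b n : (forall k, (k < n)%nat -> a k = b k) -> csum a n = csum b n.
Proof. induction n as [|n IH]; intros h; simpl; [auto|]. rewrite IH, h; auto. Qed.

Lemma csum_plus a b n : csum (fun k => a k + b k) n = csum a n + csum b n.
Proof. induction n as [|n IH]; simpl; [ring|]. rewrite IH. ring. Qed.

Lemma csum_scal c a n : csum (fun k => c * a k) n = c * csum a n.
Proof. induction n as [|n IH]; simpl; [ring|]. rewrite IH. ring. Qed.

Lemma csum_minus a b n : csum (fun k => a k - b k) n = csum a n - csum b n.
Proof. induction n as [|n IH]; simpl; [ring|]. rewrite IH. ring. Qed.

Lemma csum_zero n : csum (fun _ => 0) n = 0.
Proof. induction n as [|n IH]; simpl; [auto|]. rewrite IH. ring. Qed.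

Lemma csum_bound a (b : nat -> R) n : (forall k, (k < n)%nat -> (Cmod (a k) <= b k)%R) ->
  (Cmod (csum a n) <= rsum b n)%R.
Proof.
  induction n as [|n IH]; intros h; simpl; [rewrite Cmod_0; lra|].
  eapply Rle_trans; [apply Cmod_triangle|]. apply Rplus_le_compat; auto.
Qed.

Lemma csum_split a n m : csum a (n + m) = csum a n + csum (fun k => a (n + k)%nat) m.
Proof.
  induction m as [|m IH]; [rewrite Nat.add_0_r; simpl; ring|].
  rewrite Nat.add_succ_r. simpl. rewrite IH. ring.
Qed.

Lemma csum_S a n : csum a (S n) = a O + csum (fun k => a (S k)) n.
Proof. change (S n) with (1 + n)%nat. rewrite csum_split. simpl. ring. Qed.

Lemma rsum_split a n m : rsum a (n + m) = (rsum a n + rsum (fun k => a (n + k)%nat) m)%R.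
Proof.
  induction m as [|m IH]; [rewrite Nat.add_0_r; simpl; ring|].
  rewrite Nat.add_succ_r. simpl. rewrite IH. ring.
Qed.

Lemma rsum_pos a n : (forall k, (0 <= a k)%R) -> (0 <= rsum a n)%R.
Proof. intros h. induction n as [|n IH]; simpl; [lra|]. specialize (h n). lra. Qed.

Lemma rsum_le_Series b n : (forall k, (0 <= b k)%R) -> ex_series b -> (rsum b n <= Series b)%R.
Proof.
  intros hp hb. apply Series_correct, is_series_rsum in hb.
  apply (is_lim_seq_incr_compare _ _ hb). intros m. simpl. specialize (hp m). lra.
Qed.

Lemma Series_tail b eps : (0 < eps)%R -> ex_series b ->
  exists N, forall n, (N <= n)%nat -> (Series b - rsum b n <= eps)%R.
Proof.
  intros he hb. apply Series_correct, is_series_rsum in hb. rewrite is_lim_seq_eps in hb.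
  destruct (hb eps he) as [N HN]. exists N. intros n hn. specialize (HN n hn).
  simpl in HN. apply Rabs_def2 in HN. lra.
Qed.

Lemma CSeries_tail a b n : (forall k, (n <= k)%nat -> (Cmod (a k) <= b k)%R) ->
  (forall k, (0 <= b k)%R) -> ex_series b -> summable a ->
  (Cmod (CSeries a - csum a n) <= Series b - rsum b n)%R.
Proof.
  intros h hp hb ha. apply summable_Csums in ha.
  apply Clim_le with (u := fun m => csum a m - csum a n).
  - apply Clim_minus; [exact ha|apply Clim_const].
  - exists n. intros m hm. replace m with (n + (m - n))%nat by lia. rewrite csum_split.
    replace (csum a n + csum (fun k => a (n + k)%nat) (m - n) - csum a n)
      with (csum (fun k => a (n + k)%nat) (m - n)) by ring.
    eapply Rle_trans; [apply csum_bound with (b := fun k => b (n + k)%nat); intros; apply h; lia|].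
    pose proof (rsum_split b n (m - n)). pose proof (rsum_le_Series b (n + (m - n)) hp hb). lra.
Qed.

Lemma CSeries_bound a b : (forall k, (Cmod (a k) <= b k)%R) -> ex_series b -> (Cmod (CSeries a) <= Series b)%R.
Proof.
  intros h hb. assert (hp : forall k, (0 <= b k)%R).
  { intros k. eapply Rle_trans; [apply Cmod_ge_0|apply h]. }
  pose proof (CSeries_tail a b 0 (fun k _ => h k) hp hb (summable_le a b h hb)) as H.
  simpl in H. replace (CSeries a - 0) with (CSeries a) in H by ring. lra.
Qed.

Lemma CSeries_ext a b : (forall k, a k = b k) -> CSeries a = CSeries b.
Proof. intros h. f_equal. apply functional_extensionality, h. Qed.

Lemma CSeries_scal c a : summable a -> CSeries (fun k => c * a k) = c * CSeries a.
Proof.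
  intros h. apply CSeries_Csums. apply Clim_ext with (u := fun n => c * csum a n).
  - intros n. symmetry. apply csum_scal.
  - apply Clim_scal, summable_Csums, h.
Qed.

Lemma CSeries_split a n : summable a -> CSeries a = csum a n + CSeries (fun k => a (n + k)%nat).
Proof.
  intros h. apply summable_Csums in h.
  assert (h' : Csums (fun k => a (n + k)%nat) (CSeries a - csum a n)).
  { intros eps heps. destruct (h eps heps) as [N HN]. exists N. intros m hm.
    specialize (HN (n + m)%nat ltac:(lia)). rewrite csum_split in HN.
    eapply Rle_lt_trans; [|exact HN]. right. f_equal. ring. }
  rewrite (CSeries_Csums _ _ h'). ring.
Qed.

Lemma CSeries_finite (a : nat -> C) n : (forall k, (n <= k)%nat -> a k = 0) -> CSeries a = csum a n.
Proof.
  intros h. apply CSeries_Csums. intros eps heps. exists n. intros m hm.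
  replace m with (n + (m - n))%nat by lia. rewrite csum_split.
  rewrite (csum_ext (fun k => a (n + k)%nat) (fun _ => 0)) by (intros; apply h; lia).
  rewrite csum_zero. replace (csum a n + 0 - csum a n) with (RtoC 0) by ring. rewrite Cmod_0. auto.
Qed.

Lemma Cdiffable_csum (f : nat -> C -> C) n z : (forall k, (k < n)%nat -> Cdiffable (f k) z) ->
  Cdiffable (fun z => csum (fun k => f k z) n) z.
Proof.
  induction n as [|n IH]; intros h; simpl; [apply Cdiffable_const|].
  apply Cdiffable_plus; auto.
Qed.

(* The M-test combined with Weierstrass' theorem. *)
Lemma Cdiffable_CSeries (f : nat -> C -> C) (b : nat -> R) c r : (0 < r)%R -> ex_series b ->
  (forall k z, (Cmod (z - c) <= r)%R -> (Cmod (f k z) <= b k)%R) ->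
  (forall k z, (Cmod (z - c) <= r)%R -> Cdiffable (f k) z) ->
  forall z, (Cmod (z - c) < r)%R -> Cdiffable (fun z => CSeries (fun k => f k z)) z.
Proof.
  intros hr hb hf hd.
  assert (hp : forall k, (0 <= b k)%R).
  { intros k. eapply Rle_trans; [apply Cmod_ge_0|apply (hf k c)].
    replace (c - c) with (RtoC 0) by ring. rewrite Cmod_0. lra. }
  apply (weierstrass (fun n z => csum (fun k => f k z) n)); auto.
  - intros n z hz. apply Cdiffable_csum. intros k _. apply hd, hz.
  - intros eps heps. destruct (Series_tail b eps heps hb) as [N HN]. exists N. intros z hz.
    rewrite Cmod_minus_sym. eapply Rle_trans; [apply CSeries_tail with (b := b); auto|].
    + apply (summable_le _ b); auto.
    + apply HN. lia.
Qed.

(** * Power series *)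

Definition psum (e : nat -> C) (t : C) : C := CSeries (fun n => e n * t ^ n).

Definition conv (a b : nat -> C) (n : nat) : C := csum (fun k => a k * b (n - k)%nat) (S n).

Definition converges_on (e : nat -> C) (d : R) : Prop :=
  forall t : C, (Cmod t < d)%R -> summable (fun n => e n * t ^ n).

Lemma Cmod_term e t n : Cmod (e n * t ^ n) = (Cmod (e n) * Cmod t ^ n)%R.
Proof. rewrite Cmod_mult, Cmod_pow. auto. Qed.

Lemma converges_on_le e d d' : (d' <= d)%R -> converges_on e d -> converges_on e d'.
Proof. intros h H t ht. apply H. lra. Qed.

Lemma ex_series_Rscal (c : R) (b : nat -> R) : ex_series b -> ex_series (fun k => c * b k)%R.
Proof. apply (@ex_series_scal R_AbsRing R_NormedModule). Qed.

Lemma ex_series_Rplus (a b : nat -> R) : ex_series a -> ex_series b -> ex_series (fun k => a k + b k)%R.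
Proof. apply (@ex_series_plus R_AbsRing R_NormedModule). Qed.

Lemma summable_scal c a : summable a -> summable (fun k => c * a k).
Proof.
  intros h. apply (summable_le _ (fun k => Cmod c * Cmod (a k))%R).
  - intros k. rewrite Cmod_mult. lra.
  - apply ex_series_Rscal, h.
Qed.

Lemma sum_f_R0_rsum a n : sum_f_R0 a n = rsum a (S n).
Proof. rewrite <- rsum_sum_n. symmetry. apply sum_n_Reals. Qed.

Lemma rsum_plus a b n : rsum (fun k => a k + b k)%R n = (rsum a n + rsum b n)%R.
Proof. induction n as [|n IH]; simpl; [ring|]. rewrite IH. ring. Qed.

Lemma rsum_minus a b n : rsum (fun k => a k - b k)%R n = (rsum a n - rsum b n)%R.
Proof. induction n as [|n IH]; simpl; [ring|]. rewrite IH. ring. Qed.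

Lemma summable_Re a : summable a -> ex_series (fun n => Rabs (Re (a n))).
Proof.
  intros h. apply (ex_series_le (V := R_CompleteNormedModule)) with (b := fun k => Cmod (a k)); auto.
  intros n. change (Rabs (Rabs (Re (a n))) <= Cmod (a n))%R. rewrite Rabs_Rabsolu. apply re_le_Cmod.
Qed.

Lemma summable_Im a : summable a -> ex_series (fun n => Rabs (Im (a n))).
Proof.
  intros h. apply (ex_series_le (V := R_CompleteNormedModule)) with (b := fun k => Cmod (a k)); auto.
  intros n. change (Rabs (Rabs (Im (a n))) <= Cmod (a n))%R. rewrite Rabs_Rabsolu.
  eapply Rle_trans; [apply Rmax_r|apply Rmax_Cmod].
Qed.

Lemma Csums_conv a b : summable a -> summable b -> Csums (conv a b) (CSeries a * CSeries b).
Proof.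
  intros ha hb.
  pose proof (proj1 (Csums_pair _ _) (summable_Csums a ha)) as [a1 a2].
  pose proof (proj1 (Csums_pair _ _) (summable_Csums b hb)) as [b1 b2].
  pose proof (summable_Re a ha). pose proof (summable_Im a ha).
  pose proof (summable_Re b hb). pose proof (summable_Im b hb).
  apply Csums_pair. split.
  - eapply is_series_ext; [|apply (@is_series_minus R_AbsRing R_NormedModule); [exact (is_series_mult _ _ _ _ a1 b1 H H1)|
      exact (is_series_mult _ _ _ _ a2 b2 H0 H2)]].
    intros n. unfold conv. rewrite Re_csum, !sum_f_R0_rsum. symmetry. apply (rsum_minus _ _ (S n)).
  - eapply is_series_ext; [|apply (@is_series_plus R_AbsRing R_NormedModule); [exact (is_series_mult _ _ _ _ a1 b2 H H2)|
      exact (is_series_mult _ _ _ _ a2 b1 H0 H1)]].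
    intros n. unfold conv. rewrite Im_csum, !sum_f_R0_rsum. symmetry. apply (rsum_plus _ _ (S n)).
Qed.

Lemma summable_conv a b : summable a -> summable b -> summable (conv a b).
Proof.
  intros ha hb. set (a' := fun k => RtoC (Cmod (a k))). set (b' := fun k => RtoC (Cmod (b k))).
  assert (ha' : summable a').
  { unfold summable, a'. eapply ex_series_ext; [|exact ha]. intros n. simpl. rewrite Cmod_R, Rabs_right; auto. apply Rle_ge, Cmod_ge_0. }
  assert (hb' : summable b').
  { unfold summable, b'. eapply ex_series_ext; [|exact hb]. intros n. simpl. rewrite Cmod_R, Rabs_right; auto. apply Rle_ge, Cmod_ge_0. }
  pose proof (proj1 (Csums_pair _ _) (Csums_conv a' b' ha' hb')) as [h _].
  apply (summable_le _ (fun n => Re (conv a' b' n))); [|eexists; exact h].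
  intros n. unfold conv. rewrite Re_csum. apply csum_bound. intros k _. unfold a', b'.
  rewrite Cmod_mult. simpl. lra.
Qed.

Lemma conv_pow a b t n : conv (fun n => a n * t ^ n) (fun n => b n * t ^ n) n = conv a b n * t ^ n.
Proof.
  unfold conv. rewrite Cmult_comm, <- csum_scal. apply csum_ext. intros k hk.
  replace n with (k + (n - k))%nat at 3 by lia. rewrite Cpow_add_r. ring.
Qed.

Lemma psum_mult a b d : converges_on a d -> converges_on b d ->
  converges_on (conv a b) d /\ forall t, (Cmod t < d)%R -> psum (conv a b) t = psum a t * psum b t.
Proof.
  intros ha hb. split.
  - intros t ht. pose proof (summable_conv _ _ (ha t ht) (hb t ht)) as h.
    eapply ex_series_ext; [|exact h]. intros n. simpl. rewrite conv_pow. auto.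
  - intros t ht. apply CSeries_Csums. eapply Clim_ext; [|apply (Csums_conv _ _ (ha t ht) (hb t ht))].
    intros n. apply csum_ext. intros k _. apply conv_pow.
Qed.

Lemma psum_minus a b d : converges_on a d -> converges_on b d ->
  converges_on (fun n => a n - b n) d /\
  forall t, (Cmod t < d)%R -> psum (fun n => a n - b n) t = psum a t - psum b t.
Proof.
  intros ha hb. split.
  - intros t ht. apply (summable_le _ (fun n => Cmod (a n * t ^ n) + Cmod (b n * t ^ n))%R).
    + intros k. replace ((a k - b k) * t ^ k) with (a k * t ^ k + - (b k * t ^ k)) by ring.
      eapply Rle_trans; [apply Cmod_triangle|]. rewrite Cmod_opp. lra.
    + apply ex_series_Rplus; [apply ha|apply hb]; auto.
  - intros t ht. apply CSeries_Csums.
    apply Clim_ext with (u := fun n => csum (fun k => a k * t ^ k) n - csum (fun k => b k * t ^ k) n).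
    + intros n. rewrite <- csum_minus. apply csum_ext. intros. ring.
    + apply Clim_minus; apply summable_Csums; [apply ha|apply hb]; auto.
Qed.

(** Once the earlier coefficients are known to vanish, e_k x^k is minus the tail of the series,
    which is O(x^(k+1)) as x tends to 0 along positive reals. *)
Lemma psum_zero_coef e d : (0 < d)%R -> converges_on e d ->
  (forall t, (0 < Cmod t < d)%R -> psum e t = 0) -> forall n, e n = 0.
Proof.
  intros hd hc h. induction n as [k IH] using (well_founded_induction Wf_nat.lt_wf).
  apply Cmod_small_eq. intros eps heps. replace (e k - 0) with (e k) by ring.
  set (t0 := (d / 2)%R).
  assert (hs := hc (RtoC t0)). rewrite Cmod_R, Rabs_right in hs by (unfold t0; lra).
  specialize (hs ltac:(unfold t0; lra)).
  set (b := fun n => Cmod (e n * RtoC t0 ^ n)) in hs.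
  assert (hb : ex_series b) by exact hs.
  assert (hbp : forall n, (0 <= b n)%R) by (intros; apply Cmod_ge_0).
  set (B := (Series b / t0 ^ (S k) + 1)%R).
  assert (ht0 : (0 < t0)%R) by (unfold t0; lra).
  assert (hSp : (0 <= Series b)%R) by (apply (rsum_le_Series b 0 hbp hb)).
  assert (ptk : (0 < t0 ^ S k)%R) by (apply pow_lt; auto).
  assert (hB : (0 < B)%R).
  { unfold B. assert (0 <= Series b / t0 ^ S k)%R by (apply Rdiv_le_0_compat; auto). lra. }
  set (x := Rmin t0 (eps / B)).
  assert (hx : (0 < x)%R) by (apply Rmin_pos; [auto|apply Rdiv_lt_0_compat; auto]).
  assert (hx1 : (x <= t0)%R) by apply Rmin_l. assert (hx2 : (x <= eps / B)%R) by apply Rmin_r.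
  assert (hxm : Cmod (RtoC x) = x) by (rewrite Cmod_R, Rabs_right; lra).
  assert (hxd : (0 < Cmod (RtoC x) < d)%R) by (rewrite hxm; unfold t0 in hx1; lra).
  assert (hq : (0 <= x / t0 <= 1)%R).
  { split; [apply Rdiv_le_0_compat; lra|]. apply Rle_div_l; lra. }
  pose proof (h (RtoC x) hxd) as E. unfold psum in E.
  set (a := fun n => e n * RtoC x ^ n) in E.
  assert (ha : summable a) by (apply hc; lra).
  assert (hab : forall n, (S k <= n)%nat -> (Cmod (a n) <= (x / t0) ^ S k * b n)%R).
  { intros n hn. unfold a, b. rewrite !Cmod_term, hxm, Cmod_R, (Rabs_right t0) by lra.
    replace n with (S k + (n - S k))%nat by lia. set (j := (n - S k)%nat).
    rewrite !pow_add. unfold Rdiv. rewrite Rpow_mult_distr, pow_inv.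
    replace (x ^ S k * / t0 ^ S k * (Cmod (e (S k + j)%nat) * (t0 ^ S k * t0 ^ j)))%R
      with (Cmod (e (S k + j)%nat) * (x ^ S k * t0 ^ j))%R by (field; lra).
    apply Rmult_le_compat_l; [apply Cmod_ge_0|]. apply Rmult_le_compat_l; [apply pow_le; lra|].
    apply pow_incr. lra. }
  set (b' := fun n => ((x / t0) ^ S k * b n)%R).
  assert (hb' : ex_series b') by (apply ex_series_Rscal; auto).
  assert (hb'p : forall n, (0 <= b' n)%R).
  { intros n. apply Rmult_le_pos; [apply pow_le; lra|auto]. }
  pose proof (CSeries_tail a b' (S k) hab hb'p hb' ha) as T.
  rewrite E in T. simpl csum in T.
  rewrite (csum_ext a (fun _ => 0)) in T.
  2:{ intros j hj. unfold a. rewrite IH; auto. ring. }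
  rewrite csum_zero in T. replace (0 - (0 + a k)) with (- a k) in T by ring. rewrite Cmod_opp in T.
  unfold b' in T at 1. rewrite Series_scal_l in T.
  pose proof (rsum_pos b' (S k) hb'p).
  unfold a in T. rewrite Cmod_term, hxm in T.
  assert (T2 : (Cmod (e k) * x ^ k <= (x / t0) ^ S k * Series b)%R) by lra.
  replace ((x / t0) ^ S k * Series b)%R with (x * (Series b / t0 ^ S k) * x ^ k)%R in T2.
  2:{ unfold Rdiv. rewrite Rpow_mult_distr, pow_inv. simpl. field. split; [|lra].
      apply pow_nonzero. lra. }
  apply Rmult_le_reg_r in T2; [|apply pow_lt; auto].
  eapply Rle_trans; [exact T2|].
  apply Rle_trans with (eps / B * B)%R; [|right; field; lra].
  apply Rmult_le_compat; try lra; [|unfold B; lra]. apply Rdiv_le_0_compat; auto.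
Qed.

Lemma psum_unique a b d : (0 < d)%R -> converges_on a d -> converges_on b d ->
  (forall t, (0 < Cmod t < d)%R -> psum a t = psum b t) -> forall n, a n = b n.
Proof.
  intros hd ha hb h n. destruct (psum_minus a b d ha hb) as [h1 h2].
  assert (E : a n - b n = 0).
  { apply (psum_zero_coef (fun n => a n - b n) d); auto. intros t ht. rewrite h2, h by lra. ring. }
  replace (a n) with (a n - b n + b n) by ring. rewrite E. ring.
Qed.

(** Abel's lemma: convergence at [t0] bounds the terms there, and inside the disc a geometric series
    dominates. *)
Lemma converges_on_of_Csums e (t0 : C) l : Csums (fun n => e n * t0 ^ n) l -> converges_on e (Cmod t0).
Proof.
  intros h t ht.
  assert (h0 : (0 < Cmod t0)%R) by (eapply Rle_lt_trans; [apply Cmod_ge_0|exact ht]).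
  (* The terms of the series at t0 are eventually at most 2 in modulus. *)
  assert (hb : exists M, (0 <= M)%R /\ forall n, (Cmod (e n * t0 ^ n) <= M)%R).
  { destruct (h 1%R) as [N HN]; [lra|].
    assert (hN : forall n, (N <= n)%nat -> (Cmod (e n * t0 ^ n) <= 2)%R).
    { intros n hn. pose proof (HN n hn). pose proof (HN (S n) ltac:(lia)). simpl in H0.
      replace (e n * t0 ^ n) with ((csum (fun n => e n * t0 ^ n) n + e n * t0 ^ n - l) +
        - (csum (fun n => e n * t0 ^ n) n - l)) by ring.
      eapply Rle_trans; [apply Cmod_triangle|]. rewrite Cmod_opp. lra. }
    exists (rsum (fun n => Cmod (e n * t0 ^ n)) N + 2)%R.
    assert (hp : forall k, (0 <= Cmod (e k * t0 ^ k))%R) by (intros; apply Cmod_ge_0).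
    split; [pose proof (rsum_pos _ N hp); lra|]. intros n.
    destruct (le_lt_dec N n) as [hn|hn].
    - pose proof (rsum_pos _ N hp). specialize (hN n hn). lra.
    - assert (Cmod (e n * t0 ^ n) <= rsum (fun n => Cmod (e n * t0 ^ n)) N)%R; [|lra].
      replace N with (S n + (N - S n))%nat by lia. rewrite rsum_split. cbn [rsum].
      pose proof (rsum_pos _ n hp).
      pose proof (rsum_pos (fun k => Cmod (e (S n + k)%nat * t0 ^ (S n + k))) (N - S n)%nat (fun k => hp (S n + k)%nat)).
      lra. }
  destruct hb as [M [hM HM]].
  assert (hq : (0 <= Cmod t / Cmod t0 < 1)%R).
  { split; [apply Rdiv_le_0_compat; [apply Cmod_ge_0|auto]|]. apply Rlt_div_l; lra. }
  apply (summable_le _ (fun n => M * (Cmod t / Cmod t0) ^ n)%R).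
  - intros n. specialize (HM n). rewrite Cmod_term in *. unfold Rdiv. rewrite Rpow_mult_distr, pow_inv.
    assert (p : (0 < Cmod t0 ^ n)%R) by (apply pow_lt; auto).
    replace (Cmod (e n) * Cmod t ^ n)%R with ((Cmod (e n) * Cmod t0 ^ n) * (Cmod t ^ n * / Cmod t0 ^ n))%R by (field; lra).
    apply Rmult_le_compat_r; [|auto]. apply Rmult_le_pos; [apply pow_le, Cmod_ge_0|].
    apply Rlt_le, Rinv_0_lt_compat; auto.
  - apply ex_series_Rscal. apply ex_series_geom. rewrite Rabs_right; lra.
Qed.

(** * Exponential generating functions *)

Lemma RtoC_neq_0 (x : R) : x <> 0%R -> RtoC x <> 0.
Proof. intros h H. apply h, RtoC_inj, H. Qed.

Lemma fact_C_neq_0 n : RtoC (INR (fact n)) <> 0.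
Proof. apply RtoC_neq_0, INR_fact_neq_0. Qed.

Lemma INR_S_C_neq_0 n : RtoC (INR (S n)) <> 0.
Proof. apply RtoC_neq_0, not_0_INR. lia. Qed.

Lemma fact_S_C n : RtoC (INR (fact (S n))) = RtoC (INR (S n)) * RtoC (INR (fact n)).
Proof. rewrite <- RtoC_mult, <- mult_INR. auto. Qed.

(** Absolute convergence in a full disc but equality of values only off 0, where formulas such as
    (e^t - 1) / t take a default value. *)
Definition has_pser (g : C -> C) (e : nat -> C) : Prop :=
  exists d, (0 < d)%R /\ converges_on e d /\ forall t, (0 < Cmod t < d)%R -> g t = psum e t.

Lemma has_pser_unique g e e' : has_pser g e -> has_pser g e' -> forall n, e n = e' n.
Proof.
  intros (d & hd & hc & h) (d' & hd' & hc' & h').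
  pose proof (Rmin_l d d'). pose proof (Rmin_r d d').
  apply (psum_unique e e' (Rmin d d')).
  - apply Rmin_pos; auto.
  - apply (converges_on_le e d); auto.
  - apply (converges_on_le e' d'); auto.
  - intros t ht. rewrite <- h, <- h'; auto; lra.
Qed.

Lemma has_pser_ext g g' e :
  (exists d, (0 < d)%R /\ forall t, (0 < Cmod t < d)%R -> g t = g' t) -> has_pser g e -> has_pser g' e.
Proof.
  intros (d & hd & h) (d' & hd' & hc & h').
  pose proof (Rmin_l d d'). pose proof (Rmin_r d d'). exists (Rmin d d'). split; [|split].
  - apply Rmin_pos; auto.
  - apply (converges_on_le e d'); auto.
  - intros t ht. rewrite <- h, <- h'; auto; lra.
Qed.

Lemma has_pser_ext_coef g e e' : (forall n, e n = e' n) -> has_pser g e -> has_pser g e'.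
Proof. intros h. replace e' with e; [auto|]. apply functional_extensionality, h. Qed.

Lemma has_pser_mult g g' e e' : has_pser g e -> has_pser g' e' ->
  has_pser (fun t => g t * g' t) (conv e e').
Proof.
  intros (d & hd & hc & h) (d' & hd' & hc' & h').
  pose proof (Rmin_l d d'). pose proof (Rmin_r d d').
  destruct (psum_mult e e' (Rmin d d')) as [h1 h2].
  { apply (converges_on_le e d); auto. }
  { apply (converges_on_le e' d'); auto. }
  exists (Rmin d d'). split; [apply Rmin_pos; auto|]. split; [auto|].
  intros t ht. rewrite h2, h, h'; auto; lra.
Qed.

Lemma has_pser_comp_scal g e (al : C) : al <> 0 -> has_pser g e ->
  has_pser (fun t => g (al * t)) (fun n => e n * al ^ n).
Proof.
  intros hal (d & hd & hc & h). assert (ha := proj1 (Cmod_gt_0 _) hal).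
  assert (hlt : forall t, (Cmod t < d / Cmod al)%R -> (Cmod (al * t) < d)%R).
  { intros t ht. rewrite Cmod_mult, Rmult_comm. apply Rlt_div_r; auto. }
  exists (d / Cmod al)%R. split; [apply Rdiv_lt_0_compat; auto|]. split.
  - intros t ht. pose proof (hc (al * t) (hlt t ht)) as hs.
    eapply ex_series_ext; [|exact hs]. intros n. simpl. f_equal. rewrite Cpow_mult_l. ring.
  - intros t ht. rewrite h.
    + apply CSeries_ext. intros n. rewrite Cpow_mult_l. ring.
    + split; [|apply hlt; lra]. rewrite Cmod_mult. apply Rmult_lt_0_compat; lra.
Qed.

Definition egf_scale (a : nat -> C) (n : nat) : C := a n / RtoC (INR (fact n)).

Lemma pow_n_C (t : C) n : @pow_n C_Ring t n = t ^ n.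
Proof. induction n as [|n IH]; simpl; [auto|]. rewrite IH. auto. Qed.

Lemma is_pseries_Csums e t l : @is_pseries C_AbsRing C_NormedModule e t l <-> Csums (fun n => e n * t ^ n) l.
Proof.
  unfold is_pseries. rewrite <- Csums_is_series.
  assert (E : (fun k : nat => @scal C_AbsRing C_NormedModule (pow_n t k) (e k)) = (fun n => e n * t ^ n)).
  { apply functional_extensionality. intros n. rewrite Cmult_comm. rewrite <- pow_n_C. reflexivity. }
  rewrite E. tauto.
Qed.

Lemma is_egf_has_pser g a : is_egf g a <-> has_pser g (egf_scale a).
Proof.
  unfold is_egf. split.
  - intros [eps H].
    assert (H' : forall t : C, (0 < Cmod t < eps)%R -> Csums (fun n => egf_scale a n * t ^ n) (g t)).
    { intros t ht. apply is_pseries_Csums. apply (H t).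
      - apply C_NormedModule_mixin_compat1. change (Cmod (t - 0) < eps)%R.
        replace (t - 0) with t by ring. lra.
      - apply Cmod_gt_0. lra. }
    pose proof (cond_pos eps). set (d := (eps / 2)%R).
    assert (hm : Cmod (RtoC d) = d) by (rewrite Cmod_R, Rabs_right; unfold d; lra).
    assert (hc : converges_on (egf_scale a) d).
    { rewrite <- hm. apply (converges_on_of_Csums _ _ (g (RtoC d))). apply H'. rewrite hm. unfold d; lra. }
    exists d. split; [unfold d; lra|]. split; [auto|].
    intros t ht. symmetry. apply CSeries_Csums, H'. unfold d in ht; lra.
  - intros (d & hd & hc & h). assert (h2 : (0 < d / 2)%R) by lra. exists (mkposreal _ h2).
    refine (fun (t : C) ht ht0 => _). apply is_pseries_Csums.
    assert (hlt : (0 < Cmod t < d)%R).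
    { split; [apply Cmod_gt_0; auto|].
      apply C_NormedModule_mixin_compat2 in ht. change (Cmod (t - 0) < sqrt 2 * (d / 2))%R in ht.
      replace (t - 0) with t in ht by ring. eapply Rlt_le_trans; [exact ht|].
      assert (hs : (sqrt 2 <= 2)%R).
      { rewrite <- (sqrt_Rsqr 2) at 2; [|lra]. apply sqrt_le_1; unfold Rsqr; lra. }
      nra. }
    rewrite h by auto. apply summable_Csums, hc. lra.
Qed.

(** Uniqueness of expansions makes the choice by [epsilon] irrelevant. *)
Lemma egf_coef_eq g e : has_pser g e -> forall n, egf_coef g n = RtoC (INR (fact n)) * e n.
Proof.
  intros h.
  assert (h' : is_egf g (fun n => RtoC (INR (fact n)) * e n)).
  { apply is_egf_has_pser. eapply has_pser_ext_coef; [|exact h]. intros n.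
    unfold egf_scale. field. apply fact_C_neq_0. }
  assert (hs : is_egf g (egf_coef g)) by (unfold egf_coef; apply epsilon_spec; eexists; exact h').
  apply is_egf_has_pser in hs. intros n. rewrite <- (has_pser_unique _ _ _ hs h n).
  unfold egf_scale. field. apply fact_C_neq_0.
Qed.

(** * Power series of the exponential *)

Lemma segment_bound F F' z M :
  (forall u : R, (0 <= u <= 1)%R -> Cdiff F (RtoC u * z) (F' (RtoC u * z))) ->
  (forall u : R, (0 <= u <= 1)%R -> Ccont F' (RtoC u * z)) ->
  (forall u : R, (0 <= u <= 1)%R -> (Cmod (F' (RtoC u * z)%C) <= M)%R) ->
  (Cmod (F z - F 0) <= Cmod z * M)%R.
Proof.
  intros hd hc hM.
  assert (dz : forall u, Rdiff (fun u => RtoC u * z) u z).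
  { intros u. eapply diff_eq; [|apply diff_mult; [apply diff_e|apply diff_const]]. cbv beta. ring. }
  assert (hcI : contI (fun u => z * F' (RtoC u * z)) 0 1).
  { intros u hu. rewrite Rmin_left, Rmax_right in hu by lra.
    apply cont_mult; [apply cont_const|].
    apply (cont_comp RtoC (fun z : C => z) F' (fun u : R => RtoC u * z)); [apply hc; auto|].
    eapply diff_cont, dz. }
  assert (E : CI (fun u => z * F' (RtoC u * z)) 0 1 = F z - F 0).
  { rewrite (CI_FTC (fun u => F (RtoC u * z))); auto.
    - f_equal; [f_equal; ring|do 2 f_equal; ring].
    - intros u hu. rewrite Rmin_left, Rmax_right in hu by lra.
      eapply diff_eq; [|apply (diff_comp RtoC (fun z : C => z) F (fun u : R => RtoC u * z))].
      3: apply dz. 2: apply hd; auto. ring. }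
  rewrite <- E. replace (Cmod z * M)%R with ((1 - 0) * (Cmod z * M))%R by ring.
  apply CI_bound; auto; [lra|]. intros u hu. rewrite Cmod_mult.
  apply Rmult_le_compat_l; [apply Cmod_ge_0|auto].
Qed.

Definition exp_coef (n : nat) : C := / RtoC (INR (fact n)).

Lemma exp_coef_0 : exp_coef 0 = 1.
Proof. unfold exp_coef. simpl. apply injective_projections; simpl; field. Qed.

Lemma Cdiff_pow n z : Cdiff (fun z => z ^ (S n)) z (RtoC (INR (S n)) * z ^ n).
Proof.
  induction n as [|n IH].
  - eapply diff_eq; [|apply diff_ext with (f := fun z => z); [intros; simpl; ring|apply diff_e]].
    simpl. ring.
  - change (fun z : C => z ^ S (S n)) with (fun z : C => z * z ^ S n).
    eapply diff_eq; [|apply diff_mult; [apply diff_e|exact IH]].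
    cbv beta. rewrite (S_INR (S n)), RtoC_plus. simpl (z ^ S n). ring.
Qed.

Lemma Cdiff_exp_sum n z :
  Cdiff (fun z => csum (fun k => exp_coef k * z ^ k) (S n)) z (csum (fun k => exp_coef k * z ^ k) n).
Proof.
  induction n as [|n IH].
  - apply diff_ext with (f := fun _ : C => exp_coef 0); [intros; simpl; ring|apply diff_const].
  - set (q := csum (fun k => exp_coef k * z ^ k) (S n)).
    change (fun z : C => csum (fun k => exp_coef k * z ^ k) (S (S n))) with
      (fun z : C => csum (fun k => exp_coef k * z ^ k) (S n) + exp_coef (S n) * z ^ (S n)).
    eapply diff_eq; [|apply diff_plus; [exact IH|apply diff_scal, Cdiff_pow]].
    unfold q. simpl csum at 2. f_equal. unfold exp_coef. rewrite fact_S_C. field.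
    split; [apply fact_C_neq_0|apply INR_S_C_neq_0].
Qed.

(** The derivative of the remainder with n + 1 terms is the remainder with n terms, so one
    integration along a segment raises the order. The constant is crude but sufficient for |z| <
    1. *)
Lemma exp_remainder n z : (Cmod z <= 1)%R ->
  (Cmod (Cexp z - csum (fun k => (exp_coef k * z ^ k)%C) n) <= exp 1 * Cmod z ^ n)%R.
Proof.
  revert z. induction n as [|n IH]; intros z hz.
  - simpl. replace (Cexp z - 0) with (Cexp z) by ring. rewrite Cmod_Cexp, Rmult_1_r.
    pose proof (re_le_Cmod z) as h. pose proof (Rle_abs (Re z)).
    destruct (Req_dec (Re z) 1) as [->|h1]; [lra|]. apply Rlt_le, exp_increasing. lra.
  - set (F := fun z => Cexp z - csum (fun k => exp_coef k * z ^ k) (S n)).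
    replace (Cexp z - csum (fun k => exp_coef k * z ^ k) (S n)) with (F z - F 0).
    2:{ unfold F. rewrite Cexp_0, (csum_S (fun k => exp_coef k * 0 ^ k)). rewrite (csum_ext (fun k => exp_coef (S k) * 0 ^ S k) (fun _ => 0)).
        - rewrite csum_zero, exp_coef_0. simpl. ring.
        - intros k _. simpl. ring. }
    simpl pow. replace (exp 1 * (Cmod z * Cmod z ^ n))%R with (Cmod z * (exp 1 * Cmod z ^ n))%R by ring.
    assert (hu1 : forall u : R, (0 <= u <= 1)%R -> (Cmod (RtoC u * z) <= Cmod z)%R).
    { intros u hu. rewrite Cmod_mult, Cmod_R, Rabs_right by lra. pose proof (Cmod_ge_0 z). nra. }
    assert (hF : forall z, Cdiff F z (Cexp z - csum (fun k => exp_coef k * z ^ k) n)).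
    { intros w. apply diff_minus; [apply Cdiff_Cexp|apply Cdiff_exp_sum]. }
    apply (segment_bound F (fun z => Cexp z - csum (fun k => exp_coef k * z ^ k) n)).
    + intros u _. apply hF.
    + intros u _. apply cont_minus; [eapply diff_cont, Cdiff_Cexp|].
      apply Cdiffable_cont, Cdiffable_csum. intros k _. apply Cdiffable_mult; [apply Cdiffable_const|].
      apply Cdiffable_pow, Cdiffable_id.
    + intros u hu. pose proof (hu1 u hu). eapply Rle_trans; [apply IH; lra|].
      apply Rmult_le_compat_l; [apply Rlt_le, exp_pos|]. apply pow_incr. split; [apply Cmod_ge_0|auto].
Qed.

Lemma exp_Csums z : (Cmod z < 1)%R -> Csums (fun k => exp_coef k * z ^ k) (Cexp z).
Proof.
  intros hz.
  apply Clim_ext with (u := fun n => Cexp z - (Cexp z - csum (fun k => exp_coef k * z ^ k) n)); [intros; ring|].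
  replace (Cexp z) with (Cexp z - 0) at 1 by ring. apply Clim_minus; [apply Clim_const|].
  apply Clim_0_le with (b := fun n => (exp 1 * Cmod z ^ n)%R).
  - replace (Finite 0) with (Rbar_mult (exp 1) 0).
    + apply is_lim_seq_scal_l, is_lim_seq_geom. rewrite Rabs_right; auto. apply Rle_ge, Cmod_ge_0.
    + simpl. f_equal. ring.
  - exists O. intros n _. apply exp_remainder. lra.
Qed.

Lemma exp_converges : converges_on exp_coef (1 / 2).
Proof.
  replace (1 / 2)%R with (Cmod (RtoC (1 / 2))) by (rewrite Cmod_R, Rabs_right; lra).
  apply (converges_on_of_Csums _ _ (Cexp (RtoC (1 / 2)))). apply exp_Csums.
  rewrite Cmod_R, Rabs_right; lra.
Qed.

Lemma has_pser_exp : has_pser Cexp exp_coef.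
Proof.
  exists (1 / 2)%R. split; [lra|]. split; [apply exp_converges|].
  intros t ht. symmetry. apply CSeries_Csums, exp_Csums. lra.
Qed.

Lemma has_pser_expm1 : has_pser (fun t => (Cexp t - 1) / t) (fun n => exp_coef (S n)).
Proof.
  exists (1 / 2)%R. split; [lra|]. split.
  (* The terms are those of the exponential series divided by t, an argument that fails at t = 0,
     where only the constant term is left. *)
  - intros t ht. destruct (Req_dec (Cmod t) 0) as [h|h].
    + apply (summable_le _ (fun n => Cmod (exp_coef (S n)) * 0 ^ n)%R).
      * intros k. rewrite Cmod_mult, Cmod_pow, h. lra.
      * exists (Cmod (exp_coef 1)). apply is_series_rsum. apply is_lim_seq_incr_1.
        eapply is_lim_seq_ext; [|apply is_lim_seq_const]. intros n. simpl.
        induction n as [|n IH]; simpl; [ring|]. rewrite <- IH. ring.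
    + assert (hh := exp_converges t ht). assert (hp : (0 < Cmod t)%R) by (pose proof (Cmod_ge_0 t); lra).
      apply (summable_le _ (fun n => / Cmod t * Cmod (exp_coef (S n) * t ^ S n))%R).
      * intros k. rewrite !Cmod_mult, !Cmod_pow. simpl. right. field. lra.
      * apply ex_series_Rscal. apply (ex_series_incr_1 (fun n => Cmod (exp_coef n * t ^ n))), hh.
  - intros t ht. assert (h0 : t <> 0) by (apply Cmod_gt_0; lra).
    assert (hs : summable (fun n => exp_coef n * t ^ n)) by (apply exp_converges; lra).
    assert (E : Cexp t = CSeries (fun n => exp_coef n * t ^ n)).
    { symmetry. apply CSeries_Csums, exp_Csums. lra. }
    rewrite E, (CSeries_split _ 1) by auto.
    assert (E2 : CSeries (fun k => exp_coef (1 + k) * t ^ (1 + k)) = t * psum (fun n => exp_coef (S n)) t).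
    { unfold psum. rewrite <- CSeries_scal.
      - apply CSeries_ext. intros k. simpl. ring.
      - apply (summable_le _ (fun n => / Cmod t * Cmod (exp_coef (S n) * t ^ S n))%R).
        + intros k. rewrite !Cmod_mult, !Cmod_pow. simpl. right. field. lra.
        + apply ex_series_Rscal. apply (ex_series_incr_1 (fun n => Cmod (exp_coef n * t ^ n))), hs. }
    rewrite E2. simpl csum. rewrite exp_coef_0. simpl. field. auto.
Qed.

Lemma Cexp_neq_1 : exists d, (0 < d)%R /\ forall t, (0 < Cmod t < d)%R -> Cexp t - 1 <> 0.
Proof.
  destruct (diff_bound _ _ _ _ Cdiff_Cexp_0 (1 / 2)%R ltac:(lra)) as [d [hd H]].
  exists d. split; [auto|]. intros t ht E. specialize (H t). cbv beta in H.
  replace (t - 0) with t in H by ring. rewrite Cexp_0, E in H. specialize (H (proj2 ht)).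
  replace (0 - 1 * t) with (- t) in H by ring. rewrite Cmod_opp in H. lra.
Qed.

(** * The coefficients of the modulator *)

Definition taylor_coef (f : R -> R) (n : nat) : C := RtoC (Derive_n f n 0 / INR (fact n)).

(** By Abel's lemma the real expansion converges absolutely in a complex disc, and its coefficients
    are the Taylor coefficients that define [complexify]. *)
Lemma has_pser_complexify f : real_analytic_at_0 f -> has_pser (complexify f) (taylor_coef f).
Proof.
  intros [a [eps H]]. pose proof (cond_pos eps) as heps.
  set (t0 := (eps / 2)%R). assert (ht0 : (0 < t0)%R) by (unfold t0; lra).
  assert (hm : Cmod (RtoC t0) = t0) by (rewrite Cmod_R, Rabs_right; lra).
  assert (hb : ball (M := R_UniformSpace) 0%R eps t0).
  { change (Rabs (t0 - 0) < eps)%R. rewrite Rminus_0_r, Rabs_right; unfold t0; lra. }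
  assert (hser : is_series (fun n => a n * t0 ^ n)%R (f t0)).
  { eapply is_series_ext; [|exact (H t0 hb)]. intros n. simpl.
    rewrite pow_n_pow. unfold scal; simpl; unfold mult; simpl. ring. }
  assert (hC : Csums (fun n => RtoC (a n) * RtoC t0 ^ n) (RtoC (f t0))).
  { apply Csums_pair. split.
    - eapply is_series_ext; [|exact hser]. intros n. rewrite <- RtoC_pow, <- RtoC_mult. auto.
    - replace (fun k => Im (RtoC (a k) * RtoC t0 ^ k)) with (fun _ : nat => 0%R).
      + apply is_series_rsum. apply is_lim_seq_ext with (fun _ => 0%R); [|apply is_lim_seq_const].
        intros n. induction n as [|n IH]; simpl rsum; [auto|]. rewrite <- IH. ring.
      + apply functional_extensionality. intros n. rewrite <- RtoC_pow, <- RtoC_mult. auto. }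
  apply converges_on_of_Csums in hC. rewrite hm in hC.
  assert (hrad : Rbar_lt 0%R (CV_radius a)).
  { set (r := (t0 / 2)%R).
    apply Rbar_lt_le_trans with (Finite r); [unfold r; simpl; lra|].
    apply (proj1 (CV_radius_bounded a)).
    specialize (hC (RtoC r)). rewrite Cmod_R, Rabs_right in hC by (unfold r; lra).
    specialize (hC ltac:(unfold r; lra)).
    set (b := fun n => Cmod (RtoC (a n) * RtoC r ^ n)).
    exists (Series b). intros n.
    assert (hbn : b n = Rabs (a n * r ^ n)) by (unfold b; rewrite <- RtoC_pow, <- RtoC_mult, Cmod_R; auto).
    rewrite <- hbn.
    assert (hp : forall n, (0 <= b n)%R) by (intros; apply Cmod_ge_0).
    pose proof (rsum_le_Series b (S n) hp hC) as hle. simpl in hle.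
    pose proof (rsum_pos b n hp). lra. }
  assert (hD : forall n, Derive_n f n 0 = (a n * INR (fact n))%R).
  { intros n. rewrite <- (Derive_n_coef a n hrad). apply Derive_n_ext_loc.
    exists eps. intros t ht. symmetry. apply is_pseries_unique, H, ht. }
  assert (E : forall n, taylor_coef f n = RtoC (a n)).
  { intros n. unfold taylor_coef. rewrite hD. f_equal. field. apply INR_fact_neq_0. }
  exists t0. split; [auto|]. split.
  - intros t ht. eapply ex_series_ext; [|exact (hC t ht)]. intros n. simpl. rewrite E. auto.
  - intros t ht. reflexivity.
Qed.

(** The numbers P_{f,n} / n!, as the Cauchy product of (e^t - 1) / t and f. *)
Definition mod_coef (f : R -> R) : nat -> C := conv (fun n => exp_coef (S n)) (taylor_coef f).

Lemma has_pser_modulator f : real_analytic_at_0 f -> has_pser (modulator (complexify f)) (mod_coef f).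
Proof.
  intros h. apply has_pser_mult; [apply has_pser_expm1|apply has_pser_complexify, h].
Qed.

Lemma Pcoef_complexify f n : real_analytic_at_0 f ->
  Pcoef (complexify f) n = RtoC (INR (fact n)) * mod_coef f n.
Proof. intros h. apply egf_coef_eq, has_pser_modulator, h. Qed.

(** Near 0 the factor e^t - 1 does not vanish off 0 and cancels, leaving p_f(alpha t). *)
Lemma has_pser_modulator_scale f (al : C) : al <> 0 -> real_analytic_at_0 f ->
  has_pser (modulator (scale al (complexify f))) (fun n => mod_coef f n * al ^ n).
Proof.
  intros hal h. eapply has_pser_ext; [|apply (has_pser_comp_scal _ _ al hal (has_pser_modulator f h))].
  destruct Cexp_neq_1 as [d [hd H]]. exists d. split; [auto|]. intros t ht.
  specialize (H t ht). assert (t <> 0) by (apply Cmod_gt_0; lra).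
  unfold modulator, scale. field. auto.
Qed.

Lemma Pcoef_scale f (al : C) n : al <> 0 -> real_analytic_at_0 f ->
  Pcoef (scale al (complexify f)) n = al ^ n * Pcoef (complexify f) n.
Proof.
  intros hal h. rewrite Pcoef_complexify by auto.
  unfold Pcoef. rewrite (egf_coef_eq _ _ (has_pser_modulator_scale f al hal h)). ring.
Qed.

(** At the argument 1 - x the exponentials combine into e^(-t) e^((1 - x) t) = e^(-x t). What
    remains is f(-t) e^(-x t), the generating function at x with t replaced by -t, whence the
    sign. *)
Lemma Cpoly_underline f m (x : C) : real_analytic_at_0 f -> x <> 0 ->
  Cpoly (underline (complexify f)) m (1 - x) =
  RtoC (INR (fact m)) * ((- (1)) ^ m * csum (fun k => taylor_coef f k * (x ^ (m - k) * exp_coef (m - k))) (S m)).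
Proof.
  intros h hx. unfold Cpoly.
  assert (hx' : - x <> 0).
  { intros E. apply hx. replace x with (- - x) by ring. rewrite E. ring. }
  assert (h1 : - (1) <> 0).
  { intros E. apply C1_nz. replace (1 : C) with (- - (1)) by ring. rewrite E. ring. }
  pose proof (has_pser_mult _ _ _ _ (has_pser_comp_scal _ _ _ h1 (has_pser_complexify f h))
    (has_pser_comp_scal _ _ _ hx' has_pser_exp)) as hp.
  rewrite (egf_coef_eq _ (conv (fun n => taylor_coef f n * (- (1)) ^ n) (fun n => exp_coef n * (- x) ^ n))).
  - f_equal. unfold conv. rewrite <- csum_scal. apply csum_ext. intros k hk.
    replace ((- (1)) ^ m) with ((- (1)) ^ k * (- (1)) ^ (m - k)).
    2:{ rewrite <- Cpow_add_r. f_equal. lia. }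
    replace (- x) with (- (1) * x) by ring. rewrite Cpow_mult_l. ring.
  - eapply has_pser_ext; [|exact hp]. exists 1%R. split; [lra|]. intros t _.
    unfold underline.
    replace (Cexp (- t) * complexify f (- t) * Cexp ((1 - x) * t))
      with (complexify f (- t) * (Cexp (- t) * Cexp ((1 - x) * t))) by ring.
    rewrite <- Cexp_plus. f_equal; f_equal; ring.
Qed.

Lemma modulator_entire_psum f z : real_analytic_at_0 f ->
  modulator_entire (complexify f) z = psum (mod_coef f) z.
Proof.
  intros h. apply CSeries_ext. intros n. rewrite Pcoef_complexify by auto. field. apply fact_C_neq_0.
Qed.

(** The scalar [s] will be 1 or -1. Comparing the two expansions in a small disc is enough. *)
Lemma parity_coef f (s : C) : real_analytic_at_0 f ->
  (forall z, modulator_entire (complexify f) (- z) = s * modulator_entire (complexify f) z) ->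
  forall n, (- (1)) ^ n * Pcoef (complexify f) n = s * Pcoef (complexify f) n.
Proof.
  intros h hs n. rewrite Pcoef_complexify by auto.
  destruct (has_pser_modulator f h) as (d & hd & hc & _).
  assert (E : mod_coef f n * (- (1)) ^ n = s * mod_coef f n).
  { apply (psum_unique (fun n => mod_coef f n * (- (1)) ^ n) (fun n => s * mod_coef f n) d); auto.
    - intros t ht. assert (ht' : (Cmod (- t) < d)%R) by (rewrite Cmod_opp; auto).
      eapply ex_series_ext; [|exact (hc (- t) ht')]. intros k. simpl.
      f_equal. replace (- t) with (- (1) * t) by ring. rewrite Cpow_mult_l. ring.
    - intros t ht. eapply ex_series_ext; [|exact (summable_scal s _ (hc t ht))]. intros k. simpl. f_equal. ring.
    - intros t ht.
      transitivity (psum (mod_coef f) (- t)).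
      { apply CSeries_ext. intros k. replace (- t) with (- (1) * t) by ring. rewrite Cpow_mult_l. ring. }
      rewrite <- modulator_entire_psum, hs, modulator_entire_psum by auto.
      unfold psum. rewrite <- CSeries_scal by (apply hc; lra). apply CSeries_ext. intros k. ring. }
  transitivity (RtoC (INR (fact n)) * (mod_coef f n * (- (1)) ^ n)); [ring|]. rewrite E. ring.
Qed.

(** * The radius *)

(** With [rad_le], this describes [rad g] by geometric bounds on the coefficients: every ratio above
    it is admissible, and every positive admissible ratio is at least as large. *)
Lemma rad_bound g r : Rbar_lt 0%R (rho g) -> (rad g < r)%R ->
  exists K, (0 < K)%R /\ forall n, (Cmod (Pcoef g n) <= K * r ^ n)%R.
Proof.
  unfold rad, rho. intros hpos hr.
  pose proof (CV_radius_bounded (fun n => Cmod (Pcoef g n))) as [hub hlub].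
  set (R0 := CV_radius (fun n => Cmod (Pcoef g n))) in *.
  assert (r0 : (0 < r)%R).
  { destruct R0 as [x| |]; simpl in *; try lra; try tauto.
    assert (0 < / x)%R by (apply Rinv_0_lt_compat; auto). lra. }
  assert (hlt : Rbar_lt (/ r)%R R0).
  { destruct R0 as [x| |]; simpl in *; try tauto.
    rewrite <- (Rinv_inv x). apply Rinv_lt_contravar; [|auto].
    apply Rmult_lt_0_compat; auto. apply Rinv_0_lt_compat; auto. }
  assert (hex : exists s, (/ r < s)%R /\ exists M, forall n, (Rabs (Cmod (Pcoef g n) * s ^ n) <= M)%R).
  { apply NNPP. intros hn. apply (Rbar_lt_not_le _ _ hlt), hlub.
    intros s hs. simpl. apply Rnot_lt_le. intros h. apply hn. exists s. auto. }
  destruct hex as (s & hs & M & HM). exists (Rabs M + 1)%R.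
  split; [pose proof (Rabs_pos M); lra|]. intros n. specialize (HM n).
  assert (hir : (0 < / r)%R) by (apply Rinv_0_lt_compat; auto).
  rewrite Rabs_right in HM.
  2:{ apply Rle_ge, Rmult_le_pos; [apply Cmod_ge_0|apply pow_le; lra]. }
  assert (h1 : (Cmod (Pcoef g n) * (/ r) ^ n <= Rabs M + 1)%R).
  { apply Rle_trans with (Cmod (Pcoef g n) * s ^ n)%R.
    - apply Rmult_le_compat_l; [apply Cmod_ge_0|]. apply pow_incr. lra.
    - pose proof (Rle_abs M). lra. }
  rewrite pow_inv in h1. assert (p : (0 < r ^ n)%R) by (apply pow_lt; auto).
  apply Rle_div_l in h1; auto.
Qed.

Lemma rad_le g r K : (0 < r)%R -> (forall n, (Cmod (Pcoef g n) <= K * r ^ n)%R) ->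
  (rad g <= r)%R /\ Rbar_lt 0%R (rho g).
Proof.
  intros hr H. unfold rad, rho.
  pose proof (CV_radius_bounded (fun n => Cmod (Pcoef g n))) as [hub _].
  set (R0 := CV_radius (fun n => Cmod (Pcoef g n))) in *.
  assert (hir : (0 < / r)%R) by (apply Rinv_0_lt_compat; auto).
  assert (hle : Rbar_le (/ r)%R R0).
  { apply hub. exists K. intros n. assert (p : (0 < r ^ n)%R) by (apply pow_lt; auto).
    rewrite pow_inv, Rabs_right.
    - apply Rle_div_l; auto.
    - apply Rle_ge, Rmult_le_pos; [apply Cmod_ge_0|]. apply Rlt_le, Rinv_0_lt_compat; auto. }
  split.
  - destruct R0 as [x| |]; simpl in *; try lra.
    rewrite <- (Rinv_inv r). apply Rinv_le_contravar; auto.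
  - apply Rbar_lt_le_trans with (Finite (/ r)); auto.
Qed.

Lemma rad_pos g : Rbar_lt 0%R (rho g) -> (0 <= rad g)%R.
Proof.
  unfold rad. intros h. destruct (rho g) as [x| |]; simpl in *; try lra.
  apply Rlt_le, Rinv_0_lt_compat, h.
Qed.

Lemma rad_scale f (al : C) : al <> 0 -> standing_assumptions f ->
  rad (scale al (complexify f)) = (Cmod al * rad (complexify f))%R /\
  Rbar_lt 0%R (rho (scale al (complexify f))).
Proof.
  intros hal [h hrho]. assert (ha := proj1 (Cmod_gt_0 _) hal).
  set (g := complexify f) in *. set (g' := scale al g).
  assert (hP : forall n, Cmod (Pcoef g' n) = (Cmod al ^ n * Cmod (Pcoef g n))%R).
  { intros n. unfold g', g. rewrite Pcoef_scale, Cmod_mult, Cmod_pow by auto. auto. }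
  assert (h1 : forall r, (rad g < r)%R -> (rad g' <= Cmod al * r)%R /\ Rbar_lt 0%R (rho g')).
  { intros r hr. destruct (rad_bound g r hrho hr) as [K [hK HK]].
    apply (rad_le g' _ K).
    - apply Rmult_lt_0_compat; auto. pose proof (rad_pos g hrho). lra.
    - intros n. rewrite hP, Rpow_mult_distr.
      replace (K * (Cmod al ^ n * r ^ n))%R with (Cmod al ^ n * (K * r ^ n))%R by ring.
      apply Rmult_le_compat_l; auto. apply pow_le; lra. }
  assert (hrho' : Rbar_lt 0%R (rho g')) by (apply (h1 (rad g + 1)%R); lra).
  split; [|auto]. apply Rle_antisym.
  - apply Rnot_lt_le. intros hlt. set (e := ((rad g' / Cmod al - rad g) / 2)%R).
    assert (he : (0 < e)%R).
    { unfold e. assert (rad g < rad g' / Cmod al)%R; [|lra]. apply Rlt_div_r; auto. rewrite Rmult_comm; auto. }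
    destruct (h1 (rad g + e)%R) as [h2 _]; [lra|].
    replace (rad g') with (Cmod al * (rad g + 2 * e))%R in h2 by (unfold e; field; lra).
    apply Rmult_le_reg_l in h2; lra.
  - apply Rnot_lt_le. intros hlt. set (e := ((rad g - rad g' / Cmod al) / 2)%R).
    assert (he : (0 < e)%R).
    { unfold e. assert (rad g' / Cmod al < rad g)%R; [|lra]. apply Rlt_div_l; auto. rewrite Rmult_comm; auto. }
    destruct (rad_bound g' (rad g' + Cmod al * e)%R hrho') as [K [hK HK]]; [nra|].
    destruct (rad_le g (rad g' / Cmod al + e)%R K) as [h2 _].
    + pose proof (rad_pos g' hrho'). assert (0 <= rad g' / Cmod al)%R by (apply Rdiv_le_0_compat; auto). lra.
    + intros n. specialize (HK n). rewrite hP in HK.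
      replace (rad g' + Cmod al * e)%R with (Cmod al * (rad g' / Cmod al + e))%R in HK by (field; lra).
      rewrite Rpow_mult_distr in HK.
      apply Rmult_le_reg_l with (Cmod al ^ n)%R; [apply pow_lt; auto|]. lra.
    + unfold e in h2, he. lra.
Qed.

Lemma start_index_spec g : (0 <= rad g)%R ->
  (rad g < INR (start_index g))%R /\ (INR (start_index g) <= rad g + 1)%R /\ (1 <= start_index g)%nat.
Proof.
  intros h. unfold start_index. destruct (base_Int_part (rad g)) as [h1 h2].
  assert (hz : (0 <= Int_part (rad g))%Z).
  { apply Zlt_succ_le. apply lt_IZR. rewrite succ_IZR. lra. }
  rewrite plus_INR, INR_IZR_INZ, Z2Nat.id by auto. simpl. lra || (repeat split; try lra; lia).
Qed.

(** * Falling factorials and powers *)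

Fixpoint ff (s : C) (k : nat) : C :=
  match k with O => 1 | S j => ff s j * (s - RtoC (INR j)) end.

Lemma Cbinom_ff s k : Cbinom s k * RtoC (INR (fact k)) = ff s k.
Proof.
  induction k as [|k IH]; [simpl; ring|].
  simpl ff. rewrite <- IH, fact_S_C. simpl Cbinom.
  change (match k with O => 1 | S _ => INR k + 1 end)%R with (INR (S k)). field. apply INR_S_C_neq_0.
Qed.

Lemma ff_add s k j : ff s (k + j) = ff s k * ff (s - RtoC (INR k)) j.
Proof.
  induction j as [|j IH]; [rewrite Nat.add_0_r; simpl; ring|].
  rewrite Nat.add_succ_r. simpl. rewrite IH, plus_INR, RtoC_plus. ring.
Qed.

Lemma ff_S_left s k : ff s (S k) = s * ff (s - 1) k.
Proof. change (S k) with (1 + k)%nat. rewrite ff_add. simpl. replace (s - 0) with s by ring. ring. Qed.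

Lemma ff_nat_zero m k : (m < k)%nat -> ff (RtoC (INR m)) k = 0.
Proof.
  intros h. replace k with (S m + (k - S m))%nat by lia. rewrite ff_add. simpl. ring.
Qed.

Lemma Cdiffable_ff h k z : Cdiffable h z -> Cdiffable (fun s => ff (h s) k) z.
Proof.
  intros hh. induction k as [|k IH]; simpl; [apply Cdiffable_const|].
  apply Cdiffable_mult; auto. apply Cdiffable_minus; auto. apply Cdiffable_const.
Qed.

(* Bounds [|ff s k| / k!] for [|s| <= S0]. *)
Fixpoint bincoef (S0 : R) (k : nat) : R :=
  match k with O => 1 | S j => bincoef S0 j * ((S0 + INR j) / INR (S j)) end.

Lemma bincoef_pos S0 k : (0 < S0)%R -> (0 < bincoef S0 k)%R.
Proof.
  intros h. induction k as [|k IH]; cbn [bincoef]; [lra|].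
  apply Rmult_lt_0_compat; auto. apply Rdiv_lt_0_compat.
  - pose proof (pos_INR k). lra.
  - apply lt_0_INR. lia.
Qed.

Lemma ff_bound S0 s k : (Cmod s <= S0)%R -> (0 < S0)%R ->
  (Cmod (ff s k) <= bincoef S0 k * INR (fact k))%R.
Proof.
  intros hs h0. induction k as [|k IH]; [simpl; rewrite Cmod_1; lra|].
  cbn [ff bincoef]. rewrite Cmod_mult.
  change (fact (S k)) with (S k * fact k)%nat. rewrite mult_INR.
  assert (hk : (0 < INR (S k))%R) by (apply lt_0_INR; lia).
  replace (bincoef S0 k * ((S0 + INR k) / INR (S k)) * (INR (S k) * INR (fact k)))%R
    with ((bincoef S0 k * INR (fact k)) * (S0 + INR k))%R by (field; lra).
  apply Rmult_le_compat; auto; try apply Cmod_ge_0.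
  eapply Rle_trans; [apply Cmod_triangle|]. rewrite Cmod_opp, Cmod_R.
  rewrite Rabs_right; [lra|]. apply Rle_ge, pos_INR.
Qed.

Lemma bincoef_series S0 q : (0 < S0)%R -> (0 <= q < 1)%R -> ex_series (fun k => bincoef S0 k * q ^ k)%R.
Proof.
  intros h0 hq0.
  assert (H : forall q, (0 < q < 1)%R -> ex_series (fun k => bincoef S0 k * q ^ k)%R).
  { clear q hq0. intros q hq. apply ex_series_Rabs, ex_series_DAlembert with q; [lra| |].
    - intros n. apply Rmult_integral_contrapositive_currified.
      + pose proof (bincoef_pos S0 n h0). lra.
      + apply pow_nonzero. lra.
    - apply is_lim_seq_ext with (fun n => (q * (1 + (S0 - 1) * / INR (S n)))%R).
      + intros n. assert (hn : (0 < INR (S n))%R) by (apply lt_0_INR; lia).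
        pose proof (bincoef_pos S0 n h0). pose proof (pow_lt q n (proj1 hq)).
        pose proof (pos_INR n).
        assert (E : (bincoef S0 (S n) * q ^ S n / (bincoef S0 n * q ^ n) = q * ((S0 + INR n) / INR (S n)))%R).
        { cbn [bincoef]. simpl pow. field. lra. }
        rewrite E, Rabs_right.
        * f_equal. rewrite S_INR in *. field. lra.
        * apply Rle_ge, Rmult_le_pos; [lra|]. apply Rdiv_le_0_compat; lra.
      + replace (Finite q) with (Finite (q * (1 + (S0 - 1) * 0)))%R by (f_equal; ring).
        apply (is_lim_seq_scal_l (fun n => 1 + (S0 - 1) * / INR (S n))%R q (1 + (S0 - 1) * 0)%R).
        apply is_lim_seq_plus'; [apply is_lim_seq_const|].
        apply (is_lim_seq_scal_l (fun n => / INR (S n))%R (S0 - 1) 0%R).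
        apply (is_lim_seq_incr_1 (fun n => / INR n)%R).
        replace (Finite 0) with (Rbar_inv p_infty) by reflexivity.
        apply is_lim_seq_inv; [apply is_lim_seq_INR|discriminate]. }
  (* The ratio test needs non-zero terms, which excludes q = 0; comparison with the larger ratio (1
     + q) / 2 covers it. *)
  apply (ex_series_le (V := R_CompleteNormedModule)) with (b := fun k => (bincoef S0 k * ((1 + q) / 2) ^ k)%R).
  - intros n. change (Rabs (bincoef S0 n * q ^ n) <= bincoef S0 n * ((1 + q) / 2) ^ n)%R.
    pose proof (bincoef_pos S0 n h0). rewrite Rabs_right.
    + apply Rmult_le_compat_l; [lra|]. apply pow_incr. lra.
    + apply Rle_ge, Rmult_le_pos; [lra|apply pow_le; lra].
  - apply H. lra.
Qed.

(** For x > 0 the principal power, written with the real logarithm and thus free of the slit. *)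
Definition rpow (x : R) (a : C) : C := Cexp (a * RtoC (ln x)).

Lemma Clog_pos x : (0 < x)%R -> Clog (RtoC x) = RtoC (ln x).
Proof.
  intros h. unfold Clog. rewrite Cmod_R, Rabs_right by lra. unfold Carg. simpl.
  destruct (Rle_dec 0 0) as [_|n]; [|lra].
  rewrite Cmod_R, Rabs_right by lra. replace (x / x)%R with 1%R by (field; lra). rewrite acos_1. auto.
Qed.

Lemma Cpower_pos x a : (0 < x)%R -> Cpower (RtoC x) a = rpow x a.
Proof. intros h. unfold Cpower, rpow. rewrite Clog_pos; auto. Qed.

Lemma rpow_plus x a b : rpow x (a + b) = rpow x a * rpow x b.
Proof. unfold rpow. rewrite <- Cexp_plus. f_equal. ring. Qed.

Lemma rpow_mult x y a : (0 < x)%R -> (0 < y)%R -> rpow (x * y) a = rpow x a * rpow y a.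
Proof.
  intros hx hy. unfold rpow. rewrite <- Cexp_plus, ln_mult, RtoC_plus by auto. f_equal. ring.
Qed.

Lemma rpow_0 x : rpow x 0 = 1.
Proof. unfold rpow. rewrite Cmult_0_l. apply Cexp_0. Qed.

Lemma rpow_1 x : (0 < x)%R -> rpow x 1 = RtoC x.
Proof. intros h. unfold rpow. rewrite Cmult_1_l, Cexp_RtoC, exp_ln; auto. Qed.

Lemma rpow_nat x n : (0 < x)%R -> rpow x (RtoC (INR n)) = RtoC x ^ n.
Proof.
  intros h. induction n as [|n IH]; [apply rpow_0|].
  rewrite S_INR, RtoC_plus, rpow_plus, IH, rpow_1 by auto. simpl. ring.
Qed.

Lemma Cmod_rpow x a : Cmod (rpow x a) = exp (Re a * ln x).
Proof. unfold rpow. rewrite Cmod_Cexp. f_equal. destruct a. simpl. ring. Qed.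

Lemma rpow_opp x a : rpow x (- a) = / rpow x a.
Proof. unfold rpow. rewrite <- Cexp_opp. f_equal. ring. Qed.

Lemma Cmod_rpow_shift x a j : (0 < x)%R ->
  Cmod (rpow x (a - RtoC (INR j))) = (Cmod (rpow x a) * (/ x) ^ j)%R.
Proof.
  intros h. unfold Cminus. rewrite rpow_plus, rpow_opp, rpow_nat, Cmod_mult by auto.
  assert (hx : RtoC x <> 0) by (apply RtoC_neq_0; lra).
  rewrite Cmod_inv, Cmod_pow, Cmod_R, Rabs_right, pow_inv by (try lra; apply Cpow_nz; auto). auto.
Qed.

Lemma Cmod_rpow_le x a b : (1 <= x)%R -> (Re a <= Re b)%R -> (Cmod (rpow x a) <= Cmod (rpow x b))%R.
Proof.
  intros hx h. rewrite !Cmod_rpow.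
  assert (hl : (0 <= ln x)%R).
  { rewrite <- ln_1. destruct (Req_dec 1 x) as [<-|n]; [lra|]. apply Rlt_le, ln_increasing; lra. }
  destruct (Req_dec (Re a * ln x) (Re b * ln x)) as [->|n]; [lra|].
  apply Rlt_le, exp_increasing. assert (Re a * ln x <= Re b * ln x)%R by (apply Rmult_le_compat_r; auto). lra.
Qed.

Lemma Cmod_rpow_m2 x a : (1 <= x)%R -> (Re a <= -2)%R -> (Cmod (rpow x a) <= (/ x) ^ 2)%R.
Proof.
  intros hx h. eapply Rle_trans; [apply (Cmod_rpow_le x a (0 - RtoC (INR 2))); auto; simpl; lra|].
  rewrite Cmod_rpow_shift, rpow_0, Cmod_1 by lra. lra.
Qed.

Lemma Cdiffable_rpow x h z : Cdiffable h z -> Cdiffable (fun s => rpow x (h s)) z.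
Proof.
  intros hh. unfold rpow. apply Cdiffable_Cexp, Cdiffable_mult; [auto|apply Cdiffable_const].
Qed.

(** * Taylor's formula for (1 + x)^tau *)

Definition bin_sum (tau : C) (x : R) (J : nat) : C :=
  csum (fun j => ff tau j * exp_coef j * RtoC x ^ j) J.

Lemma Rdiff_RtoC (f : R -> R) x l : derivable_pt_lim f x l -> Rdiff (fun u => RtoC (f u)) x (RtoC l).
Proof.
  intros h. apply diff_of_bound; [intros u hu; apply RtoC_inj, hu|]. intros eps heps.
  destruct (R_deriv_bound f x l h eps heps) as [d [hd H]]. exists d. split; [auto|].
  intros u hu. rewrite <- RtoC_minus, Cmod_R in *. specialize (H (u - x)%R hu).
  replace (x + (u - x))%R with u in H by ring.
  rewrite <- RtoC_minus, <- RtoC_mult, <- RtoC_minus, !Cmod_R. exact H.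
Qed.

Lemma Rdiff_rpow a x : (0 < x)%R -> Rdiff (fun x => rpow x a) x (a * rpow x (a - 1)).
Proof.
  intros h. unfold rpow at 1.
  assert (hl : Rdiff (fun x => RtoC (ln x)) x (RtoC (/ x))).
  { apply Rdiff_RtoC, derivable_pt_lim_ln, h. }
  eapply diff_eq; [|apply diff_Cexp, diff_scal, hl].
  change (a * RtoC (/ x) * rpow x a = a * rpow x (a - 1)).
  unfold Cminus. rewrite rpow_plus, rpow_opp, rpow_1 by auto. rewrite RtoC_inv by lra. ring.
Qed.

Lemma Rdiff_bin_sum tau J x :
  Rdiff (fun x => bin_sum tau x (S J)) x (tau * bin_sum (tau - 1) x J).
Proof.
  induction J as [|J IH].
  - apply diff_ext with (f := fun _ : R => ff tau 0 * exp_coef 0); [intros; unfold bin_sum; simpl; ring|].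
    eapply diff_eq; [|apply diff_const]. unfold bin_sum. simpl. ring.
  - change (fun x : R => bin_sum tau x (S (S J))) with
      (fun x : R => bin_sum tau x (S J) + ff tau (S J) * exp_coef (S J) * RtoC x ^ (S J)).
    assert (hp : Rdiff (fun x => RtoC x ^ S J) x (RtoC (INR (S J)) * RtoC x ^ J)).
    { eapply diff_eq; [|apply (diff_comp RtoC (fun z : C => z) (fun z => z ^ S J) RtoC); [apply Cdiff_pow|apply diff_e]].
      ring. }
    eapply diff_eq; [|apply diff_plus; [exact IH|apply diff_scal, hp]].
    unfold bin_sum. simpl csum at 2. rewrite ff_S_left. unfold exp_coef at 2 4. rewrite fact_S_C.
    set (A := csum _ J). field. split; [apply fact_C_neq_0|apply INR_S_C_neq_0].
Qed.

(** The derivative of the remainder of order J + 1 for [tau] is [tau] times the remainder of order J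
    for tau - 1. The value B = 0 is allowed and yields the exact binomial theorem. *)
Lemma bin_remainder_step tau J B :
  (forall x, (0 <= x <= 1)%R -> (Cmod (rpow (1 + x) (tau - 1) - bin_sum (tau - 1) x J) <= B * x ^ J)%R) ->
  (0 <= B)%R ->
  forall x, (0 <= x <= 1)%R -> (Cmod (rpow (1 + x) tau - bin_sum tau x (S J)) <= (Cmod tau * B) * x ^ (S J))%R.
Proof.
  intros h hB x hx.
  set (F := fun x => rpow (1 + x) tau - bin_sum tau x (S J)).
  set (F' := fun x => tau * (rpow (1 + x) (tau - 1) - bin_sum (tau - 1) x J)).
  assert (hsh : forall u, Rdiff (fun u => RtoC (1 + u)) u 1).
  { intros u. apply diff_ext with (f := fun u => 1 + RtoC u); [intros; rewrite RtoC_plus; auto|].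
    eapply diff_eq; [|apply diff_plus; [apply diff_const|apply diff_e]]. ring. }
  assert (hpow : forall a u, (0 <= u)%R -> Rdiff (fun u => rpow (1 + u) a) u (a * rpow (1 + u) (a - 1))).
  { intros a u hu. eapply diff_eq; [|apply (diff_comp RtoC RtoC (fun x => rpow x a) (fun u => 1 + u)%R)].
    3: apply hsh. 2: apply Rdiff_rpow; lra. ring. }
  assert (hF : forall u, (0 <= u)%R -> Rdiff F u (F' u)).
  { intros u hu. eapply diff_eq; [|apply diff_minus; [apply hpow; auto|apply Rdiff_bin_sum]].
    unfold F'. ring. }
  assert (hc : contI F' 0 x).
  { intros u hu. rewrite Rmin_left, Rmax_right in hu by lra. apply cont_mult; [apply cont_const|].
    apply cont_minus; [eapply diff_cont, hpow; lra|].
    destruct J as [|J].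
    - apply (cont_const RtoC 0).
    - eapply diff_cont, Rdiff_bin_sum. }
  replace (rpow (1 + x) tau - bin_sum tau x (S J)) with (F x - F 0%R).
  2:{ unfold F. rewrite Rplus_0_r. unfold bin_sum at 2. rewrite csum_S.
      rewrite (csum_ext (fun k => ff tau (S k) * exp_coef (S k) * RtoC 0 ^ S k) (fun _ => 0)).
      - rewrite csum_zero, exp_coef_0. unfold rpow at 2. rewrite ln_1, Cmult_0_r, Cexp_0. simpl. ring.
      - intros k _. simpl. ring. }
  rewrite <- (CI_FTC F F' 0 x); auto.
  2:{ intros u hu. rewrite Rmin_left, Rmax_right in hu by lra. apply hF. lra. }
  replace (Cmod tau * B * x ^ S J)%R with ((x - 0) * (Cmod tau * (B * x ^ J)))%R by (simpl; ring).
  apply CI_bound; [lra|auto|]. intros u hu. unfold F'. rewrite Cmod_mult.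
  apply Rmult_le_compat_l; [apply Cmod_ge_0|].
  eapply Rle_trans; [apply h; lra|]. apply Rmult_le_compat_l; [auto|]. apply pow_incr. lra.
Qed.

(** The constant produced by iterating [bin_remainder_step]: S0 (S0 + 1) ... (S0 + J - 1) exp(S0 +
    J). *)
Fixpoint bin_const (S0 : R) (J : nat) : R :=
  match J with O => exp S0 | S J' => S0 * bin_const (S0 + 1) J' end.

Lemma bin_const_pos S0 J : (0 < S0)%R -> (0 < bin_const S0 J)%R.
Proof.
  revert S0. induction J as [|J IH]; intros S0 h; simpl; [apply exp_pos|].
  apply Rmult_lt_0_compat; auto. apply IH. lra.
Qed.

Lemma bin_remainder J : forall S0 tau x, (0 < S0)%R -> (Cmod tau <= S0)%R -> (0 <= x <= 1)%R ->
  (Cmod (rpow (1 + x) tau - bin_sum tau x J) <= bin_const S0 J * x ^ J)%R.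
Proof.
  induction J as [|J IH]; intros S0 tau x h0 ht hx.
  - unfold bin_sum. simpl. replace (rpow (1 + x) tau - 0) with (rpow (1 + x) tau) by ring.
    rewrite Cmod_rpow, Rmult_1_r.
    assert (hl : (0 <= ln (1 + x) <= 1)%R).
    { split.
      - rewrite <- ln_1. destruct (Req_dec x 0) as [->|n]; [rewrite Rplus_0_r; lra|]. apply Rlt_le, ln_increasing; lra.
      - pose proof (exp_ineq1 1 R1_neq_R0).
        apply Rle_trans with (ln (exp 1)); [apply Rlt_le, ln_increasing; lra|rewrite ln_exp; lra]. }
    assert (h1 : (Re tau * ln (1 + x) <= S0)%R).
    { pose proof (re_le_Cmod tau). pose proof (Rle_abs (Re tau)).
      assert (Re tau * ln (1 + x) <= Rabs (Re tau) * ln (1 + x))%R by (apply Rmult_le_compat_r; lra).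
      assert (Rabs (Re tau) * ln (1 + x) <= Rabs (Re tau) * 1)%R by (apply Rmult_le_compat_l; [apply Rabs_pos|lra]).
      lra. }
    destruct (Req_dec (Re tau * ln (1 + x)) S0) as [->|n]; [lra|]. apply Rlt_le, exp_increasing. lra.
  - eapply Rle_trans; [apply bin_remainder_step with (B := bin_const (S0 + 1) J); auto|].
    + intros y hy. apply IH; auto; [lra|]. eapply Rle_trans; [apply Cmod_triangle|].
      rewrite Cmod_opp, Cmod_1. lra.
    + apply Rlt_le, bin_const_pos. lra.
    + simpl bin_const. apply Rmult_le_compat_r; [apply pow_le; lra|].
      apply Rmult_le_compat_r; [|auto]. apply Rlt_le, bin_const_pos. lra.
Qed.

(** Each step lowers the exponent by 1; it reaches 0, where the expansion is exact, so every
    remainder on the way is bounded with B = 0. *)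
Lemma bin_remainder_nat m J x : (m < J)%nat -> (0 <= x <= 1)%R ->
  rpow (1 + x) (RtoC (INR m)) = bin_sum (RtoC (INR m)) x J.
Proof.
  intros hm hx. apply Cmod_sub_0.
  assert (H : forall J m, (m < J)%nat -> forall x, (0 <= x <= 1)%R ->
    (Cmod (rpow (1 + x) (RtoC (INR m)) - bin_sum (RtoC (INR m)) x J) <= 0 * x ^ J)%R).
  { clear. induction J as [|J IH]; intros m hm x hx; [lia|]. destruct m as [|m].
    - simpl INR. rewrite rpow_0. unfold bin_sum. rewrite csum_S.
      rewrite (csum_ext _ (fun _ => 0)).
      + rewrite csum_zero, exp_coef_0. simpl.
        replace (1 - (1 * 1 * 1 + 0)) with (RtoC 0) by ring. rewrite Cmod_0. lra.
      + intros k _. change (RtoC 0) with (RtoC (INR 0)). rewrite (ff_nat_zero 0 (S k)) by lia. simpl. ring.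
    - eapply Rle_trans; [apply bin_remainder_step with (B := 0%R); [|lra|auto]|].
      + replace (RtoC (INR (S m)) - 1) with (RtoC (INR m)) by (rewrite S_INR, RtoC_plus; ring).
        intros y hy. apply IH; auto. lia.
      + right. ring. }
  specialize (H J m hm x hx). rewrite Rmult_0_l in H. pose proof (Cmod_ge_0 (rpow (1 + x) (RtoC (INR m)) - bin_sum (RtoC (INR m)) x J)). lra.
Qed.

(** * Combinatorics of sums *)

Lemma csum_triangle (F : nat -> nat -> C) N :
  csum (fun k => csum (fun j => F k (k + j)%nat) (N - k)) N = csum (fun l => csum (fun k => F k l) (S l)) N.
Proof.
  induction N as [|N IH]; [auto|].
  change (csum (fun l => csum (fun k => F k l) (S l)) (S N)) with
    (csum (fun l => csum (fun k => F k l) (S l)) N + csum (fun k => F k N) (S N)).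
  rewrite <- IH. cbn [csum].
  rewrite (csum_ext (fun k => csum (fun j => F k (k + j)%nat) (S N - k))
    (fun k => csum (fun j => F k (k + j)%nat) (N - k) + F k N)).
  - rewrite csum_plus. replace (S N - N)%nat with 1%nat by lia. cbn [csum]. rewrite Nat.add_0_r. ring.
  - intros k hk. replace (S N - k)%nat with (S (N - k)) by lia. cbn [csum]. repeat f_equal. lia.
Qed.

Lemma csum_rev a n : csum a n = csum (fun k => a (n - 1 - k)%nat) n.
Proof.
  induction n as [|n IH]; [auto|]. rewrite (csum_S (fun k => a (S n - 1 - k)%nat)).
  replace (S n - 1 - 0)%nat with n by lia. simpl. rewrite IH. rewrite Cplus_comm. f_equal.
  apply csum_ext. intros k hk. f_equal. lia.
Qed.

(** The coefficient of t^(l+1) in (e^t - 1) f(t) = t p_f(t). *)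
Lemma mod_coef_rec f l : conv (taylor_coef f) exp_coef (S l) - taylor_coef f (S l) = mod_coef f l.
Proof.
  unfold mod_coef, conv. rewrite (csum_rev (fun k => exp_coef (S k) * taylor_coef f (l - k))).
  simpl csum at 1. replace (l - l)%nat with O by lia. rewrite exp_coef_0.
  set (A := csum _ l). set (u := taylor_coef f l * _).
  transitivity (csum (fun k => taylor_coef f k * exp_coef (S l - k)) (S l)).
  - simpl csum. fold A. unfold u. ring.
  - apply csum_ext. intros k hk. replace (S l - 1 - k)%nat with (l - k)%nat by lia.
    replace (l - (l - k))%nat with k by lia. replace (S (l - k)) with (S l - k)%nat by lia. ring.
Qed.

(** * Generalized powers *)

Lemma Cbinom_bound S0 s k : (Cmod s <= S0)%R -> (0 < S0)%R -> (Cmod (Cbinom s k) <= bincoef S0 k)%R.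
Proof.
  intros hs h0. pose proof (ff_bound S0 s k hs h0) as h.
  rewrite <- Cbinom_ff, Cmod_mult, Cmod_R, Rabs_right in h by (apply Rle_ge, pos_INR).
  apply Rmult_le_reg_r in h; auto. apply INR_fact_lt_0.
Qed.

Lemma gen_coef_bound g r : Rbar_lt 0%R (rho g) -> (rad g < r)%R ->
  exists K, (0 < K)%R /\ forall S0 s k, (0 < S0)%R -> (Cmod s <= S0)%R ->
    (Cmod (Cbinom s k * Pcoef g k) <= K * (bincoef S0 k * r ^ k))%R.
Proof.
  intros h hr. destruct (rad_bound g r h hr) as [K [hK HK]]. exists K. split; [auto|].
  intros S0 s k h0 hs. rewrite Cmod_mult.
  replace (K * (bincoef S0 k * r ^ k))%R with (bincoef S0 k * (K * r ^ k))%R by ring.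
  apply Rmult_le_compat; try apply Cmod_ge_0; auto. apply Cbinom_bound; auto.
Qed.

Lemma gen_power_pos g x a : (0 < x)%R ->
  gen_power g (RtoC x) a = CSeries (fun k => Cbinom a k * Pcoef g k * rpow x (a - RtoC (INR k))).
Proof. intros h. apply CSeries_ext. intros k. rewrite Cpower_pos; auto. Qed.

Lemma Cmod_disc_bound (s z : C) r : (Cmod (z - s) <= r)%R -> (Cmod z <= Cmod s + r)%R.
Proof.
  intros h. replace z with ((z - s) + s) by ring. pose proof (Cmod_triangle (z - s) s). lra.
Qed.

Lemma rpow_bound x a S0 : (Cmod a <= S0)%R -> (Cmod (rpow x a) <= exp (S0 * Rabs (ln x)))%R.
Proof.
  intros h. rewrite Cmod_rpow. set (l := ln x).
  assert (h1 : (Re a * l <= S0 * Rabs l)%R).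
  { pose proof (re_le_Cmod a). eapply Rle_trans; [apply Rle_abs|]. rewrite Rabs_mult.
    apply Rmult_le_compat_r; [apply Rabs_pos|lra]. }
  destruct (Req_dec (Re a * l) (S0 * Rabs l)) as [->|n]; [lra|]. apply Rlt_le, exp_increasing. lra.
Qed.

Lemma Cdiffable_gen_power g x : Rbar_lt 0%R (rho g) -> (rad g < x)%R -> (0 < x)%R ->
  forall s, Cdiffable (gen_power g (RtoC x)) s.
Proof.
  intros h hx hx0 s.
  apply Cdiffable_ext_loc with (f := fun a => CSeries (fun k => Cbinom a k * Pcoef g k * rpow x (a - RtoC (INR k)))).
  { exists 1%R. split; [lra|]. intros u _. rewrite gen_power_pos; auto. }
  (* A ratio strictly between [rad g] and [x] bounds the coefficients geometrically and leaves a
     quotient r / x < 1; the same device recurs in the later majorants. *)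
  set (r := ((rad g + x) / 2)%R). pose proof (rad_pos g h).
  destruct (gen_coef_bound g r h ltac:(unfold r; lra)) as [K [hK HK]].
  set (S0 := (Cmod s + 1)%R). assert (hS0 : (0 < S0)%R) by (unfold S0; pose proof (Cmod_ge_0 s); lra).
  apply (Cdiffable_CSeries (fun k a => Cbinom a k * Pcoef g k * rpow x (a - RtoC (INR k)))
    (fun k => (K * exp (S0 * Rabs (ln x))) * (bincoef S0 k * (r / x) ^ k))%R s 1); [lra| | | |].
  - apply ex_series_Rscal, bincoef_series; auto. split; [apply Rdiv_le_0_compat; unfold r; lra|].
    apply Rlt_div_l; unfold r; lra.
  - intros k z hz. apply Cmod_disc_bound in hz. rewrite Cmod_mult, Cmod_rpow_shift by auto.
    unfold Rdiv. rewrite Rpow_mult_distr.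
    replace (K * exp (S0 * Rabs (ln x)) * (bincoef S0 k * (r ^ k * (/ x) ^ k)))%R with
      ((K * (bincoef S0 k * r ^ k)) * (exp (S0 * Rabs (ln x)) * (/ x) ^ k))%R by ring.
    apply Rmult_le_compat; try apply Cmod_ge_0; [|apply HK; auto|].
    + apply Rmult_le_pos; [apply Cmod_ge_0|]. apply pow_le, Rlt_le, Rinv_0_lt_compat; auto.
    + apply Rmult_le_compat_r; [apply pow_le, Rlt_le, Rinv_0_lt_compat; auto|]. apply rpow_bound; auto.
  - intros k z hz. apply Cdiffable_mult.
    + apply Cdiffable_ext_loc with (f := fun z => ff z k * (Pcoef g k / RtoC (INR (fact k)))).
      * exists 1%R. split; [lra|]. intros u _. rewrite <- Cbinom_ff. field. apply fact_C_neq_0.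
      * apply Cdiffable_mult; [apply Cdiffable_ff, Cdiffable_id|apply Cdiffable_const].
    + apply Cdiffable_rpow, Cdiffable_minus; [apply Cdiffable_id|apply Cdiffable_const].
  - replace (s - s) with (RtoC 0) by ring. rewrite Cmod_0. lra.
Qed.

(** For x >= 1 the term 1 / x^2 is at most 2 (1 / x - 1 / (x + 1)), which telescopes. *)
Lemma ex_series_inv_sq n0 : (1 <= n0)%nat -> ex_series (fun n => (/ INR (n0 + n)) ^ 2)%R.
Proof.
  intros hn.
  apply (ex_series_le (V := R_CompleteNormedModule)) with
    (b := fun n => (2 * (/ INR (n0 + n) - / INR (n0 + S n)))%R).
  - intros n. change (Rabs ((/ INR (n0 + n)) ^ 2) <= 2 * (/ INR (n0 + n) - / INR (n0 + S n)))%R.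
    assert (h1 : (1 <= INR (n0 + n))%R) by (apply (le_INR 1); lia).
    replace (n0 + S n)%nat with (S (n0 + n)) by lia. rewrite S_INR. set (x := INR (n0 + n)) in *.
    assert (hix : (0 < / x)%R) by (apply Rinv_0_lt_compat; lra).
    rewrite Rabs_right by (apply Rle_ge, pow_le; lra).
    replace (2 * (/ x - / (x + 1)))%R with ((/ x) ^ 2 * (2 * x / (x + 1)))%R by (field; lra).
    rewrite <- (Rmult_1_r ((/ x) ^ 2)) at 1. apply Rmult_le_compat_l; [apply pow_le; lra|].
    apply Rle_div_r; [lra|]. rewrite Rmult_1_l. lra.
  - apply ex_series_Rscal. exists (/ INR n0)%R. apply is_series_rsum.
    apply is_lim_seq_ext with (fun n => (/ INR n0 - / INR (n0 + n))%R).
    + intros n. induction n as [|n IH]; cbn [rsum]; [rewrite Nat.add_0_r; ring|]. rewrite <- IH. ring.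
    + replace (Finite (/ INR n0)) with (Finite (/ INR n0 - 0))%R by (f_equal; ring).
      apply is_lim_seq_minus'; [apply is_lim_seq_const|].
      apply is_lim_seq_ext with (fun n => (/ INR (n + n0))%R); [intros; rewrite Nat.add_comm; auto|].
      apply (is_lim_seq_incr_n (fun n => / INR n)%R n0).
      replace (Finite 0) with (Rbar_inv p_infty) by reflexivity.
      apply is_lim_seq_inv; [apply is_lim_seq_INR|discriminate].
Qed.

(** * The continuation of the LC-function *)

Section LCfunction.
Variables (f : R -> R) (hf : standing_assumptions f) (L : C -> C) (hL : is_LC_function (complexify f) L).

Let g := complexify f.
Let N := start_index g.
Let c := taylor_coef f.
Let p := mod_coef f.

Lemma gen_coef_ff s k : Cbinom s k * Pcoef g k = ff s k * p k.
Proof.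
  unfold g. rewrite Pcoef_complexify by apply hf. rewrite <- Cbinom_ff. fold p. ring.
Qed.

Definition term (x : R) (a : C) (k : nat) : C := ff a k * p k * rpow x (a - RtoC (INR k)).

Lemma gen_power_term x a : (0 < x)%R -> gen_power g (RtoC x) a = CSeries (term x a).
Proof.
  intros h. rewrite gen_power_pos by auto. apply CSeries_ext. intros k. rewrite gen_coef_ff. auto.
Qed.

Lemma N_pos : (1 <= INR N)%R.
Proof.
  destruct hf as [_ h]. destruct (start_index_spec g (rad_pos g h)) as (_ & _ & h1).
  apply (le_INR 1), h1.
Qed.

Lemma rad_N : (rad g < INR N)%R.
Proof.
  destruct hf as [_ h]. apply (start_index_spec g (rad_pos g h)).
Qed.

(** One summable majorant for all x >= N and all exponents of modulus at most [S0]. The factor |x^a|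
    is left out of it, because its size in x decides the convergence of the outer sums. *)
Lemma term_bound S0 : (0 < S0)%R -> exists b, ex_series b /\ (forall k, (0 <= b k)%R) /\
  forall x a k, (INR N <= x)%R -> (Cmod a <= S0)%R -> (Cmod (ff a k * p k) * (/ x) ^ k <= b k)%R.
Proof.
  intros h0. destruct hf as [_ h]. pose proof (rad_pos g h). pose proof rad_N. pose proof N_pos.
  set (r := ((rad g + INR N) / 2)%R).
  destruct (gen_coef_bound g r h ltac:(unfold r; lra)) as [K [hK HK]].
  exists (fun k => K * (bincoef S0 k * (r / INR N) ^ k))%R.
  assert (hr : (0 <= r / INR N < 1)%R).
  { split; [apply Rdiv_le_0_compat; unfold r; lra|]. apply Rlt_div_l; unfold r; lra. }
  split; [|split].
  - apply ex_series_Rscal, bincoef_series; auto.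
  - intros k. apply Rmult_le_pos; [lra|]. apply Rmult_le_pos; [apply Rlt_le, bincoef_pos; auto|apply pow_le; lra].
  - intros x a k hx ha. rewrite <- gen_coef_ff. unfold Rdiv. rewrite Rpow_mult_distr.
    replace (K * (bincoef S0 k * (r ^ k * (/ INR N) ^ k)))%R
      with ((K * (bincoef S0 k * r ^ k)) * (/ INR N) ^ k)%R by ring.
    apply Rmult_le_compat; [apply Cmod_ge_0| |apply HK; auto|].
    + apply pow_le, Rlt_le, Rinv_0_lt_compat; lra.
    + apply pow_incr. split; [apply Rlt_le, Rinv_0_lt_compat; lra|apply Rinv_le_contravar; lra].
Qed.

Lemma summable_term x a : (INR N <= x)%R -> summable (term x a).
Proof.
  intros hx. pose proof N_pos.
  destruct (term_bound (Cmod a + 1)) as (b & hb & hbp & HB).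
  { pose proof (Cmod_ge_0 a). lra. }
  apply (summable_le _ (fun k => Cmod (rpow x a) * b k)%R).
  - intros k. unfold term. rewrite Cmod_mult, Cmod_rpow_shift by lra.
    replace (Cmod (ff a k * p k) * (Cmod (rpow x a) * (/ x) ^ k))%R
      with (Cmod (rpow x a) * (Cmod (ff a k * p k) * (/ x) ^ k))%R by ring.
    apply Rmult_le_compat_l; [apply Cmod_ge_0|]. apply HB; auto. lra.
  - apply ex_series_Rscal, hb.
Qed.

(* Truncation of the formal power [x^(sig, f)] built on the coefficients of f. *)
Definition Apow (M : nat) (x : R) (sig : C) : C :=
  csum (fun k => ff sig k * c k * rpow x (sig - RtoC (INR k))) (S M).

Definition Rem (M : nat) (x : R) (sig : C) : C :=
  sig * gen_power g (RtoC x) (sig - 1) - (Apow M (x + 1) sig - Apow M x sig).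

(** The k-th term is expanded in 1 / x up to the order M - k, so that every neglected piece has the
    same size, x^(sig - M - 1). *)
Definition err (M : nat) (x : R) (sig : C) : C :=
  csum (fun k => ff sig k * c k * rpow x (sig - RtoC (INR k)) *
    (rpow (1 + / x) (sig - RtoC (INR k)) - bin_sum (sig - RtoC (INR k)) (/ x) (S M - k))) (S M).

Lemma rpow_shift x a j : (0 < x)%R -> rpow x a * RtoC (/ x) ^ j = rpow x (a - RtoC (INR j)).
Proof.
  intros h. unfold Cminus. rewrite rpow_plus, rpow_opp, rpow_nat by auto. f_equal.
  rewrite RtoC_inv by lra. apply Cpow_inv. apply RtoC_neq_0. lra.
Qed.

(** Write x + 1 = x (1 + 1 / x), expand each power by Taylor's formula and regroup by the total
    degree l = k + j. The falling factorials multiply, and the coefficients form the Cauchy product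
    of f with e^t. *)
Lemma Apow_step M x sig : (1 <= x)%R ->
  Apow M (x + 1) sig =
  csum (fun l => ff sig l * conv c exp_coef l * rpow x (sig - RtoC (INR l))) (S M) + err M x sig.
Proof.
  intros hx.
  rewrite (csum_ext (fun l => ff sig l * conv c exp_coef l * rpow x (sig - RtoC (INR l)))
    (fun l => csum (fun k => ff sig l * (c k * exp_coef (l - k)) * rpow x (sig - RtoC (INR l))) (S l))).
  2:{ intros l _. unfold conv.
      transitivity (ff sig l * rpow x (sig - RtoC (INR l)) * csum (fun k => c k * exp_coef (l - k)) (S l)); [ring|].
      rewrite <- csum_scal. apply csum_ext. intros. ring. }
  rewrite <- (csum_triangle (fun k l => ff sig l * (c k * exp_coef (l - k)) * rpow x (sig - RtoC (INR l)))).
  unfold err, Apow. rewrite <- csum_plus. apply csum_ext. intros k hk.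
  replace (x + 1)%R with (x * (1 + / x))%R by (field; lra).
  assert (hix : (0 < / x)%R) by (apply Rinv_0_lt_compat; lra).
  rewrite rpow_mult by lra.
  assert (E : csum (fun j => ff sig (k + j) * (c k * exp_coef (k + j - k)) * rpow x (sig - RtoC (INR (k + j)))) (S M - k)
    = ff sig k * c k * rpow x (sig - RtoC (INR k)) * bin_sum (sig - RtoC (INR k)) (/ x) (S M - k)).
  { unfold bin_sum. rewrite <- csum_scal. apply csum_ext. intros j hj.
    replace (k + j - k)%nat with j by lia. rewrite ff_add, plus_INR, RtoC_plus.
    replace (sig - (RtoC (INR k) + RtoC (INR j))) with ((sig - RtoC (INR k)) - RtoC (INR j)) by ring.
    rewrite <- (rpow_shift x (sig - RtoC (INR k))) by lra. ring. }
  rewrite E. ring.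
Qed.

(** By [mod_coef_rec] the difference of the truncated powers reproduces exactly the first M terms of
    the generalized power; its tail and the Taylor remainders are left. *)
Lemma Rem_eq M x sig : (INR N <= x)%R ->
  Rem M x sig = sig * CSeries (fun k => term x (sig - 1) (M + k)) - err M x sig.
Proof.
  intros hx. pose proof N_pos. unfold Rem. rewrite gen_power_term, Apow_step by lra.
  rewrite (CSeries_split (term x (sig - 1)) M) by (apply summable_term, hx).
  assert (E : csum (fun l => ff sig l * conv c exp_coef l * rpow x (sig - RtoC (INR l))) (S M) - Apow M x sig
    = sig * csum (term x (sig - 1)) M).
  { unfold Apow. rewrite <- csum_minus, csum_S.
    assert (E0 : conv c exp_coef 0 = c O) by (unfold conv; simpl; rewrite exp_coef_0; ring).
    rewrite E0, <- csum_scal.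
    rewrite (csum_ext _ (fun k => sig * term x (sig - 1) k)); [ring|].
    intros k _. unfold term, p. rewrite <- mod_coef_rec. fold c. rewrite ff_S_left.
    rewrite S_INR, RtoC_plus.
    replace (sig - (RtoC (INR k) + RtoC 1)) with (sig - 1 - RtoC (INR k)) by ring. ring. }
  replace (csum (fun l => ff sig l * conv c exp_coef l * rpow x (sig - RtoC (INR l))) (S M) + err M x sig - Apow M x sig)
    with (sig * csum (term x (sig - 1)) M + err M x sig) by (rewrite <- E; ring).
  ring.
Qed.

Lemma err_bound M S0 : (0 < S0)%R -> exists B, (0 <= B)%R /\ forall x sig, (INR N <= x)%R ->
  (Cmod sig <= S0)%R -> (Re sig <= INR M - 1)%R -> (Cmod (err M x sig) <= B * (/ x) ^ 2)%R.
Proof.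
  intros h0. pose proof N_pos.
  set (b := fun k => (bincoef S0 k * INR (fact k) * Cmod (c k) * bin_const (S0 + INR k) (S M - k))%R).
  assert (hb : forall k, (0 <= b k)%R).
  { intros k. unfold b. repeat apply Rmult_le_pos; try apply Cmod_ge_0; try apply pos_INR.
    - apply Rlt_le, bincoef_pos, h0.
    - apply Rlt_le, bin_const_pos. pose proof (pos_INR k). lra. }
  exists (rsum b (S M)). split; [apply rsum_pos, hb|].
  intros x sig hx hs hre. assert (hix : (0 < / x <= 1)%R).
  { split; [apply Rinv_0_lt_compat; lra|]. rewrite <- Rinv_1. apply Rinv_le_contravar; lra. }
  assert (Es : forall n, (rsum b n * (/ x) ^ 2 = rsum (fun k => b k * (/ x) ^ 2)%R n)%R).
  { intros n. induction n as [|n IH]; cbn [rsum]; [ring|]. rewrite <- IH. ring. }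
  rewrite Es. apply csum_bound. intros k hk.
  set (tau := sig - RtoC (INR k)).
  assert (hrem : (Cmod (rpow (1 + / x) tau - bin_sum tau (/ x) (S M - k)) <=
    bin_const (S0 + INR k) (S M - k) * (/ x) ^ (S M - k))%R).
  { pose proof (pos_INR k). apply bin_remainder; try lra. unfold tau.
    eapply Rle_trans; [apply Cmod_triangle|]. rewrite Cmod_opp, Cmod_R, Rabs_right; lra. }
  assert (hp : (Cmod (rpow x tau) * (/ x) ^ (S M - k) <= (/ x) ^ 2)%R).
  { rewrite <- Cmod_rpow_shift by lra. apply Cmod_rpow_m2; [lra|]. unfold tau.
    rewrite minus_INR, S_INR by lia. destruct sig as [u v]. simpl in *. lra. }
  rewrite !Cmod_mult. unfold b.
  pose proof (ff_bound S0 sig k hs h0).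
  pose proof (Cmod_ge_0 (ff sig k)). pose proof (Cmod_ge_0 (c k)). pose proof (Cmod_ge_0 (rpow x tau)).
  assert (hbc : (0 < bin_const (S0 + INR k) (S M - k))%R).
  { apply bin_const_pos. pose proof (pos_INR k). lra. }
  apply Rle_trans with ((bincoef S0 k * INR (fact k) * Cmod (c k)) * Cmod (rpow x tau) *
    (bin_const (S0 + INR k) (S M - k) * (/ x) ^ (S M - k)))%R.
  - apply Rmult_le_compat; try apply Cmod_ge_0; auto; [apply Rmult_le_pos; auto; apply Rmult_le_pos; auto|].
    apply Rmult_le_compat_r; auto. apply Rmult_le_compat_r; auto.
  - replace (bincoef S0 k * INR (fact k) * Cmod (c k) * Cmod (rpow x tau) *
      (bin_const (S0 + INR k) (S M - k) * (/ x) ^ (S M - k)))%R with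
      (bincoef S0 k * INR (fact k) * Cmod (c k) * bin_const (S0 + INR k) (S M - k) *
       (Cmod (rpow x tau) * (/ x) ^ (S M - k)))%R by ring.
    apply Rmult_le_compat_l; auto. apply hb.
Qed.

(** Everything left is of size x^(sig - M - 1), at most x^(-2) when Re sig <= M - 1. The sum over x
    = N + n then converges, and increasing M enlarges the half-plane at will. *)
Lemma Rem_bound M S0 : (0 < S0)%R -> exists B, (0 <= B)%R /\ forall x sig, (INR N <= x)%R ->
  (Cmod sig <= S0)%R -> (Re sig <= INR M - 1)%R -> (Cmod (Rem M x sig) <= B * (/ x) ^ 2)%R.
Proof.
  intros h0. pose proof N_pos.
  destruct (err_bound M S0 h0) as (B1 & hB1 & H1).
  destruct (term_bound (S0 + 1) ltac:(lra)) as (b & hb & hbp & HB).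
  (* [b] was computed at [x = N]: the first M terms are absorbed by a factor [N ^ M]. *)
  set (b' := fun k => (INR N ^ M * b (M + k)%nat)%R).
  assert (hb' : ex_series b').
  { apply ex_series_Rscal. destruct M as [|M']; [exact hb|]. apply (ex_series_incr_n b), hb. }
  assert (hS : (0 <= Series b')%R).
  { apply (rsum_le_Series b' 0); auto. intros k. apply Rmult_le_pos; auto. apply pow_le; lra. }
  exists (S0 * Series b' + B1)%R. split; [nra|].
  intros x sig hx hs hre. assert (hix : (0 < / x)%R) by (apply Rinv_0_lt_compat; lra).
  rewrite Rem_eq by auto. eapply Rle_trans; [apply Cmod_triangle|]. rewrite Cmod_opp, Cmod_mult.
  pose proof (H1 x sig hx hs hre) as h1.
  assert (h2 : (Cmod (CSeries (fun k => term x (sig - 1) (M + k))) <= Series b' * (/ x) ^ 2)%R).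
  { rewrite Rmult_comm, <- Series_scal_l. apply CSeries_bound; [|apply ex_series_Rscal, hb'].
    intros k. unfold term, b'. rewrite Cmod_mult.
    replace (RtoC (INR (M + k))) with (RtoC (INR M) + RtoC (INR k)) by (rewrite plus_INR, RtoC_plus; auto).
    replace (sig - 1 - (RtoC (INR M) + RtoC (INR k))) with (sig - 1 - RtoC (INR M) - RtoC (INR k)) by ring.
    rewrite Cmod_rpow_shift by lra.
    assert (h3 : (Cmod (rpow x (sig - 1 - RtoC (INR M))) <= (/ x) ^ 2)%R).
    { apply Cmod_rpow_m2; [lra|]. destruct sig as [u v]. simpl in *. lra. }
    assert (h4 : (Cmod (ff (sig - 1) (M + k) * p (M + k)) * (/ x) ^ k <= INR N ^ M * b (M + k)%nat)%R).
    { assert (h5 : (Cmod (ff (sig - 1) (M + k) * p (M + k)) * (/ INR N) ^ (M + k) <= b (M + k)%nat)%R).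
      { apply HB; [lra|]. eapply Rle_trans; [apply Cmod_triangle|]. rewrite Cmod_opp, Cmod_1. lra. }
      rewrite pow_add in h5.
      assert (hN : (0 < INR N ^ M)%R) by (apply pow_lt; lra).
      assert (h6 : ((/ x) ^ k <= (/ INR N) ^ k)%R).
      { apply pow_incr. split; [lra|]. apply Rinv_le_contravar; lra. }
      eapply Rle_trans; [apply Rmult_le_compat_l; [apply Cmod_ge_0|exact h6]|].
      rewrite (pow_inv (INR N) M) in h5.
      replace (Cmod (ff (sig - 1) (M + k) * p (M + k)) * (/ INR N) ^ k)%R with
        (INR N ^ M * (Cmod (ff (sig - 1) (M + k) * p (M + k)) * (/ INR N ^ M * (/ INR N) ^ k)))%R by (field; lra).
      apply Rmult_le_compat_l; [lra|exact h5]. }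
    replace (Cmod (ff (sig - 1) (M + k) * p (M + k)) * (Cmod (rpow x (sig - 1 - RtoC (INR M))) * (/ x) ^ k))%R
      with (Cmod (rpow x (sig - 1 - RtoC (INR M))) * (Cmod (ff (sig - 1) (M + k) * p (M + k)) * (/ x) ^ k))%R by ring.
    apply Rmult_le_compat; auto; [apply Cmod_ge_0|].
    apply Rmult_le_pos; [apply Cmod_ge_0|apply pow_le; lra]. }
  assert (0 <= (/ x) ^ 2)%R by (apply pow_le; lra).
  rewrite Rmult_plus_distr_r. apply Rplus_le_compat; auto.
  rewrite Rmult_assoc. apply Rmult_le_compat; auto; apply Cmod_ge_0.
Qed.

(** For a natural exponent the falling factorials end the generalized power before the index M, and
    Taylor's formula is the exact binomial theorem; for m = 0 the factor [sig] is 0. *)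
Lemma Rem_nat M m x : (m <= M)%nat -> (INR N <= x)%R -> Rem M x (RtoC (INR m)) = 0.
Proof.
  intros hm hx. pose proof N_pos. rewrite Rem_eq by auto.
  assert (hix : (0 < / x <= 1)%R).
  { split; [apply Rinv_0_lt_compat; lra|]. rewrite <- Rinv_1. apply Rinv_le_contravar; lra. }
  assert (E1 : err M x (RtoC (INR m)) = 0).
  { unfold err. rewrite (csum_ext _ (fun _ => 0)); [apply csum_zero|]. intros k hk.
    destruct (le_lt_dec k m) as [h|h].
    - rewrite <- RtoC_minus, <- minus_INR by auto.
      rewrite (bin_remainder_nat (m - k) (S M - k)); [ring|lia|lra].
    - rewrite ff_nat_zero by auto. ring. }
  rewrite E1. destruct m as [|m]; [simpl; ring|].
  rewrite (CSeries_finite _ 0); [simpl; ring|]. intros k _. unfold term.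
  replace (RtoC (INR (S m)) - 1) with (RtoC (INR m)) by (rewrite S_INR, RtoC_plus; ring).
  rewrite ff_nat_zero by lia. ring.
Qed.

Definition RemSum (M : nat) (sig : C) : C := CSeries (fun n => Rem M (INR (N + n)) sig).

Lemma N_le n : (INR N <= INR (N + n))%R.
Proof. apply le_INR. lia. Qed.

Lemma N_ge_1 : (1 <= N)%nat.
Proof. apply INR_le, N_pos. Qed.

Lemma summable_Rem M sig : (Re sig <= INR M - 1)%R -> summable (fun n => Rem M (INR (N + n)) sig).
Proof.
  intros h. destruct (Rem_bound M (Cmod sig + 1)) as (B & hB & H).
  { pose proof (Cmod_ge_0 sig). lra. }
  apply (summable_le _ (fun n => B * (/ INR (N + n)) ^ 2)%R).
  - intros n. apply H; auto; [apply N_le|lra].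
  - apply ex_series_Rscal, ex_series_inv_sq, N_ge_1.
Qed.

Lemma Cdiffable_Apow M x sig : Cdiffable (Apow M x) sig.
Proof.
  apply Cdiffable_csum. intros k _. apply Cdiffable_mult.
  - apply Cdiffable_mult; [apply Cdiffable_ff, Cdiffable_id|apply Cdiffable_const].
  - apply Cdiffable_rpow, Cdiffable_minus; [apply Cdiffable_id|apply Cdiffable_const].
Qed.

Lemma Cdiffable_Rem M x sig : (INR N <= x)%R -> Cdiffable (Rem M x) sig.
Proof.
  intros hx. pose proof N_pos. pose proof rad_N. apply Cdiffable_minus.
  - apply Cdiffable_mult; [apply Cdiffable_id|].
    apply (Cdiffable_comp (fun sig => sig - 1) (gen_power g (RtoC x))).
    + apply Cdiffable_gen_power; try lra. apply hf.
    + apply Cdiffable_minus; [apply Cdiffable_id|apply Cdiffable_const].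
  - apply Cdiffable_minus; apply Cdiffable_Apow.
Qed.

Lemma Re_disc (z s : C) r : (Cmod (z - s) <= r)%R -> (Re z <= Re s + r)%R.
Proof.
  intros h. pose proof (re_le_Cmod (z - s)). pose proof (Rle_abs (Re (z - s))).
  destruct z, s. simpl in *. lra.
Qed.

Lemma Cdiffable_RemSum M sig : (Re sig < INR M - 1)%R -> Cdiffable (RemSum M) sig.
Proof.
  intros h. set (r := ((INR M - 1 - Re sig) / 2)%R). assert (hr : (0 < r)%R) by (unfold r; lra).
  destruct (Rem_bound M (Cmod sig + r)) as (B & hB & H).
  { pose proof (Cmod_ge_0 sig). lra. }
  apply (Cdiffable_CSeries (fun n s => Rem M (INR (N + n)) s) (fun n => (B * (/ INR (N + n)) ^ 2)%R) sig r); auto.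
  - apply ex_series_Rscal, ex_series_inv_sq, N_ge_1.
  - intros k z hz. apply H; [apply N_le|apply Cmod_disc_bound, hz|].
    pose proof (Re_disc z sig r hz). unfold r in *. lra.
  - intros k z _. apply Cdiffable_Rem, N_le.
  - replace (sig - sig) with (RtoC 0) by ring. rewrite Cmod_0. auto.
Qed.

Lemma Apow_limit M sig : (Re sig < 0)%R -> Clim (fun n => Apow M (INR (N + n)) sig) 0.
Proof.
  intros h. unfold Apow.
  assert (H : forall k, Clim (fun n => ff sig k * c k * rpow (INR (N + n)) (sig - RtoC (INR k))) 0).
  { intros k. replace (RtoC 0) with (ff sig k * c k * 0) by ring. apply Clim_scal.
    intros eps heps.
    assert (hl : is_lim_seq (fun n => Re sig * ln (INR (N + n)))%R m_infty).
    { replace m_infty with (Rbar_mult (Re sig) p_infty).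
      - apply is_lim_seq_scal_l.
        assert (hln : is_lim_seq (fun n => ln (INR (n + N))) p_infty).
        { apply (is_lim_seq_incr_n (fun n => ln (INR n)) N).
          apply (is_lim_comp_seq ln INR p_infty p_infty); [apply is_lim_ln_p| |apply is_lim_seq_INR].
          exists O. intros; discriminate. }
        eapply is_lim_seq_ext; [|exact hln]. intros n. rewrite Nat.add_comm. auto.
      - unfold Rbar_mult, Rbar_mult'. destruct (Rle_dec 0 (Re sig)); [exfalso; lra|auto]. }
    assert (he : is_lim_seq (fun n => exp (Re sig * ln (INR (N + n)))) 0%R).
    { apply (is_lim_comp_seq exp _ m_infty 0%R); [apply is_lim_exp_m| |exact hl].
      exists O. intros; discriminate. }
    rewrite is_lim_seq_eps in he. destruct (he eps heps) as [n0 Hn0]. exists n0. intros n hn.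
    specialize (Hn0 n hn). rewrite Rminus_0_r in Hn0. pose proof N_pos. pose proof (N_le n).
    replace (rpow (INR (N + n)) (sig - RtoC (INR k)) - 0) with (rpow (INR (N + n)) (sig - RtoC (INR k))) by ring.
    eapply Rle_lt_trans; [apply (Cmod_rpow_le _ _ sig)|].
    - lra.
    - pose proof (pos_INR k). destruct sig. simpl in *. lra.
    - rewrite Cmod_rpow. apply Rabs_def2 in Hn0. lra. }
  generalize (S M). intros n1. induction n1 as [|n1 IH]; simpl; [apply Clim_const|].
  replace (RtoC 0) with (0 + 0) by ring. apply Clim_plus; auto.
Qed.

(** Here s = 1 - sig. For Re sig < 0 the boundary term at infinity vanishes, and M >= 1 puts this
    half-plane inside the domain where the remainders are summable. *)
Lemma LC_formula M sig : (1 <= M)%nat -> (Re sig < 0)%R ->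
  sig * L (1 - sig) = - Apow M (INR N) sig + RemSum M sig.
Proof.
  intros hM h.
  assert (hs : Csums (fun k => gen_power g (RtoC (INR (N + k))) (sig - 1)) (L (1 - sig))).
  { apply Csums_is_series. replace (sig - 1) with (- (1 - sig)) by ring. apply hL.
    destruct sig. simpl in *. lra. }
  apply (Clim_scal sig) in hs.
  assert (htel : forall n, sig * csum (fun k => gen_power g (RtoC (INR (N + k))) (sig - 1)) n =
    Apow M (INR (N + n)) sig - Apow M (INR N) sig + csum (fun k => Rem M (INR (N + k)) sig) n).
  { induction n as [|n IH]; cbn [csum]; [rewrite Nat.add_0_r; ring|].
    rewrite Cmult_plus_distr_l, IH.
    change (Rem M (INR (N + n)) sig) with (sig * gen_power g (RtoC (INR (N + n))) (sig - 1) -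
      (Apow M (INR (N + n) + 1) sig - Apow M (INR (N + n)) sig)).
    replace (INR (N + S n)) with (INR (N + n) + 1)%R by (rewrite Nat.add_succ_r, S_INR; auto). ring. }
  eapply Clim_unique; [exact hs|].
  apply Clim_ext with (u := fun n => Apow M (INR (N + n)) sig - Apow M (INR N) sig + csum (fun k => Rem M (INR (N + k)) sig) n).
  { intros n. symmetry. apply htel. }
  replace (- Apow M (INR N) sig + RemSum M sig) with (0 - Apow M (INR N) sig + RemSum M sig) by ring.
  apply Clim_plus; [apply Clim_minus; [apply Apow_limit, h|apply Clim_const]|].
  apply summable_Csums, summable_Rem. apply (le_INR 1) in hM. simpl in hM. lra.
Qed.
End LCfunction.

(** * Holomorphy and the identity theorem in a half-plane *)

Lemma holomorphic_Cdiffable F s : holomorphic_at F s -> Cdiffable F s.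
Proof.
  intros h. apply locally_singleton in h. destruct h as [l hl]. exists l. apply Cdiff_is_derive, hl.
Qed.

Lemma Cdiffable_holomorphic F s :
  (exists d, (0 < d)%R /\ forall z, (Cmod (z - s) < d)%R -> Cdiffable F z) -> holomorphic_at F s.
Proof.
  intros (d & hd & h). apply locally_C. exists (mkposreal d hd). intros z hz.
  destruct (h z hz) as [l hl]. exists l. apply Cdiff_is_derive, hl.
Qed.

Lemma Re_disc_ge (z s : C) r : (Cmod (z - s) <= r)%R -> (Re s - r <= Re z)%R.
Proof.
  intros h. pose proof (re_le_Cmod (z - s)). pose proof (Rle_abs (- Re (z - s))). rewrite Rabs_Ropp in *.
  destruct z, s. simpl in *. lra.
Qed.

(* A half-plane is exhausted by the discs centred on the real axis that it contains. *)
Lemma identity_half_plane f a b : (forall z, (Re z < a)%R -> Cdiffable f z) ->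
  (forall z, (Re z < b)%R -> f z = 0) -> forall z, (Re z < a)%R -> f z = 0.
Proof.
  intros hf h0 z hz. set (e := (a - Re z)%R). assert (he : (0 < e)%R) by (unfold e; lra).
  (* The disc of centre -X and radius X + a contains z as soon as (Im z)^2 < 2 e (Re z + X); the
     other terms put the unit disc around -X into Re < b. *)
  set (X := (Im z * Im z / (2 * e) + Rabs (Re z) + Rabs b + Rabs a + 1)%R).
  assert (hq : (0 <= Im z * Im z / (2 * e))%R) by (apply Rdiv_le_0_compat; nra).
  pose proof (Rle_abs (Re z)) as r1. pose proof (Rle_abs (- Re z)) as r2. rewrite Rabs_Ropp in r2.
  pose proof (Rle_abs b) as r3. pose proof (Rle_abs (- b)) as r4. rewrite Rabs_Ropp in r4.
  pose proof (Rle_abs a) as r5. pose proof (Rle_abs (- a)) as r6. rewrite Rabs_Ropp in r6.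
  pose proof (Rabs_pos (Re z)). pose proof (Rabs_pos b). pose proof (Rabs_pos a).
  apply (identity_disc f (RtoC (- X)) (X + a)).
  - intros w hw. apply hf. apply Rnot_le_lt. intros hn.
    pose proof (re_le_Cmod (w - RtoC (- X))). pose proof (Rle_abs (Re (w - RtoC (- X)))).
    destruct w; simpl in *. lra.
  - exists 1%R. split; [lra|]. intros w hw. apply h0.
    pose proof (re_le_Cmod (w - RtoC (- X))). pose proof (Rle_abs (Re (w - RtoC (- X)))).
    destruct w; simpl in *. unfold X in *. lra.
  - assert (hX : (0 < X + a)%R) by (unfold X; lra).
    apply Rsqr_incrst_0; [|apply Cmod_ge_0|lra].
    unfold Rsqr. pose proof (Cmod2_alt (z - RtoC (- X))) as E.
    replace (Re (z - RtoC (- X))) with (Re z + X)%R in E by (destruct z; simpl; ring).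
    replace (Im (z - RtoC (- X))) with (Im z)%R in E by (destruct z; simpl; ring).
    simpl in E. rewrite !Rmult_1_r in E. rewrite E.
    replace (X + a)%R with (Re z + X + e)%R by (unfold e; ring).
    assert (hi : (Im z * Im z < 2 * e * (Re z + X))%R).
    { replace (Im z * Im z)%R with (2 * e * (Im z * Im z / (2 * e)))%R by (field; lra).
      apply Rmult_lt_compat_l; [lra|]. unfold X. lra. }
    nra.
Qed.

Lemma ff_nat_fact m k : (k <= m)%nat ->
  ff (RtoC (INR m)) k * RtoC (INR (fact (m - k))) = RtoC (INR (fact m)).
Proof.
  induction k as [|k IH]; intros h; [simpl; rewrite Nat.sub_0_r; ring|].
  rewrite <- IH by lia. cbn [ff].
  assert (E : (m - k)%nat = S (m - S k)) by lia.
  rewrite E, fact_S_C, <- E, minus_INR, RtoC_minus by lia. ring.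
Qed.

(** * The entire function (s - 1) L(s) and its values at 1 - m *)

Section Lhat.
Variables (f : R -> R) (hf : standing_assumptions f) (L : C -> C) (hL : is_LC_function (complexify f) L).

Let g := complexify f.
Let N := start_index g.

(** Whether or not p_f(0) is 0, the singularity of (s - 1) L(s) at 1 is removable, so later
    identities need not distinguish the two cases. In the case of a pole, only boundedness is taken
    from the limit. *)
Lemma Lhat_exists : exists Lh : C -> C, (forall s : C, s <> 1 -> Lh s = (s - 1) * L s) /\
  (forall s, Cdiffable Lh s).
Proof.
  assert (hd : forall s : C, s <> 1 -> Cdiffable (fun s => (s - 1) * L s) s).
  { intros s hs. apply Cdiffable_mult.
    - apply Cdiffable_minus; [apply Cdiffable_id|apply Cdiffable_const].
    - apply holomorphic_Cdiffable, hL, hs. }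
  assert (hrem : removable (fun s => (s - 1) * L s) 1).
  { destruct (excluded_middle_informative (modulator_entire g 0 = RtoC 0)) as [h|h].
    - apply cont_removable, cont_mult.
      + apply cont_minus; [apply cont_e|apply cont_const].
      + apply Cdiffable_cont, holomorphic_Cdiffable, (LC_entire _ _ hL), h.
    - pose proof (LC_pole _ _ hL h) as hp.
      set (P0 := modulator_entire g 0) in *.
      destruct (hp (fun z => (Cmod (z - P0) < 2)%R)) as [d Hd].
      { exists (mkposreal 1 Rlt_0_1). intros z hz. apply C_NormedModule_mixin_compat2 in hz.
        eapply Rlt_le_trans; [exact hz|]. simpl.
        assert (hs : (sqrt 2 <= 2)%R).
        { rewrite <- (sqrt_Rsqr 2) at 2; [|lra]. apply sqrt_le_1; unfold Rsqr; lra. }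
        lra. }
      intros eps heps. set (K := (Cmod P0 + 2)%R).
      assert (hK : (0 < K)%R) by (unfold K; pose proof (Cmod_ge_0 P0); lra).
      exists (Rmin d (eps / K)). split.
      { apply Rmin_pos; [apply cond_pos|apply Rdiv_lt_0_compat; lra]. }
      intros z hz. pose proof (Rmin_l d (eps / K)). pose proof (Rmin_r d (eps / K)).
      rewrite Cmod_mult.
      assert (h1 : (Cmod ((z - 1) * L z - P0) < 2)%R).
      { apply (Hd z).
        - apply C_NormedModule_mixin_compat1. change (Cmod (z - 1) < d)%R. lra.
        - intros E. rewrite E in hz. replace (RtoC 1 - 1) with (RtoC 0) in hz by ring. rewrite Cmod_0 in hz. lra. }
      pose proof (Cmod_ge_minus ((z - 1) * L z) P0).
      apply Rle_trans with (eps / K * K)%R; [|right; field; lra].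
      apply Rmult_le_compat; try apply Cmod_ge_0; [lra|unfold K; lra]. }
  destruct (riemann (fun s => (s - 1) * L s) 1 1 Rlt_0_1) as (Lh & h1 & h2); auto.
  { intros z hz. apply hd. intros ->. replace (RtoC 1 - 1) with (RtoC 0) in hz by ring. rewrite Cmod_0 in hz. lra. }
  exists Lh. split; [exact h1|]. intros s.
  destruct (excluded_middle_informative (s = 1)) as [->|h].
  - apply h2. replace (RtoC 1 - 1) with (RtoC 0) by ring. rewrite Cmod_0. lra.
  - apply Cdiffable_ext_loc with (f := fun s => (s - 1) * L s); [|apply hd, h].
    exists (Cmod (s - 1)). split; [apply Cmod_gt_0, Cminus_neq_0, h|]. intros u hu.
    symmetry. apply h1. intros ->. rewrite Cmod_minus_sym in hu. lra.
Qed.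

Variables (Lh : C -> C) (hLh1 : forall s : C, s <> 1 -> Lh s = (s - 1) * L s) (hLh2 : forall s, Cdiffable Lh s).

(** [LC_formula] gives this for Re sig < 0, up to the sign coming from s - 1 = - sig, and the
    identity theorem extends it. As M is free, every point of the plane is reached. *)
Lemma Lhat_formula M sig : (1 <= M)%nat -> (Re sig < INR M - 1)%R ->
  Lh (1 - sig) = Apow f M (INR N) sig - RemSum f M sig.
Proof.
  intros hM hs.
  assert (E : Lh (1 - sig) - (Apow f M (INR N) sig - RemSum f M sig) = 0).
  { apply (identity_half_plane (fun sig => Lh (1 - sig) - (Apow f M (INR N) sig - RemSum f M sig)) (INR M - 1) 0); auto.
    - intros z hz. apply Cdiffable_minus; [|apply Cdiffable_minus].
      + apply (Cdiffable_comp (fun s => 1 - s) Lh); [apply hLh2|].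
        apply Cdiffable_minus; [apply Cdiffable_const|apply Cdiffable_id].
      + apply Cdiffable_Apow; auto.
      + apply Cdiffable_RemSum; auto.
    - intros z hz. rewrite hLh1.
      + replace ((1 - z - 1) * L (1 - z)) with (- (z * L (1 - z))) by ring.
        rewrite (LC_formula f hf L hL M z hM hz). fold g. fold N. ring.
      + intros H. apply (f_equal Re) in H. destruct z. simpl in *. lra. }
  replace (Lh (1 - sig)) with (Lh (1 - sig) - (Apow f M (INR N) sig - RemSum f M sig) +
    (Apow f M (INR N) sig - RemSum f M sig)) by ring.
  rewrite E. ring.
Qed.

(** At sig = m the remainders vanish and the truncated power is a polynomial in N whose coefficients
    involve m! / (m - k)!; it is matched with [Cpoly_underline] at x = N. *)
Lemma Lhat_nat m : Cpoly (underline g) m (1 - RtoC (INR N)) = (- (1)) ^ m * Lh (1 - RtoC (INR m)).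
Proof.
  pose proof (N_pos f hf) as hN. fold g in hN. fold N in hN.
  (* The least truncation with m < M - 1; the terms of index above m are 0. *)
  rewrite (Lhat_formula (m + 2)); [|lia|].
  2:{ rewrite plus_INR. simpl. lra. }
  unfold RemSum. rewrite (CSeries_finite _ 0).
  2:{ intros k _. apply Rem_nat; auto; [lia|]. apply N_le. }
  unfold Apow. replace (S (m + 2)) with (S m + 2)%nat by lia. rewrite csum_split.
  rewrite (csum_ext (fun k => _) (fun _ => 0) 2).
  2:{ intros k _. rewrite ff_nat_zero by lia. ring. }
  rewrite csum_zero. unfold g at 1. rewrite Cpoly_underline; [|apply hf|apply RtoC_neq_0; lra].
  rewrite Cmult_assoc, (Cmult_comm (RtoC (INR (fact m)))), <- Cmult_assoc. f_equal.
  rewrite <- csum_scal. simpl (csum _ 0).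
  transitivity (csum (fun k : nat => ff (RtoC (INR m)) k * taylor_coef f k * rpow (INR N) (RtoC (INR m) - RtoC (INR k))) (S m)); [|ring].
  apply csum_ext. intros k hk. rewrite <- RtoC_minus, <- minus_INR by lia.
  rewrite rpow_nat by lra. rewrite <- (ff_nat_fact m k) by lia. unfold exp_coef. field. apply fact_C_neq_0.
Qed.
End Lhat.

(** * The Gamma function near 1 *)

(** The sequence whose limit is [CGamma]. At n = 0 the base of the power is 0, hence the use of
    [gauss w (S n)] below. *)
Definition gauss (w : C) (n : nat) : C :=
  RtoC (INR (fact n)) * Cpower (RtoC (INR n)) w / Crising w n.

Lemma CGamma_Clim w l : Clim (gauss w) l -> CGamma w = l.
Proof. apply CLim_seq_Clim. Qed.

Lemma Crising_neq_0 w n : (forall j, w + RtoC (INR j) <> 0) -> Crising w n <> 0.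
Proof.
  intros h. induction n as [|n IH]; simpl.
  - specialize (h O). simpl in h. replace (w + 0) with w in h by ring. auto.
  - apply Cmult_neq_0; auto. apply (h (S n)).
Qed.

Lemma Crising_shift w n : Crising w n * (w + RtoC (INR (S n))) = w * Crising (w + 1) n.
Proof.
  induction n as [|n IH]; [simpl; ring|].
  cbn [Crising]. rewrite IH. rewrite (S_INR (S n)), RtoC_plus. ring.
Qed.

Lemma gauss_pos w n : gauss w (S n) = RtoC (INR (fact (S n))) * rpow (INR (S n)) w / Crising w (S n).
Proof. unfold gauss. rewrite Cpower_pos; auto. apply lt_0_INR. lia. Qed.

Lemma inv_INR_lim : Clim (fun n => RtoC (/ INR (S n))) 0.
Proof.
  apply Clim_of_R. apply (is_lim_seq_incr_1 (fun n => / INR n)%R).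
  replace (Finite 0) with (Rbar_inv p_infty) by reflexivity.
  apply is_lim_seq_inv; [apply is_lim_seq_INR|discriminate].
Qed.

Lemma Clim_S u l : Clim (fun n => u (S n)) l -> Clim u l.
Proof.
  intros h eps heps. destruct (h eps heps) as [n0 H]. exists (S n0). intros [|n] hn; [lia|].
  apply H. lia.
Qed.

Lemma Clim_S_inv u l : Clim u l -> Clim (fun n => u (S n)) l.
Proof.
  intros h eps heps. destruct (h eps heps) as [n0 H]. exists n0. intros n hn. apply H. lia.
Qed.

(** The n-th terms at w and w + 1 differ by the factor (w + n + 1) / (w n), so convergence at w + 1
    gives convergence at w. *)
Lemma gauss_functional w l : (forall j, w + RtoC (INR j) <> 0) ->
  Clim (gauss (w + 1)) l -> Clim (gauss w) (l / w).
Proof.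
  intros hw h. assert (hw0 : w <> 0).
  { specialize (hw O). simpl in hw. replace (w + 0) with w in hw by ring. auto. }
  apply Clim_S.
  apply Clim_ext with (u := fun n => gauss (w + 1) (S n) * (/ w * (1 + (w + 1) * RtoC (/ INR (S n))))).
  - intros n. rewrite !gauss_pos. assert (hn : (0 < INR (S n))%R) by (apply lt_0_INR; lia).
    rewrite rpow_plus, rpow_1, RtoC_inv by lra.
    pose proof (INR_S_C_neq_0 n). pose proof (Crising_neq_0 w (S n) hw).
    pose proof (hw (S (S n))) as h2.
    assert (h3 : Crising (w + 1) (S n) <> 0).
    { apply Crising_neq_0. intros j. replace (w + 1 + RtoC (INR j)) with (w + RtoC (INR (S j))).
      - apply hw.
      - rewrite S_INR, RtoC_plus. ring. }
    pose proof (Crising_shift w (S n)) as E.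
    rewrite (S_INR (S n)), RtoC_plus in E, h2.
    assert (E2 : Crising w (S n) = w * Crising (w + 1) (S n) / (w + (RtoC (INR (S n)) + RtoC 1))).
    { rewrite <- E. field. auto. }
    rewrite E2. set (x := RtoC (INR (S n))) in *. set (cr := Crising (w + 1) (S n)) in *.
    field. repeat split; auto.
  - replace (l / w) with (l * (/ w * (1 + (w + 1) * 0))) by (field; auto).
    apply Clim_mult; [apply Clim_S_inv, h|]. apply Clim_scal.
    apply Clim_plus; [apply Clim_const|]. apply Clim_scal, inv_INR_lim.
Qed.

(** One factor fewer than [Crising w m]: the product ends at w + m - 1. *)
Fixpoint rising_prod (w : C) (m : nat) : C :=
  match m with O => 1 | S k => rising_prod w k * (w + RtoC (INR k)) end.

Lemma rising_prod_left w m : rising_prod w (S m) = w * rising_prod (w + 1) m.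
Proof.
  induction m as [|m IH]; [simpl; ring|].
  change (rising_prod w (S (S m))) with (rising_prod w (S m) * (w + RtoC (INR (S m)))).
  rewrite IH. cbn [rising_prod]. rewrite S_INR, RtoC_plus. ring.
Qed.

Lemma rising_prod_neq_0 w m : (forall j, w + RtoC (INR j) <> 0) -> rising_prod w m <> 0.
Proof.
  intros h. induction m as [|m IH]; simpl; [intros E; apply C1_nz; auto|]. apply Cmult_neq_0; auto.
Qed.

Lemma gauss_shift m : forall w l, (forall j, w + RtoC (INR j) <> 0) ->
  Clim (gauss (w + RtoC (INR m))) l -> Clim (gauss w) (l / rising_prod w m).
Proof.
  induction m as [|m IH]; intros w l hw h.
  - simpl in *. replace (w + 0) with w in h by ring. replace (l / 1) with l by (field; intros E; apply C1_nz; auto).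
    auto.
  - assert (hw1 : forall j, w + 1 + RtoC (INR j) <> 0).
    { intros j. replace (w + 1 + RtoC (INR j)) with (w + RtoC (INR (S j))); [apply hw|].
      rewrite S_INR, RtoC_plus. ring. }
    rewrite rising_prod_left.
    assert (hw0 : w <> 0).
    { specialize (hw O). simpl in hw. replace (w + 0) with w in hw by ring. auto. }
    pose proof (rising_prod_neq_0 (w + 1) m hw1).
    replace (l / (w * rising_prod (w + 1) m)) with (l / rising_prod (w + 1) m / w) by (field; auto).
    apply gauss_functional; auto. apply IH; auto.
    replace (w + 1 + RtoC (INR m)) with (w + RtoC (INR (S m))); auto.
    rewrite S_INR, RtoC_plus. ring.
Qed.

Lemma near_1 w : (Cmod (w - 1) <= 1 / 2)%R -> (1 / 2 <= Re w)%R /\ (Cmod w <= 3 / 2)%R.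
Proof.
  intros h. split.
  - pose proof (Re_disc_ge w 1 (1 / 2) h) as H. simpl in H. lra.
  - pose proof (Cmod_disc_bound 1 w (1 / 2) h) as H. rewrite Cmod_1 in H. lra.
Qed.

Lemma near_1_neq_0 w j : (Cmod (w - 1) <= 1 / 2)%R -> w + RtoC (INR j) <> 0.
Proof.
  intros h E. destruct (near_1 w h) as [h1 _]. apply (f_equal Re) in E.
  pose proof (pos_INR j). destruct w. simpl in *. lra.
Qed.

(** With y = 1 / (n + 1) the ratio of consecutive terms is (1 + y)^(w+1) / (1 + (w + 1) y).
    Numerator and denominator agree to first order, so it is 1 + O(y^2), uniformly in w. The 3 in
    [bin_const 3 2] bounds |w + 1|, and the denominator has modulus at least 1 because Re w > 0. *)
Lemma gauss_ratio w n : (Cmod (w - 1) <= 1 / 2)%R ->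
  (Cmod (gauss w (S (S n)) - gauss w (S n)) <=
    Cmod (gauss w (S n)) * (bin_const 3 2 * (/ INR (S n)) ^ 2))%R.
Proof.
  intros h. destruct (near_1 w h) as [h1 h2].
  set (y := (/ INR (S n))%R). assert (hn : (1 <= INR (S n))%R) by (apply (le_INR 1); lia).
  assert (hy : (0 < y <= 1)%R).
  { unfold y. split; [apply Rinv_0_lt_compat; lra|]. rewrite <- Rinv_1. apply Rinv_le_contravar; lra. }
  set (q := rpow (1 + y) (w + 1) / (1 + (w + 1) * RtoC y)).
  assert (hden : (1 <= Cmod (1 + (w + 1) * RtoC y))%R).
  { pose proof (re_le_Cmod (1 + (w + 1) * RtoC y)) as H. pose proof (Rle_abs (Re (1 + (w + 1) * RtoC y))).
    assert (E : Re (1 + (w + 1) * RtoC y) = (1 + (Re w + 1) * y)%R) by (destruct w; simpl; ring).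
    rewrite E in *. nra. }
  assert (hd0 : 1 + (w + 1) * RtoC y <> 0) by (apply Cmod_gt_0; lra).
  assert (E : gauss w (S (S n)) = gauss w (S n) * q).
  { rewrite !gauss_pos. unfold q.
    assert (e1 : INR (S (S n)) = (INR (S n) * (1 + y))%R).
    { rewrite (S_INR (S n)). unfold y. field. lra. }
    rewrite fact_S_C. cbn [Crising]. rewrite e1, rpow_mult by lra.
    rewrite (rpow_plus (1 + y) w 1), rpow_1 by lra.
    pose proof (Crising_neq_0 w n (fun j => near_1_neq_0 w j h)) as hc.
    pose proof (near_1_neq_0 w (S n) h) as hc1. pose proof (near_1_neq_0 w (S (S n)) h) as hc2.
    rewrite e1 in hc2.
    assert (ey : RtoC y = / RtoC (INR (S n))) by (unfold y; apply RtoC_inv; lra).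
    rewrite RtoC_mult, RtoC_plus in *. rewrite ey in *.
    pose proof (INR_S_C_neq_0 n) as h0. set (x := RtoC (INR (S n))) in *.
    assert (h4 : w + x + 1 <> 0).
    { intros E. apply hc2. rewrite <- E. field. auto. }
    field. repeat split; auto.
    - intros E. apply h4. rewrite <- E. ring. }
  rewrite E. replace (gauss w (S n) * q - gauss w (S n)) with (gauss w (S n) * (q - 1)) by ring.
  rewrite Cmod_mult. apply Rmult_le_compat_l; [apply Cmod_ge_0|].
  replace (q - 1) with ((rpow (1 + y) (w + 1) - bin_sum (w + 1) y 2) / (1 + (w + 1) * RtoC y)).
  2:{ unfold q, bin_sum. simpl csum. unfold exp_coef. simpl (fact _). simpl INR. simpl ff.
      field. auto. }
  rewrite Cmod_div by auto. apply Rle_div_l; [lra|].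
  assert (hb : (Cmod (rpow (1 + y) (w + 1) - bin_sum (w + 1) y 2) <= bin_const 3 2 * y ^ 2)%R).
  { apply bin_remainder; [lra| |lra]. eapply Rle_trans; [apply Cmod_triangle|]. rewrite Cmod_1. lra. }
  assert (0 < bin_const 3 2)%R by (apply bin_const_pos; lra).
  assert (0 <= y ^ 2)%R by (apply pow_le; lra).
  eapply Rle_trans; [exact hb|]. rewrite <- (Rmult_1_r (bin_const 3 2 * y ^ 2)) at 1.
  apply Rmult_le_compat_l; [nra|auto].
Qed.

(** The product of the factors 1 + a_n is at most the exponential of the sum of the a_n; the 2
    bounds the first term 1 / |w (w + 1)|. *)
Lemma gauss_bounded : exists M, (0 <= M)%R /\ forall w n, (Cmod (w - 1) <= 1 / 2)%R -> (Cmod (gauss w (S n)) <= M)%R.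
Proof.
  set (a := fun n => (bin_const 3 2 * (/ INR (S n)) ^ 2)%R).
  assert (ha : forall n, (0 <= a n)%R).
  { intros n. unfold a. apply Rmult_le_pos; [apply Rlt_le, bin_const_pos; lra|].
    apply pow_le, Rlt_le, Rinv_0_lt_compat, lt_0_INR; lia. }
  assert (hser : ex_series a) by (apply ex_series_Rscal, (ex_series_inv_sq 1); lia).
  exists (2 * exp (Series a))%R. split; [pose proof (exp_pos (Series a)); lra|].
  intros w n h. destruct (near_1 w h) as [h1 h2].
  assert (H : (Cmod (gauss w (S n)) <= 2 * exp (rsum a n))%R).
  { induction n as [|n IH].
    - simpl rsum. rewrite exp_0, gauss_pos. simpl (fact _). simpl INR. simpl Crising.
      unfold rpow. rewrite ln_1, Cmult_0_r, Cexp_0.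
      pose proof (near_1_neq_0 w 0 h) as n0. pose proof (near_1_neq_0 w 1 h) as n1. simpl in n0, n1.
      replace (w + 0) with w in n0 by ring.
      rewrite Cmod_div, !Cmod_mult, Cmod_1 by (apply Cmult_neq_0; auto).
      pose proof (re_le_Cmod w). pose proof (Rle_abs (Re w)).
      pose proof (re_le_Cmod (w + 1)). pose proof (Rle_abs (Re (w + 1))).
      assert (E : Re (w + 1) = (Re w + 1)%R) by (destruct w; simpl; ring). rewrite E in *.
      apply Rle_div_l; nra.
    - pose proof (gauss_ratio w n h) as hr.
      pose proof (Cmod_ge_minus (gauss w (S (S n))) (gauss w (S n))).
      cbn [rsum]. rewrite exp_plus. fold (a n) in hr.
      pose proof (exp_ineq1_le (a n)). specialize (ha n).
      pose proof (Cmod_ge_0 (gauss w (S n))). pose proof (exp_pos (rsum a n)).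
      apply Rle_trans with (Cmod (gauss w (S n)) * (1 + a n))%R; [lra|].
      rewrite <- Rmult_assoc. apply Rmult_le_compat; lra. }
  eapply Rle_trans; [exact H|]. apply Rmult_le_compat_l; [lra|].
  pose proof (rsum_le_Series a n ha hser).
  destruct (Req_dec (rsum a n) (Series a)) as [->|hn]; [lra|]. apply Rlt_le, exp_increasing. lra.
Qed.

Lemma Cdiffable_gauss w n : (forall j, w + RtoC (INR j) <> 0) -> Cdiffable (fun w => gauss w (S n)) w.
Proof.
  intros h.
  apply Cdiffable_ext_loc with (f := fun w => RtoC (INR (fact (S n))) * rpow (INR (S n)) w / Crising w (S n)).
  { exists 1%R. split; [lra|]. intros u _. rewrite gauss_pos. auto. }
  apply Cdiffable_div; [|  |apply Crising_neq_0, h].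
  - apply Cdiffable_mult; [apply Cdiffable_const|apply Cdiffable_rpow, Cdiffable_id].
  - generalize (S n). intros k. induction k as [|k IH]; simpl; [apply Cdiffable_id|].
    apply Cdiffable_mult; auto. apply Cdiffable_plus; [apply Cdiffable_id|apply Cdiffable_const].
Qed.

(** By [gauss_ratio] the telescoping series of differences satisfies the M-test in the disc, so the
    limit exists and is holomorphic. *)
Lemma gauss_near_1 : (forall w, (Cmod (w - 1) <= 1 / 2)%R -> Clim (gauss w) (CGamma w)) /\
  (forall w, (Cmod (w - 1) < 1 / 2)%R -> Cdiffable CGamma w).
Proof.
  destruct gauss_bounded as (M & hM & HM).
  set (b := fun n => (M * (bin_const 3 2 * (/ INR (S n)) ^ 2))%R).
  assert (hb : ex_series b) by (apply ex_series_Rscal, ex_series_Rscal, (ex_series_inv_sq 1); lia).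
  assert (hd : forall w n, (Cmod (w - 1) <= 1 / 2)%R -> (Cmod (gauss w (S (S n)) - gauss w (S n)) <= b n)%R).
  { intros w n h. eapply Rle_trans; [apply gauss_ratio, h|]. unfold b. apply Rmult_le_compat_r; auto.
    apply Rmult_le_pos; [apply Rlt_le, bin_const_pos; lra|].
    apply pow_le, Rlt_le, Rinv_0_lt_compat, lt_0_INR; lia. }
  set (G := fun w => gauss w 1 + CSeries (fun n => gauss w (S (S n)) - gauss w (S n))).
  assert (hG : forall w, (Cmod (w - 1) <= 1 / 2)%R -> Clim (gauss w) (G w)).
  { intros w h. apply Clim_S.
    apply Clim_ext with (u := fun n => gauss w 1 + csum (fun n => gauss w (S (S n)) - gauss w (S n)) n).
    - intros n. induction n as [|n IH]; [simpl csum; ring|]. cbn [csum]. rewrite Cplus_assoc, IH. ring.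
    - apply Clim_plus; [apply Clim_const|]. apply summable_Csums. apply (summable_le _ b); auto. }
  assert (hC : forall w, (Cmod (w - 1) <= 1 / 2)%R -> CGamma w = G w).
  { intros w h. apply CGamma_Clim, hG, h. }
  split.
  - intros w h. rewrite hC by auto. auto.
  - intros w h. apply Cdiffable_ext_loc with (f := G).
    + exists (1 / 2 - Cmod (w - 1))%R. split; [lra|]. intros u hu. symmetry. apply hC.
      replace (u - 1) with ((u - w) + (w - 1)) by ring. eapply Rle_trans; [apply Cmod_triangle|]. lra.
    + apply Cdiffable_plus.
      * apply Cdiffable_gauss. intros j. apply near_1_neq_0. lra.
      * apply (Cdiffable_CSeries (fun n w => gauss w (S (S n)) - gauss w (S n)) b 1 (1 / 2)); auto; [lra|].
        intros k z hz. apply Cdiffable_minus; apply Cdiffable_gauss; intros j; apply near_1_neq_0; auto.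
Qed.

Lemma CGamma_1 : CGamma 1 = 1.
Proof.
  apply CGamma_Clim, Clim_S.
  assert (hcr : forall n, Crising 1 n = RtoC (INR (fact (S n)))).
  { induction n as [|n IH]; [simpl; auto|]. cbn [Crising]. rewrite IH, (fact_S_C (S n)).
    rewrite (S_INR (S n)), RtoC_plus. ring. }
  apply Clim_ext with (u := fun n => 1 - RtoC (/ INR (S (S n)))).
  - intros n. rewrite gauss_pos, hcr, (fact_S_C (S n)), rpow_1 by (apply lt_0_INR; lia).
    rewrite RtoC_inv by (apply not_0_INR; lia).
    pose proof (fact_C_neq_0 (S n)). pose proof (INR_S_C_neq_0 (S n)) as h2.
    set (x := RtoC (INR (fact (S n)))) in *.
    replace (RtoC (INR (S n))) with (RtoC (INR (S (S n))) - 1) by (rewrite (S_INR (S n)), RtoC_plus; ring).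
    field. auto.
  - pose proof (Clim_minus (fun _ => 1) (fun n => RtoC (/ INR (S (S n)))) 1 0 (Clim_const 1)
      (Clim_S_inv (fun n => RtoC (/ INR (S n))) 0 inv_INR_lim)) as H.
    replace (1 - 0) with (1 : C) in H by ring. exact H.
Qed.

(** * The principal logarithm *)

Definition slit (z : C) : Prop := ~ (Im z = 0 /\ Re z <= 0)%R.

Lemma slit_neq_0 z : slit z -> z <> 0.
Proof. intros h ->. apply h. simpl. lra. Qed.

Lemma slit_den z : slit z -> (0 < Cmod z + Re z)%R.
Proof.
  intros h. pose proof (re_le_Cmod z) as h1. pose proof (Rle_abs (- Re z)) as h2. rewrite Rabs_Ropp in h2.
  destruct (Rle_lt_or_eq_dec 0 (Cmod z + Re z)) as [h0|h0]; [lra|auto|]. exfalso. apply h.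
  pose proof (Cmod2_alt z) as E. pose proof (Cmod_ge_0 z).
  assert (E1 : Re z = (- Cmod z)%R) by lra. rewrite E1 in E. split; [|lra]. nra.
Qed.

(** The formula tan(th / 2) = Im z / (|z| + Re z) is smooth on the whole slit plane, unlike the
    definition of [Carg] by cases; continuity of the argument comes from it. *)
Lemma half_angle z : slit z ->
  let th := (2 * atan (Im z / (Cmod z + Re z)))%R in
  (cos th = Re z / Cmod z)%R /\ (sin th = Im z / Cmod z)%R /\ (- PI < th < PI)%R.
Proof.
  intros h th. pose proof (slit_den z h) as hd. pose proof (proj1 (Cmod_gt_0 z) (slit_neq_0 z h)) as hm.
  pose proof (Cmod2_alt z) as E. set (m := Cmod z) in *. set (x := Re z) in *. set (y := Im z) in *.
  set (t := (y / (m + x))%R) in *.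
  assert (hq : (0 < 1 + t²)%R) by (unfold Rsqr; nra).
  assert (h1 : (1 + t² = 2 * m / (m + x))%R).
  { unfold t, Rsqr. apply Rmult_eq_reg_r with ((m + x) * (m + x))%R; [|nra].
    transitivity ((m + x) * (m + x) + y * y)%R; [field; lra|].
    transitivity (2 * m * (m + x))%R; [nra|field; lra]. }
  split; [|split].
  - unfold th. rewrite cos_2a, cos_atan, sin_atan.
    replace (1 / sqrt (1 + t²) * (1 / sqrt (1 + t²)) - t / sqrt (1 + t²) * (t / sqrt (1 + t²)))%R
      with ((1 - t²) / (sqrt (1 + t²) * sqrt (1 + t²)))%R by (unfold Rsqr at 1; field; apply Rgt_not_eq, sqrt_lt_R0; auto).
    rewrite sqrt_sqrt by lra. replace (1 - t²)%R with (2 - (1 + t²))%R by ring. rewrite h1. field. lra.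
  - unfold th. rewrite sin_2a, cos_atan, sin_atan.
    replace (2 * (t / sqrt (1 + t²)) * (1 / sqrt (1 + t²)))%R
      with (2 * t / (sqrt (1 + t²) * sqrt (1 + t²)))%R by (field; apply Rgt_not_eq, sqrt_lt_R0; auto).
    rewrite sqrt_sqrt by lra. rewrite h1. unfold t. field. lra.
  - unfold th. pose proof (atan_bound t). lra.
Qed.

Lemma Carg_atan z : slit z -> Carg z = (2 * atan (Im z / (Cmod z + Re z)))%R.
Proof.
  intros h. destruct (half_angle z h) as (hc & hs & hb). pose proof (slit_den z h) as hd.
  pose proof (proj1 (Cmod_gt_0 z) (slit_neq_0 z h)) as hm. set (th := (2 * atan _)%R) in *.
  unfold Carg. rewrite <- hc. destruct (Rle_dec 0 (Im z)) as [hy|hy].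
  - apply acos_cos. split; [|lra]. apply Rmult_le_pos; [lra|].
    rewrite <- atan_0. destruct (Req_dec (Im z) 0) as [->|hn].
    + unfold Rdiv. rewrite Rmult_0_l. lra.
    + apply Rlt_le, atan_increasing. apply Rdiv_lt_0_compat; lra.
  - rewrite <- cos_neg, acos_cos; [ring|]. split; [|lra].
    assert (th <= 0)%R; [|lra]. unfold th. assert (atan (Im z / (Cmod z + Re z)) < 0)%R; [|lra].
    rewrite <- atan_0. apply atan_increasing.
    unfold Rdiv. assert (0 < / (Cmod z + Re z))%R by (apply Rinv_0_lt_compat; auto). nra.
Qed.

Lemma Cexp_Clog z : slit z -> Cexp (Clog z) = z.
Proof.
  intros h. destruct (half_angle z h) as (hc & hs & hb). rewrite <- (Carg_atan z h) in *.
  pose proof (proj1 (Cmod_gt_0 z) (slit_neq_0 z h)) as hm.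
  unfold Clog. rewrite Cexp_polar, exp_ln, hc, hs by auto.
  destruct z as [x y]. apply injective_projections; simpl; field; lra.
Qed.

Lemma Carg_bound z : slit z -> (- PI < Carg z < PI)%R.
Proof. intros h. rewrite Carg_atan by auto. apply (half_angle z h). Qed.

Lemma slit_open z : slit z -> exists d, (0 < d)%R /\ forall w, (Cmod (w - z) < d)%R -> slit w.
Proof.
  intros h. pose proof (slit_den z h) as hd.
  (* The slit is the zero set of |w| + Re w, a function with Lipschitz constant 2. *)
  exists ((Cmod z + Re z) / 2)%R. split; [lra|]. intros w hw [h1 h2].
  assert (E : Cmod w = (- Re w)%R).
  { replace w with (RtoC (Re w)) at 1 by (destruct w; simpl in *; rewrite h1; auto).
    rewrite Cmod_R, Rabs_left1; auto. }
  pose proof (Cmod_ge_minus z w). rewrite Cmod_minus_sym in H.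
  pose proof (re_le_Cmod (w - z)). pose proof (Rle_abs (- Re (w - z))). rewrite Rabs_Ropp in *.
  replace (Re (w - z)) with (Re w - Re z)%R in * by (destruct w, z; simpl; ring). lra.
Qed.

Lemma cont_Re_Im z : Ccont (fun z => RtoC (Re z)) z /\ Ccont (fun z => RtoC (Im z)) z.
Proof.
  split; intros eps heps; exists eps; split; auto; intros u hu; eapply Rle_lt_trans; try exact hu;
    rewrite <- RtoC_minus, Cmod_R.
  - replace (Re u - Re z)%R with (Re (u - z)) by (destruct u, z; simpl; ring). apply re_le_Cmod.
  - replace (Im u - Im z)%R with (snd (u - z)) by (destruct u, z; simpl; ring).
    eapply Rle_trans; [apply Rmax_r|apply Rmax_Cmod].
Qed.

Lemma cont_R_comp {T} (e : T -> C) (k : R -> R) (f : T -> R) t : continuity_pt k (f t) ->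
  cont_at e (fun u => RtoC (f u)) t -> cont_at e (fun u => RtoC (k (f u))) t.
Proof.
  intros hk hf. apply (cont_comp e RtoC (fun x => RtoC (k x)) f); auto.
  intros eps heps. destruct (hk eps heps) as [d [hd H]]. exists d. split; [auto|].
  intros u hu. rewrite <- RtoC_minus, Cmod_R in *. simpl in H. unfold Rdist in H.
  destruct (Req_dec u (f t)) as [->|hn].
  - replace (k (f t) - k (f t))%R with 0%R by ring. rewrite Rabs_R0. auto.
  - apply H. split; [|auto]. split; [exact I|auto].
Qed.

Lemma Ccont_Clog z : slit z -> Ccont Clog z.
Proof.
  intros h. pose proof (slit_den z h) as hd.
  pose proof (proj1 (Cmod_gt_0 z) (slit_neq_0 z h)) as hm.
  destruct (cont_Re_Im z) as [hr hi].
  assert (hcm : Ccont (fun z => RtoC (Cmod z)) z) by apply (cont_Cmod (fun z => z) (fun z => z)), cont_e.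
  destruct (slit_open z h) as [d [hd0 H]].
  apply cont_ext_loc with (f := fun z => RtoC (ln (Cmod z)) + Ci * RtoC (2 * atan (Im z / (Cmod z + Re z)))).
  { exists d. split; [auto|]. intros u hu. unfold Clog. rewrite Carg_atan by (apply H; auto).
    apply injective_projections; simpl; ring. }
  apply cont_plus.
  - apply (cont_R_comp (fun z => z) ln Cmod); [|exact hcm].
    apply derivable_continuous_pt. exists (/ Cmod z)%R. apply derivable_pt_lim_ln, hm.
  - apply cont_mult; [apply cont_const|].
    apply cont_ext with (f := fun z => RtoC 2 * RtoC (atan (Im z / (Cmod z + Re z)))).
    { intros. rewrite RtoC_mult. auto. }
    apply cont_mult; [apply cont_const|].
    apply (cont_R_comp (fun z => z) atan (fun z => Im z / (Cmod z + Re z))%R).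
    + apply derivable_continuous_pt, derivable_pt_atan.
    + destruct (slit_open z h) as [d' [hd' H']].
      apply cont_ext_loc with (f := fun z => RtoC (Im z) / (RtoC (Cmod z) + RtoC (Re z))).
      * exists d'. split; [auto|]. intros u hu. pose proof (slit_den u (H' u hu)). rewrite RtoC_div, RtoC_plus by lra. auto.
      * apply cont_div; auto; [apply cont_plus; auto|]. rewrite <- RtoC_plus. apply RtoC_neq_0. lra.
Qed.

(** A continuous logarithm of a differentiable function is differentiable: the quotient of the
    exponential at l(t) is non-zero near t and can be divided out. This serves for [Clog] and for
    logarithms along the contour. *)
Lemma diff_log {T} (e : T -> C) (l F : T -> C) t m :
  (forall u, e u = e t -> u = t) -> cont_at e l t ->
  (exists d, (0 < d)%R /\ forall u, (Cmod (e u - e t) < d)%R -> Cexp (l u) = F u) ->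
  diff_at e F t m -> diff_at e l t (m / F t).
Proof.
  intros inj hl (d & hd & hE) [qF [h1 [h2 h3]]].
  assert (hEt : Cexp (l t) = F t).
  { apply hE. replace (e t - e t) with (RtoC 0) by ring. rewrite Cmod_0. auto. }
  destruct (Cdiff_Cexp (l t)) as [q [k1 [k2 k3]]].
  assert (hcq : cont_at e (fun u => q (l u)) t) by (apply (cont_comp e (fun z => z) q l); auto).
  assert (hq0 : q (l t) <> 0) by (rewrite k2; apply Cexp_neq_0).
  destruct (cont_neq_0 e _ t hcq hq0) as [d' [hd' H']].
  apply diff_ext_loc with (f := fun u => l t + qF u / q (l u) * (e u - e t)); auto.
  - exists (Rmin d d'). split; [apply Rmin_pos; auto|]. intros u hu.
    pose proof (Rmin_l d d'). pose proof (Rmin_r d d').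
    assert (hqu : q (l u) <> 0).
    { apply Cmod_gt_0. specialize (H' u ltac:(lra)). apply Cmod_gt_0 in hq0. lra. }
    assert (E : F u - F t = q (l u) * (l u - l t)).
    { rewrite <- (hE u) by lra. rewrite <- hEt. apply k1. }
    rewrite h1 in E.
    transitivity (l t + (qF u * (e u - e t)) / q (l u)); [field; auto|]. rewrite E. field. auto.
  - exists (fun u => qF u / q (l u)). split; [intros; ring|]. split.
    + rewrite h2, k2, hEt. auto.
    + apply cont_div; auto.
Qed.

Lemma Cdiff_Clog z : slit z -> Cdiff Clog z (/ z).
Proof.
  intros h. destruct (slit_open z h) as [d [hd H]].
  eapply diff_eq; [|apply (diff_log (fun z => z) Clog (fun z => z) z 1); auto].
  - field. apply slit_neq_0, h.
  - apply Ccont_Clog, h.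
  - exists d. split; [auto|]. intros u hu. apply Cexp_Clog, H, hu.
  - apply diff_e.
Qed.

(** * The fundamental theorem of calculus with finitely many breaks *)

(* [s] selects the side: right if true, left if false. *)
Definition side_limit (phi : R -> C) (t : R) (s : bool) (v : C) : Prop :=
  forall eps, (0 < eps)%R -> exists d, (0 < d)%R /\
    forall u, (Rabs (u - t) < d)%R -> (if s then t < u else u < t)%R -> (Cmod (phi u - v) < eps)%R.

Definition one_sided (phi : R -> C) (t : R) : Prop := forall s, exists v, side_limit phi t s v.

Lemma side_limit_filterlim (phi : R -> C) t v (s : bool) :
  filterlim phi (if s then at_right t else at_left t) (locally (T := C_UniformSpace) v) ->
  side_limit phi t s v.
Proof.
  intros h eps heps.
  assert (he : (0 < eps / 2)%R) by lra.
  assert (hs : (sqrt 2 <= 2)%R).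
  { rewrite <- (sqrt_Rsqr 2) at 2; [|lra]. apply sqrt_le_1; unfold Rsqr; lra. }
  specialize (h (fun z => ball (M := C_UniformSpace) v (mkposreal _ he) z)).
  destruct s.
  - destruct h as [d Hd]; [exists (mkposreal _ he); auto|].
    exists d. split; [apply cond_pos|]. intros u hu hut. specialize (Hd u hu hut).
    apply C_NormedModule_mixin_compat2 in Hd. eapply Rlt_le_trans; [exact Hd|]. simpl. nra.
  - destruct h as [d Hd]; [exists (mkposreal _ he); auto|].
    exists d. split; [apply cond_pos|]. intros u hu hut. specialize (Hd u hu hut).
    apply C_NormedModule_mixin_compat2 in Hd. eapply Rlt_le_trans; [exact Hd|]. simpl. nra.
Qed.

Lemma side_limit_cont phi t s : Rcont phi t -> side_limit phi t s (phi t).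
Proof.
  intros h eps heps. destruct (h eps heps) as [d [hd H]]. exists d. split; [auto|].
  intros u hu _. apply H. rewrite <- RtoC_minus, Cmod_R. exact hu.
Qed.

Lemma side_limit_mult phi psi t s v v' : side_limit phi t s v -> side_limit psi t s v' ->
  side_limit (fun u => phi u * psi u) t s (v * v').
Proof.
  intros h h' eps heps.
  set (A := (Cmod v + 1)%R). set (B := (Cmod v' + 1)%R).
  assert (hA : (0 < A)%R) by (unfold A; pose proof (Cmod_ge_0 v); lra).
  assert (hB : (0 < B)%R) by (unfold B; pose proof (Cmod_ge_0 v'); lra).
  destruct (h (Rmin 1 (eps / (2 * B)))) as [d [hd H]].
  { apply Rmin_pos; [lra|]. apply Rdiv_lt_0_compat; lra. }
  destruct (h' (eps / (2 * A))%R) as [d' [hd' H']].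
  { apply Rdiv_lt_0_compat; lra. }
  exists (Rmin d d'). split; [apply Rmin_pos; auto|]. intros u hu hut.
  pose proof (Rmin_l d d'). pose proof (Rmin_r d d').
  specialize (H u ltac:(lra) hut). specialize (H' u ltac:(lra) hut).
  pose proof (Rmin_l 1 (eps / (2 * B))). pose proof (Rmin_r 1 (eps / (2 * B))).
  replace (phi u * psi u - v * v') with (phi u * (psi u - v') + (phi u - v) * v') by ring.
  eapply Rle_lt_trans; [apply Cmod_triangle|]. rewrite !Cmod_mult.
  assert (h3 : (Cmod (phi u) < A)%R) by (unfold A; pose proof (Cmod_ge_minus (phi u) v); lra).
  assert (h4 : (Cmod (phi u) * Cmod (psi u - v') <= A * (eps / (2 * A)))%R).
  { apply Rmult_le_compat; try apply Cmod_ge_0; lra. }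
  assert (h5 : (Cmod (phi u - v) * Cmod v' < eps / (2 * B) * B)%R).
  { apply Rmult_le_0_lt_compat; try apply Cmod_ge_0; [lra|]. unfold B; lra. }
  replace (A * (eps / (2 * A)))%R with (eps / 2)%R in h4 by (field; lra).
  replace (eps / (2 * B) * B)%R with (eps / 2)%R in h5 by (field; lra). lra.
Qed.

(** The values of [phi] at the ends are not controlled. Replacing them by the one-sided limits gives
    a continuous [psi] with the same integral; the classical theorem applies inside, and continuity
    of [F] takes care of the ends. *)
Lemma FTC_open_interval (F phi : R -> C) a b : (a < b)%R ->
  (forall t, (a <= t <= b)%R -> Rcont F t) ->
  (forall t, (a < t < b)%R -> Rdiff F t (phi t) /\ Rcont phi t) ->
  one_sided phi a -> one_sided phi b ->
  @is_RInt C_R_NormedModule phi a b (F b - F a).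
Proof.
  intros hab hF hphi hsa hsb.
  destruct (hsa true) as [va hva]. destruct (hsb false) as [vb hvb].
  set (psi := fun t => if Rle_dec t a then va else if Rle_dec b t then vb else phi t).
  assert (hpsi : forall t, (a < t < b)%R -> psi t = phi t).
  { intros t ht. unfold psi. destruct (Rle_dec t a); [lra|]. destruct (Rle_dec b t); [lra|auto]. }
  assert (hc : contI psi a b).
  { intros t ht. rewrite Rmin_left, Rmax_right in ht by lra.
    destruct (Req_dec t a) as [->|na].
    - intros eps heps. destruct (hva eps heps) as [d [hd H]].
      exists (Rmin d (b - a)). split; [apply Rmin_pos; lra|]. intros u hu.
      pose proof (Rmin_l d (b - a)). pose proof (Rmin_r d (b - a)).
      rewrite <- RtoC_minus, Cmod_R in hu. unfold psi at 2. destruct (Rle_dec a a); [|lra].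
      unfold psi. destruct (Rle_dec u a).
      + replace (va - va) with (RtoC 0) by ring. rewrite Cmod_0. auto.
      + destruct (Rle_dec b u); [apply Rabs_def2 in hu; lra|]. apply H; lra.
    - destruct (Req_dec t b) as [->|nb].
      + intros eps heps. destruct (hvb eps heps) as [d [hd H]].
        exists (Rmin d (b - a)). split; [apply Rmin_pos; lra|]. intros u hu.
        pose proof (Rmin_l d (b - a)). pose proof (Rmin_r d (b - a)).
        rewrite <- RtoC_minus, Cmod_R in hu. unfold psi at 2. destruct (Rle_dec b a); [lra|].
        destruct (Rle_dec b b); [|lra].
        unfold psi. destruct (Rle_dec u a); [apply Rabs_def2 in hu; lra|].
        destruct (Rle_dec b u).
        * replace (vb - vb) with (RtoC 0) by ring. rewrite Cmod_0. auto.
        * apply H; lra.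
      + apply cont_ext_loc with (f := phi); [|apply hphi; lra].
        exists (Rmin (t - a) (b - t)). split; [apply Rmin_pos; lra|]. intros u hu. symmetry. apply hpsi.
        pose proof (Rmin_l (t - a) (b - t)). pose proof (Rmin_r (t - a) (b - t)).
        rewrite <- RtoC_minus, Cmod_R in hu. apply Rabs_def2 in hu. lra. }
  cut (CI psi a b = F b - F a).
  { intros E. apply (is_RInt_ext psi).
    - intros t ht. rewrite Rmin_left, Rmax_right in ht by lra. apply hpsi, ht.
    - rewrite <- E. apply CI_is, hc. }
  destruct (continuous_bounded psi a b) as [M [hM HM]]; [lra|auto|].
  apply Cmod_small_eq. intros eps heps.
  destruct (hF a ltac:(lra) (eps / 4)%R ltac:(lra)) as [d1 [hd1 H1]].
  destruct (hF b ltac:(lra) (eps / 4)%R ltac:(lra)) as [d2 [hd2 H2]].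
  set (s := Rmin (Rmin (d1 / 2) (d2 / 2)) (Rmin ((b - a) / 3) (eps / (4 * (M + 1))))).
  assert (hs : (0 < s)%R).
  { unfold s. apply Rmin_pos; apply Rmin_pos; try lra. apply Rdiv_lt_0_compat; lra. }
  assert (hs1 : (s < d1 /\ s < d2 /\ s <= (b - a) / 3 /\ s <= eps / (4 * (M + 1)))%R).
  { unfold s. pose proof (Rmin_l (Rmin (d1 / 2) (d2 / 2)) (Rmin ((b - a) / 3) (eps / (4 * (M + 1))))).
    pose proof (Rmin_r (Rmin (d1 / 2) (d2 / 2)) (Rmin ((b - a) / 3) (eps / (4 * (M + 1))))).
    pose proof (Rmin_l (d1 / 2) (d2 / 2)). pose proof (Rmin_r (d1 / 2) (d2 / 2)).
    pose proof (Rmin_l ((b - a) / 3) (eps / (4 * (M + 1)))). pose proof (Rmin_r ((b - a) / 3) (eps / (4 * (M + 1)))).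
    lra. }
  assert (hsub : forall x y, (a <= x)%R -> (x <= y)%R -> (y <= b)%R -> contI psi x y).
  { intros x y hx hxy hy t ht. rewrite Rmin_left, Rmax_right in ht by lra. apply hc.
    rewrite Rmin_left, Rmax_right; lra. }
  rewrite (CI_chasles psi a (a + s) b), (CI_chasles psi (a + s) (b - s) b); try (apply hsub; lra).
  assert (Em : CI psi (a + s) (b - s) = F (b - s)%R - F (a + s)%R).
  { apply CI_FTC; [|apply hsub; lra]. intros t ht. rewrite Rmin_left, Rmax_right in ht by lra.
    rewrite hpsi by lra. apply hphi. lra. }
  rewrite Em.
  assert (b1 : (Cmod (CI psi a (a + s)) <= (a + s - a) * M)%R).
  { apply CI_bound; [lra|apply hsub; lra|]. intros t ht. apply HM. lra. }
  assert (b2 : (Cmod (CI psi (b - s) b) <= (b - (b - s)) * M)%R).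
  { apply CI_bound; [lra|apply hsub; lra|]. intros t ht. apply HM. lra. }
  specialize (H1 (a + s)%R). specialize (H2 (b - s)%R). rewrite <- RtoC_minus, Cmod_R in H1, H2.
  replace (a + s - a)%R with s in * by ring. replace (b - s - b)%R with (- s)%R in H2 by ring.
  replace (b - (b - s))%R with s in b2 by ring.
  rewrite Rabs_Ropp in H2. rewrite Rabs_right in H1, H2 by lra.
  specialize (H1 ltac:(lra)). specialize (H2 ltac:(lra)).
  replace (CI psi a (a + s) + (F (b - s)%R - F (a + s)%R + CI psi (b - s) b) - (F b - F a))
    with (CI psi a (a + s) + CI psi (b - s) b + ((F (b - s)%R - F b) + - (F (a + s)%R - F a))) by ring.
  eapply Rle_trans; [apply Cmod_triangle|].
  eapply Rle_trans; [apply Rplus_le_compat; apply Cmod_triangle|]. rewrite Cmod_opp.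
  assert (hsm : (s * M <= eps / 4)%R).
  { apply Rle_trans with (eps / (4 * (M + 1)) * (M + 1))%R; [|right; field; lra].
    apply Rmult_le_compat; lra. }
  lra.
Qed.

Lemma FTC_breaks (F phi : R -> C) (l : list R) : forall a b, (a <= b)%R ->
  (forall t, (a <= t <= b)%R -> Rcont F t) ->
  (forall t, (a < t < b)%R -> ~ In t l -> Rdiff F t (phi t) /\ Rcont phi t) ->
  (forall t, (a <= t <= b)%R -> one_sided phi t) ->
  @is_RInt C_R_NormedModule phi a b (F b - F a).
Proof.
  induction l as [|x l IH]; intros a b hab hF hphi hs.
  - destruct (Rle_lt_or_eq_dec a b hab) as [h|<-].
    + apply FTC_open_interval; auto; apply hs; lra.
    + replace (F a - F a) with (RtoC 0) by ring. apply (@is_RInt_point C_R_NormedModule).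
  - destruct (excluded_middle_informative (a < x < b)%R) as [hx|hx].
    + replace (F b - F a) with ((F x - F a) + (F b - F x)) by ring.
      apply (is_RInt_Chasles (V := C_R_NormedModule) phi a x b).
      * apply IH; [lra| | |]; intros t ht; try (apply hF || apply hs); try lra.
        intros hn. apply hphi; [lra|]. intros [E|E]; [lra|auto].
      * apply IH; [lra| | |]; intros t ht; try (apply hF || apply hs); try lra.
        intros hn. apply hphi; [lra|]. intros [E|E]; [lra|auto].
    + apply IH; auto. intros t ht hn. apply hphi; [lra|]. intros [E|E]; [|auto]. apply hx. lra.
Qed.

(** * Primitives *)

(* Every point of [D] can be reached from [(u0, v0)] vertically, then
   horizontally, and the horizontal part has a neighbourhood inside [D]. *)
Definition vh_domain (D : C -> Prop) (u0 v0 : R) : Prop :=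
  forall u v, D (u, v) ->
    (forall y, (Rmin v0 v <= y <= Rmax v0 v)%R -> D (u0, y)) /\
    exists d, (0 < d)%R /\ forall x y, (Rmin u0 u - d < x < Rmax u0 u + d)%R -> (Rabs (y - v) < d)%R -> D (x, y).

Lemma vh_open D u0 v0 w : vh_domain D u0 v0 -> D w ->
  exists d, (0 < d)%R /\ forall z, (Cmod (z - w) < d)%R -> D z.
Proof.
  intros h hw. destruct w as [u v]. destruct (h u v hw) as [_ [d [hd H]]]. exists d. split; [auto|].
  intros [x y] hz. pose proof (Rmax_Cmod ((x, y) - (u, v))) as hm. simpl in hm.
  pose proof (Rmax_l (Rabs (x + - u)) (Rabs (y + - v))). pose proof (Rmax_r (Rabs (x + - u)) (Rabs (y + - v))).
  apply H; [|unfold Rminus; lra].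
  assert (hx : (Rabs (x - u) < d)%R) by (unfold Rminus; lra). apply Rabs_def2 in hx.
  pose proof (Rmin_r u0 u). pose proof (Rmax_r u0 u). lra.
Qed.

Lemma goursat_any f a b c d :
  (forall z, in_rect (Rmin a b) (Rmax a b) (Rmin c d) (Rmax c d) z -> Cdiffable f z) -> rect_int f a b c d = 0.
Proof.
  intros h.
  assert (ch : forall y, (Rmin c d <= y <= Rmax c d)%R -> contI (fun x => f (x, y)) a b).
  { intros y hy x hx. apply Rcont_hor, Cdiffable_cont, h. split; simpl; lra. }
  assert (cv : forall x, (Rmin a b <= x <= Rmax a b)%R -> contI (fun y => f (x, y)) c d).
  { intros x hx y hy. apply Rcont_ver, Cdiffable_cont, h. split; simpl; lra. }
  assert (m1 := Rmin_l a b). assert (m2 := Rmin_r a b). assert (m3 := Rmax_l a b). assert (m4 := Rmax_r a b).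
  assert (n1 := Rmin_l c d). assert (n2 := Rmin_r c d). assert (n3 := Rmax_l c d). assert (n4 := Rmax_r c d).
  destruct (Rle_dec a b) as [hab|hab], (Rle_dec c d) as [hcd|hcd].
  - apply goursat; auto. rewrite Rmin_left, Rmax_right, Rmin_left, Rmax_right in h by auto. auto.
  - rewrite (Rmin_left a b), (Rmax_right a b), (Rmin_right c d), (Rmax_left c d) in h by lra.
    pose proof (goursat f a b d c hab ltac:(lra) h) as G. unfold rect_int in *.
    rewrite (CI_swap (fun y => f (b, y)) d c), (CI_swap (fun y => f (a, y)) d c);
      try (apply contI_sym, cv; lra).
    replace (_ - _ - _) with (- (CI (fun x => f (x, d)) a b + Ci * CI (fun y => f (b, y)) d c -
      CI (fun x => f (x, c)) a b - Ci * CI (fun y => f (a, y)) d c)) by ring. rewrite G. ring.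
  - rewrite (Rmin_right a b), (Rmax_left a b), (Rmin_left c d), (Rmax_right c d) in h by lra.
    pose proof (goursat f b a c d ltac:(lra) hcd h) as G. unfold rect_int in *.
    rewrite (CI_swap (fun x => f (x, c)) b a), (CI_swap (fun x => f (x, d)) b a);
      try (apply contI_sym, ch; lra).
    replace (_ - _ - _) with (- (CI (fun x => f (x, c)) b a + Ci * CI (fun y => f (a, y)) c d -
      CI (fun x => f (x, d)) b a - Ci * CI (fun y => f (b, y)) c d)) by ring. rewrite G. ring.
  - rewrite (Rmin_right a b), (Rmax_left a b), (Rmin_right c d), (Rmax_left c d) in h by lra.
    pose proof (goursat f b a d c ltac:(lra) ltac:(lra) h) as G. unfold rect_int in *.
    rewrite (CI_swap (fun x => f (x, c)) b a), (CI_swap (fun x => f (x, d)) b a),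
      (CI_swap (fun y => f (b, y)) d c), (CI_swap (fun y => f (a, y)) d c);
      try (apply contI_sym, ch; lra); try (apply contI_sym, cv; lra).
    replace (_ - _ - _) with (CI (fun x => f (x, d)) b a + Ci * CI (fun y => f (a, y)) d c -
      CI (fun x => f (x, c)) b a - Ci * CI (fun y => f (b, y)) d c) by ring. exact G.
Qed.

Lemma CI_near (f : R -> C) k a b eps : contI f a b ->
  (forall t, (Rmin a b <= t <= Rmax a b)%R -> (Cmod (f t - k) <= eps)%R) ->
  (Cmod (CI f a b - RtoC (b - a) * k) <= Rabs (b - a) * eps)%R.
Proof.
  intros hf h. rewrite <- (CI_const k a b), <- CI_minus; auto.
  2:{ intros t _. apply cont_const. }
  assert (hc : contI (fun t => f t - k) a b).
  { intros t ht. apply cont_minus; [auto|apply cont_const]. }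
  destruct (Rle_dec a b) as [hab|hab].
  - rewrite Rabs_right by lra. apply CI_bound; auto. intros t ht. apply h. rewrite Rmin_left, Rmax_right; auto.
  - rewrite Rabs_left by lra. rewrite (CI_swap _ b a) by (apply contI_sym; auto). rewrite Cmod_opp.
    replace (- (b - a))%R with (a - b)%R by ring.
    apply CI_bound; [lra|apply contI_sym; auto|]. intros t ht. apply h. rewrite Rmin_right, Rmax_left; lra.
Qed.

(** The primitive is the integral along the vertical-then-horizontal path. A change of ordinate
    moves the horizontal part across a rectangle that [vh_domain] keeps in D; Goursat's theorem
    there replaces the two horizontal integrals by short vertical ones. *)
Lemma primitive_exists D u0 v0 phi : vh_domain D u0 v0 -> (forall w, D w -> Cdiffable phi w) ->
  exists Psi, forall w, D w -> Cdiff Psi w (phi w).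
Proof.
  intros hD hphi.
  exists (fun w => Ci * CI (fun y => phi (u0, y)) v0 (Im w) + CI (fun x => phi (x, Im w)) u0 (Re w)).
  intros [u v] hw. destruct (hD u v hw) as [hv [d0 [hd0 H0]]].
  apply diff_of_bound; [auto|]. intros eps heps.
  destruct (Cdiffable_cont _ _ (hphi _ hw) (eps / 2)%R ltac:(lra)) as [d1 [hd1 H1]].
  exists (Rmin d0 (d1 / 2)). split; [apply Rmin_pos; lra|]. intros [u' v'] hz.
  pose proof (Rmin_l d0 (d1 / 2)). pose proof (Rmin_r d0 (d1 / 2)).
  pose proof (Rmax_Cmod ((u', v') - (u, v))) as hm. simpl in hm.
  pose proof (Rmax_l (Rabs (u' + - u)) (Rabs (v' + - v))) as hm1. pose proof (Rmax_r (Rabs (u' + - u)) (Rabs (v' + - v))) as hm2.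
  set (m := Cmod ((u', v') - (u, v))) in *.
  assert (hu' : (Rabs (u' - u) <= m)%R) by (unfold Rminus; lra).
  assert (hv' : (Rabs (v' - v) <= m)%R) by (unfold Rminus; lra).
  simpl Re. simpl Im.
  assert (hDD : forall x y, (Rmin u0 u - d0 < x < Rmax u0 u + d0)%R -> (Rabs (y - v) < d0)%R -> Cdiffable phi (x, y)).
  { intros x y hx hy. apply hphi, H0; auto. }
  pose proof (Rmin_l u0 u). pose proof (Rmin_r u0 u). pose proof (Rmax_l u0 u). pose proof (Rmax_r u0 u).
  assert (hvv : forall y, (Rmin v v' <= y <= Rmax v v')%R -> (Rabs (y - v) <= m)%R).
  { intros y hy. destruct (Rle_dec v v').
    - rewrite Rmin_left, Rmax_right in hy by lra. apply Rabs_le.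
      pose proof (Rle_abs (v' - v)). lra.
    - rewrite Rmin_right, Rmax_left in hy by lra. apply Rabs_le.
      pose proof (Rle_abs (- (v' - v))). rewrite Rabs_Ropp in *. lra. }
  assert (huu : forall x, (Rmin u u' <= x <= Rmax u u')%R -> (Rabs (x - u) <= m)%R).
  { intros x hx. destruct (Rle_dec u u').
    - rewrite Rmin_left, Rmax_right in hx by lra. apply Rabs_le.
      pose proof (Rle_abs (u' - u)). lra.
    - rewrite Rmin_right, Rmax_left in hx by lra. apply Rabs_le.
      pose proof (Rle_abs (- (u' - u))). rewrite Rabs_Ropp in *. lra. }
  assert (hvm : (Rabs (v' - v) < d0)%R) by lra.
  assert (cvu0 : contI (fun y => phi (u0, y)) v0 v).
  { intros y hy. apply Rcont_ver, Cdiffable_cont, hphi, hv, hy. }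
  assert (cvu0' : contI (fun y => phi (u0, y)) v v').
  { intros y hy. apply Rcont_ver, Cdiffable_cont, hDD; [lra|]. specialize (hvv y hy). lra. }
  assert (chv' : contI (fun x => phi (x, v')) u0 u).
  { intros x hx. apply Rcont_hor, Cdiffable_cont, hDD; lra. }
  assert (chvu : contI (fun x => phi (x, v')) u u').
  { intros x hx. apply Rcont_hor, Cdiffable_cont, hDD; auto. specialize (huu x hx). apply Rabs_def2 in hvm.
    assert (hx2 : (Rabs (x - u) < d0)%R) by lra. apply Rabs_def2 in hx2. lra. }
  assert (cvu : contI (fun y => phi (u, y)) v v').
  { intros y hy. apply Rcont_ver, Cdiffable_cont, hDD; [lra|]. specialize (hvv y hy). lra. }
  assert (G : rect_int phi u0 u v v' = 0).
  { apply goursat_any. intros [x y] [hx hy]. simpl in hx, hy. apply hDD; [lra|]. specialize (hvv y hy). lra. }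
  unfold rect_int in G.
  rewrite (CI_chasles (fun y => phi (u0, y)) v0 v v') by auto.
  rewrite (CI_chasles (fun x => phi (x, v')) u0 u u') by auto.
  assert (E : (Ci * (CI (fun y => phi (u0, y)) v0 v + CI (fun y => phi (u0, y)) v v') +
    (CI (fun x => phi (x, v')) u0 u + CI (fun x => phi (x, v')) u u') -
    (Ci * CI (fun y => phi (u0, y)) v0 v + CI (fun x => phi (x, v)) u0 u) - phi (u, v) * ((u', v') - (u, v)))
    = Ci * (CI (fun y => phi (u, y)) v v' - RtoC (v' - v) * phi (u, v)) +
      (CI (fun x => phi (x, v')) u u' - RtoC (u' - u) * phi (u, v))).
  { assert (Ez : (u', v') - (u, v) = RtoC (u' - u) + Ci * RtoC (v' - v)).
    { apply injective_projections; simpl; ring. }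
    rewrite Ez.
    replace (Ci * CI (fun y => phi (u0, y)) v v') with
      (CI (fun x => phi (x, v)) u0 u + Ci * CI (fun y => phi (u, y)) v v' - CI (fun x => phi (x, v')) u0 u
       - (CI (fun x => phi (x, v)) u0 u + Ci * CI (fun y => phi (u, y)) v v' - CI (fun x => phi (x, v')) u0 u
       - Ci * CI (fun y => phi (u0, y)) v v')) by ring.
    rewrite Cmult_plus_distr_l.
    replace (Ci * CI (fun y => phi (u0, y)) v v') with
      (CI (fun x => phi (x, v)) u0 u + Ci * CI (fun y => phi (u, y)) v v' - CI (fun x => phi (x, v')) u0 u
       - (CI (fun x => phi (x, v)) u0 u + Ci * CI (fun y => phi (u, y)) v v' - CI (fun x => phi (x, v')) u0 u
       - Ci * CI (fun y => phi (u0, y)) v v')) by ring.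
    rewrite G. ring. }
  rewrite E. eapply Rle_trans; [apply Cmod_triangle|]. rewrite Cmod_mult, Cmod_Ci, Rmult_1_l.
  assert (b1 : (Cmod (CI (fun y => phi (u, y)) v v' - RtoC (v' - v) * phi (u, v)) <= Rabs (v' - v) * (eps / 2))%R).
  { apply CI_near; auto. intros y hy. apply Rlt_le, H1.
    replace ((u, y) - (u, v)) with (Ci * RtoC (y - v)) by (apply injective_projections; simpl; ring).
    rewrite Cmod_mult, Cmod_Ci, Cmod_R, Rmult_1_l. specialize (hvv y hy). lra. }
  assert (b2 : (Cmod (CI (fun x => phi (x, v')) u u' - RtoC (u' - u) * phi (u, v)) <= Rabs (u' - u) * (eps / 2))%R).
  { apply CI_near; auto. intros x hx. apply Rlt_le, H1.
    replace ((x, v') - (u, v)) with (RtoC (x - u) + Ci * RtoC (v' - v)) by (apply injective_projections; simpl; ring).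
    eapply Rle_lt_trans; [apply Cmod_triangle|].
    rewrite Cmod_mult, Cmod_Ci, !Cmod_R, Rmult_1_l. specialize (huu x hx). lra. }
  assert (Rabs (v' - v) * (eps / 2) <= m * (eps / 2))%R by (apply Rmult_le_compat_r; lra).
  assert (Rabs (u' - u) * (eps / 2) <= m * (eps / 2))%R by (apply Rmult_le_compat_r; lra).
  lra.
Qed.

Lemma vh_constant D u0 v0 (f : C -> C) : vh_domain D u0 v0 -> (forall w, D w -> Cdiff f w 0) ->
  forall w, D w -> f w = f (u0, v0).
Proof.
  intros hD hf [u v] hw. destruct (hD u v hw) as [hv [d [hd H]]].
  assert (E1 : CI (fun _ => 0) v0 v = f (u0, v) - f (u0, v0)).
  { apply (CI_FTC (fun y => f (u0, y))); [|intros t _; apply cont_const]. intros y hy.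
    eapply diff_eq; [|apply (diff_comp RtoC (fun z : C => z) f (fun y : R => (u0, y) : C))].
    3: apply Rdiff_ver. 2: apply hf, hv, hy. ring. }
  assert (E2 : CI (fun _ => 0) u0 u = f (u, v) - f (u0, v)).
  { apply (CI_FTC (fun x => f (x, v))); [|intros t _; apply cont_const]. intros x hx.
    eapply diff_eq; [|apply (diff_comp RtoC (fun z : C => z) f (fun x : R => (x, v) : C))].
    3: apply Rdiff_hor. 2: apply hf, H; [lra|]. ring.
    replace (v - v)%R with 0%R by ring. rewrite Rabs_R0. auto. }
  rewrite CI_const, Cmult_0_r in E1, E2.
  replace (f (u, v)) with (f (u, v) - f (u0, v) + (f (u0, v) - f (u0, v0)) + f (u0, v0)) by ring.
  rewrite <- E1, <- E2. ring.
Qed.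

(** * Removable singularities in an open set *)

(** Every point of D has a punctured neighbourhood free of P, so the corrections at different points
    do not interfere and each value can be chosen separately. *)
Lemma riemann_set (D P : C -> Prop) f :
  (forall w, D w -> exists d, (0 < d)%R /\ forall z, (0 < Cmod (z - w) < d)%R -> D z /\ ~ P z) ->
  (forall w, D w -> ~ P w -> Cdiffable f w) ->
  (forall w, D w -> P w -> removable f w) ->
  exists F, (forall w, ~ P w -> F w = f w) /\ (forall w, D w -> Cdiffable F w).
Proof.
  intros hiso hf hrem.
  set (patch := fun p v z => if excluded_middle_informative (z = p) then v else f z).
  set (val := fun p => epsilon (inhabits (RtoC 0)) (fun v => Cdiffable (patch p v) p)).
  assert (hval : forall p, D p -> P p -> Cdiffable (patch p (val p)) p).
  { intros p hp hP. apply (epsilon_spec (inhabits (RtoC 0)) (fun v => Cdiffable (patch p v) p)).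
    destruct (hiso p hp) as [d [hd H]].
    destruct (riemann f p d hd) as [F0 [h1 h2]].
    - intros z hz. destruct (H z hz). auto.
    - apply hrem; auto.
    - exists (F0 p). apply Cdiffable_ext_loc with (f := F0).
      + exists 1%R. split; [lra|]. intros u _. unfold patch.
        destruct (excluded_middle_informative (u = p)) as [->|hn]; [auto|apply h1, hn].
      + apply h2. replace (p - p) with (RtoC 0) by ring. rewrite Cmod_0. auto. }
  exists (fun w => if excluded_middle_informative (P w) then val w else f w). split.
  - intros w hw. destruct (excluded_middle_informative (P w)); [contradiction|auto].
  - intros w hw. destruct (hiso w hw) as [d [hd H]].
    destruct (excluded_middle_informative (P w)) as [hP|hP].
    + apply Cdiffable_ext_loc with (f := patch w (val w)); [|apply hval; auto].
      exists d. split; [auto|]. intros u hu. unfold patch.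
      destruct (excluded_middle_informative (u = w)) as [->|hn].
      * destruct (excluded_middle_informative (P w)); [auto|contradiction].
      * destruct (excluded_middle_informative (P u)) as [hPu|_]; [|auto].
        exfalso. apply (H u); auto. split; [apply Cmod_gt_0, Cminus_neq_0, hn|auto].
    + apply Cdiffable_ext_loc with (f := f); [|apply hf; auto].
      exists d. split; [auto|]. intros u hu.
      destruct (excluded_middle_informative (P u)) as [hPu|_]; [|auto].
      exfalso. destruct (excluded_middle_informative (u = w)) as [->|hn]; [auto|].
      apply (H u); auto. split; [apply Cmod_gt_0, Cminus_neq_0, hn|auto].
Qed.

(** * Integrals depending holomorphically on a parameter *)

Lemma CI_subdivide f p h n : (0 <= h)%R -> contI f p (p + INR n * h) ->
  CI f p (p + INR n * h) = csum (fun i => CI f (p + INR i * h) (p + INR (S i) * h)) n.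
Proof.
  intros hh. induction n as [|n IH]; intros hc.
  - simpl. rewrite Rmult_0_l, Rplus_0_r. apply CI_point.
  - assert (hn : (0 <= INR n * h)%R) by (apply Rmult_le_pos; [apply pos_INR|auto]).
    assert (hn1 : (INR (S n) * h = INR n * h + h)%R) by (rewrite S_INR; ring).
    cbn [csum]. rewrite <- IH.
    + apply CI_chasles; intros t ht; apply hc; revert ht; rewrite hn1, !Rmin_left, !Rmax_right; lra.
    + intros t ht; apply hc; revert ht; rewrite hn1, !Rmin_left, !Rmax_right; lra.
Qed.

(** Riemann sums are holomorphic in the parameter, and equicontinuity in y makes them converge
    uniformly in it. *)
Lemma param_holomorphic (G : C -> R -> C) p q c r : (0 < r)%R -> (p < q)%R ->
  (forall a, (Cmod (a - c) <= r)%R -> contI (G a) p q) ->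
  (forall a y, (Cmod (a - c) <= r)%R -> (p <= y <= q)%R -> Cdiffable (fun a => G a y) a) ->
  (forall eps, (0 < eps)%R -> exists d, (0 < d)%R /\ forall a y y', (Cmod (a - c) <= r)%R ->
     (p <= y <= q)%R -> (p <= y' <= q)%R -> (Rabs (y - y') < d)%R -> (Cmod (G a y - G a y') <= eps)%R) ->
  forall a, (Cmod (a - c) < r)%R -> Cdiffable (fun a => CI (G a) p q) a.
Proof.
  intros hr hpq hc hd hu.
  set (h := fun n => ((q - p) / INR (S n))%R).
  assert (hh : forall n, (0 < h n)%R).
  { intros n. apply Rdiv_lt_0_compat; [lra|apply lt_0_INR; lia]. }
  assert (hhn : forall n, (p + INR (S n) * h n = q)%R).
  { intros n. unfold h. field. apply not_0_INR. lia. }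
  assert (hpt : forall n i, (i <= S n)%nat -> (p <= p + INR i * h n <= q)%R).
  { intros n i hi. specialize (hh n). pose proof (pos_INR i). split; [nra|].
    rewrite <- (hhn n). apply Rplus_le_compat_l, Rmult_le_compat_r; [lra|]. apply le_INR, hi. }
  apply (weierstrass (fun n a => csum (fun i => RtoC (h n) * G a (p + INR i * h n)%R) (S n))); auto.
  - intros n z hz. apply Cdiffable_csum. intros i hi. apply Cdiffable_mult; [apply Cdiffable_const|].
    apply hd; auto. apply hpt. lia.
  - intros eps heps. set (e1 := (eps / (q - p))%R). assert (he1 : (0 < e1)%R) by (apply Rdiv_lt_0_compat; lra).
    destruct (hu e1 he1) as [d [hd0 H]].
    destruct (archimed_cor1 (d / (q - p))) as [n [hn1 hn2]]; [apply Rdiv_lt_0_compat; lra|].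
    exists n. intros a ha.
    assert (hhd : (h n < d)%R).
    { unfold h. assert (hin : (0 < INR n)%R) by (apply lt_0_INR; auto).
      assert (/ INR (S n) <= / INR n)%R by (apply Rinv_le_contravar; [auto|apply le_INR; lia]).
      assert (hx : (/ INR (S n) < d / (q - p))%R) by lra. apply Rlt_div_r in hx; [|lra].
      unfold Rdiv. lra. }
    rewrite <- (hhn n) at 1. rewrite CI_subdivide.
    2: apply Rlt_le, hh. 2:{ rewrite hhn. apply hc, ha. }
    rewrite <- csum_minus.
    assert (Ee : eps = rsum (fun _ => h n * e1)%R (S n)).
    { assert (E : forall k x, rsum (fun _ => x) k = (INR k * x)%R).
      { intros k x. induction k as [|k IH]; [simpl; ring|]. cbn [rsum]. rewrite IH, S_INR. ring. }
      rewrite E. unfold h, e1. field. split; [lra|]. apply not_0_INR. lia. }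
    rewrite Ee. apply csum_bound. intros i hi.
    pose proof (hpt n i ltac:(lia)). pose proof (hpt n (S i) ltac:(lia)).
    assert (Ei : (p + INR (S i) * h n = p + INR i * h n + h n)%R) by (rewrite S_INR; ring).
    rewrite Cmod_minus_sym. rewrite Ei in *. specialize (hh n).
    set (y := (p + INR i * h n)%R) in *.
    assert (hb : (Cmod (CI (G a) y (y + h n) - RtoC (y + h n - y) * G a y) <= Rabs (y + h n - y) * e1)%R).
    { apply CI_near.
      - intros t ht. rewrite Rmin_left, Rmax_right in ht by lra. apply hc; auto. rewrite Rmin_left, Rmax_right; lra.
      - intros t ht. rewrite Rmin_left, Rmax_right in ht by lra. apply H; auto; try lra. apply Rabs_def1; lra. }
    replace (y + h n - y)%R with (h n) in hb by ring. rewrite (Rabs_right (h n)) in hb by lra. exact hb.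
Qed.

(** * Exponentials, Cauchy sequences and the period 2 i pi *)

Lemma exp_mono x y : (x <= y)%R -> (exp x <= exp y)%R.
Proof. intros [h| ->]; [apply Rlt_le, exp_increasing, h|lra]. Qed.

Lemma Clim_cauchy u : (forall eps, (0 < eps)%R -> exists N, forall n m, (N <= n)%nat -> (N <= m)%nat ->
  (Cmod (u n - u m) < eps)%R) -> exists l, Clim u l.
Proof.
  intros h.
  assert (hre : exists l : R, is_lim_seq (fun n => Re (u n)) l).
  { destruct (proj2 (ex_lim_seq_cauchy_corr (fun n => Re (u n)))) as [l hl]; [|exists l; exact hl].
    intros eps. destruct (h eps (cond_pos eps)) as [N HN]. exists N. intros n m hn hm.
    eapply Rle_lt_trans; [|apply (HN n m hn hm)].
    replace (Re (u n) - Re (u m))%R with (Re (u n - u m)) by (unfold Re; simpl; ring). apply re_le_Cmod. }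
  assert (him : exists l : R, is_lim_seq (fun n => Im (u n)) l).
  { destruct (proj2 (ex_lim_seq_cauchy_corr (fun n => Im (u n)))) as [l hl]; [|exists l; exact hl].
    intros eps. destruct (h eps (cond_pos eps)) as [N HN]. exists N. intros n m hn hm.
    eapply Rle_lt_trans; [|apply (HN n m hn hm)].
    replace (Im (u n) - Im (u m))%R with (snd (u n - u m)) by (unfold Im; simpl; ring).
    eapply Rle_trans; [apply Rmax_r|apply Rmax_Cmod]. }
  destruct hre as [x hx], him as [y hy]. exists (x, y). apply is_lim_seq_Clim; auto.
Qed.

Lemma Cexp_nat k w : Cexp (RtoC (INR k) * w) = Cexp w ^ k.
Proof.
  induction k as [|k IH]; [simpl; rewrite Cmult_0_l; apply Cexp_0|].
  rewrite S_INR, RtoC_plus. simpl. rewrite <- IH, <- Cexp_plus. f_equal. ring.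
Qed.

Lemma Cexp_sub_nat a k w : Cexp ((a - RtoC (INR k)) * w) = Cexp (a * w) * (/ Cexp w) ^ k.
Proof.
  rewrite Cpow_inv by apply Cexp_neq_0. rewrite <- Cexp_nat, <- Cexp_opp, <- Cexp_plus. f_equal. ring.
Qed.

Lemma Cmod_Cexp_sub_nat a k w :
  Cmod (Cexp ((a - RtoC (INR k)) * w)) = (exp (Re (a * w)) * (/ exp (Re w)) ^ k)%R.
Proof.
  rewrite Cexp_sub_nat, Cmod_mult, Cmod_Cexp, Cmod_pow, Cmod_inv, Cmod_Cexp by apply Cexp_neq_0. auto.
Qed.

Lemma cos_eq_1 y : cos y = 1%R -> exists k : Z, y = (2 * PI * IZR k)%R.
Proof.
  intros h. assert (hs : sin (y / 2) = 0%R).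
  { replace y with (2 * (y / 2))%R in h by field. rewrite cos_2a_sin in h. nra. }
  destruct (sin_eq_0_0 _ hs) as [k hk]. exists k. lra.
Qed.

Definition two_pi_i : C := 2 * Ci * PI.

Lemma two_pi_i_pair : two_pi_i = (0, 2 * PI)%R.
Proof. unfold two_pi_i. apply injective_projections; simpl; ring. Qed.

Lemma two_pi_i_scal x : two_pi_i * RtoC x = (0, 2 * PI * x)%R.
Proof. rewrite two_pi_i_pair. apply injective_projections; simpl; ring. Qed.

Lemma Cmod_two_pi_i : Cmod two_pi_i = (2 * PI)%R.
Proof.
  pose proof PI_RGT_0. unfold two_pi_i. rewrite !Cmod_mult, Cmod_Ci, !Cmod_R, !Rabs_right; lra.
Qed.

Lemma two_pi_i_neq_0 : two_pi_i <> 0.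
Proof. apply Cmod_gt_0. rewrite Cmod_two_pi_i. pose proof PI_RGT_0. lra. Qed.

Lemma cos_2PI_Z k : cos (2 * PI * IZR k) = 1%R /\ sin (2 * PI * IZR k) = 0%R.
Proof.
  assert (hn : forall n, cos (2 * PI * INR n) = 1%R /\ sin (2 * PI * INR n) = 0%R).
  { intros n. replace (2 * PI * INR n)%R with (0 + 2 * INR n * PI)%R by ring.
    rewrite cos_period, sin_period, cos_0, sin_0. auto. }
  destruct (Z_le_gt_dec 0 k) as [h|h].
  - rewrite <- (Z2Nat.id k h), <- INR_IZR_INZ. apply hn.
  - replace k with (- Z.of_nat (Z.to_nat (- k)))%Z by (rewrite Z2Nat.id; lia).
    rewrite opp_IZR, <- INR_IZR_INZ.
    replace (2 * PI * - INR (Z.to_nat (- k)))%R with (- (2 * PI * INR (Z.to_nat (- k))))%R by ring.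
    rewrite cos_neg, sin_neg. destruct (hn (Z.to_nat (- k))) as [-> ->]. split; ring.
Qed.

Lemma Cexp_2PI_Z k : Cexp (two_pi_i * RtoC (IZR k)) = 1.
Proof.
  rewrite two_pi_i_scal, Cexp_polar, exp_0. destruct (cos_2PI_Z k) as [-> ->].
  apply injective_projections; simpl; ring.
Qed.

Lemma Cexp_eq_1 z : Cexp z = 1 -> exists k : Z, z = two_pi_i * RtoC (IZR k).
Proof.
  intros h. assert (hm : exp (Re z) = 1%R) by (rewrite <- Cmod_Cexp, h; apply Cmod_1).
  assert (hre : Re z = 0%R) by (apply exp_inv; rewrite hm, exp_0; auto).
  destruct z as [x y]. simpl in hre. subst x. rewrite Cexp_polar, exp_0 in h.
  apply (f_equal fst) in h. simpl in h.
  destruct (cos_eq_1 y) as [k hk]; [lra|]. exists k. rewrite two_pi_i_scal, hk. auto.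
Qed.

(** * The generalized power in the coordinate w = log z *)

Section GeneralizedPower.
Variables (h : C -> C) (hrho : Rbar_lt 0%R (rho h)).

Definition gpow_term (a w : C) (k : nat) : C := Cbinom a k * Pcoef h k * Cexp ((a - RtoC (INR k)) * w).

(** As a function of w the power is single-valued on the whole half-plane exp(Re w) > rad h, also
    beyond the strip |Im w| < pi of the principal logarithm. *)
Definition gpow (a w : C) : C := CSeries (gpow_term a w).

Lemma gen_power_gpow z a : gen_power h z a = gpow a (Clog z).
Proof. reflexivity. Qed.

Lemma gpow_term_bound S0 x0 : (0 < S0)%R -> (rad h < x0)%R -> (0 < x0)%R ->
  exists b, ex_series b /\ (forall k, (0 <= b k)%R) /\ forall a w k, (Cmod a <= S0)%R -> (x0 <= exp (Re w))%R ->
    (Cmod (gpow_term a w k) <= b k * exp (Re (a * w)))%R.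
Proof.
  intros h0 hx hx0. pose proof (rad_pos h hrho). set (r := ((rad h + x0) / 2)%R).
  destruct (gen_coef_bound h r hrho ltac:(unfold r; lra)) as [K [hK HK]].
  exists (fun k => K * (bincoef S0 k * (r / x0) ^ k))%R.
  assert (hr : (0 <= r / x0 < 1)%R).
  { split; [apply Rdiv_le_0_compat; unfold r; lra|]. apply Rlt_div_l; unfold r; lra. }
  split; [|split].
  - apply ex_series_Rscal, bincoef_series; auto.
  - intros k. apply Rmult_le_pos; [lra|]. apply Rmult_le_pos; [apply Rlt_le, bincoef_pos; auto|apply pow_le; lra].
  - intros a w k ha hw. unfold gpow_term. rewrite Cmod_mult, Cmod_Cexp_sub_nat. unfold Rdiv. rewrite Rpow_mult_distr.
    replace (K * (bincoef S0 k * (r ^ k * (/ x0) ^ k)) * exp (Re (a * w)))%R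
      with ((K * (bincoef S0 k * r ^ k)) * (exp (Re (a * w)) * (/ x0) ^ k))%R by ring.
    pose proof (exp_pos (Re w)). pose proof (exp_pos (Re (a * w))).
    assert (hix : (0 < / exp (Re w))%R) by (apply Rinv_0_lt_compat; lra).
    apply Rmult_le_compat; [apply Cmod_ge_0| |apply HK; auto|].
    + apply Rmult_le_pos; [lra|]. apply pow_le; lra.
    + apply Rmult_le_compat_l; [lra|]. apply pow_incr. split; [lra|apply Rinv_le_contravar; lra].
Qed.

Lemma gpow_bound S0 x0 : (0 < S0)%R -> (rad h < x0)%R -> (0 < x0)%R ->
  exists B, (0 <= B)%R /\ forall a w, (Cmod a <= S0)%R -> (x0 <= exp (Re w))%R ->
    (Cmod (gpow a w) <= B * exp (Re (a * w)))%R.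
Proof.
  intros h0 hx hx0. destruct (gpow_term_bound S0 x0 h0 hx hx0) as (b & hb & hbp & H).
  exists (Series b). split; [apply (rsum_le_Series b 0); auto|]. intros a w ha hw.
  rewrite <- Series_scal_r. apply CSeries_bound.
  - intros k. apply H; auto.
  - apply (ex_series_ext (fun k => exp (Re (a * w)) * b k)%R); [intros; apply Rmult_comm|].
    apply ex_series_Rscal, hb.
Qed.

Lemma Cdiffable_Cbinom k z : Cdiffable (fun z => Cbinom z k) z.
Proof.
  apply Cdiffable_ext_loc with (f := fun z => ff z k * / RtoC (INR (fact k))).
  - exists 1%R. split; [lra|]. intros u _. rewrite <- Cbinom_ff. field. apply fact_C_neq_0.
  - apply Cdiffable_mult; [apply Cdiffable_ff, Cdiffable_id|apply Cdiffable_const].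
Qed.

Lemma Re_le_Cmod z : (Re z <= Cmod z)%R.
Proof. eapply Rle_trans; [apply Rle_abs|apply re_le_Cmod]. Qed.

Lemma Cdiffable_gpow_exponent w a : (rad h < exp (Re w))%R -> Cdiffable (fun a => gpow a w) a.
Proof.
  intros hw. pose proof (Cmod_ge_0 a). set (S0 := (Cmod a + 1)%R).
  destruct (gpow_term_bound S0 (exp (Re w)) ltac:(unfold S0; lra) hw (exp_pos _)) as (b & hb & hbp & H0).
  apply (Cdiffable_CSeries (fun k a => gpow_term a w k) (fun k => exp (S0 * Cmod w) * b k)%R a 1); [lra| | | |].
  - apply ex_series_Rscal, hb.
  - intros k z hz. apply Cmod_disc_bound in hz. fold S0 in hz.
    eapply Rle_trans; [apply H0; [exact hz|lra]|]. rewrite Rmult_comm. apply Rmult_le_compat_r; auto.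
    apply exp_mono. eapply Rle_trans; [apply Re_le_Cmod|]. rewrite Cmod_mult.
    apply Rmult_le_compat_r; [apply Cmod_ge_0|auto].
  - intros k z _. unfold gpow_term. apply Cdiffable_mult.
    + apply Cdiffable_mult; [apply Cdiffable_Cbinom|apply Cdiffable_const].
    + apply Cdiffable_Cexp, Cdiffable_mult; [|apply Cdiffable_const].
      apply Cdiffable_minus; [apply Cdiffable_id|apply Cdiffable_const].
  - replace (a - a) with (RtoC 0) by ring. rewrite Cmod_0. lra.
Qed.

Lemma exp_near x0 (w z : C) d : (0 < x0)%R -> (d <= Re w - ln x0)%R -> (Cmod (z - w) <= d)%R -> (x0 <= exp (Re z))%R.
Proof.
  intros hx hd hz. pose proof (Re_disc_ge z w d hz). rewrite <- (exp_ln x0) by auto. apply exp_mono. lra.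
Qed.

Lemma Cdiffable_gpow a w : (rad h < exp (Re w))%R -> Cdiffable (gpow a) w.
Proof.
  intros hw. pose proof (rad_pos h hrho). pose proof (Cmod_ge_0 a). set (S0 := (Cmod a + 1)%R).
  set (x0 := ((rad h + exp (Re w)) / 2)%R). pose proof (exp_pos (Re w)).
  assert (hx0 : (0 < x0)%R) by (unfold x0; lra).
  assert (hd : (0 < Re w - ln x0)%R).
  { apply Rlt_0_minus. rewrite <- (ln_exp (Re w)). apply ln_increasing; auto. unfold x0; lra. }
  set (d := (Re w - ln x0)%R) in *.
  destruct (gpow_term_bound S0 x0 ltac:(unfold S0; lra) ltac:(unfold x0; lra) hx0) as (b & hb & hbp & H1').
  apply (Cdiffable_CSeries (fun k w => gpow_term a w k) (fun k => exp (S0 * (Cmod w + d)) * b k)%R w d); auto.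
  - apply ex_series_Rscal, hb.
  - intros k z hz. eapply Rle_trans; [apply H1'; [unfold S0; lra|]|].
    + apply (exp_near x0 w z d); auto. unfold d; lra.
    + rewrite Rmult_comm. apply Rmult_le_compat_r; auto. apply exp_mono.
      eapply Rle_trans; [apply Re_le_Cmod|]. rewrite Cmod_mult. apply Cmod_disc_bound in hz.
      apply Rmult_le_compat; try apply Cmod_ge_0; unfold S0; lra.
  - intros k z _. unfold gpow_term. apply Cdiffable_mult; [apply Cdiffable_const|].
    apply Cdiffable_Cexp, Cdiffable_mult; [apply Cdiffable_const|apply Cdiffable_id].
  - replace (w - w) with (RtoC 0) by ring. rewrite Cmod_0. auto.
Qed.
End GeneralizedPower.

(** * The denominator exp(-z) - 1 with z = exp w *)

Definition chi (w : C) : C := Cexp (- Cexp w) - 1.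

Lemma Cdiff_chi w : Cdiff chi w (- Cexp w * Cexp (- Cexp w)).
Proof.
  unfold chi. eapply diff_eq; [|apply diff_minus; [apply diff_Cexp, diff_opp, Cdiff_Cexp|apply diff_const]].
  cbv beta. ring.
Qed.

Lemma chi_zero w : chi w = 0 -> exists k : Z, Cexp w = two_pi_i * RtoC (IZR k) /\ exp (Re w) = (2 * PI * IZR (Z.abs k))%R.
Proof.
  intros h. assert (h1 : Cexp (- Cexp w) = 1).
  { unfold chi in h. replace (Cexp (- Cexp w)) with (Cexp (- Cexp w) - 1 + 1) by ring. rewrite h. ring. }
  destruct (Cexp_eq_1 _ h1) as [k hk]. exists (- k)%Z.
  assert (E : Cexp w = two_pi_i * RtoC (IZR (- k))).
  { rewrite opp_IZR, RtoC_opp. replace (Cexp w) with (- - Cexp w) by ring. rewrite hk. ring. }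
  split; [exact E|]. rewrite <- Cmod_Cexp, E, Cmod_mult, Cmod_two_pi_i, Cmod_R, abs_IZR. auto.
Qed.

Lemma chi_at_pole w k : Cexp w = two_pi_i * RtoC (IZR k) -> chi w = 0.
Proof.
  intros h. unfold chi. rewrite h.
  replace (- (two_pi_i * RtoC (IZR k))) with (two_pi_i * RtoC (IZR (- k))) by (rewrite opp_IZR, RtoC_opp; ring).
  rewrite Cexp_2PI_Z. ring.
Qed.

(** The zeros are simple: exp(-exp w) = 1 there, so the derivative is - exp w. *)
Lemma chi_factor w : chi w = 0 -> exists q, (forall z, chi z = q z * (z - w)) /\ q w = - Cexp w /\ Ccont q w.
Proof.
  intros h. destruct (Cdiff_chi w) as [q [h1 [h2 h3]]]. exists q. split; [|split; auto].
  - intros z. specialize (h1 z). rewrite h in h1. rewrite <- h1. ring.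
  - rewrite h2. unfold chi in h. replace (Cexp (- Cexp w)) with (Cexp (- Cexp w) - 1 + 1) by ring. rewrite h. ring.
Qed.

Lemma chi_isolated w : exists d, (0 < d)%R /\ forall z, (0 < Cmod (z - w) < d)%R -> chi z <> 0.
Proof.
  destruct (excluded_middle_informative (chi w = 0)) as [h|h].
  - destruct (chi_factor w h) as (q & h1 & h2 & h3).
    assert (hq : q w <> 0).
    { rewrite h2. intros E. apply (Cexp_neq_0 w). replace (Cexp w) with (- - Cexp w) by ring. rewrite E. ring. }
    destruct (cont_neq_0 _ q w h3 hq) as [d [hd H]]. exists d. split; [auto|]. intros z hz.
    rewrite h1. apply Cmult_neq_0; [|apply Cmod_gt_0; lra].
    apply Cmod_gt_0. apply Cmod_gt_0 in hq. specialize (H z (proj2 hz)). lra.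
  - assert (hc : Ccont chi w) by (eapply diff_cont, Cdiff_chi).
    destruct (cont_neq_0 _ chi w hc h) as [d [hd H]]. exists d. split; [auto|]. intros z hz.
    apply Cmod_gt_0. apply Cmod_gt_0 in h. specialize (H z (proj2 hz)). lra.
Qed.

Lemma cos_far v : (2 * PI / 3 <= Rabs v <= 4 * PI / 3)%R -> (cos v <= - (1 / 2))%R.
Proof.
  intros h. pose proof PI_RGT_0.
  assert (E : cos v = (- cos (Rabs (Rabs v - PI)))%R).
  { assert (Ea : forall x, cos (Rabs x) = cos x).
    { intros x. unfold Rabs. destruct (Rcase_abs x); [apply cos_neg|auto]. }
    rewrite Ea, <- (Ea v). replace (Rabs v - PI)%R with (- (PI - Rabs v))%R by ring.
    rewrite cos_neg, Rtrigo_facts.cos_pi_minus. ring. }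
  rewrite E. assert (h1 : (Rabs (Rabs v - PI) <= PI / 3)%R) by (apply Rabs_le; lra).
  assert (h2 : (cos (PI / 3) <= cos (Rabs (Rabs v - PI)))%R).
  { apply cos_decr_1; try lra. apply Rabs_pos. }
  rewrite cos_PI3 in h2. lra.
Qed.

(** In the sector within pi / 3 of the negative axis, Re z <= - |z| / 2, so exp(-z) is exponentially
    large in |z|. The allowed angles extend on both sides of Im w = pi and of Im w = - pi. *)
Lemma chi_far_bound w : (2 * PI / 3 <= Rabs (Im w) <= 4 * PI / 3)%R -> (2 <= exp (Re w))%R ->
  (exp (exp (Re w) / 2) / 2 <= Cmod (chi w))%R.
Proof.
  intros hv hu. set (x := exp (Re w)) in *.
  assert (h1 : (Re (Cexp w) <= - (x / 2))%R).
  { unfold Cexp. simpl. fold x. pose proof (cos_far _ hv). nra. }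
  assert (h2 : (exp (x / 2) <= Cmod (Cexp (- Cexp w)))%R).
  { rewrite Cmod_Cexp. apply exp_mono. destruct (Cexp w). simpl in *. lra. }
  pose proof (Cmod_ge_minus (Cexp (- Cexp w)) 1) as h3. rewrite Cmod_1 in h3. fold (chi w) in h3.
  pose proof (exp_ineq1_le (x / 2)). lra.
Qed.

(** The inequality x / c <= exp(x / c) with c = 2 (n + 1), raised to the power n + 1. *)
Lemma pow_le_exp n x : (0 <= x)%R -> (x ^ S n <= (2 * INR (S n)) ^ S n * exp (x / 2))%R.
Proof.
  intros hx. assert (hn : (0 < 2 * INR (S n))%R) by (pose proof (lt_0_INR (S n) ltac:(lia)); lra).
  set (c := (2 * INR (S n))%R) in *.
  assert (E : exp (x / 2) = (exp (x / c) ^ S n)%R).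
  { replace (x / 2)%R with (INR (S n) * (x / c))%R.
    - generalize (S n) (x / c)%R. intros m y. induction m as [|m IH]; [simpl; rewrite Rmult_0_l, exp_0; auto|].
      rewrite S_INR, Rmult_plus_distr_r, Rmult_1_l, exp_plus, IH. simpl. ring.
    - unfold c. field. apply not_0_INR. lia. }
  rewrite E, <- Rpow_mult_distr. apply pow_incr. split; [auto|].
  pose proof (exp_ineq1_le (x / c)).
  apply Rle_trans with (c * (x / c))%R; [right; field; lra|]. apply Rmult_le_compat_l; lra.
Qed.

(** For |Re z| >= 1 the modulus of exp(-z) is far from 1. Otherwise |Im z| is within 1 of (2 K + 1)
    pi, where the cosine is at most 0, and Re(exp(-z) - 1) <= -1. The radius halfway between two
    poles is what makes this work. *)
Lemma chi_circle_bound w K : exp (Re w) = ((2 * INR K + 1) * PI)%R -> (1 / 2 <= Cmod (chi w))%R.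
Proof.
  intros hR. set (z := Cexp w). assert (hz : Cmod z = ((2 * INR K + 1) * PI)%R) by (unfold z; rewrite Cmod_Cexp; auto).
  set (R0 := ((2 * INR K + 1) * PI)%R) in *. pose proof PI_RGT_0. pose proof (pos_INR K).
  assert (hpi : (3 < PI)%R) by (pose proof PI2_3_2; lra).
  assert (hR3 : (3 < R0)%R) by (unfold R0; nra).
  unfold chi. fold z. destruct z as [X Y] eqn:Ez.
  assert (hcm : Cmod (Cexp (- (X, Y))) = exp (- X)) by (rewrite Cmod_Cexp; auto).
  assert (he : (2 <= exp 1)%R) by (pose proof (exp_ineq1_le 1); lra).
  destruct (Rle_dec 1 X) as [h1|h1].
  - pose proof (Cmod_ge_minus 1 (Cexp (- (X, Y)))) as h2. rewrite hcm, Cmod_1, Cmod_minus_sym in h2.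
    assert (h3 : (exp (- X) <= / exp 1)%R) by (rewrite <- exp_Ropp; apply exp_mono; lra).
    assert (h4 : (/ exp 1 <= / 2)%R) by (apply Rinv_le_contravar; lra). lra.
  - destruct (Rle_dec X (-1)) as [h2|h2].
    + pose proof (Cmod_ge_minus (Cexp (- (X, Y))) 1) as h3. rewrite hcm, Cmod_1 in h3.
      assert (h4 : (exp 1 <= exp (- X))%R) by (apply exp_mono; lra). lra.
    + assert (hY : (X * X + Y * Y = R0 * R0)%R).
      { pose proof (Cmod2_alt (X, Y)) as E. rewrite hz in E. simpl in E. lra. }
      assert (hXX : (X * X < 1)%R) by nra.
      set (d := (R0 - Rabs Y)%R). pose proof (Rabs_pos Y).
      assert (hYY : (Rabs Y * Rabs Y = Y * Y)%R) by (rewrite <- Rabs_mult; apply Rabs_right; nra).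
      assert (hd : (0 <= d <= 1)%R) by (unfold d; split; nra).
      assert (hc : (cos Y <= 0)%R).
      { assert (Ea : cos Y = cos (Rabs Y)) by (unfold Rabs; destruct (Rcase_abs Y); [rewrite cos_neg|]; auto).
        rewrite Ea. replace (Rabs Y) with (PI - d + 2 * INR K * PI)%R by (unfold d, R0; ring).
        rewrite cos_period, Rtrigo_facts.cos_pi_minus.
        assert (0 <= cos d)%R by (apply cos_ge_0; lra). lra. }
      assert (h3 : (1 <= Rabs (Re (Cexp (- (X, Y)) - 1)))%R).
      { unfold Cexp. simpl. rewrite cos_neg. pose proof (exp_pos (- X)).
        rewrite Rabs_left1; nra. }
      pose proof (re_le_Cmod (Cexp (- (X, Y)) - 1)). lra.
Qed.

(** * Sums over finite lists of poles *)

Definition lsum (F : Z -> C) (l : list Z) : C := fold_right (fun k s => F k + s) 0 l.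

Lemma lsum_app F l l' : lsum F (l ++ l') = lsum F l + lsum F l'.
Proof. induction l as [|k l IH]; simpl; [ring|]. rewrite IH. ring. Qed.

Lemma lsum_pick k l : In k l -> NoDup l ->
  exists l', ~ In k l' /\ (forall j, In j l' -> In j l) /\ forall F, lsum F l = F k + lsum F l'.
Proof.
  intros hk hd. destruct (in_split k l hk) as (l1 & l2 & ->). exists (l1 ++ l2). split; [|split].
  - apply NoDup_remove_2, hd.
  - intros j hj. apply in_app_iff in hj. apply in_app_iff. simpl. tauto.
  - intros F. rewrite !lsum_app. simpl. ring.
Qed.

Lemma diff_lsum {T} (e : T -> C) (F : Z -> T -> C) (F' : Z -> C) l t :
  (forall k, In k l -> diff_at e (F k) t (F' k)) -> diff_at e (fun u => lsum (fun k => F k u) l) t (lsum F' l).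
Proof.
  induction l as [|k l IH]; intros h; simpl; [apply diff_const|].
  apply diff_plus; [apply h; simpl; auto|]. apply IH. intros j hj. apply h. simpl. auto.
Qed.

Lemma cont_lsum {T} (e : T -> C) (F : Z -> T -> C) l t :
  (forall k, In k l -> cont_at e (F k) t) -> cont_at e (fun u => lsum (fun k => F k u) l) t.
Proof.
  induction l as [|k l IH]; intros h; simpl; [apply cont_const|].
  apply cont_plus; [apply h; simpl; auto|]. apply IH. intros j hj. apply h. simpl. auto.
Qed.

Lemma Cdiffable_lsum (F : Z -> C -> C) l z : (forall k, In k l -> Cdiffable (F k) z) ->
  Cdiffable (fun w => lsum (fun k => F k w) l) z.
Proof.
  induction l as [|k l IH]; intros h; simpl; [apply Cdiffable_const|].
  apply Cdiffable_plus; [apply h; simpl; auto|]. apply IH. intros j hj. apply h. simpl. auto.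
Qed.

Lemma lsum_ext F F' l : (forall k, In k l -> F k = F' k) -> lsum F l = lsum F' l.
Proof.
  induction l as [|k l IH]; intros h; simpl; [auto|]. rewrite h by (simpl; auto).
  rewrite IH; auto. intros j hj. apply h. simpl. auto.
Qed.

Lemma lsum_scal c F l : lsum (fun k => c * F k) l = c * lsum F l.
Proof. induction l as [|k l IH]; simpl; [ring|]. rewrite IH. ring. Qed.

Lemma lsum_minus F F' l : lsum (fun k => F k - F' k) l = lsum F l - lsum F' l.
Proof. induction l as [|k l IH]; simpl; [ring|]. rewrite IH. ring. Qed.

(** * The integrand in the log-plane, its cut region and its primitive *)

Section Contour.
Variables (h : C -> C) (hrho : Rbar_lt 0%R (rho h)) (N : nat).
Hypotheses (hN1 : (1 <= N)%nat) (hN : (rad h < 2 * PI * INR N)%R).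
Hypothesis hNk : forall k : Z, (rad h < 2 * PI * IZR (Z.abs k))%R -> (INR N <= IZR (Z.abs k))%R.

(** Strictly between the disc and the first pole, so that log x0 is a base point common to all the
    regions below. *)
Let x0 := ((rad h + 2 * PI * INR N) / 2)%R.
Let u0 := ln x0.

Lemma N_ge_1_R : (1 <= INR N)%R.
Proof. apply (le_INR 1), hN1. Qed.

Lemma PI_gt_3 : (3 < PI)%R.
Proof. pose proof PI2_3_2. lra. Qed.

Lemma x0_spec : (rad h < x0 < 2 * PI * INR N)%R /\ (3 < x0)%R.
Proof.
  pose proof (rad_pos h hrho). pose proof N_ge_1_R. pose proof PI_gt_3. unfold x0. split; [lra|]. nra.
Qed.

Lemma exp_u0 : exp u0 = x0.
Proof. unfold u0. apply exp_ln. pose proof x0_spec. lra. Qed.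

Definition below (B : option R) (x : R) : Prop := match B with None => True | Some b => (x < b)%R end.

(* The log-plane strip outside the disk of radius [rad h], with [exp (Re w) < B],
   and cut to the left half of the z-plane where [exp (Re w) >= A]. *)
Definition reg (A : R) (B : option R) (w : C) : Prop :=
  (rad h < exp (Re w))%R /\ below B (exp (Re w)) /\ (Rabs (Im w) < 3 * PI / 2)%R /\
  ((exp (Re w) < A)%R \/ (PI / 2 < Rabs (Im w))%R).

Lemma exp_gt_near r m : (0 <= r)%R -> (r < exp m)%R ->
  exists d, (0 < d)%R /\ forall x, (m - d < x)%R -> (r < exp x)%R.
Proof.
  intros hr hm. set (y := ((r + exp m) / 2)%R). pose proof (exp_pos m).
  assert (hy : (0 < y)%R) by (unfold y; lra).
  exists (m - ln y)%R. split.
  - apply Rlt_0_minus. rewrite <- (ln_exp m) at 1. apply ln_increasing; auto. unfold y; lra.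
  - intros x hx. apply Rlt_trans with y; [unfold y; lra|]. rewrite <- (exp_ln y) by auto.
    apply exp_increasing. lra.
Qed.

Lemma exp_lt_near b m : (exp m < b)%R -> exists d, (0 < d)%R /\ forall x, (x < m + d)%R -> (exp x < b)%R.
Proof.
  intros hm. pose proof (exp_pos m). exists (ln b - m)%R. split.
  - apply Rlt_0_minus. rewrite <- (ln_exp m) at 1. apply ln_increasing; auto.
  - intros x hx. rewrite <- (exp_ln b) by lra. apply exp_increasing. lra.
Qed.

Lemma exp_max x y b : (exp x < b)%R -> (exp y < b)%R -> (exp (Rmax x y) < b)%R.
Proof. intros. unfold Rmax. destruct (Rle_dec x y); auto. Qed.

Lemma exp_min x y b : (b < exp x)%R -> (b < exp y)%R -> (b < exp (Rmin x y))%R.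
Proof. intros. unfold Rmin. destruct (Rle_dec x y); auto. Qed.

Lemma reg_vh A B : (x0 < A)%R -> below B x0 -> vh_domain (reg A B) u0 0.
Proof.
  intros hA hB u v (h1 & h2 & h3 & h4). simpl in *.
  pose proof x0_spec as hx0. pose proof exp_u0 as hu0. pose proof (rad_pos h hrho) as hrp. split.
  - intros y hy. unfold reg. simpl. rewrite hu0. split; [lra|]. split; [auto|]. split; [|left; auto].
    eapply Rle_lt_trans; [|exact h3]. unfold Rmin, Rmax, Rabs in *.
    destruct (Rle_dec 0 v); destruct (Rcase_abs y); destruct (Rcase_abs v); lra.
  - destruct (exp_gt_near (rad h) (Rmin u0 u)) as [d1 [hd1 H1]]; auto.
    { apply exp_min; auto. rewrite hu0. lra. }
    assert (hb : exists d2, (0 < d2)%R /\ forall x, (x < Rmax u0 u + d2)%R -> below B (exp x)).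
    { destruct B as [b|]; [|exists 1%R; split; [lra|intros; exact I]]. simpl in *.
      apply exp_lt_near. apply exp_max; auto. rewrite hu0. auto. }
    destruct hb as [d2 [hd2 H2]].
    assert (ha : exists d3, (0 < d3)%R /\ forall x y, (x < Rmax u0 u + d3)%R -> (Rabs (y - v) < d3)%R ->
      (exp x < A \/ PI / 2 < Rabs y)%R).
    { destruct h4 as [h4|h4].
      - destruct (exp_lt_near A (Rmax u0 u)) as [d3 [hd3 H3]].
        { apply exp_max; auto. rewrite hu0. auto. }
        exists d3. split; auto.
      - exists (Rabs v - PI / 2)%R. split; [lra|]. intros x y _ hy. right.
        pose proof (Rabs_triang_inv v y). rewrite Rabs_minus_sym in hy. lra. }
    destruct ha as [d3 [hd3 H3]].
    exists (Rmin (Rmin d1 d2) (Rmin d3 (3 * PI / 2 - Rabs v))).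
    split; [apply Rmin_pos; apply Rmin_pos; lra|]. intros x y hx hy.
    pose proof (Rmin_l (Rmin d1 d2) (Rmin d3 (3 * PI / 2 - Rabs v))).
    pose proof (Rmin_r (Rmin d1 d2) (Rmin d3 (3 * PI / 2 - Rabs v))).
    pose proof (Rmin_l d1 d2). pose proof (Rmin_r d1 d2).
    pose proof (Rmin_l d3 (3 * PI / 2 - Rabs v)). pose proof (Rmin_r d3 (3 * PI / 2 - Rabs v)).
    unfold reg. simpl. split; [apply H1; lra|]. split; [apply H2; lra|]. split; [|apply H3; lra].
    pose proof (Rabs_triang_inv y v). lra.
Qed.

(** The integrand of the Hankel integral with dz = exp w dw. *)
Definition Phi (a w : C) : C := gpow h a w * (Cexp w / chi w).

Definition pole (k : Z) : C := two_pi_i * RtoC (IZR k).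

Definition lpole (k : Z) : C :=
  (ln (2 * PI * IZR (Z.abs k)), if Z_lt_dec 0 k then PI / 2 else (- (PI / 2)))%R.

Lemma pole_mod_pos k : k <> 0%Z -> (0 < 2 * PI * IZR (Z.abs k))%R.
Proof.
  intros hk. pose proof PI_RGT_0. assert (1 <= IZR (Z.abs k))%R by (apply IZR_le; lia). nra.
Qed.

Lemma Cexp_lpole k : k <> 0%Z -> Cexp (lpole k) = pole k.
Proof.
  intros hk. unfold lpole, pole. rewrite Cexp_polar, exp_ln, two_pi_i_scal by (apply pole_mod_pos, hk).
  destruct (Z_lt_dec 0 k) as [hp|hp].
  - rewrite cos_PI2, sin_PI2, Z.abs_eq by lia. apply injective_projections; simpl; ring.
  - rewrite cos_neg, sin_neg, cos_PI2, sin_PI2, Z.abs_neq, opp_IZR by lia. apply injective_projections; simpl; ring.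
Qed.

(** Two logarithms differ by a multiple of 2 i pi, and moving i pi / 2 or - i pi / 2 by a non-zero
    multiple leaves the open strip of half-width 3 pi / 2. Each pole thus occurs exactly once in
    it. *)
Lemma lpole_unique w k : Cexp w = pole k -> k <> 0%Z -> (Rabs (Im w) < 3 * PI / 2)%R -> w = lpole k.
Proof.
  intros hw hk hi.
  assert (he : Cexp (w - lpole k) = 1).
  { unfold Cminus. rewrite Cexp_plus, Cexp_opp, Cexp_lpole, <- hw by auto. field. apply Cexp_neq_0. }
  destruct (Cexp_eq_1 _ he) as [j hj].
  assert (ew : w = lpole k + two_pi_i * RtoC (IZR j)) by (rewrite <- hj; ring).
  rewrite two_pi_i_scal in ew.
  assert (hj0 : j = 0%Z).
  { pose proof PI_RGT_0. rewrite ew in hi. unfold lpole in hi. simpl in hi. apply Rabs_def2 in hi.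
    destruct (Z_le_gt_dec 1 j) as [h1|h1].
    - apply IZR_le in h1. destruct (Z_lt_dec 0 k); nra.
    - destruct (Z_le_gt_dec j (-1)) as [h2|h2]; [|lia].
      apply IZR_le in h2. destruct (Z_lt_dec 0 k); nra. }
  rewrite ew, hj0. apply injective_projections; simpl; ring.
Qed.

Lemma chi_pole w : (rad h < exp (Re w))%R -> chi w = 0 ->
  exists k, Cexp w = pole k /\ exp (Re w) = (2 * PI * IZR (Z.abs k))%R /\ (INR N <= IZR (Z.abs k))%R /\ k <> 0%Z.
Proof.
  intros hw hc. destruct (chi_zero w hc) as (k & h1 & h2). exists k. split; [auto|]. split; [auto|].
  assert (h3 : (INR N <= IZR (Z.abs k))%R) by (apply hNk; lra). split; [auto|].
  intros ->. simpl in h3. pose proof N_ge_1_R. lra.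
Qed.

Lemma cos_left v : (PI / 2 < Rabs v < 3 * PI / 2)%R -> (cos v < 0)%R.
Proof.
  intros hv. assert (Ea : cos v = cos (Rabs v)) by (unfold Rabs; destruct (Rcase_abs v); [rewrite cos_neg|]; auto).
  rewrite Ea. apply cos_lt_0; lra.
Qed.

Lemma Re_Cexp_left w : (PI / 2 < Rabs (Im w) < 3 * PI / 2)%R -> (Re (Cexp w) < 0)%R.
Proof.
  intros hv. unfold Cexp. simpl. pose proof (cos_left _ hv). pose proof (exp_pos (Re w)). nra.
Qed.

(** Below the modulus 2 pi N there is no pole outside the disc, and beyond it the region lies over
    the left half-plane, which the imaginary axis avoids. *)
Lemma reg_chi B w : reg (2 * PI * INR N) B w -> chi w <> 0.
Proof.
  intros (h1 & h2 & h3 & h4) hc. destruct (chi_pole w h1 hc) as (k & e1 & e2 & e3 & e4).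
  pose proof PI_RGT_0. destruct h4 as [h4|h4].
  - rewrite e2 in h4. nra.
  - pose proof (Re_Cexp_left w (conj h4 h3)) as hl. rewrite e1 in hl. unfold pole in hl.
    rewrite two_pi_i_scal in hl. simpl in hl. lra.
Qed.

Lemma Cdiffable_Phi a w : (rad h < exp (Re w))%R -> chi w <> 0 -> Cdiffable (Phi a) w.
Proof.
  intros hw hc. apply Cdiffable_mult; [apply Cdiffable_gpow; auto|]. apply Cdiffable_div; auto.
  - apply Cdiffable_Cexp, Cdiffable_id.
  - eexists. apply Cdiff_chi.
Qed.

Definition primitive (a : C) (Psi : C -> C) : Prop :=
  forall w, reg (2 * PI * INR N) None w -> Cdiff Psi w (Phi a w).

Lemma Psi_exists a : exists Psi, primitive a Psi.
Proof.
  apply (primitive_exists (reg (2 * PI * INR N) None) u0 0).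
  - apply reg_vh; [apply x0_spec|exact I].
  - intros w hw. apply Cdiffable_Phi; [apply hw|]. eapply reg_chi, hw.
Qed.

(** * Subtracting finitely many poles *)

Definition poles (K : nat) : list Z :=
  map Z.of_nat (seq N (S K - N)) ++ map (fun n => (- Z.of_nat n)%Z) (seq N (S K - N)).

Lemma In_poles K k : In k (poles K) <-> (INR N <= IZR (Z.abs k) <= INR K)%R.
Proof.
  unfold poles. rewrite in_app_iff, !in_map_iff. rewrite !INR_IZR_INZ. split.
  - intros [[n [<- hn]]|[n [<- hn]]]; apply in_seq in hn; split; apply IZR_le; lia.
  - intros [h1 h2]. apply le_IZR in h1. apply le_IZR in h2. destruct (Z_le_gt_dec 0 k).
    + left. exists (Z.to_nat k). split; [lia|]. apply in_seq. lia.
    + right. exists (Z.to_nat (- k)). split; [lia|]. apply in_seq. lia.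
Qed.

Lemma NoDup_poles K : NoDup (poles K).
Proof.
  unfold poles. apply NoDup_app.
  - apply FinFun.Injective_map_NoDup; [|apply seq_NoDup]. intros x y. apply Nat2Z.inj.
  - apply FinFun.Injective_map_NoDup; [|apply seq_NoDup]. intros x y hxy. apply Nat2Z.inj. lia.
  - intros k hk hk'. apply in_map_iff in hk. apply in_map_iff in hk'.
    destruct hk as [n [<- hn]]. destruct hk' as [n' [e hn']]. apply in_seq in hn. apply in_seq in hn'. lia.
Qed.

(** The residue of the integrand is the opposite of this value, since e^(-z) - 1 has derivative -1
    at the pole; hence the polar parts are added, not subtracted. *)
Definition res (a : C) (k : Z) : C := gpow h a (lpole k).

(** The factor exp w / (exp w - pole k) is dz / (z - pole k) in the coordinate w. *)
Definition polar (a : C) (K : nat) (w : C) : C :=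
  lsum (fun k => res a k * (Cexp w / (Cexp w - pole k))) (poles K).

Lemma In_poles_neq_0 K k : In k (poles K) -> k <> 0%Z.
Proof. intros hk ->. apply In_poles in hk. simpl in hk. pose proof N_ge_1_R. lra. Qed.

Lemma pole_term_diffable c k w : Cexp w <> pole k -> Cdiffable (fun w => c * (Cexp w / (Cexp w - pole k))) w.
Proof.
  intros hw. apply Cdiffable_mult; [apply Cdiffable_const|]. apply Cdiffable_div.
  - apply Cdiffable_Cexp, Cdiffable_id.
  - apply Cdiffable_minus; [apply Cdiffable_Cexp, Cdiffable_id|apply Cdiffable_const].
  - apply Cminus_neq_0, hw.
Qed.

Lemma chi_not_pole w k : chi w <> 0 -> Cexp w <> pole k.
Proof. intros hw E. apply hw. eapply chi_at_pole, E. Qed.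

(** The modulus of the first poles left out of [poles K], for K >= N. *)
Definition big (K : nat) : R := (2 * PI * (INR K + 1))%R.

Lemma big_gt K : (N <= K)%nat -> (x0 < big K)%R.
Proof.
  intros hK. pose proof x0_spec. apply le_INR in hK. pose proof PI_RGT_0. unfold big. nra.
Qed.

Lemma pole_inj k k' : pole k = pole k' -> k = k'.
Proof.
  unfold pole. rewrite !two_pi_i_scal. intros E. apply (f_equal snd) in E. simpl in E. pose proof PI_RGT_0.
  apply eq_IZR. nra.
Qed.

(** [M] is w - p times the function, with the zeros of the denominators divided out. It is
    continuous, and its value at [p] is 0 because the quotients of [chi] and of the exponential are
    - exp p and exp p there. *)
Lemma regularized_removable a K p : (N <= K)%nat -> reg (big K) (Some (big K)) p -> chi p = 0 ->
  removable (fun w => Phi a w + polar a K w) p.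
Proof.
  intros hK (h1 & h2 & h3 & h4) hc. destruct (chi_pole p h1 hc) as (k0 & e1 & e2 & e3 & e4).
  pose proof PI_RGT_0. simpl in h2.
  assert (hk0 : In k0 (poles K)).
  { apply In_poles. split; [auto|]. rewrite e2 in h2. unfold big in h2.
    assert (hlt : (IZR (Z.abs k0) < INR K + 1)%R) by nra.
    rewrite INR_IZR_INZ in *. rewrite <- plus_IZR in hlt. apply lt_IZR in hlt. apply IZR_le. lia. }
  assert (hp : p = lpole k0) by (apply lpole_unique; auto).
  destruct (lsum_pick k0 (poles K) hk0 (NoDup_poles K)) as (l' & hl1 & hl2 & hl3).
  destruct (chi_factor p hc) as (q & q1 & q2 & q3).
  destruct (Cdiff_Cexp p) as (r & r1 & r2 & r3).
  set (rest := fun w => lsum (fun k => res a k * (Cexp w / (Cexp w - pole k))) l').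
  set (M := fun w => gpow h a w * (Cexp w / q w) + res a k0 * (Cexp w / r w) + (w - p) * rest w).
  pose proof (Cexp_neq_0 p) as hp0.
  assert (hq0 : q p <> 0).
  { rewrite q2. intros E. apply hp0. replace (Cexp p) with (- - Cexp p) by ring. rewrite E. ring. }
  assert (hr0 : r p <> 0) by (rewrite r2; auto).
  assert (hM0 : M p = 0).
  { unfold M. rewrite q2, r2. replace (res a k0) with (gpow h a p) by (unfold res; rewrite hp; auto). field. auto. }
  assert (hMc : Ccont M p).
  { unfold M. apply cont_plus; [apply cont_plus|].
    - apply cont_mult; [apply Cdiffable_cont, Cdiffable_gpow; auto|].
      apply cont_div; auto. eapply diff_cont, Cdiff_Cexp.
    - apply cont_mult; [apply cont_const|]. apply cont_div; auto. eapply diff_cont, Cdiff_Cexp.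
    - apply cont_mult; [apply cont_minus; [apply cont_e|apply cont_const]|].
      apply cont_lsum. intros k hk. apply Cdiffable_cont, pole_term_diffable.
      rewrite e1. intros E. apply pole_inj in E. subst k. auto. }
  destruct (cont_neq_0 _ q p q3 hq0) as [d1 [hd1 H1]].
  destruct (cont_neq_0 _ r p r3 hr0) as [d2 [hd2 H2]].
  apply Cmod_gt_0 in hq0. apply Cmod_gt_0 in hr0.
  intros eps heps. destruct (hMc eps heps) as [d [hd Hd]].
  exists (Rmin d (Rmin d1 d2)). split; [apply Rmin_pos; [auto|apply Rmin_pos; auto]|].
  intros w hw. pose proof (Rmin_l d (Rmin d1 d2)). pose proof (Rmin_r d (Rmin d1 d2)).
  pose proof (Rmin_l d1 d2). pose proof (Rmin_r d1 d2).
  specialize (Hd w ltac:(lra)). rewrite hM0 in Hd.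
  assert (hqw : q w <> 0) by (apply Cmod_gt_0; specialize (H1 w ltac:(lra)); lra).
  assert (hrw : r w <> 0) by (apply Cmod_gt_0; specialize (H2 w ltac:(lra)); lra).
  assert (hwp : w - p <> 0) by (apply Cmod_gt_0; lra).
  apply Rlt_le. eapply Rle_lt_trans; [|exact Hd]. right. f_equal.
  unfold polar, Phi. rewrite hl3. fold (rest w). rewrite q1, <- e1, r1. unfold M. field. auto.
Qed.

(** With both bounds equal to [big K] the last condition of [reg] is automatic, so the region has no
    cut: the regularized integrand has a primitive across the poles up to index K. *)
Lemma regularized a K : (N <= K)%nat -> exists F H, (forall w, chi w <> 0 -> F w = Phi a w + polar a K w) /\
  forall w, reg (big K) (Some (big K)) w -> Cdiff H w (F w).
Proof.
  intros hK. pose proof (big_gt K hK) as hb.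
  assert (hvh : vh_domain (reg (big K) (Some (big K))) u0 0) by (apply reg_vh; auto).
  destruct (riemann_set (reg (big K) (Some (big K))) (fun w => chi w = 0) (fun w => Phi a w + polar a K w)) as (F & h1 & h2).
  - intros w hw. destruct (vh_open _ u0 0 w hvh hw) as [d [hd Hd]]. destruct (chi_isolated w) as [d' [hd' Hd']].
    exists (Rmin d d'). split; [apply Rmin_pos; auto|]. intros z hz.
    pose proof (Rmin_l d d'). pose proof (Rmin_r d d'). split; [apply Hd; lra|apply Hd'; lra].
  - intros w hw hc. apply Cdiffable_plus; [apply Cdiffable_Phi; auto; apply hw|].
    apply Cdiffable_lsum. intros k _. apply pole_term_diffable, chi_not_pole, hc.
  - intros w hw hc. apply regularized_removable; auto.
  - destruct (primitive_exists _ u0 0 F hvh h2) as [H hH]. exists F, H. split; auto.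
Qed.

(** * The logarithms of 1 - z / pole k *)

Definition lam (k : Z) (w : C) : C := Clog (1 - Cexp w / pole k).

Lemma pole_neq_0 k : k <> 0%Z -> pole k <> 0.
Proof. intros hk. rewrite <- Cexp_lpole by auto. apply Cexp_neq_0. Qed.

Lemma div_pole z k : k <> 0%Z -> z / pole k = (Im z / (2 * PI * IZR k), - (Re z / (2 * PI * IZR k)))%R.
Proof.
  intros hk. pose proof PI_RGT_0. assert (hk' : IZR k <> 0%R) by (apply not_0_IZR; auto).
  set (X := (_, _)). assert (E : z = X * pole k).
  { unfold X, pole. rewrite two_pi_i_scal. destruct z as [x y].
    apply injective_projections; simpl; field; split; auto; lra. }
  clearbody X. rewrite E. field. apply pole_neq_0, hk.
Qed.

Lemma slit_left z k : k <> 0%Z -> (Re z < 0)%R -> slit (1 - z / pole k).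
Proof.
  intros hk hz [h1 _]. rewrite div_pole in h1 by auto. simpl in h1.
  assert (hk' : IZR k <> 0%R) by (apply not_0_IZR; auto). pose proof PI_RGT_0.
  assert (E : (Re z / (2 * PI * IZR k) = 0)%R) by lra.
  apply (f_equal (fun x => x * (2 * PI * IZR k))%R) in E. rewrite Rmult_0_l in E.
  replace (Re z / (2 * PI * IZR k) * (2 * PI * IZR k))%R with (Re z) in E; [lra|]. field. split; [auto|lra].
Qed.

Lemma Cmod_pole k : Cmod (pole k) = (2 * PI * IZR (Z.abs k))%R.
Proof. unfold pole. rewrite Cmod_mult, Cmod_two_pi_i, Cmod_R, abs_IZR. auto. Qed.

(** Inside the circle through the pole the real part of 1 - z / pole k is positive; over the left
    half-plane its imaginary part, Re z / (2 pi k), is not 0. *)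
Lemma lam_slit k w B : (INR N <= IZR (Z.abs k))%R -> k <> 0%Z -> reg (2 * PI * INR N) B w -> slit (1 - Cexp w / pole k).
Proof.
  intros hk hk0 (h1 & h2 & h3 & h4). pose proof PI_RGT_0. destruct h4 as [h4|h4].
  - intros [_ hre]. assert (hq : (Cmod (Cexp w / pole k) < 1)%R).
    { rewrite Cmod_div, Cmod_Cexp, Cmod_pole by (apply pole_neq_0, hk0).
      apply Rlt_div_l; [apply pole_mod_pos, hk0|]. nra. }
    pose proof (Re_le_Cmod (Cexp w / pole k)). unfold Cminus in hre.
    destruct (Cexp w / pole k). simpl in *. lra.
  - apply slit_left; auto. apply Re_Cexp_left. auto.
Qed.

Lemma lam_diff k w B : (INR N <= IZR (Z.abs k))%R -> k <> 0%Z -> reg (2 * PI * INR N) B w ->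
  Cdiff (lam k) w (Cexp w / (Cexp w - pole k)).
Proof.
  intros hk hk0 hw. pose proof (lam_slit k w B hk hk0 hw) as hs. pose proof (pole_neq_0 k hk0) as hp.
  assert (hd : Cdiff (fun w => 1 - Cexp w / pole k) w (- (Cexp w / pole k))).
  { apply diff_ext with (f := fun w => 1 - / pole k * Cexp w); [intros; unfold Cdiv; ring|].
    eapply diff_eq; [|apply diff_minus; [apply diff_const|apply diff_scal, Cdiff_Cexp]]. unfold Cdiv. ring. }
  eapply diff_eq; [|apply (diff_comp (fun z => z) (fun z => z) Clog (fun w => 1 - Cexp w / pole k));
    [apply Cdiff_Clog, hs|exact hd]].
  pose proof (reg_chi B w hw) as hc. pose proof (Cminus_neq_0 _ _ (chi_not_pole w k hc)) as h0.
  assert (h0' : pole k - Cexp w <> 0).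
  { intros E. apply h0. replace (Cexp w - pole k) with (- (pole k - Cexp w)) by ring. rewrite E. ring. }
  field. auto.
Qed.

(** Both sides have the derivative [Phi a], and the region is swept from its base point, so they
    differ by a constant. *)
Lemma Psi_regularized a K Psi F H : (N <= K)%nat -> primitive a Psi ->
  (forall w, chi w <> 0 -> F w = Phi a w + polar a K w) ->
  (forall w, reg (big K) (Some (big K)) w -> Cdiff H w (F w)) ->
  exists c, forall w, reg (2 * PI * INR N) (Some (big K)) w ->
    Psi w = H w - lsum (fun k => res a k * lam k w) (poles K) + c.
Proof.
  intros hK hPsi hF hH. pose proof x0_spec as hx0. pose proof (big_gt K hK) as hb.
  set (f := fun w => Psi w - (H w - lsum (fun k => res a k * lam k w) (poles K))).
  exists (f (u0, 0%R)). intros w hw.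
  rewrite <- (vh_constant (reg (2 * PI * INR N) (Some (big K))) u0 0 f) with (w := w); auto.
  - unfold f. ring.
  - apply reg_vh; auto. lra.
  - clear w hw. intros w hw. pose proof (reg_chi _ w hw) as hc.
    eapply diff_eq; [|apply diff_minus; [apply hPsi|apply diff_minus; [apply hH|
      apply (diff_lsum (fun z => z) (fun k w => res a k * lam k w) (fun k => res a k * (Cexp w / (Cexp w - pole k))))]]].
    + rewrite hF by auto. unfold polar. ring.
    + destruct hw as (h1 & h2 & h3 & h4). split; [auto|]. split; [exact I|]. auto.
    + destruct hw as (h1 & h2 & h3 & h4). split; [auto|]. split; [auto|]. split; [auto|]. left. exact h2.
    + intros k hk. apply diff_scal. eapply lam_diff; [|eapply In_poles_neq_0, hk|exact hw].
      apply In_poles in hk. lra.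
Qed.

(** * The values at the points of the imaginary rays *)

Definition U (K : nat) : R := ln ((2 * INR K + 1) * PI).

Lemma exp_U K : exp (U K) = ((2 * INR K + 1) * PI)%R.
Proof.
  apply exp_ln. pose proof PI_RGT_0. pose proof (pos_INR K). nra.
Qed.

Definition V (K : nat) (a : C) : C := Ci * CI (fun y => Phi a (U K, y)) (- PI) PI.

Definition J (K : nat) (a : C) : C := V K a + lsum (fun k => two_pi_i * res a k) (poles K).

Lemma U_chi K y : (N <= K)%nat -> chi (U K, y) <> 0.
Proof.
  intros hK hc. destruct (chi_zero _ hc) as (k & _ & h2). simpl in h2. rewrite exp_U in h2.
  pose proof PI_RGT_0. assert (E : (2 * INR K + 1 = 2 * IZR (Z.abs k))%R) by nra.
  rewrite INR_IZR_INZ, <- !mult_IZR, <- plus_IZR in E. apply eq_IZR in E. lia.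
Qed.

Lemma U_rad K : (N <= K)%nat -> (x0 < exp (U K) < big K)%R.
Proof.
  intros hK. rewrite exp_U. pose proof x0_spec. apply le_INR in hK. pose proof PI_RGT_0. unfold big. split; nra.
Qed.

(** The two points project to the same point of the negative axis, where the [lam k] take equal
    values. Hence only [H] varies: its increment, along a vertical segment, is the circle integral
    of [Phi] plus the polar parts, and each polar part contributes 2 i pi since its pole is inside
    the circle. *)
Lemma J_formula K a Psi : (N <= K)%nat -> primitive a Psi -> Psi (U K, PI) - Psi (U K, (- PI)%R) = J K a.
Proof.
  intros hK hPsi. pose proof PI_RGT_0 as hpi. pose proof (U_rad K hK) as hU. pose proof x0_spec as hx0.
  destruct (regularized a K hK) as (F & H & hF & hH).
  destruct (Psi_regularized a K Psi F H hK hPsi hF hH) as [c hc].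
  assert (hq : forall y, (- PI <= y <= PI)%R -> reg (big K) (Some (big K)) (U K, y)).
  { intros y hy. unfold reg. simpl. repeat split; try lra. apply Rabs_def1; lra. }
  assert (hs : forall y, Rabs y = PI -> reg (2 * PI * INR N) (Some (big K)) (U K, y)).
  { intros y hy. unfold reg. simpl. rewrite hy. repeat split; lra. }
  rewrite (hc (U K, PI)), (hc (U K, (- PI)%R)).
  2:{ apply hs. rewrite Rabs_Ropp, Rabs_right; lra. }
  2:{ apply hs. rewrite Rabs_right; lra. }
  assert (El : forall k, lam k (U K, PI) = lam k (U K, (- PI)%R)).
  { intros k. unfold lam. do 3 f_equal. unfold Cexp. simpl. rewrite cos_neg, sin_neg, sin_PI, Ropp_0. auto. }
  rewrite (lsum_ext (fun k => res a k * lam k (U K, PI)) (fun k => res a k * lam k (U K, (- PI)%R))).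
  2:{ intros k _. rewrite El. auto. }
  assert (cPhi : contI (fun y => Phi a (U K, y)) (- PI) PI).
  { intros y _. apply Rcont_ver, Cdiffable_cont, Cdiffable_Phi; [simpl; lra|apply U_chi, hK]. }
  assert (cterm : forall k, contI (fun y => res a k * (Cexp (U K, y) / (Cexp (U K, y) - pole k))) (- PI) PI).
  { intros k y _. apply (Rcont_ver (fun w => res a k * (Cexp w / (Cexp w - pole k)))).
    apply Cdiffable_cont, pole_term_diffable, chi_not_pole, U_chi, hK. }
  assert (clsum : forall l, contI (fun y => lsum (fun k => res a k * (Cexp (U K, y) / (Cexp (U K, y) - pole k))) l) (- PI) PI).
  { intros l y hy. apply (cont_lsum RtoC (fun k y => res a k * (Cexp (U K, y) / (Cexp (U K, y) - pole k)))).
    intros k _. apply cterm, hy. }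
  assert (EH : H (U K, PI) - H (U K, (- PI)%R) = Ci * CI (fun y => Phi a (U K, y) + polar a K (U K, y)) (- PI) PI).
  { rewrite <- CI_scal; [|apply contI_plus; [exact cPhi|apply clsum]].
    symmetry. apply (CI_FTC (fun y => H (U K, y))).
    - intros y hy. rewrite Rmin_left, Rmax_right in hy by lra. rewrite <- hF by (apply U_chi, hK).
      eapply diff_eq; [|apply (diff_comp RtoC (fun z : C => z) H (fun y : R => (U K, y) : C))].
      3: apply Rdiff_ver. 2: apply hH, hq, hy. ring.
    - apply contI_scal, contI_plus; [exact cPhi|apply clsum]. }
  assert (Ec : forall l, (forall k, In k l -> In k (poles K)) ->
    Ci * CI (fun y => lsum (fun k => res a k * (Cexp (U K, y) / (Cexp (U K, y) - pole k))) l) (- PI) PI =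
    lsum (fun k => two_pi_i * res a k) l).
  { induction l as [|k l IH]; intros hl.
    - simpl. rewrite CI_const. ring.
    - simpl. rewrite CI_plus; [|apply cterm|apply clsum].
      rewrite Cmult_plus_distr_l, IH by (intros; apply hl; simpl; auto). f_equal.
      rewrite CI_scal.
      2:{ intros y _. apply (Rcont_ver (fun w => Cexp w / (Cexp w - pole k))).
          apply Cdiffable_cont. apply Cdiffable_div.
          - apply Cdiffable_Cexp, Cdiffable_id.
          - apply Cdiffable_minus; [apply Cdiffable_Cexp, Cdiffable_id|apply Cdiffable_const].
          - apply Cminus_neq_0, chi_not_pole, U_chi, hK. }
      assert (hk : In k (poles K)) by (apply hl; simpl; auto).
      pose proof (In_poles_neq_0 K k hk) as hk0. apply In_poles in hk.
      assert (E : CI (fun y => Cexp (U K, y) / (Cexp (U K, y) - pole k)) (- PI) PI = 2 * PI * 1).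
      { rewrite <- (cmean_kernel 0 (exp (U K)) (pole k)).
        - unfold cmean. f_equal. apply functional_extensionality. intros y. unfold circ.
          rewrite <- Cexp_polar. f_equal; ring.
        - lra.
        - replace (pole k - 0) with (pole k) by ring. rewrite Cmod_pole, exp_U. nra. }
      rewrite E. unfold two_pi_i. ring. }
  replace (H (U K, PI) - lsum (fun k => res a k * lam k (U K, (- PI)%R)) (poles K) + c -
    (H (U K, (- PI)%R) - lsum (fun k => res a k * lam k (U K, (- PI)%R)) (poles K) + c))
    with (H (U K, PI) - H (U K, (- PI)%R)) by ring.
  rewrite EH, CI_plus, Cmult_plus_distr_l; [|exact cPhi|apply clsum].
  unfold J. f_equal. apply Ec. auto.
Qed.

(** * Estimates *)

(** The constant 6 exceeds 4 pi / 3, the largest ordinate used on the tails. *)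
Lemma Re_prod_bound a w S0 : (Cmod a <= S0)%R -> (0 <= Re w)%R -> (Rabs (Im w) <= 6)%R ->
  (Re (a * w) <= S0 * Re w + 6 * S0)%R.
Proof.
  intros ha hw hi. pose proof (Rmax_Cmod a) as hm. pose proof (Rmax_l (Rabs (fst a)) (Rabs (snd a))).
  pose proof (Rmax_r (Rabs (fst a)) (Rabs (snd a))). destruct a as [a1 a2], w as [u v]. simpl in *.
  assert (a1 * u <= S0 * u)%R by (apply Rmult_le_compat_r; [auto|]; pose proof (Rle_abs a1); lra).
  assert (- (a2 * v) <= S0 * 6)%R.
  { eapply Rle_trans; [apply Rle_abs|]. rewrite Rabs_Ropp, Rabs_mult.
    apply Rmult_le_compat; try apply Rabs_pos; lra. }
  lra.
Qed.

(** |z^(a,h)| grows at most like |z|^S0, whereas the denominator grows exponentially in |z|, so any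
    power of 1 / |z| can be gained, uniformly in a. *)
Lemma Phi_tail S0 : (0 < S0)%R -> exists C0, (0 <= C0)%R /\ forall a w, (Cmod a <= S0)%R ->
  (u0 <= Re w)%R -> (2 * PI / 3 <= Rabs (Im w) <= 4 * PI / 3)%R -> (Cmod (Phi a w) <= C0 * exp (- Re w))%R.
Proof.
  intros h0. pose proof x0_spec as hx0. pose proof PI_RGT_0 as hpi.
  pose proof PI_4 as hpi4.
  destruct (gpow_bound h hrho S0 x0) as (B & hB & HB); try lra.
  (* An exponent S0 + 2 is needed: S0 for the power, 1 for dz = exp w dw and 1 for the decay. *)
  destruct (archimed_cor1 (/ (S0 + 3))) as [n [hn1 hn2]]; [apply Rinv_0_lt_compat; lra|].
  assert (hn : (S0 + 3 <= INR n)%R).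
  { apply lt_0_INR in hn2. apply Rnot_lt_le. intros hlt.
    apply Rinv_lt_contravar in hlt; [lra|]. apply Rmult_lt_0_compat; lra. }
  destruct n as [|n]; [lia|]. set (Q := ((2 * INR (S n)) ^ S n)%R).
  assert (hQ : (0 < Q)%R) by (apply pow_lt; pose proof (lt_0_INR (S n) ltac:(lia)); lra).
  exists (2 * B * exp (6 * S0) * Q)%R. pose proof (exp_pos (6 * S0)) as he6. split; [apply Rmult_le_pos; [apply Rmult_le_pos; [apply Rmult_le_pos|]|]; lra|].
  intros a w ha hu hv. set (u := Re w) in *.
  assert (hx : (x0 <= exp u)%R) by (rewrite <- exp_u0; apply exp_mono, hu).
  assert (hu1 : (0 <= u)%R).
  { apply Rnot_lt_le. intros hlt. apply exp_increasing in hlt. rewrite exp_0 in hlt. lra. }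
  pose proof (chi_far_bound w hv ltac:(fold u; lra)) as hchi. fold u in hchi.
  pose proof (exp_pos (exp u / 2)) as hee.
  assert (hc0 : chi w <> 0) by (apply Cmod_gt_0; lra).
  unfold Phi. rewrite Cmod_mult, Cmod_div, Cmod_Cexp by auto. fold u.
  assert (hg : (Cmod (gpow h a w) <= B * exp (S0 * u + 6 * S0))%R).
  { eapply Rle_trans; [apply HB; auto|]. apply Rmult_le_compat_l; [auto|]. apply exp_mono, Re_prod_bound; auto. lra. }
  assert (hk : (exp u / Cmod (chi w) <= exp u * (2 / exp (exp u / 2)))%R).
  { apply Rmult_le_compat_l; [apply Rlt_le, exp_pos|].
    replace (2 / exp (exp u / 2))%R with (/ (exp (exp u / 2) / 2))%R by (field; lra).
    apply Rinv_le_contravar; lra. }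
  assert (hpw : (exp ((S0 + 2) * u) <= Q * exp (exp u / 2))%R).
  { apply Rle_trans with (exp u ^ S n)%R; [|apply pow_le_exp; apply Rlt_le, exp_pos].
    assert (E : forall m, (exp u ^ m = exp (INR m * u))%R).
    { induction m as [|m IH]; [simpl; rewrite Rmult_0_l, exp_0; auto|].
      rewrite S_INR, Rmult_plus_distr_r, Rmult_1_l, exp_plus, <- IH. simpl. ring. }
    rewrite E. apply exp_mono. apply Rmult_le_compat_r; lra. }
  apply Rle_trans with ((B * exp (S0 * u + 6 * S0)) * (exp u * (2 / exp (exp u / 2))))%R.
  { apply Rmult_le_compat; auto; [apply Cmod_ge_0|]. apply Rdiv_le_0_compat; [apply Rlt_le, exp_pos|].
    apply Cmod_gt_0, hc0. }
  replace ((S0 + 2) * u)%R with (S0 * u + u + u)%R in hpw by ring.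
  rewrite !exp_plus in hpw. rewrite exp_plus, exp_Ropp.
  pose proof (exp_pos u) as heu. pose proof (exp_pos (S0 * u)) as hes.
  apply Rmult_le_reg_r with (exp u * exp (exp u / 2))%R; [apply Rmult_lt_0_compat; auto|].
  replace (B * (exp (S0 * u) * exp (6 * S0)) * (exp u * (2 / exp (exp u / 2))) * (exp u * exp (exp u / 2)))%R
    with ((2 * B * exp (6 * S0)) * (exp (S0 * u) * exp u * exp u))%R by (field; lra).
  replace (2 * B * exp (6 * S0) * Q * / exp u * (exp u * exp (exp u / 2)))%R
    with ((2 * B * exp (6 * S0)) * (Q * exp (exp u / 2)))%R by (field; lra).
  apply Rmult_le_compat_l; [repeat apply Rmult_le_pos; lra|exact hpw].
Qed.

(** On the circle of radius R the denominator is bounded below, so the integral is of size R^(Re a +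
    1); this is where Re a < -1 enters. *)
Lemma V_vanishes a : (Re a < -1)%R -> Clim (fun K => V K a) 0.
Proof.
  intros ha. pose proof x0_spec as hx0. pose proof PI_RGT_0 as hpi. pose proof PI_4 as hpi4.
  set (S0 := (Cmod a + 1)%R). pose proof (Cmod_ge_0 a).
  destruct (gpow_bound h hrho S0 x0) as (B & hB & HB); try (unfold S0; lra).
  apply Clim_0_le with (b := fun K => (4 * PI * B * exp (6 * S0) * exp ((Re a + 1) * U K))%R).
  - replace (Rbar.Finite 0) with (Rbar_mult (4 * PI * B * exp (6 * S0))%R 0%R) by (simpl; f_equal; ring).
    apply is_lim_seq_scal_l.
    apply (is_lim_comp_seq exp (fun K => (Re a + 1) * U K)%R m_infty 0%R); [apply is_lim_exp_m| |].
    { exists O. intros; discriminate. }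
    replace m_infty with (Rbar_mult (Re a + 1)%R p_infty).
    2:{ unfold Rbar_mult, Rbar_mult'. destruct (Rle_dec 0 (Re a + 1)); [exfalso; lra|auto]. }
    apply is_lim_seq_scal_l.
    apply (is_lim_comp_seq ln (fun K => (2 * INR K + 1) * PI)%R p_infty p_infty); [apply is_lim_ln_p| |].
    { exists O. intros; discriminate. }
    apply is_lim_seq_le_p_loc with INR; [|apply is_lim_seq_INR].
    exists O. intros n _. pose proof (pos_INR n). pose proof PI_gt_3. nra.
  - exists N. intros K hK. pose proof (U_rad K hK) as hU. unfold V. rewrite Cmod_mult, Cmod_Ci, Rmult_1_l.
    replace (4 * PI * B * exp (6 * S0) * exp ((Re a + 1) * U K))%R with
      ((PI - - PI) * (2 * B * exp (6 * S0) * exp ((Re a + 1) * U K)))%R by ring.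
    apply CI_bound; [lra| |].
    { intros y _. apply Rcont_ver, Cdiffable_cont, Cdiffable_Phi; [simpl; lra|apply U_chi, hK]. }
    intros y hy. set (w := (U K, y)).
    assert (hchi : (1 / 2 <= Cmod (chi w))%R) by (apply (chi_circle_bound w K), exp_U).
    unfold Phi. rewrite Cmod_mult, Cmod_div, Cmod_Cexp by (apply U_chi, hK).
    assert (hg : (Cmod (gpow h a w) <= B * exp (Re a * U K + 6 * S0))%R).
    { eapply Rle_trans; [apply HB; [unfold S0; lra|simpl; lra]|].
      apply Rmult_le_compat_l; [auto|]. apply exp_mono. unfold w.
      pose proof (Rmax_Cmod a) as hm. pose proof (Rmax_r (Rabs (fst a)) (Rabs (snd a))).
      destruct a as [a1 a2]. simpl in *.
      assert (- (a2 * y) <= S0 * 6)%R; [|lra].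
      eapply Rle_trans; [apply Rle_abs|]. rewrite Rabs_Ropp, Rabs_mult.
      apply Rmult_le_compat; try apply Rabs_pos; [unfold S0; lra|]. apply Rabs_le; lra. }
    change (Re w) with (U K).
    assert (hk : (exp (U K) / Cmod (chi w) <= exp (U K) * 2)%R).
    { apply Rmult_le_compat_l; [apply Rlt_le, exp_pos|]. rewrite <- (Rinv_inv 2).
      apply Rinv_le_contravar; lra. }
    apply Rle_trans with ((B * exp (Re a * U K + 6 * S0)) * (exp (U K) * 2))%R.
    { apply Rmult_le_compat; auto; [apply Cmod_ge_0|]. apply Rdiv_le_0_compat; [apply Rlt_le, exp_pos|lra]. }
    rewrite Rmult_plus_distr_r, Rmult_1_l, !exp_plus. right. ring.
Qed.

Lemma CI_exp_decay f a b C0 : (a <= b)%R -> (0 <= C0)%R -> contI f a b ->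
  (forall t, (a <= t <= b)%R -> (Cmod (f t) <= C0 * exp (- t))%R) -> (Cmod (CI f a b) <= C0 * exp (- a))%R.
Proof.
  intros hab hC hf hb.
  assert (hI : is_RInt (fun t => C0 * exp (- t))%R a b (C0 * exp (- a) - C0 * exp (- b))%R).
  { replace (C0 * exp (- a) - C0 * exp (- b))%R with (minus (- (C0 * exp (- b)))%R (- (C0 * exp (- a)))%R)
      by (unfold minus, plus, opp; simpl; ring).
    apply (is_RInt_derive (V := R_CompleteNormedModule) (fun t => - (C0 * exp (- t)))%R).
    - intros x _. auto_derive; auto. ring.
    - intros x _. apply (ex_derive_continuous (V := R_NormedModule)). auto_derive. auto. }
  eapply Rle_trans; [apply (CI_le f (fun t => C0 * exp (- t))%R); auto; eexists; exact hI|].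
  rewrite (is_RInt_unique _ _ _ _ hI). pose proof (exp_pos (- b)).
  assert (0 <= C0 * exp (- b))%R by (apply Rmult_le_pos; lra). lra.
Qed.

(* Two points of the same tail are joined by a vertical and a horizontal segment. *)
Lemma Psi_tail S0 : (0 < S0)%R -> exists C0, (0 <= C0)%R /\ forall a Psi u v u' v' s,
  (Cmod a <= S0)%R -> primitive a Psi -> (s = 1 \/ s = -1)%R -> (u0 <= u <= u')%R ->
  (2 * PI / 3 <= v <= 4 * PI / 3)%R -> (2 * PI / 3 <= v' <= 4 * PI / 3)%R ->
  (Cmod (Psi (u', s * v')%R - Psi (u, s * v)%R) <= C0 * exp (- u))%R.
Proof.
  intros h0. destruct (Phi_tail S0 h0) as (C0 & hC0 & HC). pose proof PI_RGT_0 as hpi. pose proof PI_4 as hpi4.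
  pose proof x0_spec as hx0.
  exists (4 * C0)%R. split; [lra|]. intros a Psi u v u' v' s ha hPsi hs hu hv hv'.
  assert (hsv : forall y, (2 * PI / 3 <= y <= 4 * PI / 3)%R -> Rabs (s * y) = y).
  { intros y hy. rewrite Rabs_mult, (Rabs_right y) by lra. destruct hs as [-> | ->].
    - rewrite Rabs_R1. ring.
    - rewrite Rabs_left by lra. ring. }
  assert (hreg : forall x y, (u0 <= x)%R -> (2 * PI / 3 <= Rabs y <= 4 * PI / 3)%R -> reg (2 * PI * INR N) None (x, y)).
  { intros x y hx hy. unfold reg. simpl.
    assert (x0 <= exp x)%R by (rewrite <- exp_u0; apply exp_mono, hx).
    split; [lra|]. split; [exact I|]. split; [lra|right; lra]. }
  assert (hdf : forall x y, (u0 <= x)%R -> (2 * PI / 3 <= Rabs y <= 4 * PI / 3)%R -> Cdiffable (Phi a) (x, y)).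
  { intros x y hx hy. pose proof (hreg x y hx hy) as hr. apply Cdiffable_Phi; [apply hr|]. eapply reg_chi, hr. }
  assert (hmid : forall y, (Rmin (s * v) (s * v') <= y <= Rmax (s * v) (s * v'))%R -> (2 * PI / 3 <= Rabs y <= 4 * PI / 3)%R).
  { intros y hy. unfold Rmin, Rmax, Rabs in *. destruct hs as [-> | ->];
      destruct (Rle_dec _ _); destruct (Rcase_abs y); lra. }
  assert (cv : contI (fun y => Ci * Phi a (u, y)) (s * v) (s * v')).
  { apply contI_scal. intros y hy. apply Rcont_ver, Cdiffable_cont, hdf; [lra|apply hmid, hy]. }
  assert (ch : contI (fun x => Phi a (x, s * v')%R) u u').
  { intros x hx. rewrite Rmin_left, Rmax_right in hx by lra. apply Rcont_hor, Cdiffable_cont, hdf; [lra|].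
    rewrite hsv; auto. }
  assert (E1 : CI (fun y => Ci * Phi a (u, y)) (s * v) (s * v') = Psi (u, s * v')%R - Psi (u, s * v)%R).
  { apply (CI_FTC (fun y => Psi (u, y))); auto. intros y hy.
    eapply diff_eq; [|apply (diff_comp RtoC (fun z : C => z) Psi (fun y : R => (u, y) : C))].
    3: apply Rdiff_ver. 2: apply hPsi, hreg; [lra|apply hmid, hy]. ring. }
  assert (E2 : CI (fun x => Phi a (x, s * v')%R) u u' = Psi (u', s * v')%R - Psi (u, s * v')%R).
  { apply (CI_FTC (fun x => Psi (x, s * v')%R)); auto. intros x hx. rewrite Rmin_left, Rmax_right in hx by lra.
    eapply diff_eq; [|apply (diff_comp RtoC (fun z : C => z) Psi (fun x : R => (x, s * v')%R : C))].
    3: apply Rdiff_hor. 2: apply hPsi, hreg; [lra|rewrite hsv; auto]. ring. }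
  replace (Psi (u', s * v')%R - Psi (u, s * v)%R) with
    ((Psi (u', s * v')%R - Psi (u, s * v')%R) + (Psi (u, s * v')%R - Psi (u, s * v)%R)) by ring.
  rewrite <- E1, <- E2. eapply Rle_trans; [apply Cmod_triangle|].
  assert (b2 : (Cmod (CI (fun x => Phi a (x, s * v')%R) u u') <= C0 * exp (- u))%R).
  { apply CI_exp_decay; auto; [lra|]. intros x hx. apply (HC a (x, s * v')%R); auto; simpl; [lra|]. rewrite hsv; auto. }
  assert (b1 : (Cmod (CI (fun y => (Ci * Phi a (u, y))%C) (s * v) (s * v')) <= Rabs (s * v' - s * v) * (C0 * exp (- u)))%R).
  { replace (CI (fun y => Ci * Phi a (u, y)) (s * v) (s * v')) with
      (CI (fun y => Ci * Phi a (u, y)) (s * v) (s * v') - RtoC (s * v' - s * v) * 0) by ring.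
    apply CI_near; auto. intros y hy. replace (Ci * Phi a (u, y) - 0) with (Ci * Phi a (u, y)) by ring.
    rewrite Cmod_mult, Cmod_Ci, Rmult_1_l. apply (HC a (u, y)); auto; try (simpl; lra). all: try (apply hmid, hy). }
  assert (hl : (Rabs (s * v' - s * v) <= 3)%R).
  { replace (s * v' - s * v)%R with (s * (v' - v))%R by ring. rewrite Rabs_mult.
    assert (Rabs s = 1)%R by (destruct hs as [-> | ->]; [apply Rabs_R1|rewrite Rabs_left; lra]).
    rewrite H, Rmult_1_l. apply Rabs_le. lra. }
  assert (hp : (0 <= C0 * exp (- u))%R) by (apply Rmult_le_pos; [auto|apply Rlt_le, exp_pos]).
  nra.
Qed.
(** * The integral as a limit of finite parts *)

Lemma u0_U K : (N <= K)%nat -> (u0 < U K)%R.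
Proof.
  intros hK. apply exp_lt_inv. rewrite exp_u0. apply U_rad, hK.
Qed.

(** The factor [kap] does not depend on the exponent, and Cauchy's estimate makes the powers
    Lipschitz in w with a constant uniform in a; together they give the equicontinuity required by
    [param_holomorphic]. The radius [d] keeps the discs in |z| >= x0. *)
Lemma Cdiffable_V K a0 : (N <= K)%nat -> Cdiffable (V K) a0.
Proof.
  intros hK. pose proof PI_RGT_0 as hpi. pose proof x0_spec as hx0. pose proof (U_rad K hK) as hU.
  pose proof (u0_U K hK) as hu. set (d := (U K - u0)%R). assert (hd : (0 < d)%R) by (unfold d; lra).
  set (S0 := (Cmod a0 + 1)%R). pose proof (Cmod_ge_0 a0) as ha0.
  destruct (gpow_bound h hrho S0 x0) as (B & hB & HB); try (unfold S0; lra).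
  set (M1 := (B * exp (S0 * (Rabs (U K) + PI + d)))%R).
  assert (hM1 : (0 <= M1)%R) by (apply Rmult_le_pos; [auto|apply Rlt_le, exp_pos]).
  set (kap := fun w => Cexp w / chi w).
  assert (hkap : forall y, Ccont kap (U K, y)).
  { intros y. apply Cdiffable_cont, Cdiffable_div; [apply Cdiffable_Cexp, Cdiffable_id| |apply U_chi, hK].
    eexists. apply Cdiff_chi. }
  destruct (continuous_bounded (fun y => kap (U K, y)) (- PI) PI) as [M2 [hM2 HM2]]; [lra| |].
  { intros y _. apply Rcont_ver, hkap. }
  assert (hgd : forall a y z, (Cmod (z - (U K, y)) <= d)%R -> Cdiffable (gpow h a) z).
  { intros a y z hz. apply Cdiffable_gpow; auto. apply Rlt_le_trans with x0; [lra|].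
    apply (exp_near x0 (U K, y) z d); auto; [lra|]. unfold d, u0. simpl. lra. }
  assert (hgb : forall a y z, (Cmod (a - a0) <= 1)%R -> (- PI <= y <= PI)%R -> (Cmod (z - (U K, y)) <= d)%R ->
    (Cmod (gpow h a z) <= M1)%R).
  { intros a y z ha hy hz. apply Cmod_disc_bound in ha. fold S0 in ha.
    eapply Rle_trans; [apply HB; [exact ha|]|].
    - apply (exp_near x0 (U K, y) z d); auto; [lra|]. unfold d, u0. simpl. lra.
    - apply Rmult_le_compat_l; [auto|]. apply exp_mono. eapply Rle_trans; [apply Re_le_Cmod|].
      rewrite Cmod_mult. apply Rmult_le_compat; try apply Cmod_ge_0; auto.
      apply Cmod_disc_bound in hz. pose proof (Cmod_le_Re_Im (U K, y)) as hc. simpl in hc.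
      assert (Rabs y <= PI)%R by (apply Rabs_le; lra). lra. }
  assert (hdec : forall a y, Phi a (U K, y) = gpow h a (U K, y) * kap (U K, y)) by (intros; reflexivity).
  assert (H : Cdiffable (fun a => CI (fun y => Phi a (U K, y)) (- PI) PI) a0).
  { apply (param_holomorphic (fun a y => Phi a (U K, y)) (- PI) PI a0 1); try lra.
    - intros a _ y _. apply Rcont_ver, Cdiffable_cont, Cdiffable_Phi; [simpl; lra|apply U_chi, hK].
    - intros a y _ _. apply Cdiffable_mult; [|apply Cdiffable_const].
      apply Cdiffable_gpow_exponent; auto. simpl. lra.
    - intros eps heps.
      destruct (unif_cont_segment kap (U K) (- PI) PI (fun y _ => hkap y) (eps / (2 * (M1 + 1)))%R) as [d1 [hd1 H1]].
      { apply Rdiv_lt_0_compat; lra. }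
      set (L := (4 * M1 / d)%R). assert (hL : (0 <= L)%R) by (apply Rdiv_le_0_compat; lra).
      set (d2 := (eps / (2 * (L * M2 + 1)))%R).
      assert (hLM : (0 <= L * M2)%R) by (apply Rmult_le_pos; auto).
      assert (hd2 : (0 < d2)%R) by (apply Rdiv_lt_0_compat; lra).
      exists (Rmin (Rmin d1 d2) (d / 2)). split; [apply Rmin_pos; [apply Rmin_pos; auto|lra]|].
      intros a y y' ha hy hy' hyy.
      pose proof (Rmin_l (Rmin d1 d2) (d / 2)). pose proof (Rmin_r (Rmin d1 d2) (d / 2)).
      pose proof (Rmin_l d1 d2). pose proof (Rmin_r d1 d2).
      assert (em : Cmod ((U K, y) - (U K, y')) = Rabs (y - y')).
      { replace ((U K, y) - (U K, y')) with (Ci * RtoC (y - y')) by (apply injective_projections; simpl; ring).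
        rewrite Cmod_mult, Cmod_Ci, Cmod_R. ring. }
      rewrite !hdec.
      replace (gpow h a (U K, y) * kap (U K, y) - gpow h a (U K, y') * kap (U K, y')) with
        ((gpow h a (U K, y) - gpow h a (U K, y')) * kap (U K, y) + gpow h a (U K, y') * (kap (U K, y) - kap (U K, y'))) by ring.
      eapply Rle_trans; [apply Cmod_triangle|]. rewrite !Cmod_mult.
      assert (zz : forall z : C, Cmod (z - z) = 0%R).
      { intros z. replace (z - z) with (RtoC 0) by ring. apply Cmod_0. }
      assert (b1 : (Cmod (gpow h a (U K, y) - gpow h a (U K, y')) <= L * Rabs (y - y'))%R).
      { rewrite <- em. apply (cauchy_lipschitz (gpow h a) (U K, y') d M1); auto.
        - intros z hz. apply (hgd a y'), hz.
        - intros z hz. apply (hgb a y'); auto. lra.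
        - rewrite em. lra.
        - rewrite zz. lra. }
      assert (b2 : (Cmod (kap (U K, y)) <= M2)%R) by (apply (HM2 y hy)).
      assert (b3 : (Cmod (gpow h a (U K, y')) <= M1)%R).
      { apply (hgb a y'); auto. rewrite zz. lra. }
      assert (b4 : (Cmod (kap (U K, y) - kap (U K, y')) < eps / (2 * (M1 + 1)))%R).
      { apply (H1 y' (U K, y) hy'). rewrite em. lra. }
      assert (c1 : (Cmod (gpow h a (U K, y) - gpow h a (U K, y')) * Cmod (kap (U K, y)) <= eps / 2)%R).
      { apply Rle_trans with ((L * Rabs (y - y')) * M2)%R.
        - apply Rmult_le_compat; try apply Cmod_ge_0; auto.
        - apply Rle_trans with (d2 * (L * M2 + 1))%R; [|unfold d2; right; field; lra].
          pose proof (Rabs_pos (y - y')).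
          replace (L * Rabs (y - y') * M2)%R with (Rabs (y - y') * (L * M2))%R by ring.
          apply Rmult_le_compat; lra. }
      assert (c2 : (Cmod (gpow h a (U K, y')) * Cmod (kap (U K, y) - kap (U K, y')) <= eps / 2)%R).
      { apply Rle_trans with ((M1 + 1) * (eps / (2 * (M1 + 1))))%R; [|right; field; lra].
        apply Rmult_le_compat; try apply Cmod_ge_0; lra. }
      lra.
    - replace (a0 - a0) with (RtoC 0) by ring. rewrite Cmod_0. lra. }
  apply Cdiffable_mult; [apply Cdiffable_const|exact H].
Qed.

Lemma res_rad K k : In k (poles K) -> (rad h < exp (Re (lpole k)))%R.
Proof.
  intros hk. pose proof (In_poles_neq_0 K k hk) as hk0. apply In_poles in hk. simpl.
  rewrite exp_ln by (apply pole_mod_pos, hk0). pose proof PI_RGT_0. nra.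
Qed.

Lemma Cdiffable_J K a : (N <= K)%nat -> Cdiffable (J K) a.
Proof.
  intros hK. apply Cdiffable_plus; [apply Cdiffable_V, hK|].
  apply (Cdiffable_lsum (fun k a => two_pi_i * res a k)). intros k hk.
  apply Cdiffable_mult; [apply Cdiffable_const|]. apply (Cdiffable_gpow_exponent h hrho (lpole k) a), (res_rad K), hk.
Qed.

Lemma U_mono K K' : (K <= K')%nat -> (U K <= U K')%R.
Proof.
  intros hK. apply le_INR in hK. pose proof PI_RGT_0. pose proof (pos_INR K). apply ln_le; nra.
Qed.

(** By [J_formula] the difference consists of two increments of a single primitive, one on each
    tail. The circle integrals and the residues need not be estimated separately, so a is
    arbitrary. *)
Lemma J_cauchy S0 : (0 < S0)%R -> exists C0, (0 <= C0)%R /\ forall a K K', (Cmod a <= S0)%R ->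
  (N <= K)%nat -> (K <= K')%nat -> (Cmod (J K' a - J K a) <= C0 * exp (- U K))%R.
Proof.
  intros h0. destruct (Psi_tail S0 h0) as (C0 & hC0 & HC). pose proof PI_RGT_0 as hpi.
  exists (2 * C0)%R. split; [lra|]. intros a K K' ha hK hKK.
  destruct (Psi_exists a) as [Psi hPsi].
  rewrite <- (J_formula K a Psi), <- (J_formula K' a Psi); auto; [|lia].
  pose proof (u0_U K hK). pose proof (U_mono K K' hKK).
  pose proof (HC a Psi (U K) PI (U K') PI 1%R ha hPsi ltac:(lra) ltac:(lra) ltac:(lra) ltac:(lra)) as b1.
  pose proof (HC a Psi (U K) PI (U K') PI (-1)%R ha hPsi ltac:(lra) ltac:(lra) ltac:(lra) ltac:(lra)) as b2.
  replace (1 * PI)%R with PI in b1 by ring. replace (-1 * PI)%R with (- PI)%R in b2 by ring.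
  replace (Psi (U K', PI) - Psi (U K', (- PI)%R) - (Psi (U K, PI) - Psi (U K, (- PI)%R))) with
    ((Psi (U K', PI) - Psi (U K, PI)) + - (Psi (U K', (- PI)%R) - Psi (U K, (- PI)%R))) by ring.
  eapply Rle_trans; [apply Cmod_triangle|]. rewrite Cmod_opp. lra.
Qed.

Lemma exp_U_small eps : (0 < eps)%R -> exists K0, (N <= K0)%nat /\ forall K, (K0 <= K)%nat -> (exp (- U K) < eps)%R.
Proof.
  intros heps. destruct (archimed_cor1 eps heps) as [n [h1 h2]]. exists (max N n). split; [lia|].
  intros K hK. rewrite exp_Ropp, exp_U. eapply Rle_lt_trans; [|exact h1].
  apply Rinv_le_contravar; [apply lt_0_INR, h2|]. pose proof PI_gt_3.
  assert (hn : (INR n <= INR K)%R) by (apply le_INR; lia). pose proof (pos_INR K). nra.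
Qed.

(** [J_cauchy] makes the convergence locally uniform in a, so the limit is holomorphic by
    Weierstrass' theorem. *)
Lemma I_exists : exists I : C -> C, (forall a, Clim (fun K => J K a) (I a)) /\ (forall a, Cdiffable I a).
Proof.
  assert (hex : forall a, exists l, Clim (fun K => J K a) l).
  { intros a. apply Clim_cauchy. intros eps heps.
    destruct (J_cauchy (Cmod a + 1)) as (C0 & hC0 & HC); [pose proof (Cmod_ge_0 a); lra|].
    destruct (exp_U_small (eps / (2 * (C0 + 1)))) as (K0 & hK0 & H); [apply Rdiv_lt_0_compat; lra|].
    exists K0. intros n m hn hm.
    assert (hb : forall k, (K0 <= k)%nat -> (Cmod (J k a - J K0 a) < eps / 2)%R).
    { intros k hk. eapply Rle_lt_trans; [apply HC; auto; lra|]. specialize (H K0 (le_n _)).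
      apply Rle_lt_trans with ((C0 + 1) * exp (- U K0))%R; [apply Rmult_le_compat_r; [apply Rlt_le, exp_pos|lra]|].
      apply Rlt_le_trans with ((C0 + 1) * (eps / (2 * (C0 + 1))))%R; [apply Rmult_lt_compat_l; lra|right; field; lra]. }
    replace (J n a - J m a) with ((J n a - J K0 a) + - (J m a - J K0 a)) by ring.
    eapply Rle_lt_trans; [apply Cmod_triangle|]. rewrite Cmod_opp. pose proof (hb n hn). pose proof (hb m hm). lra. }
  set (I := fun a => epsilon (inhabits (RtoC 0)) (fun l => Clim (fun K => J K a) l)).
  assert (hI : forall a, Clim (fun K => J K a) (I a)) by (intros a; apply (epsilon_spec (inhabits (RtoC 0)) _ (hex a))).
  exists I. split; [exact hI|]. intros a0.
  apply (weierstrass (fun K => J (N + K)) I a0 1); [lra| | |].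
  - intros K z _. apply Cdiffable_J. lia.
  - intros eps heps.
    destruct (J_cauchy (Cmod a0 + 1)) as (C0 & hC0 & HC); [pose proof (Cmod_ge_0 a0); lra|].
    destruct (exp_U_small (eps / (C0 + 1))) as (K0 & hK0 & H); [apply Rdiv_lt_0_compat; lra|].
    exists (K0 - N)%nat. intros z hz. replace (N + (K0 - N))%nat with K0 by lia.
    apply Cmod_disc_bound in hz. rewrite Cmod_minus_sym.
    apply Clim_le with (u := fun K => J K z - J K0 z).
    + apply Clim_minus; [apply hI|apply Clim_const].
    + exists K0. intros K hK. eapply Rle_trans; [apply HC; auto|].
      apply Rle_trans with ((C0 + 1) * (eps / (C0 + 1)))%R; [|right; field; lra].
      specialize (H K0 (le_n _)). apply Rmult_le_compat; try lra. apply Rlt_le, exp_pos.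
  - replace (a0 - a0) with (RtoC 0) by ring. rewrite Cmod_0. lra.
Qed.

Lemma I_bound I S0 : (0 < S0)%R -> (forall a, Clim (fun K => J K a) (I a)) ->
  exists C0, (0 <= C0)%R /\ forall a K, (Cmod a <= S0)%R -> (N <= K)%nat -> (Cmod (I a - J K a) <= C0 * exp (- U K))%R.
Proof.
  intros h0 hI. destruct (J_cauchy S0 h0) as (C0 & hC0 & HC). exists C0. split; [auto|]. intros a K ha hK.
  apply Clim_le with (u := fun K' => J K' a - J K a).
  - apply Clim_minus; [apply hI|apply Clim_const].
  - exists K. intros K' hK'. apply HC; auto.
Qed.
End Contour.

(** * Hankel contours in the log-plane *)

Lemma acos_ge x th : (-1 <= x <= 1)%R -> (0 <= th <= PI)%R -> (x <= cos th)%R -> (th <= acos x)%R.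
Proof.
  intros hx hth h. pose proof (acos_bound x) as hb. destruct (Rle_dec th (acos x)) as [|hn]; [auto|exfalso].
  apply Rnot_le_lt in hn. pose proof (cos_decreasing_1 (acos x) th ltac:(lra) ltac:(lra) ltac:(lra) ltac:(lra) hn) as h1.
  rewrite cos_acos in h1 by lra. lra.
Qed.

Lemma acos_gt x th : (-1 <= x <= 1)%R -> (0 <= th <= PI)%R -> (x < cos th)%R -> (th < acos x)%R.
Proof.
  intros hx hth h. destruct (acos_ge x th hx hth ltac:(lra)) as [|E]; [auto|].
  exfalso. rewrite E, cos_acos in h by lra. lra.
Qed.

Lemma acos_lt x th : (-1 <= x <= 1)%R -> (0 <= th <= PI)%R -> (cos th < x)%R -> (acos x < th)%R.
Proof.
  intros hx hth h. pose proof (acos_bound x) as hb. destruct (Rlt_dec (acos x) th) as [|hn]; [auto|exfalso].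
  apply Rnot_lt_le in hn. pose proof (cos_decr_1 th (acos x) ltac:(lra) ltac:(lra) ltac:(lra) ltac:(lra) hn) as h1.
  rewrite cos_acos in h1 by lra. lra.
Qed.

Lemma Re_div_Cmod (z : C) : z <> 0 -> (-1 <= Re z / Cmod z <= 1)%R.
Proof.
  intros hz. apply Cmod_gt_0 in hz. pose proof (re_le_Cmod z) as h. apply Rabs_le_between in h.
  split; [apply Rle_div_r|apply Rle_div_l]; lra.
Qed.

Lemma Carg_pos z : (0 <= Im z)%R -> Carg z = acos (Re z / Cmod z).
Proof. intros h. unfold Carg. destruct (Rle_dec 0 (Im z)); [auto|lra]. Qed.

Lemma Carg_neg z : (Im z < 0)%R -> Carg z = (- acos (Re z / Cmod z))%R.
Proof. intros h. unfold Carg. destruct (Rle_dec 0 (Im z)); [lra|auto]. Qed.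

Lemma acos_left z : (Re z < 0)%R -> (PI / 2 < acos (Re z / Cmod z))%R.
Proof.
  intros h. assert (hz : z <> 0) by (intros ->; simpl in h; lra). pose proof PI_RGT_0.
  apply acos_gt; [apply Re_div_Cmod, hz|lra|]. rewrite cos_PI2. apply Cmod_gt_0 in hz.
  apply Rlt_div_l; lra.
Qed.

Lemma acos_far_left z : (Re z < 0)%R -> (Rabs (Im z) <= - Re z)%R -> (2 * PI / 3 <= acos (Re z / Cmod z))%R.
Proof.
  intros h h'. assert (hz : z <> 0) by (intros ->; simpl in h; lra). pose proof PI_RGT_0.
  apply acos_ge; [apply Re_div_Cmod, hz|lra|]. apply Cmod_gt_0 in hz.
  replace (2 * PI / 3)%R with (2 * (PI / 3))%R by field. rewrite cos_2PI3.
  pose proof (Cmod2_alt z) as E. assert (h2 : (Im z * Im z <= Re z * Re z)%R).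
  { replace (Im z * Im z)%R with (Rabs (Im z) * Rabs (Im z))%R by (rewrite <- Rabs_mult; apply Rabs_right; nra).
    pose proof (Rabs_pos (Im z)). nra. }
  apply Rle_div_l; [auto|]. nra.
Qed.

(** Far up or down a vertical strip the argument is close to pi / 2 or - pi / 2. It is applied to 1
    - z / pole k, which turns the horizontal strip of the contour into a vertical one. *)
Lemma Carg_imaginary B eps : (0 < eps)%R -> exists M, forall z, (Rabs (Re z) <= B)%R ->
  ((M <= Im z)%R -> (Rabs (Carg z - PI / 2) < eps)%R) /\ ((Im z <= - M)%R -> (Rabs (Carg z + PI / 2) < eps)%R).
Proof.
  intros heps. pose proof PI_RGT_0. pose proof (Rabs_pos B).
  set (e := Rmin eps (PI / 4)). assert (he : (0 < e)%R) by (apply Rmin_pos; lra).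
  pose proof (Rmin_l eps (PI / 4)) as he1. pose proof (Rmin_r eps (PI / 4)) as he2. fold e in he1, he2.
  assert (hd : (0 < sin e)%R) by (apply sin_gt_0; lra).
  exists ((Rabs B + 1) / sin e)%R. intros z hz.
  assert (hM : (0 < (Rabs B + 1) / sin e)%R) by (apply Rdiv_lt_0_compat; lra).
  assert (key : ((Rabs B + 1) / sin e <= Rabs (Im z))%R -> (Rabs (acos (Re z / Cmod z) - PI / 2) < eps)%R).
  { intros hi. assert (hz0 : z <> 0) by (intros ->; simpl in hi; rewrite Rabs_R0 in hi; lra).
    assert (hzm : (Rabs (Im z) <= Cmod z)%R).
    { eapply Rle_trans; [|apply Rmax_Cmod]. apply Rmax_r. }
    apply Cmod_gt_0 in hz0 as hzp. pose proof (Rle_abs B).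
    assert (hx : (Rabs (Re z / Cmod z) < sin e)%R).
    { unfold Rdiv. rewrite Rabs_mult, (Rabs_right (/ Cmod z)) by (apply Rle_ge, Rlt_le, Rinv_0_lt_compat; auto).
      apply Rlt_div_l; [auto|]. apply Rle_div_l in hi; [|auto]. nra. }
    apply Rabs_def2 in hx. apply Rabs_def1.
    - assert (acos (Re z / Cmod z) < PI / 2 + e)%R; [|lra].
      apply acos_lt; [apply Re_div_Cmod, hz0|lra|]. replace (PI / 2 + e)%R with (PI / 2 - - e)%R by ring.
      rewrite cos_shift, sin_neg. lra.
    - assert (PI / 2 - e < acos (Re z / Cmod z))%R; [|lra].
      apply acos_gt; [apply Re_div_Cmod, hz0|lra|]. rewrite cos_shift. lra. }
  split; intros hi.
  - rewrite Carg_pos by lra. apply key. rewrite (Rabs_right (Im z)); lra.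
  - rewrite Carg_neg by lra. replace (- acos (Re z / Cmod z) + PI / 2)%R with (- (acos (Re z / Cmod z) - PI / 2))%R by ring.
    rewrite Rabs_Ropp. apply key. rewrite (Rabs_left (Im z)); lra.
Qed.

Section Hankel.
Variables (h : C -> C) (hrho : Rbar_lt 0%R (rho h)) (N : nat).
Hypotheses (hN1 : (1 <= N)%nat) (hN : (rad h < 2 * PI * INR N)%R).
Hypothesis hNk : forall k : Z, (rad h < 2 * PI * IZR (Z.abs k))%R -> (INR N <= IZR (Z.abs k))%R.
Variables (gamma : R -> C) (hg : hankel_contour h gamma).

Definition om (t : R) : C := Clog (gamma t).

Lemma gamma_slit t : slit (gamma t).
Proof. apply (hankel_Omega _ _ hg t). Qed.

Lemma gamma_neq_0 t : gamma t <> 0.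
Proof. apply slit_neq_0, gamma_slit. Qed.

Lemma Cexp_om t : Cexp (om t) = gamma t.
Proof. apply Cexp_Clog, gamma_slit. Qed.

Lemma exp_Re_om t : exp (Re (om t)) = Cmod (gamma t).
Proof. apply exp_ln, Cmod_gt_0, gamma_neq_0. Qed.

Lemma om_rad t : (rad h < exp (Re (om t)))%R.
Proof. rewrite exp_Re_om. apply (hankel_Omega _ _ hg t). Qed.

Lemma Rcont_gamma t : Rcont gamma t.
Proof. apply Rcont_continuous. apply (proj1 (hankel_regular _ _ hg)). Qed.

Lemma Rcont_om t : Rcont om t.
Proof.
  apply (cont_comp RtoC (fun z => z) Clog gamma); [apply Ccont_Clog, gamma_slit|apply Rcont_gamma].
Qed.

(** Avoiding the point is part of [winds_around], so the winding condition at the poles already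
    excludes zeros of the denominator. *)
Lemma chi_om t : chi (om t) <> 0.
Proof.
  intros E. destruct (chi_pole h N hN1 hNk (om t) (om_rad t) E) as (k & h1 & h2 & h3 & h4).
  rewrite Cexp_om in h1. pose proof (om_rad t) as h5. rewrite h2 in h5.
  apply (proj1 (hankel_poles _ _ hg k h5) t). exact h1.
Qed.

Definition phi (a : C) (t : R) : C :=
  gen_power h (gamma t) a / (Cexp (- gamma t) - 1) * velocity gamma t.

Lemma phi_Phi a t : phi a t = Phi h a (om t) * (velocity gamma t / gamma t).
Proof.
  unfold phi, Phi. rewrite gen_power_gpow. fold (om t). pose proof (chi_om t) as hc. revert hc. unfold chi. rewrite Cexp_om.
  pose proof (gamma_neq_0 t). generalize dependent (Cexp (- gamma t) - 1). intros z.
  generalize dependent (gamma t). intros. field. auto.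
Qed.

Lemma Rdiff_gamma t : @ex_derive R_AbsRing C_R_NormedModule gamma t -> Rdiff gamma t (velocity gamma t).
Proof.
  intros [l hl]. apply Rdiff_is_derive in hl. eapply diff_eq; [|exact hl].
  destruct hl as [q [h1 [h2 h3]]].
  assert (h4 : forall s : bool, Derive (fun u => if s then Re (gamma u) else Im (gamma u)) t = if s then Re l else Im l).
  { intros s. apply is_derive_unique, is_derive_Reals. intros eps heps.
    destruct (h3 eps heps) as [d [hd H]]. exists (mkposreal d hd). intros x hx hxd. simpl in hxd.
    specialize (H (t + x)%R). rewrite <- RtoC_minus, Cmod_R in H.
    replace (t + x - t)%R with x in H by ring. specialize (H hxd).
    rewrite h2 in H. specialize (h1 (t + x)%R). rewrite <- RtoC_minus in h1. replace (t + x - t)%R with x in h1 by ring.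
    assert (E : q (t + x)%R - l = ((Re (gamma (t + x)%R) - Re (gamma t)) / x - Re l, (Im (gamma (t + x)%R) - Im (gamma t)) / x - Im l)%R).
    { apply (f_equal (fun z => z / RtoC x)) in h1. cbv beta in h1.
      assert (hx' : RtoC x <> 0) by (apply RtoC_neq_0; auto).
      replace (q (t + x)%R) with ((gamma (t + x)%R - gamma t) / x) by (rewrite h1; field; auto).
      apply injective_projections; simpl; unfold Re, Im; field; auto. }
    rewrite E in H. eapply Rle_lt_trans; [|exact H].
    pose proof (Rmax_Cmod ((Re (gamma (t + x)%R) - Re (gamma t)) / x - Re l, (Im (gamma (t + x)%R) - Im (gamma t)) / x - Im l)%R) as hm.
    simpl in hm. destruct s.
    - eapply Rle_trans; [|exact hm]. apply Rmax_l.
    - eapply Rle_trans; [|exact hm]. apply Rmax_r. }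
  unfold velocity. rewrite (h4 true), (h4 false). destruct l; reflexivity.
Qed.

Lemma Rdiff_om t : @ex_derive R_AbsRing C_R_NormedModule gamma t -> Rdiff om t (velocity gamma t / gamma t).
Proof.
  intros hd. eapply diff_eq; [|apply (diff_comp RtoC (fun z => z) Clog gamma); [apply Cdiff_Clog, gamma_slit|apply Rdiff_gamma, hd]].
  field. apply gamma_neq_0.
Qed.

Lemma Rcont_Phi_om a t : Rcont (fun u => Phi h a (om u)) t.
Proof.
  apply (cont_comp RtoC (fun z => z) (Phi h a) om); [|apply Rcont_om].
  apply Cdiffable_cont, Cdiffable_Phi; auto; [apply om_rad|apply chi_om].
Qed.

Lemma Rcont_inv_gamma t : Rcont (fun u => / gamma u) t.
Proof. apply cont_inv; [apply Rcont_gamma|apply gamma_neq_0]. Qed.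

Lemma gamma_breaks : exists l : list R,
  (forall t, ~ In t l -> @ex_derive R_AbsRing C_R_NormedModule gamma t /\ Rcont (velocity gamma) t) /\
  (forall t, one_sided (velocity gamma) t).
Proof.
  destruct (hankel_regular _ _ hg) as [_ (l & h1 & h2)]. exists l.
  assert (h3 : forall t, ~ In t l -> @ex_derive R_AbsRing C_R_NormedModule gamma t /\ Rcont (velocity gamma) t).
  { intros t ht. destruct (h1 t ht). split; [auto|]. apply Rcont_continuous. auto. }
  split; [exact h3|]. intros t s.
  destruct (excluded_middle_informative (In t l)) as [ht|ht].
  - destruct (h2 t ht) as [[v hv] [v' hv']]. destruct s.
    + exists v'. apply side_limit_filterlim. exact hv'.
    + exists v. apply side_limit_filterlim. exact hv.
  - exists (velocity gamma t). apply side_limit_cont, h3, ht.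
Qed.

Lemma one_sided_phi a t : one_sided (phi a) t.
Proof.
  intros s. destruct gamma_breaks as (l & _ & h2). destruct (h2 t s) as [v hv].
  exists (Phi h a (om t) * / gamma t * v).
  replace (phi a) with (fun u => Phi h a (om u) * / gamma u * velocity gamma u).
  - apply (side_limit_mult (fun u => Phi h a (om u) * / gamma u)); [|exact hv].
    apply (side_limit_cont (fun u => Phi h a (om u) * / gamma u)).
    apply cont_mult; [apply Rcont_Phi_om|apply Rcont_inv_gamma].
  - apply functional_extensionality. intros u. rewrite phi_Phi. field. apply gamma_neq_0.
Qed.

Lemma Rcont_phi a t : Rcont (velocity gamma) t -> Rcont (phi a) t.
Proof.
  intros hv. apply cont_ext with (f := fun u => Phi h a (om u) * / gamma u * velocity gamma u).
  - intros u. rewrite phi_Phi. field. apply gamma_neq_0.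
  - apply cont_mult; [|exact hv]. apply cont_mult; [apply Rcont_Phi_om|apply Rcont_inv_gamma].
Qed.

Lemma phi_FTC a (F : R -> C) s b : (s <= b)%R -> (forall t, (s <= t <= b)%R -> Rcont F t) ->
  (forall t, (s < t < b)%R -> @ex_derive R_AbsRing C_R_NormedModule gamma t -> Rdiff F t (phi a t)) ->
  @is_RInt C_R_NormedModule (phi a) s b (F b - F s).
Proof.
  intros hsb hF hd. destruct gamma_breaks as (l & h1 & h2).
  apply FTC_breaks with (l := l); auto.
  - intros t ht hn. destruct (h1 t hn). split; [auto|]. apply Rcont_phi. auto.
  - intros t _. apply one_sided_phi.
Qed.

(** The margin 1 makes T and - T interior to the ranges of parameters where the contour is over the
    left half-plane, so that functions can be differentiated at them. *)
Definition far (T : R) : Prop :=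
  (1 <= T)%R /\
  (forall t, (T - 1 < t)%R -> (Re (gamma t) < 0)%R /\ (0 < Im (gamma t))%R) /\
  (forall t, (t < - T + 1)%R -> (Re (gamma t) < 0)%R /\ (Im (gamma t) < 0)%R).

Lemma far_exists : exists T, far T.
Proof.
  destruct (proj2 (is_lim_spec _ _ _) (hankel_start _ _ hg) 0%R) as [m1 h1].
  destruct (proj2 (is_lim_spec _ _ _) (hankel_end _ _ hg) 0%R) as [m2 h2].
  destruct (hankel_below _ _ hg) as [m3 h3]. destruct (hankel_above _ _ hg) as [m4 h4].
  exists (Rabs m1 + Rabs m2 + Rabs m3 + Rabs m4 + 1)%R.
  pose proof (Rabs_pos m1). pose proof (Rabs_pos m2). pose proof (Rabs_pos m3). pose proof (Rabs_pos m4).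
  pose proof (Rle_abs (- m1)). pose proof (Rle_abs (- m3)). rewrite Rabs_Ropp in *.
  pose proof (Rle_abs m2). pose proof (Rle_abs m4).
  split; [lra|]. split; intros t ht; split; [apply h2|apply h4|apply h1|apply h3]; lra.
Qed.

Lemma far_reg T t : far T -> (T - 1 < t \/ t < - T + 1)%R -> reg h (2 * PI * INR N) None (om t).
Proof.
  intros (_ & h1 & h2) ht. pose proof PI_RGT_0. pose proof (Carg_bound _ (gamma_slit t)) as hb.
  split; [apply om_rad|]. split; [exact I|]. change (Im (om t)) with (Carg (gamma t)).
  split; [apply Rabs_def1; lra|]. right. destruct ht as [ht|ht].
  - destruct (h1 t ht) as [hr hi]. pose proof (acos_left _ hr). rewrite Carg_pos by lra. rewrite Rabs_right; lra.
  - destruct (h2 t ht) as [hr hi]. pose proof (acos_left _ hr). rewrite Carg_neg by lra. rewrite Rabs_left; lra.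
Qed.

Lemma Rdiff_zero_const (D : R -> C) a b : (a <= b)%R -> (forall t, (a <= t <= b)%R -> Rdiff D t 0) -> D a = D b.
Proof.
  intros hab hD. assert (E : CI (fun _ => 0) a b = D b - D a).
  { apply (CI_FTC D); [|intros t _; apply cont_const]. rewrite Rmin_left, Rmax_right by auto. exact hD. }
  rewrite CI_const, Cmult_0_r in E. replace (D b) with (D b - D a + D a) by ring. rewrite <- E. ring.
Qed.

(* A continuous logarithm of [gamma - pole k] along the contour takes the same
   variation as the branch of [log (1 - gamma / pole k)] at the two ends, since
   the winding number is 0. *)
Definition path_log (k : Z) (ell : R -> C) : Prop :=
  (forall t, Rcont ell t) /\ (forall t, Cexp (ell t) = gamma t - pole k) /\
  forall T, far T -> ell T - ell (- T)%R = lam k (om T) - lam k (om (- T)%R).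

(** The argument given by the winding number yields [ell]. On each end [D] = [ell] - [lam] has the
    constant exponential - pole k, hence is constant. The two constants have the same real part;
    their imaginary parts are compared at infinity, where the argument has equal limits and the
    branch of the logarithm has the same limit at both ends. *)
Lemma path_log_exists k : (INR N <= IZR (Z.abs k))%R -> exists ell, path_log k ell.
Proof.
  intros hk. pose proof PI_RGT_0 as hpi.
  assert (hk0 : k <> 0%Z).
  { intros ->. simpl in hk. apply le_INR in hN1. simpl in hN1. lra. }
  assert (hkr : (rad h < 2 * PI * IZR (Z.abs k))%R) by nra.
  destruct (hankel_poles _ _ hg k hkr) as [hne (theta & hth & hpol & l & hl1 & hl2)].
  change (2 * Ci * PI * IZR k) with (pole k) in *.
  replace (l + 2 * 0 * PI)%R with l in hl2 by ring.
  set (ell := fun t => (ln (Cmod (gamma t - pole k)), theta t) : C).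
  assert (hpos : forall t, (0 < Cmod (gamma t - pole k))%R).
  { intros t. apply Cmod_gt_0, Cminus_neq_0, hne. }
  assert (hexp : forall t, Cexp (ell t) = gamma t - pole k).
  { intros t. unfold ell. rewrite Cexp_polar, exp_ln by auto. symmetry. apply hpol. }
  assert (hcont : forall t, Rcont ell t).
  { intros t. apply cont_ext with (f := fun u => RtoC (ln (Cmod (gamma u - pole k))) + Ci * RtoC (theta u)).
    { intros u. apply injective_projections; simpl; ring. }
    apply cont_plus.
    - apply (cont_R_comp RtoC ln (fun u => Cmod (gamma u - pole k))).
      + apply derivable_continuous_pt. exists (/ Cmod (gamma t - pole k))%R. apply derivable_pt_lim_ln, hpos.
      + apply cont_Cmod. apply cont_minus; [apply Rcont_gamma|apply cont_const].
    - apply cont_mult; [apply cont_const|]. apply (cont_R_comp RtoC theta (fun u => u)); [apply hth|apply cont_e]. }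
  exists ell. split; [exact hcont|]. split; [exact hexp|].
  intros T hT. pose proof hT as (hT1 & hTp & hTn).
  set (D := fun t => ell t - lam k (om t)).
  assert (hslit : forall t, (T - 1 < t \/ t < - T + 1)%R -> slit (1 - gamma t / pole k)).
  { intros t ht. apply (slit_left N hN1); [auto|]. destruct ht; [apply hTp|apply hTn]; auto. }
  assert (hDexp : forall t, (T - 1 < t \/ t < - T + 1)%R -> Cexp (D t) = - pole k).
  { intros t ht. unfold D, Cminus. rewrite Cexp_plus, Cexp_opp, hexp. unfold lam. rewrite Cexp_om, Cexp_Clog by auto.
    pose proof (slit_neq_0 _ (hslit t ht)) as hn. pose proof (pole_neq_0 N hN1 k hk0) as hp.
    assert (hn' : pole k - gamma t <> 0).
    { intros E. apply hn. replace (1 - gamma t / pole k) with ((pole k - gamma t) / pole k) by (field; auto). rewrite E. field. auto. }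
    field. split; auto. }
  assert (hDdiff : forall t, (T - 1 < t \/ t < - T + 1)%R -> Rdiff D t 0).
  { intros t ht. eapply diff_eq; [|apply (diff_log RtoC D (fun _ => - pole k) t 0)].
    - unfold Cdiv. ring.
    - intros u hu. injection hu. auto.
    - apply cont_minus; [apply hcont|]. apply (cont_comp RtoC (fun z => z) Clog (fun u => 1 - Cexp (om u) / pole k)).
      + apply Ccont_Clog. rewrite Cexp_om. apply hslit, ht.
      + apply cont_ext with (f := fun u => 1 - gamma u * / pole k); [intros; rewrite Cexp_om; reflexivity|].
        apply cont_minus; [apply cont_const|]. apply cont_mult; [apply Rcont_gamma|apply cont_const].
    - destruct ht as [ht|ht].
      + exists (t - (T - 1))%R. split; [lra|]. intros u hu. rewrite <- RtoC_minus, Cmod_R in hu. apply Rabs_def2 in hu.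
        apply hDexp. lra.
      + exists (- T + 1 - t)%R. split; [lra|]. intros u hu. rewrite <- RtoC_minus, Cmod_R in hu. apply Rabs_def2 in hu.
        apply hDexp. lra.
    - apply diff_const. }
  assert (hright : forall t, (T <= t)%R -> D T = D t).
  { intros t ht. apply Rdiff_zero_const; [auto|]. intros u hu. apply hDdiff. lra. }
  assert (hleft : forall t, (t <= - T)%R -> D t = D (- T)%R).
  { intros t ht. apply Rdiff_zero_const; [auto|]. intros u hu. apply hDdiff. lra. }
  cut (D T = D (- T)%R).
  { intros E. unfold D in E. replace (ell T) with (ell T - lam k (om T) + lam k (om T)) by ring. rewrite E. ring. }
  assert (hRe : Re (D T) = Re (D (- T)%R)).
  { apply exp_inv. rewrite <- !Cmod_Cexp, !hDexp by lra. auto. }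
  assert (hIm : Im (D T) = Im (D (- T)%R)); [|destruct (D T), (D (- T)%R); simpl in *; congruence].
  apply cond_eq. intros eps heps.
  destruct (hankel_strip _ _ hg) as [B hB].
  set (q := (2 * PI * IZR k)%R).
  assert (hq : q <> 0%R).
  { unfold q. apply Rmult_integral_contrapositive_currified; [lra|]. apply not_0_IZR, hk0. }
  assert (hqa : (0 < Rabs q)%R) by (apply Rabs_pos_lt, hq).
  destruct (Carg_imaginary (1 + B / Rabs q) (eps / 4) ltac:(lra)) as [M HM].
  assert (hend : forall t, (Re (gamma t) < - Rabs (M * q))%R ->
    (Rabs (Carg (1 - gamma t / pole k) - (if Rlt_dec 0 q then - (PI / 2) else PI / 2)) < eps / 4)%R).
  { intros t ht. rewrite (div_pole N hN1 _ k hk0). fold q.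
    set (z := 1 - _ : C).
    assert (hzr : (Rabs (Re z) <= 1 + B / Rabs q)%R).
    { unfold z. simpl. replace (1 + - (Im (gamma t) / q))%R with (1 - Im (gamma t) / q)%R by ring.
      eapply Rle_trans; [apply Rabs_triang|]. rewrite Rabs_R1, Rabs_Ropp. apply Rplus_le_compat_l.
      unfold Rdiv. rewrite Rabs_mult, Rabs_inv. apply Rmult_le_compat_r; [apply Rlt_le, Rinv_0_lt_compat, hqa|apply hB]. }
    assert (hzi : Im z = (Re (gamma t) / q)%R) by (unfold z; simpl; field; auto).
    destruct (HM z hzr) as [H1 H2]. rewrite Rabs_mult in ht. pose proof (Rle_abs M) as hM.
    destruct (Rlt_dec 0 q) as [hp|hn].
    - replace (Carg z - - (PI / 2))%R with (Carg z + PI / 2)%R by ring. apply H2. rewrite hzi.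
      apply Rle_div_l; [auto|]. rewrite (Rabs_right q) in ht by lra. nra.
    - apply H1. rewrite hzi. replace (Re (gamma t) / q)%R with (- Re (gamma t) / - q)%R by (field; auto).
      apply Rle_div_r; [lra|]. rewrite (Rabs_left q) in ht by lra. nra. }
  (* At both ends Re gamma tends to - infinity, so Im(1 - gamma / pole k) = Re gamma / q tends to
     the infinity of sign opposite to q. *)
  set (c0 := (if Rlt_dec 0 q then - (PI / 2) else PI / 2)%R) in *.
  destruct (proj2 (is_lim_spec _ _ _) hl1 (mkposreal (eps / 4) ltac:(lra))) as [m1 h1].
  destruct (proj2 (is_lim_spec _ _ _) hl2 (mkposreal (eps / 4) ltac:(lra))) as [m2 h2].
  destruct (proj2 (is_lim_spec _ _ _) (hankel_start _ _ hg) (- Rabs (M * q))%R) as [m3 h3].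
  destruct (proj2 (is_lim_spec _ _ _) (hankel_end _ _ hg) (- Rabs (M * q))%R) as [m4 h4].
  set (t1 := (Rmin (- T) (Rmin m1 m3) - 1)%R). set (t2 := (Rmax T (Rmax m2 m4) + 1)%R).
  pose proof (Rmin_l (- T) (Rmin m1 m3)). pose proof (Rmin_r (- T) (Rmin m1 m3)).
  pose proof (Rmin_l m1 m3). pose proof (Rmin_r m1 m3).
  pose proof (Rmax_l T (Rmax m2 m4)). pose proof (Rmax_r T (Rmax m2 m4)).
  pose proof (Rmax_l m2 m4). pose proof (Rmax_r m2 m4).
  rewrite (hright t2), <- (hleft t1) by (unfold t1, t2; lra).
  specialize (h1 t1 ltac:(unfold t1; lra)). specialize (h3 t1 ltac:(unfold t1; lra)).
  specialize (h2 t2 ltac:(unfold t2; lra)). specialize (h4 t2 ltac:(unfold t2; lra)).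
  apply hend in h3, h4. simpl in h1, h2.
  assert (E : forall t, Im (D t) = (theta t - Carg (1 - gamma t / pole k))%R).
  { intros t. unfold D, lam. rewrite Cexp_om. simpl. ring. }
  rewrite !E. apply Rabs_def2 in h1, h2, h3, h4. apply Rabs_def1; lra.
Qed.

Lemma gamma_bounded T : (0 <= T)%R -> exists M, forall t, (- T <= t <= T)%R -> (Cmod (gamma t) <= M)%R.
Proof.
  intros hT. destruct (continuous_bounded gamma (- T) T) as [M [_ HM]]; [lra| |exists M; exact HM].
  intros t _. apply Rcont_gamma.
Qed.

(* [Psi] is a primitive on the cut region only.  Through the cuts, the polar parts
   are integrated along the contour by the logarithms of [path_log], and what
   remains of the integrand has a primitive. *)
Lemma middle_integral a Psi T : far T -> primitive h N a Psi ->
  @is_RInt C_R_NormedModule (phi a) (- T) T (Psi (om T) - Psi (om (- T)%R)).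
Proof.
  intros hT hPsi. pose proof hT as (hT1 & _). pose proof PI_gt_3 as hpi.
  destruct (gamma_bounded T ltac:(lra)) as [M HM].
  (* So many polar parts that no pole remains within reach of the compact piece of the contour. *)
  set (K := Nat.max N (Z.to_nat (up (Rabs M)))).
  assert (hK : (N <= K)%nat) by (unfold K; lia).
  assert (hbig : forall t, (- T <= t <= T)%R -> (exp (Re (om t)) < big K)%R).
  { intros t ht. rewrite exp_Re_om. eapply Rle_lt_trans; [apply HM, ht|].
    destruct (archimed (Rabs M)) as [h1 _]. pose proof (Rle_abs M). pose proof (Rabs_pos M).
    assert (hz : (0 <= up (Rabs M))%Z) by (apply le_IZR; lra).
    assert (IZR (up (Rabs M)) <= INR K)%R.
    { rewrite <- (Z2Nat.id _ hz) at 1. rewrite <- INR_IZR_INZ. apply le_INR. unfold K. lia. }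
    unfold big. nra. }
  destruct (regularized h hrho N hN1 hN hNk a K hK) as (F & H & hF & hH).
  destruct (Psi_regularized h hrho N hN1 hN hNk a K Psi F H hK hPsi hF hH) as [c hc].
  set (ell := fun k => epsilon (inhabits (fun _ : R => RtoC 0)) (path_log k)).
  assert (hell : forall k, In k (poles N K) -> path_log k (ell k)).
  { intros k hk. apply (In_poles N hN1) in hk. unfold ell. apply epsilon_spec, path_log_exists. lra. }
  set (Th := fun t => H (om t) - lsum (fun k => res h a k * ell k t) (poles N K)).
  assert (hreg : forall t, (- T <= t <= T)%R -> reg h (big K) (Some (big K)) (om t)).
  { intros t ht. pose proof (Carg_bound _ (gamma_slit t)) as hb. split; [apply om_rad|]. split; [apply hbig, ht|].
    split; [|left; apply hbig, ht]. change (Im (om t)) with (Carg (gamma t)). apply Rabs_def1; lra. }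
  assert (E : Psi (om T) - Psi (om (- T)%R) = Th T - Th (- T)%R).
  { assert (hr : forall t, (- T <= t <= T)%R -> (T - 1 < t \/ t < - T + 1)%R -> reg h (2 * PI * INR N) (Some (big K)) (om t)).
    { intros t ht1 ht2. destruct (far_reg T t hT ht2) as (q1 & _ & q3). split; [exact q1|]. split; [apply hbig, ht1|exact q3]. }
    rewrite (hc (om T)), (hc (om (- T)%R)) by (apply hr; lra). unfold Th.
    assert (E1 : lsum (fun k => res h a k * lam k (om T)) (poles N K) - lsum (fun k => res h a k * lam k (om (- T)%R)) (poles N K)
      = lsum (fun k => res h a k * ell k T) (poles N K) - lsum (fun k => res h a k * ell k (- T)%R) (poles N K)).
    { rewrite <- !lsum_minus. apply lsum_ext. intros k hk. destruct (hell k hk) as (_ & _ & q). specialize (q T hT).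
      transitivity (res h a k * (lam k (om T) - lam k (om (- T)%R))); [ring|]. rewrite <- q. ring. }
    revert E1. generalize (lsum (fun k => res h a k * lam k (om T)) (poles N K)) (lsum (fun k => res h a k * lam k (om (- T)%R)) (poles N K)).
    intros A1 A2 E1. replace (H (om T) - A1 + c - (H (om (- T)%R) - A2 + c)) with (H (om T) - H (om (- T)%R) - (A1 - A2)) by ring.
    rewrite E1. ring. }
  rewrite E. apply (phi_FTC a Th); [lra| |].
  - intros t ht. apply cont_minus.
    + apply (cont_comp RtoC (fun z => z) H om); [|apply Rcont_om]. eapply diff_cont, hH, hreg, ht.
    + apply cont_lsum. intros k hk. apply cont_mult; [apply cont_const|apply hell, hk].
  - intros t ht hd. pose proof (Rdiff_om t hd) as hom. pose proof (Rdiff_gamma t hd) as hga.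
    eapply diff_eq; [|apply diff_minus].
    2:{ apply (diff_comp RtoC (fun z => z) H om); [apply hH, hreg; lra|exact hom]. }
    2:{ apply diff_lsum. intros k hk. apply diff_scal with (c := res h a k).
      apply (diff_log RtoC (ell k) (fun u => gamma u - pole k) t (velocity gamma t)).
      - intros u hu. injection hu. auto.
      - apply hell, hk.
      - exists 1%R. split; [lra|]. intros u _. apply hell, hk.
      - eapply diff_eq; [|apply diff_minus; [exact hga|apply diff_const]]. ring. }
    cbv beta. rewrite (hF _ (chi_om t)), phi_Phi. unfold polar. rewrite Cexp_om.
    rewrite Cmult_plus_distr_r.
    assert (E2 : lsum (fun k => res h a k * (velocity gamma t / (gamma t - pole k))) (poles N K)
      = lsum (fun k => res h a k * (gamma t / (gamma t - pole k))) (poles N K) * (velocity gamma t / gamma t)).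
    { rewrite Cmult_comm, <- lsum_scal. apply lsum_ext. intros k hk. pose proof (gamma_neq_0 t) as hn.
      pose proof (chi_not_pole (om t) k (chi_om t)) as hp. rewrite Cexp_om in hp. apply Cminus_neq_0 in hp.
      generalize dependent (gamma t - pole k). generalize dependent (gamma t). intros. field. auto. }
    rewrite E2. ring.
Qed.

Lemma tail_integral a Psi T s b : far T -> primitive h N a Psi -> (s <= b)%R -> (T <= s \/ b <= - T)%R ->
  @is_RInt C_R_NormedModule (phi a) s b (Psi (om b) - Psi (om s)).
Proof.
  intros hT hPsi hsb hd. apply (phi_FTC a (fun t => Psi (om t))); [auto| |].
  - intros t ht. apply (cont_comp RtoC (fun z => z) Psi om); [|apply Rcont_om].
    eapply diff_cont, hPsi, (far_reg T); [auto|lra].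
  - intros t ht hex. rewrite phi_Phi. apply (diff_comp RtoC (fun z => z) Psi om); [|apply Rdiff_om, hex].
    apply hPsi, (far_reg T); [auto|lra].
Qed.

Lemma whole_integral a Psi T s b : far T -> primitive h N a Psi -> (s <= - T)%R -> (T <= b)%R ->
  @is_RInt C_R_NormedModule (phi a) s b (Psi (om b) - Psi (om s)).
Proof.
  intros hT hPsi hs hb.
  replace (Psi (om b) - Psi (om s)) with
    ((Psi (om (- T)%R) - Psi (om s)) + ((Psi (om T) - Psi (om (- T)%R)) + (Psi (om b) - Psi (om T)))) by ring.
  apply (is_RInt_Chasles (V := C_R_NormedModule) (phi a) s (- T)%R b); [apply (tail_integral a Psi T); auto; lra|].
  apply (is_RInt_Chasles (V := C_R_NormedModule) (phi a) (- T)%R T b); [apply middle_integral; auto|].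
  apply (tail_integral a Psi T); auto; lra.
Qed.

Lemma om_far K : exists m, forall t,
  ((t < - m)%R -> (U K <= Re (om t))%R /\ (2 * PI / 3 <= - Im (om t) <= 4 * PI / 3)%R) /\
  ((m < t)%R -> (U K <= Re (om t))%R /\ (2 * PI / 3 <= Im (om t) <= 4 * PI / 3)%R).
Proof.
  destruct (hankel_strip _ _ hg) as [B hB]. pose proof PI_RGT_0.
  (* To the left of X the contour is outside the circle of index K, and |Im z| <= - Re z puts its
     argument in the sector of the tail estimates. *)
  set (X := (- (Rabs B + exp (U K)))%R).
  assert (key : forall t, (Re (gamma t) < X)%R -> (U K <= Re (om t))%R /\
    (2 * PI / 3 <= acos (Re (gamma t) / Cmod (gamma t)) <= 4 * PI / 3)%R).
  { intros t ht. pose proof (Rabs_pos B). pose proof (exp_pos (U K)). pose proof (Rle_abs B). unfold X in ht. split.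
    - apply Rlt_le, exp_lt_inv. rewrite exp_Re_om. pose proof (re_le_Cmod (gamma t)) as hr.
      rewrite Rabs_left in hr by lra. lra.
    - split; [|pose proof (acos_bound (Re (gamma t) / Cmod (gamma t))); lra].
      apply acos_far_left; [lra|]. specialize (hB t). lra. }
  destruct (proj2 (is_lim_spec _ _ _) (hankel_start _ _ hg) X) as [m1 h1].
  destruct (proj2 (is_lim_spec _ _ _) (hankel_end _ _ hg) X) as [m2 h2].
  destruct (hankel_below _ _ hg) as [m3 h3]. destruct (hankel_above _ _ hg) as [m4 h4].
  exists (Rabs m1 + Rabs m2 + Rabs m3 + Rabs m4)%R.
  pose proof (Rabs_pos m1). pose proof (Rabs_pos m2). pose proof (Rabs_pos m3). pose proof (Rabs_pos m4).
  pose proof (Rle_abs (- m1)). pose proof (Rle_abs (- m3)). rewrite Rabs_Ropp in *.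
  pose proof (Rle_abs m2). pose proof (Rle_abs m4).
  intros t. change (Im (om t)) with (Carg (gamma t)). split; intros ht.
  - destruct (key t) as [q1 q2]; [apply h1; lra|]. split; [exact q1|].
    rewrite Carg_neg by (apply h3; lra). rewrite Ropp_involutive. exact q2.
  - destruct (key t) as [q1 q2]; [apply h2; lra|]. split; [exact q1|].
    rewrite Carg_pos; [exact q2|]. apply Rlt_le, h4. lra.
Qed.

(** The integral from s to b is the increment of [Psi] between the lifted ends. Each end is joined
    to (U K, pi) or (U K, - pi) inside a tail, at the cost C0 exp(- U K), and the increment between
    these two points is [J], at distance C1 exp(- U K) from I(a). *)
Lemma hankel_integral_limit I a : (forall a, Clim (fun K => J h N K a) (I a)) -> hankel_integral h gamma a = I a.
Proof.
  intros hI.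
  change (hankel_integral h gamma a) with
    (@RInt_gen C_R_CompleteNormedModule (phi a) (Rbar_locally m_infty) (Rbar_locally p_infty)).
  refine (@is_RInt_gen_unique C_R_CompleteNormedModule (Rbar_locally m_infty) (Rbar_locally p_infty) _ _ (phi a) (I a) _).
  change (@is_RInt_gen C_R_NormedModule (phi a) (Rbar_locally m_infty) (Rbar_locally p_infty) (I a)).
  destruct (Psi_exists h hrho N hN1 hN hNk a) as [Psi hPsi].
  set (S0 := (Cmod a + 1)%R). pose proof (Cmod_ge_0 a) as ha.
  destruct (I_bound h hrho N hN1 hN hNk I S0 ltac:(unfold S0; lra) hI) as (C1 & hC1 & H1).
  destruct (Psi_tail h hrho N hN1 hN hNk S0 ltac:(unfold S0; lra)) as (C0 & hC0 & H0).
  destruct far_exists as [T hT]. pose proof hT as (hT1 & _). pose proof PI_RGT_0 as hpi.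
  intros P [eps HP].
  set (e := (eps / (2 * C0 + C1 + 1))%R).
  assert (he : (0 < e)%R) by (apply Rdiv_lt_0_compat; [apply cond_pos|lra]).
  destruct (exp_U_small N hN1 e he) as (K & hK & HK). specialize (HK K (le_n _)).
  destruct (om_far K) as [m Hm].
  apply (Filter_prod _ _ _ (fun s => (s < Rmin (- m) (- T))%R) (fun b => (Rmax m T < b)%R)).
  { exists (Rmin (- m) (- T)). auto. } { exists (Rmax m T). auto. }
  intros s b hs hb. simpl.
  pose proof (Rmin_l (- m) (- T)). pose proof (Rmin_r (- m) (- T)).
  pose proof (Rmax_l m T). pose proof (Rmax_r m T).
  exists (Psi (om b) - Psi (om s)). split; [apply (whole_integral a Psi T); auto; lra|].
  apply HP. apply (C_NormedModule_mixin_compat1 (I a)).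
  destruct (proj1 (Hm s) ltac:(lra)) as [s1 s2]. destruct (proj2 (Hm b) ltac:(lra)) as [b1 b2].
  pose proof (u0_U h hrho N hN1 hN K hK) as hu.
  pose proof (H0 a Psi (U K) PI (Re (om b)) (Im (om b)) 1%R ltac:(unfold S0; lra) hPsi ltac:(auto) ltac:(lra) ltac:(lra) b2) as q1.
  pose proof (H0 a Psi (U K) PI (Re (om s)) (- Im (om s))%R (-1)%R ltac:(unfold S0; lra) hPsi ltac:(auto) ltac:(lra) ltac:(lra) s2) as q2.
  pose proof (H1 a K ltac:(unfold S0; lra) hK) as q3.
  rewrite !Rmult_1_l in q1. replace (-1 * - Im (om s))%R with (Im (om s)) in q2 by ring.
  replace (-1 * PI)%R with (- PI)%R in q2 by ring.
  change (Re (om b), Im (om b)) with (om b) in q1. change (Re (om s), Im (om s)) with (om s) in q2.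
  rewrite <- (J_formula h hrho N hN1 hN hNk K a Psi hK hPsi) in q3.
  change (Cmod (Psi (om b) - Psi (om s) - I a) < eps)%R.
  replace (Psi (om b) - Psi (om s) - I a) with
    ((Psi (om b) - Psi (U K, PI)) + (- (Psi (om s) - Psi (U K, (- PI)%R)) + - (I a - (Psi (U K, PI) - Psi (U K, (- PI)%R))))) by ring.
  eapply Rle_lt_trans; [apply Cmod_triangle|].
  eapply Rle_lt_trans; [apply Rplus_le_compat_l, Cmod_triangle|]. rewrite !Cmod_opp.
  apply Rle_lt_trans with ((2 * C0 + C1) * exp (- U K))%R; [lra|].
  replace (pos eps) with ((2 * C0 + C1 + 1) * e)%R by (unfold e; field; lra).
  pose proof (exp_pos (- U K)). nra.
Qed.
End Hankel.

(** * The functional equation at the integers *)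

Lemma lsum_seq F (e : nat -> Z) n m : lsum F (map e (seq n m)) = csum (fun i => F (e (n + i)%nat)) m.
Proof.
  induction m as [|m IH]; [reflexivity|].
  rewrite seq_S, map_app, lsum_app, IH. simpl. ring.
Qed.

Lemma cont_zero (f : C -> C) (c : C) : Ccont f c -> (forall z, z <> c -> f z = 0) -> f c = 0.
Proof.
  intros hf hz. cut (f c = RtoC 0); [auto|]. apply Cmod_small_eq. intros eps heps.
  destruct (hf eps heps) as [d [hd H]].
  specialize (H (c + RtoC (d / 2))). rewrite hz in H.
  - replace (f c - 0) with (- (0 - f c)) by ring. rewrite Cmod_opp. apply Rlt_le, H.
    replace (c + (d / 2)%R - c) with (RtoC (d / 2)) by ring. rewrite Cmod_R, Rabs_right; lra.
  - intros E. assert (E2 : RtoC (d / 2) = 0) by (replace (RtoC (d / 2)) with (c + RtoC (d / 2) - c) by ring; rewrite E; ring).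
    apply RtoC_inj in E2. lra.
Qed.

(** Carathéodory's quotient is continuous at m and differentiable elsewhere, so Riemann's theorem
    makes it differentiable at m too. *)
Lemma quotient_diffable (c : C -> C) (m l : C) : (forall z, Cdiffable c z) -> c m = 0 -> Cdiff c m l ->
  exists q, (forall z, c z = q z * (z - m)) /\ q m = l /\ forall z, (Cmod (z - m) < 1)%R -> Cdiffable q z.
Proof.
  intros hc hm [q [h1 [h2 h3]]]. exists q. split; [|split; [exact h2|]].
  { intros z. rewrite <- h1, hm. ring. }
  assert (hq : forall z, z <> m -> Cdiffable q z).
  { intros z hz. apply Cminus_neq_0 in hz as hz'.
    apply Cdiffable_ext_loc with (f := fun u => c u / (u - m)).
    - exists (Cmod (z - m)). split; [apply Cmod_gt_0, hz'|]. intros u hu.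
      assert (hu' : u - m <> 0).
      { intros E. replace (u - z) with (- (z - m) + (u - m)) in hu by ring. rewrite E, Cplus_0_r, Cmod_opp in hu. lra. }
      replace (c u) with (q u * (u - m)) by (rewrite <- h1, hm; ring). field. exact hu'.
    - apply Cdiffable_div; [apply hc|apply Cdiffable_minus; [apply Cdiffable_id|apply Cdiffable_const]|exact hz']. }
  destruct (riemann q m 1 Rlt_0_1) as [F [k1 k2]].
  - intros z hz. apply hq. intros ->. replace (m - m) with (RtoC 0) in hz by ring. rewrite Cmod_0 in hz. lra.
  - apply cont_removable, h3.
  - assert (E : F m = q m).
    { replace (F m) with (F m - q m + q m) by ring.
      rewrite (cont_zero (fun z => F z - q z) m); [ring| |].
      - apply cont_minus; [|exact h3]. apply Cdiffable_cont, k2. replace (m - m) with (RtoC 0) by ring. rewrite Cmod_0. lra.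
      - intros z hz. rewrite k1 by auto. ring. }
    intros z hz. apply Cdiffable_ext_loc with (f := F); [|apply k2, hz].
    exists 1%R. split; [lra|]. intros u _. destruct (excluded_middle_informative (u = m)) as [->|hn]; auto.
Qed.

Lemma rising_prod_opp m : rising_prod (- RtoC (INR m)) m = (- (1)) ^ m * RtoC (INR (fact m)).
Proof.
  induction m as [|m IH]; [simpl; ring|].
  rewrite rising_prod_left. replace (- RtoC (INR (S m)) + 1) with (- RtoC (INR m)) by (rewrite S_INR, RtoC_plus; ring).
  rewrite IH. change (fact (S m)) with (S m * fact m)%nat. rewrite mult_INR, RtoC_mult. simpl. ring.
Qed.

Lemma Cdiffable_rising_prod m (s : C) : Cdiffable (fun s => rising_prod (- s) m) s.
Proof.
  induction m as [|m IH]; [exact (Cdiffable_const 1 s)|]. cbn [rising_prod]. apply Cdiffable_mult; [exact IH|].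
  apply Cdiffable_plus; [apply Cdiffable_opp, Cdiffable_id|apply Cdiffable_const].
Qed.

Lemma sign_square m : (- (1)) ^ m * (- (1)) ^ m = (1 : C).
Proof. rewrite <- Cpow_mult_l. replace (- (1) * - (1)) with (RtoC 1) by ring. apply Cpow_1_l. Qed.

Lemma sign_neq_0 m : (- (1)) ^ m <> (0 : C).
Proof.
  intros E. pose proof (sign_square m) as hs. rewrite E in hs.
  apply (RtoC_neq_0 1); [lra|]. rewrite <- hs. ring.
Qed.

(** With [ell_down], the logarithms of 2 i pi and - 2 i pi in the strip; [lpole k] is ln |k| plus
    one of the two. *)
Definition ell_up : C := (ln (2 * PI), PI / 2)%R.
Definition ell_down : C := (ln (2 * PI), - (PI / 2))%R.

Lemma Cexp_ell : Cexp ell_up = two_pi_i /\ Cexp ell_down = - two_pi_i.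
Proof.
  pose proof PI_RGT_0. unfold ell_up, ell_down. rewrite !Cexp_polar, !exp_ln, cos_neg, sin_neg, cos_PI2, sin_PI2, two_pi_i_pair by lra.
  split; apply injective_projections; simpl; ring.
Qed.

Section Core.
Variables (f : R -> R) (hf : standing_assumptions f) (L : C -> C) (hL : is_LC_function (complexify f) L).
Let g := complexify f.
Let h := scale two_pi_i g.
Let N := start_index g.
Variables (mu : R -> C) (hmu : hankel_contour h mu) (sg : C).
Hypothesis hpar : forall z, modulator_entire g (- z) = sg * modulator_entire g z.

Lemma rho_scaled : Rbar_lt 0%R (rho h).
Proof. apply (rad_scale f two_pi_i two_pi_i_neq_0 hf). Qed.

Lemma rad_scaled : rad h = (2 * PI * rad g)%R.
Proof. unfold h, g. rewrite (proj1 (rad_scale f two_pi_i two_pi_i_neq_0 hf)), Cmod_two_pi_i. reflexivity. Qed.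

Lemma N_spec : (rad g < INR N)%R /\ (INR N <= rad g + 1)%R /\ (1 <= N)%nat.
Proof. apply start_index_spec, rad_pos, hf. Qed.

Lemma rad_scaled_lt : (rad h < 2 * PI * INR N)%R.
Proof. rewrite rad_scaled. pose proof PI_RGT_0. pose proof N_spec. nra. Qed.

(** After division by 2 pi: N exceeds [rad g] by at most 1, so an integer above [rad g] is at least
    N. *)
Lemma scaled_pole_index k : (rad h < 2 * PI * IZR (Z.abs k))%R -> (INR N <= IZR (Z.abs k))%R.
Proof.
  rewrite rad_scaled. intros hk. pose proof PI_RGT_0. destruct N_spec as (_ & h2 & _).
  assert (hk' : (rad g < IZR (Z.abs k))%R) by (apply Rmult_lt_reg_l with (2 * PI)%R; lra).
  rewrite INR_IZR_INZ in *. apply IZR_le. assert (hz : (IZR (Z.of_nat N) < IZR (Z.abs k + 1))%R) by (rewrite plus_IZR; lra).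
  apply lt_IZR in hz. lia.
Qed.

Lemma gpow_summable a w : (rad g < exp (Re w))%R -> summable (gpow_term g a w).
Proof.
  intros hw. pose proof (Cmod_ge_0 a).
  destruct (gpow_term_bound g (proj2 hf) (Cmod a + 1) (exp (Re w)) ltac:(lra) hw (exp_pos _)) as (b & h1 & h2 & h3).
  apply summable_le with (b := fun k => (exp (Re (a * w)) * b k)%R).
  - intros k. rewrite Rmult_comm. apply h3; lra.
  - apply ex_series_Rscal, h1.
Qed.

(** The factor (2 i pi)^j of the coefficients cancels the power (e 2 i pi)^(-j) up to e^j, where e
    is 1 on the upper ray and -1 on the lower one; parity of the coefficients turns e^j into the
    constant [eps]. *)
Lemma res_eq (e eps l : C) (n : nat) (k : Z) a : (N <= n)%nat ->
  lpole k = RtoC (ln (INR n)) + l -> Cexp l = e * two_pi_i -> e * e = 1 ->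
  (forall j, e ^ j * Pcoef g j = eps * Pcoef g j) ->
  res h a k = eps * Cexp (a * l) * gen_power g (RtoC (INR n)) a.
Proof.
  intros hn hl he hee hP. destruct N_spec as (h1 & _ & h2).
  assert (hn0 : (0 < INR n)%R) by (apply lt_0_INR; lia).
  rewrite gen_power_pos by auto. unfold res, gpow. rewrite hl.
  rewrite <- CSeries_scal.
  - apply CSeries_ext. intros j. unfold gpow_term, h, g. rewrite Pcoef_scale by (apply two_pi_i_neq_0 || apply hf). fold g.
    rewrite Cmult_plus_distr_l, Cexp_plus, (Cexp_sub_nat a j l), he.
    assert (he0 : e <> 0) by (intros ->; apply (RtoC_neq_0 1); [lra|]; rewrite <- hee; ring).
    assert (E : (/ (e * two_pi_i)) ^ j * two_pi_i ^ j = e ^ j).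
    { rewrite <- Cpow_mult_l. f_equal. transitivity (e * e / e); [rewrite hee|]; field; auto using two_pi_i_neq_0. }
    unfold rpow.
    transitivity (Cbinom a j * (((/ (e * two_pi_i)) ^ j * two_pi_i ^ j) * Pcoef g j) * Cexp ((a - RtoC (INR j)) * RtoC (ln (INR n))) * Cexp (a * l)); [ring|].
    rewrite E, hP. ring.
  - apply (gpow_summable a (RtoC (ln (INR n)))). simpl. rewrite exp_ln by auto.
    apply Rlt_le_trans with (INR N); [auto|]. apply le_INR, hn.
Qed.

(** 2 i pi times (2 i pi)^a + sg (- 2 i pi)^a, with principal powers. *)
Definition cfac (a : C) : C := two_pi_i * (Cexp (a * ell_up) + sg * Cexp (a * ell_down)).

Lemma J_eq K a : (N <= K)%nat ->
  J h N K a = V h K a + cfac a * csum (fun i => gen_power g (RtoC (INR (N + i))) a) (S K - N).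
Proof.
  intros hK. unfold J, poles. f_equal. rewrite lsum_app, !lsum_seq, <- csum_plus. unfold cfac.
  assert (E : forall c u n, c * csum u n = csum (fun i => c * u i) n).
  { intros c u n. induction n as [|n IH]; simpl; [ring|]. rewrite <- IH. ring. }
  rewrite E. f_equal. apply functional_extensionality. intros i.
  destruct N_spec as (_ & _ & h1). destruct Cexp_ell as [e1 e2]. pose proof PI_RGT_0 as hpi.
  assert (hp : (0 < INR (N + i))%R) by (apply lt_0_INR; lia).
  assert (hln : ln (2 * PI * IZR (Z.abs (Z.of_nat (N + i)))) = (ln (INR (N + i)) + ln (2 * PI))%R).
  { rewrite Z.abs_eq by lia. rewrite <- INR_IZR_INZ, ln_mult by lra. ring. }
  rewrite (res_eq 1 1 ell_up (N + i) (Z.of_nat (N + i)) a), (res_eq (- (1)) sg ell_down (N + i) (- Z.of_nat (N + i)) a); try lia.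
  - ring.
  - unfold lpole, ell_down. destruct (Z_lt_dec 0 (- Z.of_nat (N + i))) as [hz|hz]; [lia|]. rewrite Z.abs_opp, hln.
    apply injective_projections; simpl; ring.
  - rewrite e2. ring.
  - ring.
  - apply parity_coef; [apply hf|exact hpar].
  - unfold lpole, ell_up. destruct (Z_lt_dec 0 (Z.of_nat (N + i))) as [hz|hz]; [|lia]. rewrite hln.
    apply injective_projections; simpl; ring.
  - rewrite e1. ring.
  - ring.
  - intros j. rewrite Cpow_1_l. reflexivity.
Qed.

Lemma Cdiffable_cfac a : Cdiffable cfac a.
Proof.
  apply Cdiffable_mult; [apply Cdiffable_const|]. apply Cdiffable_plus.
  - apply Cdiffable_Cexp, Cdiffable_mult; [apply Cdiffable_id|apply Cdiffable_const].
  - apply Cdiffable_mult; [apply Cdiffable_const|]. apply Cdiffable_Cexp, Cdiffable_mult; [apply Cdiffable_id|apply Cdiffable_const].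
Qed.

Lemma I_half_plane I a : (forall a, Clim (fun K => J h N K a) (I a)) -> (Re a < -1)%R -> I a = cfac a * L (- a).
Proof.
  intros hI ha. apply (Clim_unique (fun K => J h N K a)); [apply hI|].
  apply Clim_ext_ev with (u := fun K => V h K a + cfac a * csum (fun i => gen_power g (RtoC (INR (N + i))) a) (S K - N)).
  { exists N. intros K hK. symmetry. apply J_eq, hK. }
  replace (cfac a * L (- a)) with (0 + cfac a * L (- a)) by ring. apply Clim_plus.
  - destruct N_spec as (_ & _ & h1). apply (V_vanishes h rho_scaled N h1 rad_scaled_lt), ha.
  - apply Clim_scal. pose proof (LC_series _ _ hL (- a) ltac:(unfold Re in *; simpl; lra)) as hs. apply Csums_is_series in hs.
    replace (- - a) with a in hs by ring.
    intros eps heps. destruct (hs eps heps) as [n Hn]. exists (N + n)%nat. intros K hK. apply Hn. lia.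
Qed.

(** The factor a + 1 clears the possible pole of L(-a) at a = -1, so that both sides are entire and
    the identity theorem applies. *)
Lemma I_functional I Lh : (forall a, Clim (fun K => J h N K a) (I a)) -> (forall a, Cdiffable I a) ->
  (forall s : C, s <> 1 -> Lh s = (s - 1) * L s) -> (forall s, Cdiffable Lh s) ->
  forall a : C, (a + 1) * I a = - cfac a * Lh (- a).
Proof.
  intros hI hId hLh hLd a.
  assert (E : (fun a : C => (a + 1) * I a + cfac a * Lh (- a)) a = 0).
  { apply (identity_half_plane (fun a : C => (a + 1) * I a + cfac a * Lh (- a)) (Re a + 1) (-1)); [| |lra].
    - intros z _. apply Cdiffable_plus; apply Cdiffable_mult; auto using Cdiffable_cfac.
      + apply Cdiffable_plus; [apply Cdiffable_id|apply Cdiffable_const].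
      + apply (Cdiffable_comp (fun z => - z) Lh); [apply hLd|apply Cdiffable_opp, Cdiffable_id].
    - intros z hz. rewrite (I_half_plane I z hI hz), hLh; [ring|]. intros E. apply (f_equal Re) in E. unfold Re in *. simpl in E. lra. }
  cbv beta in E. replace ((a + 1) * I a) with ((a + 1) * I a + cfac a * Lh (- a) - cfac a * Lh (- a)) by ring.
  rewrite E. ring.
Qed.

(** Division by a + 1 off a = -1; at that point both sides are continuous when p_f(0) = 0. *)
Lemma I_L I a : (forall a, Clim (fun K => J h N K a) (I a)) -> (forall a, Cdiffable I a) ->
  (a <> - (1) \/ modulator_entire g 0 = 0) -> I a = cfac a * L (- a).
Proof.
  intros hI hId ha. destruct (Lhat_exists f L hL) as (Lh & hL1 & hL2).
  pose proof (I_functional I Lh hI hId hL1 hL2) as E.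
  assert (hoff : forall a : C, a <> - (1) -> I a = cfac a * L (- a)).
  { intros z hz. specialize (E z). rewrite hL1 in E.
    - assert (hz1 : z + 1 <> 0).
      { intros E1. apply hz. replace z with (z + 1 - 1) by ring. rewrite E1. ring. }
      transitivity ((z + 1) * I z / (z + 1)); [field; auto|]. rewrite E. field. auto.
    - intros E1. apply hz. replace z with (- - z) by ring. rewrite E1. ring. }
  destruct (excluded_middle_informative (a = - (1))) as [Ea|]; [|auto].
  destruct ha as [|h0]; [contradiction|].
  replace (I a) with ((fun a => I a - cfac a * L (- a)) a + cfac a * L (- a)) by (cbv beta; ring).
  rewrite (cont_zero (fun a => I a - cfac a * L (- a)) a); [ring| |].
  - apply Cdiffable_cont, Cdiffable_minus; [apply hId|]. apply Cdiffable_mult; [apply Cdiffable_cfac|].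
    apply (Cdiffable_comp (fun z => - z) L); [|apply Cdiffable_opp, Cdiffable_id].
    rewrite Ea. replace (- - (1)) with (RtoC 1) by ring. apply holomorphic_Cdiffable, (LC_entire _ _ hL h0).
  - intros z hz. rewrite hoff by congruence. ring.
Qed.

Variable m : nat.
Hypothesis hsg : sg = (- (1)) ^ m.

(** With sg = (-1)^m the two terms of [cfac] at - m coincide, and its value is 2 (2 i pi)^(1 -
    m). *)
Lemma L_hankel : (m <> 1%nat \/ modulator_entire g 0 = 0) ->
  L (RtoC (INR m)) = two_pi_i ^ m / (2 * two_pi_i) * hankel_integral h mu (- RtoC (INR m)).
Proof.
  intros hm. destruct N_spec as (_ & _ & hN1).
  destruct (I_exists h rho_scaled N hN1 rad_scaled_lt scaled_pole_index) as (I & hI & hId).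
  rewrite (hankel_integral_limit h rho_scaled N hN1 rad_scaled_lt scaled_pole_index mu hmu I _ hI).
  rewrite (I_L I); auto.
  - replace (- - RtoC (INR m)) with (RtoC (INR m)) by ring. unfold cfac.
    destruct Cexp_ell as [e1 e2]. replace (- RtoC (INR m) * ell_up) with (- (RtoC (INR m) * ell_up)) by ring.
    replace (- RtoC (INR m) * ell_down) with (- (RtoC (INR m) * ell_down)) by ring. rewrite !Cexp_opp, !Cexp_nat, e1, e2, hsg.
    replace (- two_pi_i) with (- (1) * two_pi_i) by ring. rewrite Cpow_mult_l.
    pose proof (sign_square m) as hs.
    pose proof (sign_neq_0 m) as hs0.
    pose proof two_pi_i_neq_0 as ht. pose proof (Cpow_nz _ m ht) as htm.
    assert (h2 : RtoC 2 <> 0) by (apply RtoC_neq_0; lra). field. auto.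
  - destruct hm as [hm|hm]; [left|auto]. intros E. apply hm. apply (f_equal Copp) in E.
    replace (- - RtoC (INR m)) with (RtoC (INR m)) in E by ring. replace (- - (1)) with (RtoC 1) in E by ring.
    apply RtoC_inj in E. apply (INR_eq m 1), E.
Qed.

(** cfac(s - 1) = (2 i pi)^s - sg (- 2 i pi)^s vanishes at s = m. Its derivative there is (2 i pi)^m
    times the difference i pi of the two logarithms. *)
Lemma cfac_quotient : exists q : C -> C, (forall s : C, cfac (s - 1) = q s * (s - RtoC (INR m))) /\
  q (RtoC (INR m)) = Ci * PI * two_pi_i ^ m /\ forall s, (Cmod (s - RtoC (INR m)) < 1)%R -> Cdiffable q s.
Proof.
  destruct Cexp_ell as [e1 e2]. pose proof two_pi_i_neq_0 as ht.
  pose proof (sign_square m) as hs.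
  assert (hc : forall s : C, cfac (s - 1) = Cexp (s * ell_up) - sg * Cexp (s * ell_down)).
  { intros s. unfold cfac. replace ((s - 1) * ell_up) with (s * ell_up + - ell_up) by ring.
    replace ((s - 1) * ell_down) with (s * ell_down + - ell_down) by ring.
    rewrite !Cexp_plus, !Cexp_opp, e1, e2. field. auto. }
  assert (eu : Cexp (RtoC (INR m) * ell_up) = two_pi_i ^ m) by (rewrite Cexp_nat, e1; auto).
  assert (ed : Cexp (RtoC (INR m) * ell_down) = (- (1)) ^ m * two_pi_i ^ m).
  { rewrite Cexp_nat, e2. replace (- two_pi_i) with (- (1) * two_pi_i) by ring. apply Cpow_mult_l. }
  apply quotient_diffable.
  - intros z. apply (Cdiffable_comp (fun s : C => s - 1) cfac); [apply Cdiffable_cfac|].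
    apply Cdiffable_minus; [apply Cdiffable_id|apply Cdiffable_const].
  - rewrite hc, eu, ed, hsg, Cmult_assoc, hs. ring.
  - apply diff_ext with (f := fun s : C => Cexp (s * ell_up) - sg * Cexp (s * ell_down)); [intros; symmetry; apply hc|].
    eapply diff_eq; [|apply diff_minus; [apply diff_Cexp, diff_mult; [apply diff_e|apply diff_const]|
      apply diff_scal, diff_Cexp, diff_mult; [apply diff_e|apply diff_const]]].
    cbv beta. rewrite eu, ed, hsg.
    assert (E : ell_up - ell_down = Ci * PI) by (apply injective_projections; simpl; field).
    rewrite <- E. transitivity (two_pi_i ^ m * (ell_up - ell_down * ((- (1)) ^ m * (- (1)) ^ m))); [ring|]. rewrite hs. ring.
Qed.

(** The functional equation writes Gamma(1 - s) as Gamma(m + 1 - s) / ((1 - s) ... (m - s)), while s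
    I(s - 1) carries the factor s - m of [cfac_quotient]. After cancellation the continuation is
    explicit, and at s = m only Gamma(1), [q] and a value of [Lh] remain. *)
Lemma FC_value_nat : FC_value h mu (RtoC (INR m))
  (- (two_pi_i ^ m * Cpoly (underline g) m (1 - RtoC (INR N)) / (2 * RtoC (INR (fact m))))).
Proof.
  destruct N_spec as (_ & _ & hN1).
  destruct (I_exists h rho_scaled N hN1 rad_scaled_lt scaled_pole_index) as (I & hI & hId).
  destruct (Lhat_exists f L hL) as (Lh & hL1 & hL2).
  destruct cfac_quotient as (q & q1 & q2 & q3).
  pose proof (I_functional I Lh hI hId hL1 hL2) as hfun.
  pose proof two_pi_i_neq_0 as ht.
  assert (hE : forall s : C, s * I (s - 1) = - (q s * (s - RtoC (INR m))) * Lh (1 - s)).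
  { intros s. specialize (hfun (s - 1)). rewrite q1 in hfun. replace (s - 1 + 1) with s in hfun by ring.
    replace (- (s - 1)) with (1 - s) in hfun by ring. exact hfun. }
  (* The product (- s)(1 - s) ... (m - 1 - s): the denominator (1 - s) ... (m - s) with its last
     factor exchanged for - s. It has no zero within 1/2 of m. *)
  set (P := fun s => rising_prod (- s) m).
  assert (hP : forall s : C, (Cmod (s - RtoC (INR m)) < 1 / 2)%R -> P s <> 0).
  { intros s hs. unfold P. clear - hs.
    assert (H : forall k, (k <= m)%nat -> rising_prod (- s) k <> 0); [|apply H; auto].
    induction k as [|k IH]; intros hk; [simpl; intros E; apply RtoC_inj in E; lra|].
    cbn [rising_prod]. apply Cmult_neq_0; [apply IH; lia|]. intros E.
    replace (s - RtoC (INR m)) with (RtoC (INR k - INR m) - (- s + RtoC (INR k))) in hs by (rewrite RtoC_minus; ring).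
    rewrite E in hs. replace ((INR k - INR m)%R - 0) with (RtoC (INR k - INR m)) in hs by ring. rewrite Cmod_R in hs.
    assert (h1 : (INR k + 1 <= INR m)%R) by (rewrite <- S_INR; apply le_INR; lia).
    rewrite Rabs_left in hs; lra. }
  set (w := fun s : C => RtoC (INR m) + 1 - s).
  assert (hw : forall s, (Cmod (s - RtoC (INR m)) < 1 / 2)%R -> (Cmod (w s - 1) < 1 / 2)%R).
  { intros s hs. unfold w. replace (RtoC (INR m) + 1 - s - 1) with (- (s - RtoC (INR m))) by ring. rewrite Cmod_opp. exact hs. }
  set (F := fun s : C => - (CGamma (w s) * Lh (1 - s) / (two_pi_i * P s) * q s)).
  assert (hcm : Cmod (RtoC (INR m) - RtoC (INR m)) = 0%R) by (rewrite <- Cmod_0; f_equal; ring).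
  exists F. split; [|split].
  - apply Cdiffable_holomorphic. exists (1 / 2)%R. split; [lra|]. intros s hs. unfold F.
    apply Cdiffable_opp, Cdiffable_mult; [|apply q3; lra]. apply Cdiffable_div.
    + apply Cdiffable_mult.
      * apply (Cdiffable_comp w CGamma); [apply (proj2 gauss_near_1), hw, hs|].
        apply Cdiffable_minus; [apply Cdiffable_const|apply Cdiffable_id].
      * apply (Cdiffable_comp (fun s : C => 1 - s) Lh); [apply hL2|].
        apply Cdiffable_minus; [apply Cdiffable_const|apply Cdiffable_id].
    + apply Cdiffable_mult; [apply Cdiffable_const|apply Cdiffable_rising_prod].
    + apply Cmult_neq_0; [exact ht|apply hP, hs].
  - exists (mkposreal (1 / 2 / 2) ltac:(lra)). refine (fun (s : C) hs hn => _).
    apply C_NormedModule_mixin_compat2 in hs.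
    assert (hs' : (Cmod (s - RtoC (INR m)) < 1 / 2)%R).
    { eapply Rlt_le_trans; [exact hs|]. simpl.
      assert (sqrt 2 <= 2)%R; [|lra]. rewrite <- (sqrt_Rsqr 2) at 2; [|lra]. apply sqrt_le_1; unfold Rsqr; lra. }
    assert (hj : forall j, 1 - s + RtoC (INR j) <> 0).
    { intros j E. apply (hn j). change (@eq C s (RtoC (INR (S j)))). rewrite S_INR, RtoC_plus. replace s with (RtoC (INR j) + 1 - (1 - s + RtoC (INR j))) by ring.
      rewrite E. ring. }
    assert (hG : CGamma (1 - s) = CGamma (w s) / rising_prod (1 - s) m).
    { apply CGamma_Clim, gauss_shift; [exact hj|]. replace (1 - s + RtoC (INR m)) with (w s) by (unfold w; ring).
      apply gauss_near_1, Rlt_le, hw, hs'. }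
    unfold FC. change (2 * Ci * PI) with two_pi_i.
    rewrite (hankel_integral_limit h rho_scaled N hN1 rad_scaled_lt scaled_pole_index mu hmu I _ hI), hG.
    pose proof (rising_prod_neq_0 _ m hj) as hr.
    assert (hPr : P s * (RtoC (INR m) - s) = - s * rising_prod (1 - s) m).
    { unfold P. replace (1 - s) with (- s + 1) by ring. rewrite <- rising_prod_left. cbn [rising_prod]. ring. }
    specialize (hP s hs'). unfold F.
    (* The functional equation carries a factor s. The point s = 0 lies in this neighbourhood only
       when m = 0; there the identity is obtained by continuity. *)
    assert (key : I (s - 1) * P s = - (Lh (1 - s) * q s * rising_prod (1 - s) m)).
    { destruct (excluded_middle_informative (s = 0)) as [->|hs0].
      - assert (hm0 : m = 0%nat).
        { replace (0 - RtoC (INR m)) with (RtoC (- INR m)) in hs' by (rewrite RtoC_opp; ring).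
          rewrite Cmod_R, Rabs_Ropp, Rabs_right in hs' by (apply Rle_ge, pos_INR).
          destruct m as [|m']; [auto|]. rewrite S_INR in hs'. pose proof (pos_INR m'). lra. }
        unfold P. rewrite hm0 in *. cbn [rising_prod].
        replace (I (0 - 1) * 1) with ((fun s => I (s - 1) + Lh (1 - s) * q s) 0 - Lh (1 - 0) * q 0) by (cbv beta; ring).
        rewrite (cont_zero (fun s : C => I (s - 1) + Lh (1 - s) * q s) 0); [ring| |].
        + apply Cdiffable_cont. apply Cdiffable_plus; [|apply Cdiffable_mult].
          * apply (Cdiffable_comp (fun s : C => s - 1) I); [apply hId|]. apply Cdiffable_minus; [apply Cdiffable_id|apply Cdiffable_const].
          * apply (Cdiffable_comp (fun s : C => 1 - s) Lh); [apply hL2|]. apply Cdiffable_minus; [apply Cdiffable_const|apply Cdiffable_id].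
          * apply q3. lra.
        + intros z hz. specialize (hE z). simpl in hE.
          transitivity ((z * I (z - 1) + z * (q z * Lh (1 - z))) / z); [field; auto|]. rewrite hE. field. auto.
      - transitivity (s * I (s - 1) * P s / s); [field; auto|]. rewrite hE.
        transitivity (q s * (P s * (RtoC (INR m) - s)) * Lh (1 - s) / s); [field; auto|]. rewrite hPr. field. auto. }
    transitivity (CGamma (w s) / (two_pi_i * P s * rising_prod (1 - s) m) * (- (Lh (1 - s) * q s * rising_prod (1 - s) m))); [field; auto|].
    rewrite <- key. field. auto.
  - unfold F, P. rewrite rising_prod_opp, q2. replace (w (RtoC (INR m))) with (RtoC 1) by (unfold w; ring).
    rewrite CGamma_1. unfold N, g. rewrite (Lhat_nat f hf L hL Lh hL1 hL2 m).
    pose proof (sign_square m) as hs.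
    pose proof (sign_neq_0 m) as hs0.
    pose proof (fact_C_neq_0 m) as hfm.
    unfold two_pi_i at 1.
    assert (hCi : Ci <> 0) by (intros E; apply (f_equal Im) in E; simpl in E; lra).
    assert (hPI : RtoC PI <> 0) by (apply RtoC_neq_0; pose proof PI_RGT_0; lra).
    assert (h2 : RtoC 2 <> 0) by (apply RtoC_neq_0; lra).
    replace ((- (1)) ^ m * Lh (1 - RtoC (INR m))) with (Lh (1 - RtoC (INR m)) * ((- (1)) ^ m * (- (1)) ^ m) / (- (1)) ^ m) by (field; auto).
    rewrite hs. field. auto.
Qed.
End Core.

(** * Powers of 2 i pi and the two parities *)

Lemma two_pi_i_even p : two_pi_i ^ (2 * p) = (-1) ^ p * (2 * PI) ^ (2 * p).
Proof.
  rewrite !Cpow_mult_r, <- Cpow_mult_l. f_equal. unfold two_pi_i. simpl.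
  replace (2 * Ci * PI * (2 * Ci * PI * 1)) with (Ci * Ci * (2 * PI * (2 * PI * 1))) by ring.
  f_equal. apply injective_projections; simpl; ring.
Qed.

Theorem theorem4p1
  (f : R -> R) (hf : standing_assumptions f)
  (L : C -> C) (hL : is_LC_function (complexify f) L)
  (mu : R -> C) (hmu : hankel_contour (scale (2 * Ci * PI) (complexify f)) mu) :
  (even_modulator (complexify f) ->
   forall p : nat,
     L (RtoC (INR (2 * p))) =
       (-1) ^ p * (2 * PI) ^ (2 * p) / (4 * Ci * PI)
       * hankel_integral (scale (2 * Ci * PI) (complexify f)) mu
           (- RtoC (INR (2 * p)))
     /\
     FC_value (scale (2 * Ci * PI) (complexify f)) mu (RtoC (INR (2 * p)))
       ((-1) ^ (p + 1)
        * Cpoly (underline (complexify f)) (2 * p)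
            (1 - RtoC (INR (start_index (complexify f))))
        / (2 * RtoC (INR (fact (2 * p)))) * (2 * PI) ^ (2 * p)))
  /\
  (odd_modulator (complexify f) ->
   forall p : nat,
     L (RtoC (INR (2 * p + 1))) =
       (-1) ^ p * (2 * PI) ^ (2 * p + 1) / (4 * PI)
       * hankel_integral (scale (2 * Ci * PI) (complexify f)) mu
           (- RtoC (INR (2 * p + 1)))
     /\
     FC_value (scale (2 * Ci * PI) (complexify f)) mu (RtoC (INR (2 * p + 1)))
       ((-1) ^ p
        * Cpoly (underline (complexify f)) (2 * p + 1)
            (1 - RtoC (INR (start_index (complexify f))))
        / (2 * Ci * RtoC (INR (fact (2 * p + 1)))) * (2 * PI) ^ (2 * p + 1))).
Proof.
  assert (hCi : Ci <> 0) by (intros E; apply (f_equal Im) in E; simpl in E; lra).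
  assert (hCi2 : Ci * Ci = - (1)) by (apply injective_projections; simpl; ring).
  assert (hPI : RtoC PI <> 0) by (apply RtoC_neq_0; pose proof PI_RGT_0; lra).
  assert (h2 : RtoC 2 <> 0) by (apply RtoC_neq_0; lra).
  assert (h4 : RtoC 4 = 2 * 2) by (rewrite <- RtoC_mult; f_equal; ring).
  assert (hsq : - (1) * - (1) = (1 : C)) by ring.
  change (2 * Ci * PI) with two_pi_i in *. split; intros hpar p.
  - assert (hpar' : forall z, modulator_entire (complexify f) (- z) = 1 * modulator_entire (complexify f) z).
    { intros z. rewrite Cmult_1_l. apply hpar. }
    assert (hs : RtoC 1 = (- (1)) ^ (2 * p)).
    { rewrite Cpow_mult_r. simpl. rewrite Cmult_1_r, hsq, Cpow_1_l. auto. }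
    split.
    + rewrite (L_hankel f hf L hL mu hmu 1 hpar' (2 * p) hs) by (left; lia).
      rewrite two_pi_i_even. rewrite h4. unfold two_pi_i. field. auto.
    + pose proof (FC_value_nat f hf L hL mu hmu 1 hpar' (2 * p) hs) as H.
      rewrite two_pi_i_even in H. rewrite Cpow_add_r.
      match type of H with FC_value _ _ _ ?v => match goal with |- FC_value _ _ _ ?v' => replace v' with v; [exact H|] end end.
      pose proof (fact_C_neq_0 (2 * p)). rewrite Cpow_1_r. field. auto.
  - assert (hpar' : forall z, modulator_entire (complexify f) (- z) = - (1) * modulator_entire (complexify f) z).
    { intros z. rewrite hpar. ring. }
    assert (hs : - (1) = (- (1)) ^ (2 * p + 1)).
    { rewrite Cpow_add_r, Cpow_mult_r. simpl. rewrite Cmult_1_r, hsq, Cpow_1_l. ring. }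
    (* An odd modulator vanishes at 0, so L has no pole at 1; this admits m = 1, that is p = 0. *)
    assert (h0 : modulator_entire (complexify f) 0 = 0).
    { pose proof (hpar 0) as h0. replace (- (0)) with (RtoC 0) in h0 by ring. set (v := modulator_entire _ _) in *.
      assert (E : 2 * v = 0) by (transitivity (v + v); [ring|rewrite h0 at 1; ring]).
      replace v with (2 * v / 2) by (field; auto). rewrite E. field; auto. }
    split.
    + rewrite (L_hankel f hf L hL mu hmu (- (1)) hpar' (2 * p + 1) hs) by (right; exact h0).
      rewrite !Cpow_add_r, two_pi_i_even, !Cpow_1_r, h4. unfold two_pi_i. field. auto.
    + pose proof (FC_value_nat f hf L hL mu hmu (- (1)) hpar' (2 * p + 1) hs) as H.
      match type of H with FC_value _ _ _ ?v => match goal with |- FC_value _ _ _ ?v' => replace v' with v; [exact H|] end end.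
      pose proof (fact_C_neq_0 (2 * p + 1)) as hfa.
      rewrite !Cpow_add_r, two_pi_i_even, !Cpow_1_r. unfold two_pi_i.
      set (cp := Cpoly _ _ _). set (fa := RtoC (INR (fact (2 * p + 1)))) in *.
      (* The factor - i^2 = 1 moves i from the numerator to the denominator. *)
      transitivity (- (Ci * Ci) * ((-1) ^ p * cp / (2 * Ci * fa) * ((2 * PI) ^ (2 * p) * (2 * PI)))); [field; auto|].
      rewrite hCi2. field. auto.
Qed.
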